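(* Let $X_n$ be the sum of digits $\sum_{h\in\mathcal S}a(h)$ of a multi-base representation $a$ of $n$ chosen uniformly at random among all $P(n)$ representations. Then \[ \mathbb E[X_n]=\frac{\kappa(d-1)}{2\log d}(\log n)^m+O\big((\log n)^{m-1}\log\log n\big),\qquad \operatorname{Var}[X_n]=\frac{\kappa(d-1)(d+1)}{12\log d}(\log n)^m+O\big((\log n)^{m-1}\log\log n\big), \] and $(X_n-\mathbb E[X_n])/\sqrt{\operatorname{Var}[X_n]}$ converges in distribution to a standard Gaussian random variable as $n\to\infty$.
   Context: Fix integers $d\geq 2$ and $m\geq 2$, and integers $1<p_1<p_2<\dots<p_m$ with $\gcd(p_i,p_j)=1$ for $i\neq j$. Let $\mathcal S=\{p_1^{\alpha_1}p_2^{\alpha_2}\cdots p_m^{\alpha_m}:\alpha_1,\dots,\alpha_m\in\mathbb Z_{\ge 0}\}$. A multi-base representation of a positive integer $n$ (with bases $p_1,\dots,p_m$ and digit set $\{0,1,\dots,d-1\}$) is a function $a:\mathcal S\to\{0,1,\dots,d-1\}$ with finite support such that $\sum_{h\in\mathcal S}a(h)\,h=n$. Let $P(n)$ be the (finite) number of multi-base representations of $n$. Set $\kappa=\frac{\log d}{m!}\prod_{j=1}^m\frac{1}{\log p_j}$. *)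

(* Defs.v *)
From Stdlib Require Import Reals ClassicalEpsilon.
From mathcomp Require Import all_boot.
Set Implicit Arguments. Unset Strict Implicit. Unset Printing Implicit Defensive.

Section MultiBase.
Local Open Scope R_scope.
Variables (d m : nat) (p : 'I_m -> nat).

Definition inS (h : nat) : Prop :=
  exists alpha : 'I_m -> nat, h = (\prod_(i < m) p i ^ alpha i)%N.

Definition inSb (h : nat) : bool :=
  if excluded_middle_informative (inS h) then true else false.

(* A multi-base representation of n is a finitely supported a : S -> {0..d-1}
   with sum a(h) h = n.  Since a(h) h <= n whenever a(h) <> 0, its support lies
   in [0, n]; we encode it as a function on 'I_n.+1 (value h = the integer h)
   vanishing outside S. *)
Definition is_rep (n : nat) (a : {ffun 'I_n.+1 -> 'I_d}) : bool :=
  [forall h, (nat_of_ord (a h) != 0%N) ==> inSb h] &&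
  ((\sum_(h < n.+1) a h * h)%N == n).

Definition reps (n : nat) : {set {ffun 'I_n.+1 -> 'I_d}} := [set a | is_rep a].

Definition Pn (n : nat) : nat := #|reps n|.

Definition digit_sum (n : nat) (a : {ffun 'I_n.+1 -> 'I_d}) : nat :=
  (\sum_(h < n.+1) a h)%N.

Definition EX (n : nat) : R :=
  (\big[Rplus/R0]_(a in reps n) INR (digit_sum a) / INR (Pn n)).

Definition VarX (n : nat) : R :=
  (\big[Rplus/R0]_(a in reps n) (INR (digit_sum a) - EX n) ^ 2 / INR (Pn n)).

Definition cdf_norm (n : nat) (x : R) : R :=
  (INR #|[set a in reps n |
          if Rle_dec ((INR (digit_sum a) - EX n) / sqrt (VarX n)) x then true else false]|
   / INR (Pn n)).

Definition kappa : R :=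
  (ln (INR d) / INR (m`!) * \big[Rmult/R1]_(j < m) / ln (INR (p j))).

End MultiBase.

Local Open Scope R_scope.

Definition std_normal_cdf_is (x l : R) : Prop :=
  forall eps : R, (0 < eps) -> exists A0 : R, forall A : R, (A0 <= A) ->
    exists pr : Riemann_integrable (fun t => exp (- (t ^ 2) / 2)) (- A) x,
      (Rabs (RiemannInt pr / sqrt (2 * PI) - l) < eps).

(* Main.v *)
Require Import Defs.
From HB Require Import structures.
From Stdlib Require Import Reals ZArith Lra Lia ClassicalEpsilon.
From Coquelicot Require Import Coquelicot.
From mathcomp Require Import all_boot.
From mathcomp Require Import zify.
Local Open Scope R_scope.
Set Implicit Arguments.
Unset Strict Implicit.
Unset Printing Implicit Defensive.

(* Write t = log n, so that S has about t^m elements below n. Give the digits independent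
   laws P(a_h = k) proportional to exp(-r h k), with r chosen so that N = sum a_h h has mean n.
   Since the product of these weights is exp(-r N), a uniform random representation of n is
   this product law conditioned on N = n. Apart from a thin strip, the elements
   h < n / t^K, for a large constant K, carry digits that are
   uniform up to a negligible error, and they contribute all of the mean and the variance of
   the digit sum except O(t^(m-1) log t). They contribute almost nothing to N, so the
   conditioning decouples from them once the law of the remaining part of N is smooth on the
   scale rho of its standard deviation. To control correlations, the remaining elements
   p^a q^b c are split by the parity of a + b, and each half alone is already smooth: for
   frequencies on major arcs the characteristic function has Gaussian decay, since there are
   of order t^(m-1) elements in each window (X / p^2, X]; on minor arcs the rows of the
   two-dimensional progressions p^(2a) q^(2b) yield a saving of any power of t, using positive
   definiteness to average the characteristic function over frequencies modulo p^(2R).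
   The lower bound P(N = n) >= c / rho and the central limit theorem for the independent
   digits both follow from Lindeberg's replacement argument with solutions of the heat
   equation as test functions. *)

(** * Finite sums and products *)

(** Conditioning costs a factor of order 1/rho, which the lower bound on P(N = n) cancels. A bounded
    loss is harmless for the O(t^(m-1) log t) remaining digits, but the t^m nearly uniform ones must
    be decoupled with relative error O(1/t). This fixes K: the nearly uniform digits move N by
    O(rho/t) only. Two halves are needed because the covariance of the uniform digits with one half
    is estimated against a smooth density that does not involve that half. On the minor arcs,
    averaging over frequencies loses a power of t, which a pointwise saving must pay back. So each
    digit factor is bounded by a fourth power: after the square root the product occurs twice, and
    one copy is averaged while the other is bounded pointwise. The pointwise saving needs two bases:
    a row of powers of p may contain a single element whose cosine is away from 1, and the powers of
    q multiply the rows. As log t rows already save any power of t, the progressions only need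
    exponents of q up to O(log t), and such elements fit into the admissible error. *)

HB.instance Definition _ := Monoid.isComLaw.Build R R0 Rplus
  (fun x y z => esym (Rplus_assoc x y z)) Rplus_comm Rplus_0_l.
HB.instance Definition _ := Monoid.isComLaw.Build R R1 Rmult
  (fun x y z => esym (Rmult_assoc x y z)) Rmult_comm Rmult_1_l.
HB.instance Definition _ := Monoid.isMulLaw.Build R R0 Rmult Rmult_0_l Rmult_0_r.
HB.instance Definition _ :=
  Monoid.isAddLaw.Build R Rmult Rplus Rmult_plus_distr_r Rmult_plus_distr_l.

Notation "\sum_ ( i <- r ) F" := (\big[Rplus/R0]_(i <- r) F) : R_scope.
Notation "\sum_ ( i <- r | P ) F" := (\big[Rplus/R0]_(i <- r | P) F) : R_scope.
Notation "\sum_ ( i < n ) F" := (\big[Rplus/R0]_(i < n) F) : R_scope.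
Notation "\prod_ ( i <- r ) F" := (\big[Rmult/R1]_(i <- r) F) : R_scope.
Notation "\prod_ ( i < n ) F" := (\big[Rmult/R1]_(i < n) F) : R_scope.

Section FiniteSums.
Variable I : eqType.
Implicit Types (r : seq I) (F G : I -> R).

Lemma Rsum_le r F G :
  (forall i, i \in r -> F i <= G i) -> \sum_(i <- r) F i <= \sum_(i <- r) G i.
Proof.
elim: r => [|j r IH] H; first by rewrite !big_nil; lra.
rewrite !big_cons; apply: Rplus_le_compat; first by apply: H; rewrite inE eqxx.
by apply: IH => i ir; apply: H; rewrite inE ir orbT.
Qed.

Lemma Rsum_ge0 r F : (forall i, i \in r -> 0 <= F i) -> 0 <= \sum_(i <- r) F i.
Proof.
move=> H; apply: Rle_trans _ (Rsum_le H).
by rewrite big1 //; lra.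
Qed.

Lemma Rsum_abs r F : Rabs (\sum_(i <- r) F i) <= \sum_(i <- r) Rabs (F i).
Proof.
elim: r => [|j r IH]; first by rewrite !big_nil Rabs_R0; lra.
rewrite !big_cons; apply: Rle_trans (Rabs_triang _ _) _; lra.
Qed.

Lemma Rsum_const r (c : R) : \sum_(i <- r) c = INR (size r) * c.
Proof.
elim: r => [|j r IH]; first by rewrite big_nil /=; lra.
rewrite big_cons IH -[size (j :: r)]/((size r).+1) S_INR; lra.
Qed.

Lemma Rsum_distr (c : R) r F : \sum_(i <- r) (c * F i) = c * \sum_(i <- r) F i.
Proof. by rewrite big_distrr. Qed.

Lemma Rsum_add r F G :
  \sum_(i <- r) (F i + G i) = \sum_(i <- r) F i + \sum_(i <- r) G i.
Proof. by rewrite big_split. Qed.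

Lemma Rsum_ge1 r F i :
  (forall j, j \in r -> 0 <= F j) -> i \in r -> F i <= \sum_(j <- r) F j.
Proof.
elim: r => [|j r IH] // H; rewrite big_cons inE => /orP [/eqP ->|ir].
  have := @Rsum_ge0 r F (fun k kr => H k (mem_behead (s := j :: r) kr)); lra.
have := IH (fun k kr => H k (mem_behead (s := j :: r) kr)) ir.
have := H j (mem_head _ _); lra.
Qed.

Lemma Rsum_subset r1 r2 F :
  uniq r1 -> {subset r1 <= r2} -> (forall i, i \in r2 -> 0 <= F i) ->
  \sum_(i <- r1) F i <= \sum_(i <- r2) F i.
Proof.
elim: r1 r2 => [|j r IH] r2 /=; first by move=> _ _ H; rewrite big_nil; apply: Rsum_ge0.
move=> /andP [jr ur] sub H.
have jr2 : j \in r2 by apply: sub; rewrite inE eqxx.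
rewrite big_cons (perm_big _ (perm_to_rem jr2)) big_cons.
apply: Rplus_le_compat_l; apply: IH => // [i ir|i ir].
- have := sub i; rewrite inE ir orbT => /(_ isT).
  rewrite (perm_mem (perm_to_rem jr2)) inE => /orP [/eqP E|//].
  by rewrite -E ir in jr.
- by apply: H; apply: mem_rem ir.
Qed.

Lemma Rprod_ge0 r F : (forall i, i \in r -> 0 <= F i) -> 0 <= \prod_(i <- r) F i.
Proof.
elim: r => [|j r IH] H; first by rewrite big_nil; lra.
rewrite big_cons; apply: Rmult_le_pos; first by apply: H; rewrite inE eqxx.
by apply: IH => i ir; apply: H; rewrite inE ir orbT.
Qed.

Lemma Rprod_le r F G :
  (forall i, i \in r -> 0 <= F i <= G i) -> \prod_(i <- r) F i <= \prod_(i <- r) G i.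
Proof.
elim: r => [|j r IH] H; first by rewrite !big_nil; lra.
have Hj := H j (mem_head _ _).
have Hr i : i \in r -> 0 <= F i <= G i by move=> ir; apply: H; rewrite inE ir orbT.
rewrite !big_cons; apply: Rmult_le_compat; try lra.
  by apply: Rprod_ge0 => i /Hr [].
exact: IH.
Qed.

Lemma Rprod_const r (c : R) : \prod_(i <- r) c = c ^ size r.
Proof. by elim: r => [|j r IH]; rewrite ?big_nil // big_cons IH. Qed.

Lemma Rprod_le1 r F : (forall i, i \in r -> 0 <= F i <= 1) -> 0 <= \prod_(i <- r) F i <= 1.
Proof.
move=> H; split; first by apply: Rprod_ge0 => i /H [].
by apply: Rle_trans (Rprod_le H) _; rewrite Rprod_const pow1; lra.
Qed.

Lemma Rprod_subset r1 r2 F :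
  uniq r1 -> {subset r1 <= r2} -> (forall i, i \in r2 -> 0 <= F i <= 1) ->
  \prod_(i <- r2) F i <= \prod_(i <- r1) F i.
Proof.
elim: r1 r2 => [|j r IH] r2 /=.
  by move=> _ _ H; rewrite big_nil; case: (Rprod_le1 H).
move=> /andP [jr ur] sub H.
have jr2 : j \in r2 by apply: sub; rewrite inE eqxx.
rewrite big_cons (perm_big _ (perm_to_rem jr2)) big_cons.
apply: Rmult_le_compat_l; first by case: (H j jr2).
apply: IH => // [i ir|i ir].
- have := sub i; rewrite inE ir orbT => /(_ isT).
  rewrite (perm_mem (perm_to_rem jr2)) inE => /orP [/eqP E|//].
  by rewrite -E ir in jr.
- by apply: H; apply: mem_rem ir.
Qed.

End FiniteSums.

Lemma exp_le_compat x y : x <= y -> exp x <= exp y.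
Proof. by case=> [H|->]; [left; apply: exp_increasing | lra]. Qed.

Lemma exp_ge1x x : 1 + x <= exp x.
Proof.
case: (Req_dec x 0) => [->|H]; first by rewrite exp_0; lra.
by left; apply: exp_ineq1.
Qed.

Lemma exp_mulN (n : nat) x : exp (INR n * x) = exp x ^ n.
Proof.
elim: n => [|n IH]; first by rewrite Rmult_0_l exp_0.
by rewrite S_INR Rmult_plus_distr_r Rmult_1_l exp_plus IH /= Rmult_comm.
Qed.

Lemma ord_sumE (n : nat) (F : nat -> R) : \sum_(i < n) F i = \sum_(i <- iota 0 n) F i.
Proof. by rewrite -(big_mkord xpredT F) /index_iota subn0. Qed.

Lemma Rsum_ord_le (n : nat) (F G : nat -> R) :
  (forall i, (i < n)%N -> F i <= G i) -> \sum_(i < n) F i <= \sum_(i < n) G i.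
Proof.
move=> H; rewrite !ord_sumE; apply: Rsum_le => i; rewrite mem_iota add0n => /andP [_].
exact: H.
Qed.

Lemma Rsum_ord_ge0 (n : nat) (F : nat -> R) :
  (forall i, (i < n)%N -> 0 <= F i) -> 0 <= \sum_(i < n) F i.
Proof.
move=> H; rewrite ord_sumE; apply: Rsum_ge0 => i; rewrite mem_iota add0n => /andP [_].
exact: H.
Qed.

Lemma Rsum_ord_const (n : nat) (c : R) : \sum_(i < n) c = INR n * c.
Proof. by rewrite (ord_sumE n (fun=> c)) Rsum_const size_iota. Qed.

Lemma Rsum_ord_ge1 (n j : nat) (F : nat -> R) :
  (forall i, (i < n)%N -> 0 <= F i) -> (j < n)%N -> F j <= \sum_(i < n) F i.
Proof.
move=> H jn; rewrite ord_sumE; apply: (Rsum_ge1 (F := F) (i := j)).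
  by move=> i; rewrite mem_iota add0n => /andP [_]; apply: H.
by rewrite mem_iota.
Qed.

Lemma Rsum_ord_distr (n : nat) (c : R) (F : nat -> R) :
  \sum_(i < n) (c * F i) = c * \sum_(i < n) F i.
Proof. by rewrite big_distrr. Qed.

Lemma Rsum_ord_sub (n : nat) (F G : nat -> R) :
  \sum_(i < n) (F i - G i) = \sum_(i < n) F i - \sum_(i < n) G i.
Proof.
rewrite (eq_bigr (fun i : 'I_n => F i + (-1) * G i)); last by move=> i _; ring.
by rewrite big_split (Rsum_ord_distr _ _ G) /=; ring.
Qed.

Lemma pow_natE (a k : nat) : INR (a ^ k)%N = INR a ^ k.
Proof. by elim: k => [|k IH] //; rewrite expnS mult_INR IH. Qed.

Lemma INR_leq (a b : nat) : (a <= b)%N -> INR a <= INR b.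
Proof. by move=> H; apply: le_INR; lia. Qed.

Lemma INR_ltn (a b : nat) : (a < b)%N -> INR a < INR b.
Proof. by move=> H; apply: lt_INR; lia. Qed.

Lemma INR_ltn0 (a : nat) : (0 < a)%N -> 0 < INR a.
Proof. by move=> H; apply: (@INR_ltn 0 a). Qed.

(** * Sums of independent digits *)

Section DigitLaw.
Variables (d : nat) (w : nat -> nat -> R).

(* The digits [a_h], [h] in [l], are independent with [P(a_h = k) = w h k];
   [Ex l F] is the expectation of [F (sum of a_h) (sum of a_h * h)]. *)
Fixpoint Ex (l : seq nat) (F : nat -> nat -> R) : R :=
  if l is h :: l' then
    \sum_(k < d) (w h k * Ex l' (fun x y => F (k + x)%N (k * h + y)%N))
  else F 0%N 0%N.

Definition dmean (h : nat) : R := \sum_(k < d) (w h k * INR k).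
Definition dvar (h : nat) : R := \sum_(k < d) (w h k * (INR k - dmean h) ^ 2).
Definition dabs3 (h : nat) : R := \sum_(k < d) (w h k * Rabs (INR k - dmean h) ^ 3).

Lemma Ex_ext l F G : (forall x y, F x y = G x y) -> Ex l F = Ex l G.
Proof.
elim: l F G => [|h l IH] F G H //=; apply: eq_bigr => k _; congr (_ * _).
exact: IH.
Qed.

Lemma Ex_add l F G : Ex l (fun x y => F x y + G x y) = Ex l F + Ex l G.
Proof.
elim: l F G => [|h l IH] F G //=; rewrite -big_split /=; apply: eq_bigr => k _.
by rewrite IH Rmult_plus_distr_l.
Qed.

Lemma Ex_scal l c F : Ex l (fun x y => c * F x y) = c * Ex l F.
Proof.
elim: l F => [|h l IH] F //=; rewrite big_distrr /=; apply: eq_bigr => k _.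
by rewrite IH -!Rmult_assoc (Rmult_comm c).
Qed.

Lemma Ex_sub l F G : Ex l (fun x y => F x y - G x y) = Ex l F - Ex l G.
Proof.
rewrite (Ex_ext _ (G := fun x y => F x y + (-1) * G x y)); last by move=> x y; lra.
by rewrite Ex_add Ex_scal; lra.
Qed.

Lemma Ex_sum l n (F : nat -> nat -> nat -> R) :
  Ex l (fun x y => \sum_(i < n) F i x y) = \sum_(i < n) Ex l (F i).
Proof.
elim: l F => [|h l IH] F //=.
rewrite exchange_big /=; apply: eq_bigr => k _.
by rewrite (IH (fun i x y => F i (k + x)%N (k * h + y)%N)) big_distrr.
Qed.

Lemma Ex_cat l1 l2 F :
  Ex (l1 ++ l2) F = Ex l1 (fun x y => Ex l2 (fun x' y' => F (x + x')%N (y + y')%N)).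
Proof.
elim: l1 F => [|h l IH] F //=; apply: eq_bigr => k _; congr (_ * _).
rewrite IH; apply: Ex_ext => x y; apply: Ex_ext => x' y'.
by rewrite !addnA.
Qed.

Lemma Ex_comm l1 l2 (F : nat -> nat -> nat -> nat -> R) :
  Ex l1 (fun x y => Ex l2 (fun x' y' => F x y x' y')) =
  Ex l2 (fun x' y' => Ex l1 (fun x y => F x y x' y')).
Proof.
elim: l1 F => [|h l IH] F //=.
rewrite (Ex_sum l2 d (fun k x' y' => w h k * Ex l (fun x y => F (k + x)%N (k * h + y)%N x' y'))).
apply: eq_bigr => k _.
by rewrite Ex_scal (IH (fun x y x' y' => F (k + x)%N (k * h + y)%N x' y')).
Qed.

Hypothesis w_ge0 : forall h k, 0 <= w h k.
Hypothesis w_sum : forall h, \sum_(k < d) w h k = 1.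

Lemma Ex_const l c : Ex l (fun _ _ => c) = c.
Proof.
elim: l => [|h l IH] //=; rewrite IH -[RHS]Rmult_1_l -(w_sum h) big_distrl /=.
by apply: eq_bigr.
Qed.

Lemma Ex_le_in l F G :
  (forall x y, (x <= d * size l)%N -> (y <= d * sumn l)%N -> F x y <= G x y) ->
  Ex l F <= Ex l G.
Proof.
elim: l F G => [|h l IH] F G H /=; first exact: H.
apply: (Rsum_ord_le (F := fun k => w h k * Ex l (fun x y => F (k + x)%N (k * h + y)%N))
  (G := fun k => w h k * Ex l (fun x y => G (k + x)%N (k * h + y)%N))) => k kd.
apply: Rmult_le_compat_l => //; apply: IH => x y hx hy; apply: H => /=.
  by rewrite mulnS leq_add // ltnW.
by rewrite mulnDr leq_add // leq_mul2r ltnW // orbT.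
Qed.

Lemma Ex_le l F G : (forall x y, F x y <= G x y) -> Ex l F <= Ex l G.
Proof. by move=> H; apply: Ex_le_in. Qed.

Lemma Ex_ge0 l F : (forall x y, 0 <= F x y) -> 0 <= Ex l F.
Proof. by move=> H; rewrite -{1}(Ex_const l 0); apply: Ex_le. Qed.

Lemma Ex_abs l F : Rabs (Ex l F) <= Ex l (fun x y => Rabs (F x y)).
Proof.
apply: Rabs_le; split.
  rewrite -[X in X <= _]/(- _).
  have -> : - Ex l (fun x y => Rabs (F x y)) = Ex l (fun x y => (-1) * Rabs (F x y)).
    by rewrite Ex_scal; lra.
  apply: Ex_le => x y; have := Rle_abs (- F x y); rewrite Rabs_Ropp; lra.
by apply: Ex_le => x y; apply: Rle_abs.
Qed.

Lemma Ex_sqr_le l F : Ex l F ^ 2 <= Ex l (fun x y => F x y ^ 2).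
Proof.
have := Ex_ge0 l (fun x y => pow2_ge_0 (F x y - Ex l F)).
rewrite (Ex_ext _ (G := fun x y => (F x y ^ 2 + (- 2 * Ex l F) * F x y) + Ex l F ^ 2)); last first.
  by move=> x y; lra.
by rewrite !Ex_add Ex_scal Ex_const; nra.
Qed.

Lemma dmean_center h : \sum_(k < d) (w h k * (INR k - dmean h)) = 0.
Proof.
rewrite (eq_bigr (fun k : 'I_d => w h k * INR k + (- dmean h) * w h k)); last first.
  by move=> k _; lra.
by rewrite big_split /= -big_distrr /= w_sum -/(dmean h); lra.
Qed.

Section LinearForm.
Variables a b : R.
(** A general linear form in the digit sum and the weighted sum lets one replacement argument serve
    twice: with [a = 0] for the local lower bound and with [b = 0] for the limit law. *)
Definition lcoef (h : nat) := a + b * INR h.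
Definition lmean (l : seq nat) := \sum_(h <- l) (lcoef h * dmean h).
Definition lvar (l : seq nat) := \sum_(h <- l) (lcoef h ^ 2 * dvar h).
Definition lform l (x y : nat) := a * INR x + b * INR y - lmean l.

Lemma lform_cons h l k x y :
  lform (h :: l) (k + x) (k * h + y) = lform l x y + lcoef h * (INR k - dmean h).
Proof.
by rewrite /lform /lmean big_cons !plus_INR mult_INR /lcoef; ring.
Qed.

(** The free shift [z] carries the induction: the centred head digit is moved into it. *)
Lemma lform_mean l z : Ex l (fun x y => lform l x y + z) = z.
Proof.
elim: l z => [|h l IH] z /=; first by rewrite /lform /lmean big_nil; simpl; lra.
rewrite (eq_bigr (fun k : 'I_d => z * w h k + lcoef h * (w h k * (INR k - dmean h)))).
  by rewrite big_split /= -!big_distrr /= w_sum dmean_center; lra.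
move=> k _; rewrite (Ex_ext _ (G := fun x y => lform l x y + (z + lcoef h * (INR k - dmean h)))).
  by rewrite IH; ring.
by move=> x y; rewrite lform_cons; lra.
Qed.

Lemma lform_var l z : Ex l (fun x y => (lform l x y + z) ^ 2) = lvar l + z ^ 2.
Proof.
elim: l z => [|h l IH] z /=; first by rewrite /lform /lmean /lvar !big_nil; simpl; lra.
rewrite (eq_bigr (fun k : 'I_d => (lvar l + z ^ 2) * w h k +
  (2 * z * lcoef h * (w h k * (INR k - dmean h)) + lcoef h ^ 2 * (w h k * (INR k - dmean h) ^ 2)))).
  rewrite !big_split /= -!big_distrr /= w_sum dmean_center -/(dvar h) /lvar big_cons.
  by rewrite /=; ring.
move=> k _; rewrite (Ex_ext _ (G := fun x y => (lform l x y + (z + lcoef h * (INR k - dmean h))) ^ 2)).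
  by rewrite IH; ring.
by move=> x y; rewrite lform_cons; ring.
Qed.

(* Lindeberg's replacement argument against a solution [v] of the heat equation
   [dv/ds = v_xx / 2]: a centred summand of variance [tau] acts on [v s] like
   the time shift [s -> s + tau], up to third-order terms. *)
Lemma lindeberg (v v1 v2 : R -> R -> R) (s0 M : R) l :
  (forall s z e, s0 <= s ->
    Rabs (v s (z + e) - v s z - e * v1 s z - e ^ 2 / 2 * v2 s z) <= M * Rabs e ^ 3) ->
  (forall s z t, s0 <= s -> 0 <= t ->
    Rabs (v (s + t) z - v s z - t / 2 * v2 s z) <= M * t ^ 2) ->
  forall s z, s0 <= s ->
  Rabs (Ex l (fun x y => v s (lform l x y + z)) - v (s + lvar l) z) <=
  M * \sum_(h <- l) (Rabs (lcoef h) ^ 3 * dabs3 h + (lcoef h ^ 2 * dvar h) ^ 2).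
Proof.
move=> Hx Hs s z hs.
have var0 h : 0 <= dvar h.
  apply: (Rsum_ord_ge0 (F := fun k => w h k * (INR k - dmean h) ^ 2)) => k _.
  by apply: Rmult_le_pos => //; apply: pow2_ge_0.
have lvar0 l' : 0 <= lvar l'.
  by apply: Rsum_ge0 => h _; apply: Rmult_le_pos => //; apply: pow2_ge_0.
elim: l z => [|h l IH] z.
  rewrite big_nil [Ex _ _]/= (_ : v s _ - _ = 0) ?Rabs_R0; first lra.
  by apply: Rminus_diag_eq; congr v; rewrite /lform /lmean /lvar !big_nil; simpl; lra.
set S := s + lvar l; have hS : s0 <= S by rewrite /S; have := lvar0 l; lra.
set xi := fun k : nat => lcoef h * (INR k - dmean h).
set E1 := Ex _ _; set M1 := \sum_(i <- l) _ in IH.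
rewrite big_cons.
(* For each value [k] of the head digit, the induction hypothesis at the shifted point [z + xi k]
   replaces the tail by a time shift. *)
have A1 : Rabs (E1 - \sum_(k < d) (w h k * v S (z + xi k))) <= M * M1.
  rewrite /E1 /= (_ : _ - _ = \sum_(k < d)
      (w h k * (Ex l (fun x y => v s (lform (h :: l) (k + x) (k * h + y) + z)) - v S (z + xi k)))).
    have sumE (F : nat -> R) : \sum_(k < d) F k = \sum_(k <- iota 0 d) F k by exact: ord_sumE.
    rewrite (sumE (fun k => w h k * (Ex l (fun x y => v s (lform (h :: l) (k + x) (k * h + y) + z))
       - v S (z + xi k)))).
    apply: Rle_trans (Rsum_abs _ _) _.
    apply: Rle_trans (Rsum_le (G := fun k => w h k * (M * M1)) _) _.
      move=> k _; rewrite Rabs_mult (Rabs_pos_eq (w h k)) //.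
      apply: Rmult_le_compat_l => //.
      rewrite (Ex_ext _ (G := fun x y => v s (lform l x y + (z + xi k)))); first exact: IH.
      by move=> x y; rewrite lform_cons /xi; congr v; ring.
    by rewrite -(ord_sumE d (fun k => w h k * (M * M1))) -big_distrl /= w_sum; lra.
  rewrite [RHS](eq_bigr (fun k : 'I_d => w h k * Ex l (fun x y => v s (lform (h :: l) (k + x) (k * h + y) + z))
      + (-1) * (w h k * v S (z + xi k)))) => [|k _]; last by ring.
  by rewrite big_split /= -big_distrr /=; ring.
(* Space expansion in the head digit: the first-order term averages to zero, the second-order one
   carries its variance. *)
have A2 : Rabs (\sum_(k < d) (w h k * v S (z + xi k)) - v S z - lcoef h ^ 2 * dvar h / 2 * v2 S z)
   <= M * (Rabs (lcoef h) ^ 3 * dabs3 h).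
  rewrite (_ : _ - _ = \sum_(k < d)
      (w h k * (v S (z + xi k) - v S z - xi k * v1 S z - xi k ^ 2 / 2 * v2 S z))).
    rewrite (ord_sumE d (fun k => w h k * (v S (z + xi k) - v S z - xi k * v1 S z - xi k ^ 2 / 2 * v2 S z))).
    apply: Rle_trans (Rsum_abs _ _) _.
    apply: Rle_trans (Rsum_le (G := fun k => M * Rabs (lcoef h) ^ 3 * (w h k * Rabs (INR k - dmean h) ^ 3)) _) _.
      move=> k _; rewrite Rabs_mult (Rabs_pos_eq (w h k)) //.
      have -> : M * Rabs (lcoef h) ^ 3 * (w h k * Rabs (INR k - dmean h) ^ 3) =
        w h k * (M * (Rabs (lcoef h) * Rabs (INR k - dmean h)) ^ 3) by ring.
      apply: Rmult_le_compat_l => //; rewrite -Rabs_mult; exact: Hx.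
    rewrite -(ord_sumE d (fun k => M * Rabs (lcoef h) ^ 3 * (w h k * Rabs (INR k - dmean h) ^ 3))) -big_distrr /=.
    by rewrite -/(dabs3 h); lra.
  rewrite [RHS](eq_bigr (fun k : 'I_d => w h k * v S (z + xi k) + ((- v S z) * w h k +
     ((- lcoef h * v1 S z) * (w h k * (INR k - dmean h)) +
      (- lcoef h ^ 2 / 2 * v2 S z) * (w h k * (INR k - dmean h) ^ 2))))) => [|k _]; last first.
    by rewrite /xi; field.
  rewrite !big_split /= -!big_distrr /= w_sum dmean_center -/(dvar h) /=; field.
(* Time expansion by the variance of the head: its first-order term is the second-order term of
   [A2], so the two cancel. *)
have A3 := Hs S z (lcoef h ^ 2 * dvar h) hS (Rmult_le_pos _ _ (pow2_ge_0 _) (var0 h)).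
have -> : s + lvar (h :: l) = S + lcoef h ^ 2 * dvar h by rewrite /lvar big_cons /S /lvar; lra.
move: A1 A2 A3; set X1 := \sum_(k < d) _; set y1 := v (S + _) z; set y2 := v S z.
move=> A1 A2 A3.
rewrite (_ : E1 - y1 = (E1 - X1) + ((X1 - y2 - lcoef h ^ 2 * dvar h / 2 * v2 S z)
   - (y1 - y2 - lcoef h ^ 2 * dvar h / 2 * v2 S z))); last by ring.
apply: Rle_trans (Rabs_triang _ _) _.
have := Rabs_triang (X1 - y2 - lcoef h ^ 2 * dvar h / 2 * v2 S z) (-(y1 - y2 - lcoef h ^ 2 * dvar h / 2 * v2 S z)).
rewrite Rabs_Ropp -/(Rminus _ _) -/M1; move: A1 A2 A3; lra.
Qed.

End LinearForm.
End DigitLaw.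

(** * The Gaussian distribution function *)

Definition gker (x : R) : R := exp (- (x ^ 2) / 2).
Definition gint (x : R) : R := RInt gker 0 x.
Definition gcdf (x : R) : R := 1 / 2 + gint x / sqrt (2 * PI).

Lemma gker_gt0 x : 0 < gker x.
Proof. exact: exp_pos. Qed.

Lemma gker_cont x : continuous gker x.
Proof.
apply: (ex_derive_continuous (K := R_AbsRing) (V := R_NormedModule)).
by rewrite /gker; auto_derive.
Qed.

Lemma gker_ex_RInt a b : ex_RInt gker a b.
Proof. by apply: ex_RInt_continuous => z _; apply: gker_cont. Qed.

Lemma gint_derive x : is_derive gint x (gker x).
Proof.
apply: is_derive_RInt; last exact: gker_cont.
by apply: filter_forall => y; apply: RInt_correct; apply: gker_ex_RInt.
Qed.

Lemma gint0 : gint 0 = 0.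
Proof. exact: RInt_point. Qed.

Lemma gint_opp x : gint (- x) = - gint x.
Proof.
have H := RInt_comp_lin (V := R_CompleteNormedModule) gker (-1) 0 0 x (gker_ex_RInt _ _).
rewrite (_ : -1 * 0 + 0 = 0) in H; last by ring.
rewrite (_ : -1 * x + 0 = - x) in H; last by ring.
rewrite /gint -H (RInt_ext _ (fun y => opp (gker y))).
  by rewrite RInt_opp //; apply: gker_ex_RInt.
move=> y _; rewrite /scal /opp /= /mult /= /gker (_ : (-1 * y + 0) ^ 2 = y ^ 2); ring.
Qed.

(** Classical evaluation of the Gaussian integral under the integral sign: the integral of [gaux x]
    over [0, 1] has derivative [- gker x * gint x], hence its sum with [gint x ^ 2 / 2] is constant,
    and at [x = 0] it equals [atan 1]. *)
Definition gaux (x u : R) : R := exp (- (x ^ 2) * (1 + u ^ 2) / 2) / (1 + u ^ 2).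

Lemma gaux_derive x u : is_derive (fun z => gaux z u) x (- x * exp (- (x ^ 2) * (1 + u ^ 2) / 2)).
Proof.
rewrite /gaux; have : 0 < 1 + u ^ 2 by have := pow2_ge_0 u; lra.
move=> H; auto_derive; simpl in *; first lra.
rewrite -/(Rdiv (- (x * (x * 1)) * (1 + u * (u * 1))) 2).
set e := exp _; field; lra.
Qed.

Lemma gaux_ex_RInt x a b : ex_RInt (gaux x) a b.
Proof.
apply: ex_RInt_continuous => z _.
apply: (ex_derive_continuous (K := R_AbsRing) (V := R_NormedModule)).
by rewrite /gaux; auto_derive; have := pow2_ge_0 z; simpl; lra.
Qed.

Lemma gint_aux_derive x :
  is_derive (fun z => gint z ^ 2 / 2 + RInt (gaux z) 0 1) x 0.
Proof.
have D : is_derive (fun z => RInt (gaux z) 0 1) x (- gker x * gint x).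
  have -> : - gker x * gint x = RInt (fun u => Derive (fun z => gaux z u) x) 0 1.
    rewrite (RInt_ext _ (fun u => (- gker x) * (x * gker (x * u + 0)))); last first.
      move=> u _; rewrite /= (is_derive_unique _ _ _ (gaux_derive x u)).
      rewrite Rplus_0_r /gker -Rmult_assoc (Rmult_comm _ x).
      have -> : - (x ^ 2) * (1 + u ^ 2) / 2 = - x ^ 2 / 2 + - (x * u) ^ 2 / 2 by field.
      by rewrite exp_plus; ring.
    have H := RInt_scal (V := R_CompleteNormedModule) (fun u => x * gker (x * u + 0)) 0 1 (- gker x).
    rewrite /scal /= /mult /= in H; rewrite H.
      have H2 := RInt_comp_lin (V := R_CompleteNormedModule) gker x 0 0 1.
      rewrite /scal /= /mult /= in H2; rewrite H2; last exact: gker_ex_RInt.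
      by rewrite Rmult_0_r Rmult_1_r !Rplus_0_r.
    apply: ex_RInt_continuous => z _.
    apply: (ex_derive_continuous (K := R_AbsRing) (V := R_NormedModule)).
    by rewrite /gker; auto_derive.
  apply: is_derive_RInt_param.
  - by apply: filter_forall => y t _; eexists; apply: gaux_derive.
  - move=> t _.
    apply: (continuity_2d_pt_ext (fun z u => - z * exp (- (z ^ 2) * (1 + u ^ 2) / 2))).
      by move=> z u; rewrite (is_derive_unique _ _ _ (gaux_derive z u)).
    apply: continuity_2d_pt_mult.
      by apply: continuity_2d_pt_opp; apply: continuity_2d_pt_id1.
    apply: (continuity_1d_2d_pt_comp exp).
      by apply: derivable_continuous_pt; apply: derivable_pt_exp.
    apply: (continuity_2d_pt_ext (fun z u => - (z * z) * (1 + u * u) * (/ 2))).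
      by move=> z u; rewrite /Rdiv /=; ring.
    apply: continuity_2d_pt_mult; last exact: continuity_2d_pt_const.
    apply: continuity_2d_pt_mult.
      by apply: continuity_2d_pt_opp; apply: continuity_2d_pt_mult; apply: continuity_2d_pt_id1.
    apply: continuity_2d_pt_plus; first exact: continuity_2d_pt_const.
    by apply: continuity_2d_pt_mult; apply: continuity_2d_pt_id2.
  - by apply: filter_forall => y; apply: gaux_ex_RInt.
have D2 : is_derive (fun z => gint z ^ 2 / 2) x (gker x * gint x).
  have E : ex_derive gint x by eexists; apply: gint_derive.
  auto_derive; first by [].
  by rewrite (is_derive_unique _ _ _ (gint_derive x)); field.
have := is_derive_plus (K := R_AbsRing) (V := R_NormedModule) _ _ _ _ _ D2 D.
by rewrite /plus /= (_ : gker x * gint x + - gker x * gint x = 0); [|ring].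
Qed.

Lemma gint_sqr x : gint x ^ 2 / 2 + RInt (gaux x) 0 1 = PI / 4.
Proof.
have C : gint x ^ 2 / 2 + RInt (gaux x) 0 1 = gint 0 ^ 2 / 2 + RInt (gaux 0) 0 1.
  have [c [_ H]] := MVT_gen (fun z => gint z ^ 2 / 2 + RInt (gaux z) 0 1) 0 x (fun _ => 0)
     (fun z _ => gint_aux_derive z)
     (fun z _ => derivable_continuous_pt _ _ (ex_derive_Reals_0 _ _ (ex_intro _ _ (gint_aux_derive z)))).
  simpl in H; simpl; lra.
rewrite C gint0.
rewrite (RInt_ext _ (fun u => / (1 + u ^ 2))); last first.
  move=> u _; rewrite /gaux (_ : - 0 ^ 2 * (1 + u ^ 2) / 2 = 0); last by field.
  by rewrite exp_0 /Rdiv Rmult_1_l.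
have : is_RInt (fun u => / (1 + u ^ 2)) 0 1 (atan 1 - atan 0).
  have H := @is_RInt_derive R_CompleteNormedModule atan (fun u => / (1 + u ^ 2)) 0 1.
  apply: H => z _.
    by apply/is_derive_Reals; have := derivable_pt_lim_atan z; rewrite /Rsqr /= Rmult_1_r.
  apply: (ex_derive_continuous (K := R_AbsRing) (V := R_NormedModule)).
  by auto_derive; have := pow2_ge_0 z; simpl; lra.
move/is_RInt_unique=> ->; rewrite atan_1 atan_0 /minus /plus /opp /=; lra.
Qed.

Lemma gaux_RInt_bound x : 0 <= RInt (gaux x) 0 1 <= gker x.
Proof.
have P u : 0 < 1 + u ^ 2 by have := pow2_ge_0 u; lra.
split.
  apply: RInt_ge_0; [lra | exact: gaux_ex_RInt|].
  by move=> u _; left; apply: Rdiv_lt_0_compat => //; apply: exp_pos.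
have -> : gker x = RInt (fun _ => gker x) 0 1 by rewrite RInt_const /scal /= /mult /=; lra.
apply: RInt_le; [lra | exact: gaux_ex_RInt | by apply: ex_RInt_const|].
move=> u _; rewrite /gaux /gker; apply: Rmult_le_reg_r (P u) _.
rewrite /Rdiv Rmult_assoc Rinv_l; last by have := P u; lra.
apply: Rle_trans (_ : exp (- x ^ 2 / 2) * 1 <= _); last first.
  by apply: Rmult_le_compat_l; [left; apply: exp_pos | have := pow2_ge_0 u; lra].
rewrite !Rmult_1_r; apply: exp_le_compat.
have := pow2_ge_0 u; have := pow2_ge_0 x; nra.
Qed.

Lemma sqrt2PI_gt0 : 0 < sqrt (2 * PI).
Proof. by apply: sqrt_lt_R0; have := PI_RGT_0; lra. Qed.

Lemma gint_ge0 x : 0 <= x -> 0 <= gint x.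
Proof.
move=> hx; apply: RInt_ge_0 => //; first exact: gker_ex_RInt.
by move=> z _; left; apply: gker_gt0.
Qed.

Lemma gker_inv_le x : 0 < x -> gker x <= 2 / x ^ 2.
Proof.
move=> hx; rewrite /gker.
have -> : - x ^ 2 / 2 = - (x ^ 2 / 2) by field.
have x2 : 0 < x ^ 2 by apply: pow_lt.
rewrite exp_Ropp (_ : 2 / x ^ 2 = / (x ^ 2 / 2)); last by field; lra.
apply: Rinv_le_contravar; first lra.
have := exp_ge1x (x ^ 2 / 2); lra.
Qed.

Lemma gcdf_opp x : gcdf (- x) = 1 - gcdf x.
Proof. by rewrite /gcdf gint_opp; field; have := sqrt2PI_gt0; lra. Qed.

Lemma gcdf_deriv x : is_derive gcdf x (gker x / sqrt (2 * PI)).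
Proof.
have E : ex_derive gint x by eexists; apply: gint_derive.
have := sqrt2PI_gt0 => H.
rewrite /gcdf; auto_derive; first by [].
rewrite (is_derive_unique _ _ _ (gint_derive x)) /Rdiv; ring.
Qed.

Lemma gcdf_cont x : continuity_pt gcdf x.
Proof.
apply: derivable_continuous_pt; apply: ex_derive_Reals_0.
by eexists; apply: gcdf_deriv.
Qed.

Lemma gcdf_mono x y : x <= y -> gcdf x <= gcdf y.
Proof.
move=> xy; have [c [_ H]] := MVT_gen gcdf x y _ (fun z _ => gcdf_deriv z) (fun z _ => gcdf_cont z).
have : 0 <= gker c / sqrt (2 * PI) * (y - x).
  apply: Rmult_le_pos; last lra.
  by left; apply: Rdiv_lt_0_compat; [apply: gker_gt0 | apply: sqrt2PI_gt0].
lra.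
Qed.

(* [gint x] tends to [sqrt (2 PI) / 2] because [gint x ^ 2 = PI / 2 - 2 RInt (gaux x) 0 1]. *)
Lemma gcdf_tail x : 0 < x -> 1 - 4 / x ^ 2 <= gcdf x <= 1.
Proof.
move=> hx.
have s0 := sqrt2PI_gt0; have g0 := gint_ge0 (Rlt_le _ _ hx).
have s2 : sqrt (2 * PI) ^ 2 = 2 * PI by rewrite /= Rmult_1_r sqrt_def //; have := PI_RGT_0; lra.
have [B1 B2] := gaux_RInt_bound x; have B3 := gker_inv_le hx; have E := gint_sqr x.
have x2 : 0 < / x ^ 2 by apply: Rinv_0_lt_compat; apply: pow_lt.
set y := gint x / sqrt (2 * PI).
have y0 : 0 <= y by apply: Rmult_le_pos => //; left; apply: Rinv_0_lt_compat.
have gy : gint x = y * sqrt (2 * PI) by rewrite /y; field; lra.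
have Y : y ^ 2 = 1 / 4 - RInt (gaux x) 0 1 / PI.
  have : y ^ 2 * (2 * PI) = gint x ^ 2 by rewrite gy Rpow_mult_distr s2.
  have -> : gint x ^ 2 = PI / 2 - 2 * RInt (gaux x) 0 1 by lra.
  move=> K; apply: (Rmult_eq_reg_r (2 * PI)); last by have := PI_RGT_0; lra.
  by rewrite K; field; have := PI_RGT_0; lra.
have PI1 : 1 <= PI by have := PI2_1; lra.
have R1 : 0 <= RInt (gaux x) 0 1 / PI <= 2 / x ^ 2.
  split; first by apply: Rmult_le_pos => //; left; apply: Rinv_0_lt_compat; lra.
  apply: Rle_trans (_ : RInt (gaux x) 0 1 <= _); last by lra.
  apply: Rmult_le_reg_r (_ : 0 < PI) _; first lra.
  by rewrite /Rdiv Rmult_assoc Rinv_l; nra.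
rewrite /gcdf -/y; split; last by nra.
rewrite /Rdiv in R1 *; nra.
Qed.

Lemma gcdf_bound x : 0 <= gcdf x <= 1.
Proof.
have U z : gcdf z <= 1.
  case: (Rle_lt_dec z 0) => [h|h]; last by case: (gcdf_tail h).
  apply: Rle_trans (_ : gcdf 1 <= _); first by apply: gcdf_mono; lra.
  by case: (@gcdf_tail 1 ltac:(lra)).
split; last exact: U.
have := U (- x); rewrite gcdf_opp; lra.
Qed.

Lemma gcdf_to1 eps : 0 < eps -> exists A, 0 < A /\ forall x, A <= x -> 1 - eps < gcdf x.
Proof.
move=> h; exists (1 + 4 / eps); have q : 0 < / eps by apply: Rinv_0_lt_compat.
split; first by rewrite /Rdiv; lra.
move=> x hx; have x0 : 1 <= x by rewrite /Rdiv in hx; lra.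
have [H _] := @gcdf_tail x ltac:(lra).
suff : 4 / x ^ 2 < eps by lra.
have x2 : 0 < x ^ 2 by apply: pow_lt; lra.
apply: (Rmult_lt_reg_r (x ^ 2)) => //.
have -> : 4 / x ^ 2 * x ^ 2 = 4 by field; apply: Rgt_not_eq; lra.
have : 4 / eps * eps = 4 by field; lra.
have : eps * (1 + 4 / eps) <= eps * x by apply: Rmult_le_compat_l; lra.
move=> h1 h2; have : eps * x * 1 <= eps * x * x by apply: Rmult_le_compat_l; lra.
by simpl; lra.
Qed.

Lemma gcdf_std x : std_normal_cdf_is x (gcdf x).
Proof.
move=> eps h; have [A [A0 H]] := gcdf_to1 h; exists A => B hB.
have E := gker_ex_RInt (- B) x; exists (ex_RInt_Reals_0 _ _ _ E).
rewrite -RInt_Reals -/gker.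
have -> : RInt gker (- B) x = gint x + gint B.
  rewrite -(RInt_Chasles gker (-B) 0 x); [|exact: gker_ex_RInt|exact: gker_ex_RInt].
  rewrite -(opp_RInt_swap gker); last exact: gker_ex_RInt.
  by rewrite -/(gint _) -/(gint _) gint_opp /plus /opp /=; ring.
have -> : (gint x + gint B) / sqrt (2 * PI) - gcdf x = gcdf B - 1.
  by rewrite /gcdf; field; have := sqrt2PI_gt0; lra.
have := H B hB; have := gcdf_bound B => G1 G2; rewrite Rabs_left1; lra.
Qed.

(** * Taylor remainders and Gaussian solutions of the heat equation *)

Definition btw (z e u : R) := Rmin z (z + e) <= u <= Rmax z (z + e).

Lemma btw_abs z e u : btw z e u -> Rabs (u - z) <= Rabs e.
Proof.
rewrite /btw /Rmin /Rmax; case: Rle_dec => h [h1 h2].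
  by rewrite !Rabs_pos_eq; lra.
by rewrite !Rabs_left1; lra.
Qed.

Lemma btw_sub z e u v : btw z e u -> btw z (u - z) v -> btw z e v.
Proof.
by rewrite /btw /Rmin /Rmax; do 2 case: Rle_dec => ?; lra.
Qed.

Lemma btw_pos z e u : 0 <= e -> btw z e u -> z <= u.
Proof. by move=> h; rewrite /btw /Rmin; case: Rle_dec => ?; lra. Qed.

Lemma btw_start z e : btw z e z.
Proof. by rewrite /btw /Rmin /Rmax; case: Rle_dec => ?; lra. Qed.

Lemma taylor0 f g M z e :
  (forall u, btw z e u -> is_derive f u (g u)) ->
  (forall u, btw z e u -> Rabs (g u) <= M) -> Rabs (f (z + e) - f z) <= M * Rabs e.
Proof.
move=> D B.
have [c [cb ->]] := MVT_gen f z (z + e) g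
  (fun u (h : _ < u < _) => D u (conj (Rlt_le _ _ (proj1 h)) (Rlt_le _ _ (proj2 h))))
  (fun u h => derivable_continuous_pt _ _ (ex_derive_Reals_0 _ _ (ex_intro _ _ (D u h)))).
rewrite Rabs_mult (_ : z + e - z = e); last by ring.
by apply: Rmult_le_compat_r; [apply: Rabs_pos | apply: B].
Qed.

(** Mean value theorem for [f] minus its tangent, whose derivative is an order-zero remainder of
    [f1]. [taylor2] repeats this one order higher; the factorials are given up. *)
Lemma taylor1 f f1 f2 M z e :
  (forall u, btw z e u -> is_derive f u (f1 u)) ->
  (forall u, btw z e u -> is_derive f1 u (f2 u)) ->
  (forall u, btw z e u -> Rabs (f2 u) <= M) ->
  Rabs (f (z + e) - f z - e * f1 z) <= M * Rabs e ^ 2.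
Proof.
move=> D1 D2 B; have M0 : 0 <= M by apply: Rle_trans (Rabs_pos _) (B _ (btw_start z e)).
have -> : f (z + e) - f z - e * f1 z =
  (f (z + e) - (z + e) * f1 z) - (f z - z * f1 z) by ring.
rewrite (_ : M * Rabs e ^ 2 = M * Rabs e * Rabs e); last by ring.
apply: (@taylor0 (fun u => f u - u * f1 z) (fun u => f1 u - f1 z)) => u hu.
  have E : ex_derive f u by eexists; apply: D1.
  by auto_derive => //; rewrite (is_derive_unique _ _ _ (D1 u hu)); ring.
rewrite {1}(_ : u = z + (u - z)); last by ring.
apply: Rle_trans (_ : M * Rabs (u - z) <= _).
  by apply: (@taylor0 f1 f2) => v hv; [apply: D2 | apply: B]; apply: btw_sub hv.
by apply: Rmult_le_compat_l => //; apply: btw_abs.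
Qed.

Lemma taylor2 f f1 f2 f3 M z e :
  (forall u, btw z e u -> is_derive f u (f1 u)) ->
  (forall u, btw z e u -> is_derive f1 u (f2 u)) ->
  (forall u, btw z e u -> is_derive f2 u (f3 u)) ->
  (forall u, btw z e u -> Rabs (f3 u) <= M) ->
  Rabs (f (z + e) - f z - e * f1 z - e ^ 2 / 2 * f2 z) <= M * Rabs e ^ 3.
Proof.
move=> D1 D2 D3 B; have M0 : 0 <= M by apply: Rle_trans (Rabs_pos _) (B _ (btw_start z e)).
have -> : f (z + e) - f z - e * f1 z - e ^ 2 / 2 * f2 z =
  (f (z + e) - (z + e) * f1 z - (z + e - z) ^ 2 / 2 * f2 z)
  - (f z - z * f1 z - (z - z) ^ 2 / 2 * f2 z) by field.
rewrite (_ : M * Rabs e ^ 3 = M * Rabs e ^ 2 * Rabs e); last by ring.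
apply: (@taylor0 (fun u => f u - u * f1 z - (u - z) ^ 2 / 2 * f2 z)
  (fun u => f1 u - f1 z - (u - z) * f2 z)) => u hu.
  have E : ex_derive f u by eexists; apply: D1.
  by auto_derive => //; rewrite (is_derive_unique _ _ _ (D1 u hu)); field.
rewrite {1}(_ : u = z + (u - z)); last by ring.
apply: Rle_trans (_ : M * Rabs (u - z) ^ 2 <= _).
  by apply: (@taylor1 f1 f2 f3) => v hv; [apply: D2 | apply: D3 | apply: B]; apply: btw_sub hv.
apply: Rmult_le_compat_l => //; apply: pow_incr; split; first exact: Rabs_pos.
exact: btw_abs.
Qed.

(** Probability that [z] plus a centred Gaussian of variance [s] is at most [a]: the indicator of
    [z <= a] mollified by the heat flow. [heat1], [heat2], [heat3] are its derivatives in [z], and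
    [heat_ss] is its second derivative in [s]. *)
Definition heat (a s z : R) := gcdf ((a - z) / sqrt s).
Definition hc : R := / sqrt (2 * PI).
Definition heat1 (a s z : R) := - hc * gker ((a - z) / sqrt s) / sqrt s.
Definition heat2 (a s z : R) :=
  - hc * ((a - z) / sqrt s * gker ((a - z) / sqrt s)) / s.
Definition heat3 (a s z : R) :=
  hc * ((1 - ((a - z) / sqrt s) ^ 2) * gker ((a - z) / sqrt s)) / (s * sqrt s).
Definition heat_ss (a s z : R) :=
  hc / (4 * s ^ 2) * ((a - z) / sqrt s * (3 - ((a - z) / sqrt s) ^ 2) * gker ((a - z) / sqrt s)).

Lemma gker_deriv y : is_derive gker y (- y * gker y).
Proof.
rewrite /gker; auto_derive => //; simpl.
by rewrite -/(Rdiv (- (y * (y * 1))) 2); set E := exp _; field.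
Qed.

Lemma hc_bound : 0 < hc <= 1.
Proof.
have := sqrt2PI_gt0 => h; split; first exact: Rinv_0_lt_compat.
rewrite /hc -Rinv_1; apply: Rinv_le_contravar; first lra.
by rewrite -sqrt_1; apply: sqrt_le_1_alt; have := PI2_1; lra.
Qed.

Section HeatDerivatives.
Variables (a s z : R).
Hypothesis s_gt0 : 0 < s.

Let rs_gt0 : 0 < sqrt s. Proof. exact: sqrt_lt_R0. Qed.

Lemma heat_dx : is_derive (heat a s) z (heat1 a s z).
Proof.
have E y : ex_derive gcdf y by eexists; apply: gcdf_deriv.
rewrite /heat /heat1; auto_derive; first by repeat split; solve [exact: E | lra | apply: Rgt_not_eq; lra].
rewrite (is_derive_unique _ _ _ (gcdf_deriv _)) /hc /Rminus /Rdiv.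
by field; split; apply: Rgt_not_eq => //; apply: sqrt2PI_gt0.
Qed.

Lemma heat1_dx : is_derive (heat1 a s) z (heat2 a s z).
Proof.
have E y : ex_derive gker y by eexists; apply: gker_deriv.
rewrite /heat1 /heat2; auto_derive; first by repeat split; solve [exact: E | lra | apply: Rgt_not_eq; lra].
rewrite (is_derive_unique _ _ _ (gker_deriv _)).
have Is : / s = / sqrt s * / sqrt s by rewrite -Rinv_mult sqrt_sqrt //; lra.
by rewrite /Rminus /Rdiv Is; ring.
Qed.

Lemma heat2_dx : is_derive (heat2 a s) z (heat3 a s z).
Proof.
have E y : ex_derive gker y by eexists; apply: gker_deriv.
rewrite /heat2 /heat3; auto_derive; first by repeat split; solve [exact: E | lra | apply: Rgt_not_eq; lra].
rewrite (is_derive_unique _ _ _ (gker_deriv _)).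
rewrite /Rminus /Rdiv Rinv_mult.
have Is : / s = / sqrt s * / sqrt s by rewrite -Rinv_mult sqrt_sqrt //; lra.
by ring.
Qed.

Lemma heat_ds : is_derive (fun s => heat a s z) s (/ 2 * heat2 a s z).
Proof.
have E y : ex_derive gcdf y by eexists; apply: gcdf_deriv.
rewrite /heat /heat2; auto_derive; first by repeat split; solve [exact: E | lra | apply: Rgt_not_eq; lra].
rewrite (is_derive_unique _ _ _ (gcdf_deriv _)) /hc /Rminus /Rdiv.
set Y := gker _.
have -> : / s = / sqrt s * / sqrt s by rewrite -Rinv_mult sqrt_sqrt //; lra.
by field; split; apply: Rgt_not_eq => //; apply: sqrt2PI_gt0.
Qed.

Lemma heat_dss : is_derive (fun s => / 2 * heat2 a s z) s (heat_ss a s z).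
Proof.
have E y : ex_derive gker y by eexists; apply: gker_deriv.
rewrite /heat_ss /heat2; auto_derive.
  by repeat split; solve [exact: E | lra | apply: Rgt_not_eq; lra].
rewrite (is_derive_unique _ _ _ (gker_deriv _)) /Rminus /Rdiv.
set Y := gker _.
have S2 : s = sqrt s * sqrt s by rewrite sqrt_sqrt //; lra.
have Is : / s = / sqrt s * / sqrt s by rewrite -Rinv_mult sqrt_sqrt //; lra.
move: rs_gt0; set q := sqrt s in S2 Is Y *; rewrite S2 => q0.
by field; apply: Rgt_not_eq.
Qed.

End HeatDerivatives.

(** Square of [1 + y^2/4 <= exp (y^2/4)]. *)
Lemma gker_poly y : (1 + y ^ 2 / 2 + y ^ 4 / 16) * gker y <= 1.
Proof.
have h0 := exp_ge1x (y ^ 2 / 4); have y2 := pow2_ge_0 y.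
have E : exp (y ^ 2 / 2) = exp (y ^ 2 / 4) ^ 2 by rewrite -exp_mulN; congr exp; simpl; field.
have : 1 + y ^ 2 / 2 + y ^ 4 / 16 <= exp (y ^ 2 / 2).
  rewrite E (_ : 1 + y ^ 2 / 2 + y ^ 4 / 16 = (1 + y ^ 2 / 4) ^ 2); last by field.
  by apply: pow_incr; lra.
rewrite /gker (_ : - y ^ 2 / 2 = - (y ^ 2 / 2)) ?exp_Ropp; last by field.
move=> h; have p := exp_pos (y ^ 2 / 2).
by apply: (Rmult_le_reg_r (exp (y ^ 2 / 2))) => //; rewrite Rmult_assoc Rinv_l; lra.
Qed.

Lemma gker_poly2 y : Rabs ((1 - y ^ 2) * gker y) <= 8.
Proof.
have := gker_poly y; have g0 := gker_gt0 y; have y2 := pow2_ge_0 y.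
have -> : y ^ 4 = y ^ 2 * y ^ 2 by ring.
move=> h; apply: Rabs_le; split; nra.
Qed.

Lemma gker_poly3 y : Rabs (y * (3 - y ^ 2) * gker y) <= 8.
Proof.
have h := gker_poly y; have g0 := gker_gt0 y; have y2 := pow2_ge_0 y.
have B : Rabs (y * (3 - y ^ 2)) <= 8 * (1 + y ^ 2 / 2 + y ^ 4 / 16).
  apply: Rabs_le; have -> : y ^ 4 = y ^ 2 * y ^ 2 by ring.
  have -> : y * (3 - y ^ 2) = 3 * y - y * y ^ 2 by ring.
  have := pow2_ge_0 (y - 1); have := pow2_ge_0 (y + 1).
  have := pow2_ge_0 (y ^ 2 - y); have := pow2_ge_0 (y ^ 2 + y).
  by split; nra.
rewrite Rabs_mult (Rabs_pos_eq (gker y)); last lra.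
by apply: Rle_trans (Rmult_le_compat_r _ _ _ (Rlt_le _ _ g0) B) _; lra.
Qed.

(** The two expansions required by [lindeberg]. [heat3] is O(s^(-3/2)) and [heat_ss] is O(s^(-2)),
    so a starting time [s0 > 0] gives one constant for all later times and all thresholds [a]. *)
Lemma heat_bounds s0 : 0 < s0 -> exists M, 0 <= M /\ forall a,
  (forall s z e, s0 <= s ->
    Rabs (heat a s (z + e) - heat a s z - e * heat1 a s z - e ^ 2 / 2 * heat2 a s z)
    <= M * Rabs e ^ 3) /\
  (forall s z t, s0 <= s -> 0 <= t ->
    Rabs (heat a (s + t) z - heat a s z - t / 2 * heat2 a s z) <= M * t ^ 2).
Proof.
move=> h0; have r0 : 0 < sqrt s0 by apply: sqrt_lt_R0.
have [c0 c1] := hc_bound.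
have M1 : 0 < / (s0 * sqrt s0) by apply: Rinv_0_lt_compat; apply: Rmult_lt_0_compat.
have M2 : 0 < / s0 ^ 2 by apply: Rinv_0_lt_compat; apply: pow_lt.
exists (8 * / (s0 * sqrt s0) + 8 * / s0 ^ 2); split; first lra.
move=> a; split.
  move=> s z e hs; have s_gt0 : 0 < s by lra.
  apply: (@taylor2 (heat a s) (heat1 a s) (heat2 a s) (heat3 a s)) => u _.
  - exact: heat_dx.
  - exact: heat1_dx.
  - exact: heat2_dx.
  rewrite /heat3 /Rdiv; set y := (a - u) * / sqrt s.
  have rs : sqrt s0 <= sqrt s by apply: sqrt_le_1_alt.
  have q : 0 < / (s * sqrt s) <= / (s0 * sqrt s0).
    split; first by apply: Rinv_0_lt_compat; apply: Rmult_lt_0_compat; lra.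
    by apply: Rinv_le_contravar; [apply: Rmult_lt_0_compat | apply: Rmult_le_compat; lra].
  rewrite !Rabs_mult -Rabs_mult (Rabs_pos_eq hc); last lra.
  rewrite (Rabs_pos_eq (/ _)); last lra.
  have := gker_poly2 y; have := Rabs_pos ((1 - y ^ 2) * gker y).
  set X := Rabs _ => X0 X8.
  apply: Rle_trans (_ : 1 * 8 * / (s0 * sqrt s0) <= _); last lra.
  by apply: Rmult_le_compat; try lra; [apply: Rmult_le_pos; lra | apply: Rmult_le_compat; lra].
move=> s z t hs ht.
have -> : t / 2 * heat2 a s z = t * (/ 2 * heat2 a s z) by field.
rewrite -{3}(Rabs_pos_eq t ht).
apply: (@taylor1 (fun s => heat a s z) (fun s => / 2 * heat2 a s z) (fun s => heat_ss a s z)) => u hu;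
  have s_gt0 : 0 < u by have := btw_pos ht hu; lra.
- exact: heat_ds.
- exact: heat_dss.
rewrite /heat_ss; set y := (a - z) / sqrt u.
have su := btw_pos ht hu.
have q : 0 < / (4 * u ^ 2) <= / s0 ^ 2.
  have : s0 ^ 2 <= u ^ 2 by apply: pow_incr; lra.
  have : 0 < s0 ^ 2 by apply: pow_lt.
  move=> q1 q2; split; first by apply: Rinv_0_lt_compat; lra.
  by apply: Rinv_le_contravar; lra.
rewrite /Rdiv Rabs_mult (Rabs_mult hc) (Rabs_pos_eq hc); last lra.
rewrite (Rabs_pos_eq (/ _)); last lra.
have := gker_poly3 y; have := Rabs_pos (y * (3 - y ^ 2) * gker y).
set X := Rabs _ => X0 X8.
apply: Rle_trans (_ : (1 * / s0 ^ 2) * 8 <= _); last lra.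
by apply: Rmult_le_compat; try lra; [apply: Rmult_le_pos; lra | apply: Rmult_le_compat; lra].
Qed.

(** * Finite Fourier analysis *)

Lemma sin_IZR_period x (k : Z) : sin (x + 2 * IZR k * PI) = sin x.
Proof.
have P (n : nat) y : sin (y + 2 * IZR (Z.of_nat n) * PI) = sin y.
  by rewrite -INR_IZR_INZ; apply: sin_period.
case: (Z.le_gt_cases 0 k) => h; first by rewrite -(Z2Nat.id k) //; apply: P.
rewrite -(P (Z.to_nat (- k)) (x + 2 * IZR k * PI)); congr sin.
by rewrite Z2Nat.id ?opp_IZR; [ring | lia].
Qed.

Lemma cos_IZR_period x (k : Z) : cos (x + 2 * IZR k * PI) = cos x.
Proof.
rewrite !cos_sin (_ : PI / 2 + (x + 2 * IZR k * PI) = PI / 2 + x + 2 * IZR k * PI); last by ring.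
by rewrite sin_IZR_period.
Qed.

Lemma cos_sum_telescope (Q : nat) a z :
  2 * sin z * \sum_(x < Q) cos (a + 2 * INR x * z) = sin (a + (2 * INR Q - 1) * z) - sin (a - z).
Proof.
elim: Q => [|Q IH].
  by rewrite big_ord0 Rmult_0_r (_ : a + (2 * INR 0 - 1) * z = a - z); [lra | simpl; ring].
rewrite big_ord_recr /= Rmult_plus_distr_l IH.
have -> : a + (2 * INR Q.+1 - 1) * z = (a + 2 * INR Q * z) + z by rewrite S_INR; ring.
have -> : a + (2 * INR Q - 1) * z = (a + 2 * INR Q * z) - z by ring.
by rewrite sin_plus sin_minus; ring.
Qed.

Definition tpi (Q : nat) (k : Z) (x : nat) : R := 2 * PI * INR x * IZR k / INR Q.

Lemma cos_sum0 (Q : nat) (k : Z) a : (0 < Q)%N -> sin (PI * IZR k / INR Q) <> 0 ->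
  \sum_(x < Q) cos (a + tpi Q k x) = 0.
Proof.
move=> Q0 hs; have q0 := INR_ltn0 Q0.
have := cos_sum_telescope Q a (PI * IZR k / INR Q).
have -> : a + (2 * INR Q - 1) * (PI * IZR k / INR Q) = (a - PI * IZR k / INR Q) + 2 * IZR k * PI.
  by field; lra.
rewrite sin_IZR_period Rminus_diag.
move/Rmult_integral => [h|h]; first by exfalso; apply: hs; lra.
rewrite -[RHS]h; apply: eq_bigr => x _; congr cos; rewrite /tpi; field; lra.
Qed.

(** Orthogonality of characters modulo [Q]: if the sine [sin (PI * k / Q)] is nonzero the sum
    telescopes to zero; if it vanishes, [Q] divides [k] and all terms agree. *)
Lemma cos_sum_dichotomy (Q : nat) (k : Z) : (0 < Q)%N ->
  (forall a, \sum_(x < Q) cos (a + tpi Q k x) = 0) \/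
  (forall a, \sum_(x < Q) cos (a + tpi Q k x) = INR Q * cos a).
Proof.
move=> Q0; have q0 := INR_ltn0 Q0.
case: (Req_dec (sin (PI * IZR k / INR Q)) 0) => h; last by left=> a; apply: cos_sum0.
right=> a; have [l hl] := sin_eq_0_0 _ h.
rewrite -(Rsum_ord_const Q); apply: eq_bigr => x _.
rewrite -(cos_IZR_period a (Z.of_nat x * l)); congr cos.
have -> : tpi Q k x = 2 * INR x * (PI * IZR k / INR Q) by rewrite /tpi; field; lra.
by rewrite hl mult_IZR -INR_IZR_INZ; ring.
Qed.

Lemma fourier_indicator (Q y n : nat) : (y < Q)%N -> (n < Q)%N ->
  / INR Q * \sum_(x < Q) cos (2 * PI * INR x / INR Q * (INR y - INR n)) =
  (if y == n then 1 else 0).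
Proof.
move=> yQ nQ; have Q0 : (0 < Q)%N by apply: leq_ltn_trans yQ.
have q0 := INR_ltn0 Q0.
case: eqP => [->|ne].
  rewrite (eq_bigr (fun _ => 1)); last by move=> x _; rewrite Rminus_diag Rmult_0_r cos_0.
  by rewrite Rsum_ord_const; field; lra.
rewrite (eq_bigr (fun x : 'I_Q => cos (0 + tpi Q (Z.of_nat y - Z.of_nat n) x))); last first.
  by move=> x _; congr cos; rewrite /tpi minus_IZR -!INR_IZR_INZ; field; lra.
rewrite cos_sum0 ?Rmult_0_r // minus_IZR -!INR_IZR_INZ.
have piq : 0 < PI / INR Q by apply: Rdiv_lt_0_compat => //; exact: PI_RGT_0.
have yr := INR_ltn yQ; have nr := INR_ltn nQ; have y0 := pos_INR y; have n0 := pos_INR n.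
have E : PI / INR Q * INR Q = PI by field; lra.
rewrite (_ : PI * (INR y - INR n) / INR Q = PI / INR Q * (INR y - INR n)); last by field; lra.
have ner : INR y <> INR n by move=> /INR_eq.
case: (Rtotal_order (INR y) (INR n)) => [h|[//|h]].
  rewrite (_ : INR y - INR n = - (INR n - INR y)); last by ring.
  rewrite -Ropp_mult_distr_r sin_neg.
  suff : 0 < sin (PI / INR Q * (INR n - INR y)) by lra.
  by apply: sin_gt_0; nra.
by apply: Rgt_not_eq; apply: sin_gt_0; nra.
Qed.

Lemma sin_mul_le (j : nat) z : Rabs (sin (INR j * z)) <= INR j * Rabs (sin z).
Proof.
elim: j => [|j IH]; first by rewrite /= Rmult_0_l sin_0 Rabs_R0; lra.
rewrite S_INR Rmult_plus_distr_r Rmult_1_l sin_plus.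
apply: Rle_trans (Rabs_triang _ _) _; rewrite !Rabs_mult.
have c1 y : Rabs (cos y) <= 1 by apply: Rabs_le; have := COS_bound y; lra.
have := c1 z; have := c1 (INR j * z); have := Rabs_pos (sin (INR j * z)); have := Rabs_pos (sin z).
by nra.
Qed.

Lemma sin_abs_le z : Rabs (sin z) <= Rabs z.
Proof.
have [c [_ H]] := MVT_gen sin 0 z cos (fun u _ => is_derive_sin u)
  (fun u _ => derivable_continuous_pt _ _ (derivable_pt_sin u)).
rewrite sin_0 !Rminus_0_r in H; rewrite H Rabs_mult.
have : Rabs (cos c) <= 1 by apply: Rabs_le; have := COS_bound c; lra.
by have := Rabs_pos z; nra.
Qed.

(* distance of x / Q to the nearest integer *)
Definition fdist (Q x : nat) := INR (minn x (Q - x)) / INR Q.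

Lemma fdist_cases Q x : (x < Q)%N ->
  fdist Q x = INR x / INR Q \/ fdist Q x = 1 - INR x / INR Q.
Proof.
move=> xQ; have q0 : 0 < INR Q by apply: INR_ltn0; apply: leq_ltn_trans xQ.
rewrite /fdist; case: (leqP x (Q - x)) => h; first by left.
by right; rewrite minus_INR; [field; lra | lia].
Qed.

Lemma fdist_bound Q x : (x < Q)%N -> 0 <= fdist Q x <= / 2.
Proof.
move=> xQ; have q0 : 0 < INR Q by apply: INR_ltn0; apply: leq_ltn_trans xQ.
split; first by apply: Rmult_le_pos; [apply: pos_INR | left; apply: Rinv_0_lt_compat].
apply: (Rmult_le_reg_r (INR Q)) => //; rewrite /fdist /Rdiv Rmult_assoc Rinv_l; last lra.
suff : INR (minn x (Q - x)) * 2 <= INR Q by lra.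
by rewrite -(mult_INR _ 2); apply: INR_leq; lia.
Qed.

Lemma cos_fdist Q x (h : nat) : (x < Q)%N ->
  cos (2 * PI * INR x / INR Q * INR h) = cos (2 * PI * fdist Q x * INR h).
Proof.
move=> xQ; case: (fdist_cases xQ) => ->; first by congr cos; rewrite /Rdiv; ring.
rewrite -cos_neg -(cos_IZR_period _ (Z.of_nat h)) -INR_IZR_INZ; congr cos.
by rewrite /Rdiv; ring.
Qed.

Lemma lin_le_sqrt a b C S : a ^ 2 + b ^ 2 <= 1 -> Rabs (a * C - b * S) <= sqrt (C ^ 2 + S ^ 2).
Proof.
move=> h; rewrite -[X in X <= _]sqrt_pow2; last exact: Rabs_pos.
apply: sqrt_le_1_alt; rewrite pow2_abs.
have := pow2_ge_0 (a * S + b * C); have := pow2_ge_0 C; have := pow2_ge_0 S; nra.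
Qed.

Section Modulus.
Variables (d : nat) (w : nat -> nat -> R).
Hypothesis d_ge2 : (2 <= d)%N.
Hypothesis w_ge0 : forall h k, 0 <= w h k.
Hypothesis w_sum : forall h, \sum_(k < d) w h k = 1.
Notation Ex := (Ex d w).

Definition Ecos l th := Ex l (fun _ y => cos (th * INR y)).
Definition Esin l th := Ex l (fun _ y => sin (th * INR y)).

(* squared modulus of the characteristic function of the sum of the [a_h * h] *)
Definition cmod2 l th := Ecos l th ^ 2 + Esin l th ^ 2.

Lemma Ecos_shift l th c :
  Ex l (fun _ y => cos (c + th * INR y)) = cos c * Ecos l th - sin c * Esin l th.
Proof.
by rewrite /Ecos /Esin -!Ex_scal -Ex_sub; apply: Ex_ext => x y; rewrite cos_plus.
Qed.

Lemma Esin_shift l th c :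
  Ex l (fun _ y => sin (c + th * INR y)) = sin c * Ecos l th + cos c * Esin l th.
Proof.
by rewrite /Ecos /Esin -!Ex_scal -Ex_add; apply: Ex_ext => x y; rewrite sin_plus.
Qed.

Definition dcos h th := \sum_(k < d) (w h k * cos (th * INR h * INR k)).
Definition dsin h th := \sum_(k < d) (w h k * sin (th * INR h * INR k)).

Lemma cmod2_cons h l th : cmod2 (h :: l) th = (dcos h th ^ 2 + dsin h th ^ 2) * cmod2 l th.
Proof.
have C : Ecos (h :: l) th = dcos h th * Ecos l th - dsin h th * Esin l th.
  rewrite [Ecos (h :: l) th]/Ecos [LHS]/= /dcos /dsin !big_distrl [RHS]/=.
  rewrite (eq_bigr (fun k : 'I_d => w h k * cos (th * INR h * INR k) * Ecos l th +
     (-1) * (w h k * sin (th * INR h * INR k) * Esin l th))).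
    by rewrite big_split /= -big_distrr /=; ring.
  move=> k _; rewrite (Ex_ext d w l (G := fun _ y => cos (th * INR h * INR k + th * INR y))).
    by rewrite Ecos_shift; ring.
  by move=> x y; rewrite plus_INR mult_INR; congr cos; ring.
have S : Esin (h :: l) th = dsin h th * Ecos l th + dcos h th * Esin l th.
  rewrite [Esin (h :: l) th]/Esin [LHS]/= /dcos /dsin !big_distrl [RHS]/= -big_split [RHS]/=; apply: eq_bigr => k _.
  rewrite (Ex_ext d w l (G := fun _ y => sin (th * INR h * INR k + th * INR y))).
    by rewrite Esin_shift; ring.
  by move=> x y; rewrite plus_INR mult_INR; congr sin; ring.
by rewrite /cmod2 C S; ring.
Qed.

(** One minus the squared modulus is the double sum of [w h k * w h j * (1 - cos (th h (k - j)))],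
    whose terms are nonnegative; only the pairs (0, 1) and (1, 0) are kept. *)
Lemma dmod2_le h th :
  dcos h th ^ 2 + dsin h th ^ 2 <= 1 - 2 * (w h 0 * w h 1) * (1 - cos (th * INR h)).
Proof.
set f := fun k j : nat => w h k * (w h j * (1 - cos (th * INR h * INR k - th * INR h * INR j))).
have u0 y : 0 <= 1 - cos y by have := COS_bound y; lra.
have f0 k j : 0 <= f k j by apply: Rmult_le_pos => //; apply: Rmult_le_pos.
have E : 1 - (dcos h th ^ 2 + dsin h th ^ 2) = \sum_(k < d) \sum_(j < d) f k j.
  rewrite (eq_bigr (fun k : 'I_d => w h k - dcos h th * (w h k * cos (th * INR h * INR k))
     - dsin h th * (w h k * sin (th * INR h * INR k)))); last first.
    move=> k _; rewrite /f -big_distrr /=.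
    rewrite (eq_bigr (fun j : 'I_d => w h j + ((- cos (th * INR h * INR k)) * (w h j * cos (th * INR h * INR j))
      + (- sin (th * INR h * INR k)) * (w h j * sin (th * INR h * INR j))))).
      by rewrite !big_split /= w_sum -!big_distrr /= -/(dcos h th) -/(dsin h th); ring.
    by move=> j _; rewrite cos_minus; ring.
  rewrite (eq_bigr (fun k : 'I_d => w h k + ((- dcos h th) * (w h k * cos (th * INR h * INR k))
     + (- dsin h th) * (w h k * sin (th * INR h * INR k))))); last by move=> k _; ring.
  by rewrite !big_split /= w_sum -!big_distrr /= -/(dcos h th) -/(dsin h th); ring.
have two (g : nat -> R) : (forall k, 0 <= g k) -> g 0%N + g 1%N <= \sum_(k < d) g k.
  move=> g0; rewrite ord_sumE.
  have -> : g 0%N + g 1%N = \sum_(k <- [:: 0%N; 1%N]) g k by rewrite !big_cons big_nil; lra.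
  apply: Rsum_subset => // k; rewrite !inE mem_iota add0n => /orP [] /eqP -> //.
  exact: ltnW.
have := two (fun k => \sum_(j < d) f k j) (fun k => Rsum_ord_ge0 (fun j _ => f0 k j)).
rewrite -E /=.
have A : f 0%N 1%N <= \sum_(j < d) f 0%N j by apply: (Rsum_ord_ge1 (F := f 0%N)).
have B : f 1%N 0%N <= \sum_(j < d) f 1%N j.
  by apply: (Rsum_ord_ge1 (F := f 1%N)) => //; apply: ltnW.
have FA : f 0%N 1%N = w h 0 * w h 1 * (1 - cos (th * INR h)).
  rewrite /f /= (_ : th * INR h * 0 - th * INR h * 1 = - (th * INR h)) ?cos_neg; ring.
have FB : f 1%N 0%N = w h 0 * w h 1 * (1 - cos (th * INR h)).
  rewrite /f /= (_ : th * INR h * 1 - th * INR h * 0 = th * INR h); ring.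
rewrite -/(pow _ 1) => T; have := Rle_trans _ _ _ (Rplus_le_compat _ _ _ _ A B) T; rewrite FA FB; simpl; lra.
Qed.

(** The majorant of a digit factor. Written as [(1 - e) + e * cos y] it has nonnegative Fourier
    coefficients, and products keep this property, which an exponential bound would not offer to the
    averaging argument. *)
Definition psi (e y : R) := 1 - e * (1 - cos y).

Lemma psi_bound e y : 0 <= e <= / 2 -> 0 <= psi e y <= 1.
Proof. by have := COS_bound y => B1 B2; rewrite /psi; split; nra. Qed.

(** Digits outside [W] are bounded by 1. For those in [W], [1 - 4 x <= (1 - x)^4] turns the bound of
    [dmod2_le] into the fourth power of [psi]; the square in the conclusion provides the two copies
    of the product that the minor arcs need. *)
Lemma cmod2_le (e : R) l W th : 0 <= e <= / 8 -> uniq W -> {subset W <= l} ->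
  (forall h, h \in W -> 2 * e <= w h 0 * w h 1) ->
  sqrt (cmod2 l th) <= (\prod_(h <- W) psi e (th * INR h)) ^ 2.
Proof.
move=> he uW sW hW.
have P0 : 0 <= \prod_(h <- W) psi e (th * INR h).
  by apply: Rprod_ge0 => h _; case: (@psi_bound e (th * INR h) ltac:(lra)).
rewrite -[X in _ <= X]sqrt_pow2; last by apply: pow2_ge_0.
apply: sqrt_le_1_alt.
set m := fun h => dcos h th ^ 2 + dsin h th ^ 2.
have -> : cmod2 l th = \prod_(h <- l) m h.
  elim: l {sW} => [|h l IH]; last by rewrite big_cons cmod2_cons IH.
  by rewrite /cmod2 /Ecos /Esin /= big_nil Rmult_0_r cos_0 sin_0; lra.
have u0 h : 0 <= 1 - cos (th * INR h) <= 2 by have := COS_bound (th * INR h); lra.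
have m01 h : 0 <= m h <= 1.
  split; first by have := pow2_ge_0 (dcos h th); have := pow2_ge_0 (dsin h th); rewrite /m; lra.
  apply: Rle_trans (dmod2_le h th) _.
  have := Rmult_le_pos _ _ (w_ge0 h 0) (w_ge0 h 1); have := u0 h; nra.
apply: Rle_trans (Rprod_subset uW sW (fun h _ => m01 h)) _.
have -> : ((\prod_(h <- W) psi e (th * INR h)) ^ 2) ^ 2 = \prod_(h <- W) (psi e (th * INR h) ^ 4).
  elim: W {uW sW hW P0} => [|h W IH]; first by rewrite !big_nil; lra.
  by rewrite !big_cons -IH; ring.
apply: Rprod_le => h hl; split; first by case: (m01 h).
apply: Rle_trans (dmod2_le h th) _.
have := hW h hl; have := u0 h; rewrite /psi; set u := 1 - _; set q := w h 0 * _ => U Hq.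
have eu : 0 <= e * u <= / 4 by nra.
apply: Rle_trans (_ : 1 - 4 * (e * u) <= _); first by nra.
move: eu; set x := e * u => X.
have -> : (1 - x) ^ 4 = 1 - 4 * x + x ^ 2 * (2 + (2 - x) ^ 2) by ring.
by have := pow2_ge_0 x; have := pow2_ge_0 (2 - x); nra.
Qed.

(** Probability that the weighted sum over [l] equals [n - m], viewed as a function of the offset
    [m] contributed by all other digits. *)
Definition hit l (n m : nat) := Ex l (fun _ y => if (m + y == n)%N then 1 else 0).

(** Since [Q] exceeds [n] and every value of the sum, equality is congruence modulo [Q]; the
    circle-method integral becomes a finite sum over the frequencies [x / Q]. *)
Lemma hit_fourier l n m Q : (n < Q)%N -> (m + d * sumn l < Q)%N ->
  hit l n m = / INR Q * \sum_(x < Q)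
    Ex l (fun _ y => cos (2 * PI * INR x / INR Q * (INR m - INR n) + 2 * PI * INR x / INR Q * INR y)).
Proof.
move=> nQ mQ; rewrite -(Ex_sum d w l Q (fun x _ y => cos (2 * PI * INR x / INR Q * (INR m - INR n) +
  2 * PI * INR x / INR Q * INR y))) -Ex_scal.
apply: Rle_antisym; apply: Ex_le_in => // x y _ hy;
  rewrite -(@fourier_indicator Q (m + y) n) //; try (by apply: leq_ltn_trans mQ; rewrite leq_add2l);
  right; congr (_ * _); apply: eq_bigr => i _; congr cos; rewrite plus_INR; ring.
Qed.

Lemma hit_le l n m Q (bnd : nat -> R) : (n < Q)%N -> (m + d * sumn l < Q)%N ->
  (forall x, (x < Q)%N -> sqrt (cmod2 l (2 * PI * INR x / INR Q)) <= bnd x) ->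
  hit l n m <= / INR Q * \sum_(x < Q) bnd x.
Proof.
move=> nQ mQ H; have Q0 : (0 < Q)%N by apply: leq_ltn_trans nQ.
rewrite (hit_fourier nQ mQ); apply: Rmult_le_compat_l.
  by left; apply: Rinv_0_lt_compat; apply: INR_ltn0.
apply: (Rsum_ord_le (F := fun x => Ex l (fun _ y => cos (2 * PI * INR x / INR Q * (INR m - INR n)
  + 2 * PI * INR x / INR Q * INR y)))) => x xQ.
rewrite Ecos_shift; apply: Rle_trans (H x xQ); apply: Rle_trans (Rle_abs _) _.
apply: lin_le_sqrt; set t := (2 * PI * _ / _ * _); have := sin2_cos2 t; rewrite /Rsqr /=; lra.
Qed.

(** The two phases differ by [2 |sin (PI x (m' - m) / Q)|]. Of the two bounds in the minimum, the
    trivial one serves on the minor arcs and the linear one on the major arcs. *)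
Lemma hit_lip l n m m' Q (bnd : nat -> R) : (n < Q)%N ->
  (m + d * sumn l < Q)%N -> (m' + d * sumn l < Q)%N -> (m <= m')%N ->
  (forall x, (x < Q)%N -> sqrt (cmod2 l (2 * PI * INR x / INR Q)) <= bnd x) ->
  Rabs (hit l n m - hit l n m') <=
  / INR Q * \sum_(x < Q) (bnd x * Rmin 2 (2 * PI * INR (m' - m) * fdist Q x)).
Proof.
move=> nQ mQ mQ' mm H; have Q0 : (0 < Q)%N by apply: leq_ltn_trans nQ.
have q0 := INR_ltn0 Q0; have iq := Rinv_0_lt_compat _ q0.
rewrite (hit_fourier nQ mQ) (hit_fourier nQ mQ') -Rmult_minus_distr_l Rabs_mult.
rewrite (Rabs_pos_eq (/ _)); last lra.
apply: Rmult_le_compat_l; first lra.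
pose F (k x : nat) := Ex l (fun _ y => cos (2 * PI * INR x / INR Q * (INR k - INR n) +
  2 * PI * INR x / INR Q * INR y)).
have -> : \sum_(x < Q) F m x - \sum_(x < Q) F m' x = \sum_(x < Q) (F m x - F m' x).
  rewrite [RHS](eq_bigr (fun x : 'I_Q => F m x + (-1) * F m' x)); last by move=> x _; ring.
  by rewrite big_split /= -big_distrr /=; ring.
rewrite (ord_sumE Q (fun x => F m x - F m' x)); apply: Rle_trans (Rsum_abs _ _) _.
rewrite (ord_sumE Q (fun x => bnd x * Rmin 2 (2 * PI * INR (m' - m) * fdist Q x))).
apply: Rsum_le => x; rewrite mem_iota add0n => /andP [_ xQ].
rewrite /F !Ecos_shift; have := H x xQ; rewrite /cmod2.
set C := Ecos _ _; set S := Esin _ _; set a := _ / _ * (INR m - _); set b := _ / _ * (INR m' - _) => Hx.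
set z := PI * INR x / INR Q * INR (m' - m).
have D : (b - a) / 2 = z by rewrite /a /b /z minus_INR; [field; lra | lia].
have r0 : 0 <= Rabs (sin z) by apply: Rabs_pos.
have D' : (a - b) / 2 = - z by rewrite -D; field.
have E1 : cos a - cos b = 2 * sin z * sin ((a + b) / 2) by rewrite form2 D' sin_neg; ring.
have E2 : sin a - sin b = - (2 * sin z * cos ((a + b) / 2)) by rewrite form4 D' sin_neg; ring.
have -> : cos a * C - sin a * S - (cos b * C - sin b * S) =
  2 * sin z * (sin ((a + b) / 2) * C - (- cos ((a + b) / 2)) * S).
  by transitivity ((cos a - cos b) * C - (sin a - sin b) * S); [ring | rewrite E1 E2; ring].
rewrite !Rabs_mult (Rabs_pos_eq 2); last lra.
have L : Rabs (sin ((a + b) / 2) * C - - cos ((a + b) / 2) * S) <= bnd x.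
  apply: Rle_trans Hx; apply: lin_le_sqrt.
  by have := sin2_cos2 ((a + b) / 2); rewrite /Rsqr /=; lra.
have Z : 2 * Rabs (sin z) <= Rmin 2 (2 * PI * INR (m' - m) * fdist Q x).
  apply: Rmin_glb; first by have : Rabs (sin z) <= 1 by [apply: Rabs_le; have := SIN_bound z; lra]; lra.
  rewrite /z Rmult_comm; apply: Rle_trans (_ : (INR (m' - m) * Rabs (PI * fdist Q x)) * 2 <= _); last first.
    rewrite (Rabs_pos_eq (PI * _)); first lra.
    by apply: Rmult_le_pos; [have := PI_RGT_0; lra | case: (fdist_bound xQ)].
  apply: Rmult_le_compat_r; first lra.
  rewrite Rmult_comm; apply: Rle_trans (sin_mul_le _ _) _.
  apply: Rmult_le_compat_l; first exact: pos_INR.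
  apply: Rle_trans (sin_abs_le _); right.
  case: (fdist_cases xQ) => ->; first by congr (Rabs (sin _)); rewrite /Rdiv; ring.
  rewrite (_ : PI * (1 - _) = PI - PI * INR x / INR Q); last by rewrite /Rdiv; ring.
  by rewrite sin_PI_x.
rewrite Rmult_comm; apply: Rmult_le_compat => //; first exact: Rabs_pos; lra.
Qed.

End Modulus.

(** * Positive definite functions of period 1 and averages over frequencies *)

Inductive posdef : (R -> R) -> Prop :=
| posdef_cos c k : 0 <= c -> posdef (fun t => c * cos (2 * PI * IZR k * t))
| posdef_add f g : posdef f -> posdef g -> posdef (fun t => f t + g t)
| posdef_ext f g : (forall t, f t = g t) -> posdef f -> posdef g.

(** The product formula for two cosines has nonnegative coefficients. *)
Lemma posdef_mul f g : posdef f -> posdef g -> posdef (fun t => f t * g t).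
Proof.
move=> Hf; elim: Hf g => {f} [c k c0|f1 f2 _ IH1 _ IH2|f1 f2 E _ IH] g Hg.
- elim: Hg => {g} [c' k' c'0|g1 g2 _ IH1 _ IH2|g1 g2 E _ IH].
  + have H : 0 <= c * c' / 2 by apply: Rmult_le_pos; [apply: Rmult_le_pos | lra].
    apply: posdef_ext (posdef_add (posdef_cos (k + k') H) (posdef_cos (k - k') H)) => t /=.
    have -> : 2 * PI * IZR (k + k') * t = 2 * PI * IZR k * t + 2 * PI * IZR k' * t.
      by rewrite plus_IZR; ring.
    have -> : 2 * PI * IZR (k - k') * t = 2 * PI * IZR k * t - 2 * PI * IZR k' * t.
      by rewrite minus_IZR; ring.
    by rewrite cos_plus cos_minus; field.
  + by apply: posdef_ext (posdef_add IH1 IH2) => t /=; ring.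
  + by apply: posdef_ext IH => t /=; rewrite E.
- by apply: posdef_ext (posdef_add (IH1 g Hg) (IH2 g Hg)) => t /=; ring.
- by apply: posdef_ext (IH g Hg) => t /=; rewrite E.
Qed.

Lemma posdef_psi e (k : nat) : 0 <= e <= 1 -> posdef (fun t => psi e (2 * PI * INR k * t)).
Proof.
move=> he; apply: posdef_ext (posdef_add (@posdef_cos (1 - e) 0 _) (@posdef_cos e (Z.of_nat k) _)); try lra.
by move=> t; rewrite -INR_IZR_INZ /psi Rmult_0_r Rmult_0_l cos_0; ring.
Qed.

Lemma posdef_prod (I : Type) (r : seq I) (F : I -> R -> R) :
  (forall i, posdef (F i)) -> posdef (fun t => \prod_(i <- r) F i t).
Proof.
move=> H; elim: r => [|i r IH].
  apply: posdef_ext (@posdef_cos 1 0 _); last lra.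
  by move=> t; rewrite big_nil Rmult_0_r Rmult_0_l cos_0; lra.
by apply: posdef_ext (posdef_mul (H i) IH) => t; rewrite big_cons.
Qed.

Lemma posdef_period f t (k : Z) : posdef f -> f (t + IZR k) = f t.
Proof.
elim=> {f} [c l _|f g _ -> _ -> //|f g E _]; last by rewrite -!E.
rewrite -(cos_IZR_period (2 * PI * IZR l * t) (l * k)) mult_IZR; congr (c * cos _).
by ring.
Qed.

(** Summation over the coset kills the frequencies that are not multiples of [P] and multiplies the
    others by [P]; as the coefficients are nonnegative, what remains is largest at [t = 0]. *)
Lemma posdef_coset f (P : nat) t : (0 < P)%N -> posdef f ->
  \sum_(y < P) f (t + INR y / INR P) <= \sum_(y < P) f (INR y / INR P).
Proof.
move=> P0; elim=> {f} [c l c0|f g _ IHf _ IHg|f g E _ IH].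
- rewrite -!big_distrr /=; apply: Rmult_le_compat_l => //.
  rewrite (eq_bigr (fun y : 'I_P => cos (2 * PI * IZR l * t + tpi P l y))); last first.
    by move=> y _; congr cos; rewrite /tpi /Rdiv; ring.
  rewrite [X in _ <= X](eq_bigr (fun y : 'I_P => cos (0 + tpi P l y))); last first.
    by move=> y _; congr cos; rewrite /tpi /Rdiv; ring.
  case: (@cos_sum_dichotomy P l P0) => H; rewrite !H; first lra.
  apply: Rmult_le_compat_l; first exact: pos_INR.
  by rewrite cos_0; case: (COS_bound (2 * PI * IZR l * t)).
- by rewrite !big_split /=; apply: Rplus_le_compat.
- rewrite (eq_bigr (fun y : 'I_P => f (t + INR y / INR P))) => [|y _]; last by rewrite E.
  by rewrite [X in _ <= X](eq_bigr (fun y : 'I_P => f (INR y / INR P))) => [|y _]; last by rewrite E.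
Qed.

Lemma Rsum_ord_mul (a b : nat) (F : nat -> R) :
  \sum_(x < a * b) F x = \sum_(y < b) \sum_(x < a) F (x + a * y)%N.
Proof.
elim: b F => [|b IH] F; first by rewrite muln0 !big_ord0.
rewrite mulnS big_split_ord big_ord_recl /=; congr (_ + _).
  by apply: eq_bigr => x _; rewrite muln0 addn0.
rewrite (IH (fun x => F (a + x)%N)); apply: eq_bigr => y _; apply: eq_bigr => x _.
by rewrite /= mulnS addnCA.
Qed.

(** Split off the leading base-[P] digit [y] of [x]. It shifts the argument of the factor [a = 0] by
    [y / P] and changes the later ones by integers, so [posdef_coset] bounds the sum over [y] by the
    full sum at 0, uniformly in the lower digits, and the remaining factors form the same problem
    with [R] and [L] lowered by one. *)
Lemma posdef_average g (P R L : nat) : (0 < P)%N -> posdef g -> (forall t, 0 <= g t) -> (L <= R)%N ->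
  \sum_(x < P ^ R) \prod_(a <- iota 0 L) g (INR P ^ a * (INR x / INR P ^ R)) <=
  (\sum_(y < P) g (INR y / INR P)) ^ L * INR P ^ (R - L).
Proof.
move=> P0 pd g0; have p0 := INR_ltn0 P0.
have pk k : 0 < INR P ^ k by apply: pow_lt.
set G := \sum_(y < P) _.
have G0 : 0 <= G by apply: (Rsum_ord_ge0 (F := fun y => g (INR y / INR P))).
elim: L R => [|L IH] R LR.
  rewrite subn0 (eq_bigr (fun=> 1)); last by move=> x _; rewrite big_nil.
  by rewrite Rsum_ord_const pow_natE /=; lra.
case: R LR => [|R] LR //.
rewrite expnSr (Rsum_ord_mul _ _ (fun x => \prod_(a <- iota 0 L.+1) g (INR P ^ a * (INR x / INR P ^ R.+1)))).
rewrite exchange_big /= subSS.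
apply: Rle_trans (_ : \sum_(x < P ^ R) (G * \prod_(a <- iota 0 L) g (INR P ^ a * (INR x / INR P ^ R))) <= _); last first.
  by rewrite -big_distrr /= Rmult_assoc; apply: Rmult_le_compat_l => //; apply: IH.
apply: (Rsum_ord_le (F := fun x => \sum_(y < P) \prod_(a <- 0%N :: iota 1 L) g (INR P ^ a * (INR (x + P ^ R * y) / INR P ^ R.+1)))
  (G := fun x => G * \prod_(a <- iota 0 L) g (INR P ^ a * (INR x / INR P ^ R)))) => x _.
rewrite (eq_bigr (fun y : 'I_P => g (INR x / INR P ^ R.+1 + INR y / INR P) *
  \prod_(a <- iota 0 L) g (INR P ^ a * (INR x / INR P ^ R)))).
  rewrite -big_distrl /=; apply: Rmult_le_compat_r; first by apply: Rprod_ge0.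
  exact: posdef_coset.
move=> y _; rewrite big_cons; congr (_ * _).
  congr g; rewrite plus_INR mult_INR pow_natE /=; field; split; apply: Rgt_not_eq => //; exact: pk.
rewrite (iotaDl 1 0) big_map; apply: eq_bigr => a _.
rewrite -(posdef_period (INR P ^ a * (INR x / INR P ^ R)) (Z.of_nat (P ^ a * y)) pd) -INR_IZR_INZ; congr g.
rewrite plus_INR !mult_INR !pow_natE add1n /=; field; split; apply: Rgt_not_eq => //; exact: pk.
Qed.

(** * Orbits modulo 1 under multiplication by two coprime integers *)

Definition near (u tau : R) := exists k : Z, Rabs (u - IZR k) < tau.

Lemma cos_le_of_far u dl : 0 < dl <= / 2 -> ~ near u dl -> cos (2 * PI * u) <= cos (2 * PI * dl).
Proof.
move=> hd nu; set k := up (u - / 2); have [k1 k2] := archimed (u - / 2); rewrite -/k in k1 k2.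
have far : dl <= Rabs (u - IZR k) by apply: Rnot_lt_le => h; apply: nu; exists k.
have hf : Rabs (u - IZR k) <= / 2 by apply: Rabs_le; lra.
have -> : cos (2 * PI * u) = cos (2 * PI * Rabs (u - IZR k)).
  rewrite -(cos_IZR_period _ (- k)) opp_IZR.
  rewrite (_ : 2 * PI * u + 2 * - IZR k * PI = 2 * PI * (u - IZR k)); last by ring.
  rewrite /Rabs; case: Rcase_abs => _ //.
  by rewrite -cos_neg; congr cos; ring.
have := PI_RGT_0 => pi0.
case: far => [far|<-]; last lra.
by left; apply: cos_decreasing_1; nra.
Qed.

(** If [u] is within [1/(2P)] of [k], then [P u] is within [1/2] of [P k], so the integer close to
    [P u] must be [P k]; the closeness of [P u] then passes to [u] with a gain of the factor [P]. *)
Lemma near_of_orbit (P L : nat) u : (2 <= P)%N ->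
  (forall a, (a < L.+1)%N -> near (INR P ^ a * u) (/ (2 * INR P))) ->
  near u (/ (2 * INR P ^ L.+1)).
Proof.
move=> P2; have p2 := INR_leq P2; rewrite -[INR 2]/2 in p2.
elim: L u => [|L IH] u H; first by have := H 0%N isT; rewrite /= Rmult_1_l Rmult_1_r.
have [k hk] := H 0%N isT; rewrite /= Rmult_1_l in hk.
have [k' hk'] : near (INR P * u) (/ (2 * INR P ^ L.+1)).
  apply: IH => a aL; have := H a.+1 aL; rewrite /= (Rmult_comm (INR P)) Rmult_assoc //.
have pL : 0 < INR P ^ L.+1 by apply: pow_lt; lra.
have pL1 : 2 <= INR P ^ L.+1.
  by have := Rle_pow (INR P) 1 L.+1 ltac:(lra) ltac:(lia); rewrite pow_1; lra.
have i1 : / (2 * INR P ^ L.+1) <= / 4 by apply: Rinv_le_contravar; lra.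
have Pk : Rabs (INR P * u - IZR (Z.of_nat P * k)) < / 2.
  rewrite mult_IZR -INR_IZR_INZ -Rmult_minus_distr_l Rabs_mult Rabs_pos_eq; last lra.
  have -> : / 2 = INR P * / (2 * INR P) by field; lra.
  by apply: Rmult_lt_compat_l; lra.
have E : (Z.of_nat P * k = k')%Z.
  apply: (proj1 (Z.sub_move_0_r _ _)); apply: one_IZR_lt1; rewrite minus_IZR.
  have [? ?] := Rabs_def2 _ _ hk'; have [? ?] := Rabs_def2 _ _ Pk; lra.
exists k; move: hk'; rewrite -E mult_IZR -INR_IZR_INZ -Rmult_minus_distr_l Rabs_mult Rabs_pos_eq; last lra.
move=> h; apply: (Rmult_lt_reg_l (INR P)); first lra.
have pL0 : 0 < INR P ^ L by apply: pow_lt; lra.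
by apply: Rlt_le_trans h _; right; rewrite /=; field; repeat split; apply: Rgt_not_eq; lra.
Qed.

Lemma coprime_bezout (P Q : nat) : (0 < P)%N -> coprime P Q ->
  exists u v : nat, (u * P = v * Q + 1)%N.
Proof.
move=> P0 /(coprimeP _ P0) [[u v] /= h]; exists u, v; lia.
Qed.

Lemma dvd_pow_coprime (P Q : nat) (j : Z) a : (0 < P)%N -> coprime P Q ->
  (Z.of_nat Q | Z.of_nat P ^ Z.of_nat a * j)%Z -> (Z.of_nat Q | j)%Z.
Proof.
move=> P0 cop; have [u [v uv]] := coprime_bezout P0 cop.
elim: a => [|a IH]; first by rewrite Z.mul_1_l.
rewrite Nat2Z.inj_succ Z.pow_succ_r; last lia.
move=> [z hz]; apply: IH.
have uvZ : (Z.of_nat u * Z.of_nat P = Z.of_nat v * Z.of_nat Q + 1)%Z by lia.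
exists (Z.of_nat u * z - Z.of_nat v * (Z.of_nat P ^ Z.of_nat a * j))%Z.
set x := (Z.of_nat P ^ Z.of_nat a * j)%Z.
have hx : (Z.of_nat P * x = z * Z.of_nat Q)%Z by rewrite -hz /x; ring.
have e1 : (Z.of_nat u * (Z.of_nat P * x) = (Z.of_nat v * Z.of_nat Q + 1) * x)%Z.
  by rewrite Z.mul_assoc uvZ.
rewrite hx in e1; nia.
Qed.

(* If multiplication by [Q] brings [u] close to an integer, then [u] itself is
   close to some [j / Q] with [j] prime to [Q], and so are all its multiples [P ^ a * u]. *)
Lemma far_orbit (P Q L : nat) u a : (2 <= P)%N -> (2 <= Q)%N -> coprime P Q -> (a < L)%N ->
  ~ near u (/ (2 * INR P ^ L)) -> near (INR Q * u) (/ (2 * INR P ^ L)) ->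
  ~ near (INR P ^ a * u) (/ (2 * INR Q)).
Proof.
move=> P2 Q2 cop aL far [j hj] [k hk]; apply: far.
have p2 := INR_leq P2; have q2 := INR_leq Q2; rewrite -[INR 2]/2 in p2 q2.
have pa : 0 < INR P ^ a by apply: pow_lt; lra.
have pL : 2 * INR P ^ a <= INR P ^ L.
  apply: Rle_trans (_ : INR P ^ a.+1 <= _); last by apply: Rle_pow; [lra | lia].
  by rewrite /=; apply: Rmult_le_compat_r; lra.
have h1 : Rabs (INR P ^ a * (INR Q * u - IZR j)) < / 4.
  rewrite Rabs_mult Rabs_pos_eq; last lra.
  apply: Rlt_le_trans (Rmult_lt_compat_l _ _ _ pa hj) _.
  apply: Rle_trans (_ : INR P ^ a * / (2 * (2 * INR P ^ a)) <= _).
    apply: Rmult_le_compat_l; first lra.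
    by apply: Rinv_le_contravar; lra.
  by right; field; lra.
have h2 : Rabs (INR Q * (INR P ^ a * u - IZR k)) < / 2.
  rewrite Rabs_mult Rabs_pos_eq; last lra.
  apply: Rlt_le_trans (Rmult_lt_compat_l (INR Q) _ _ _ hk) _; first lra.
  by right; field; lra.
have E : (Z.of_nat P ^ Z.of_nat a * j = k * Z.of_nat Q)%Z.
  apply: (proj1 (Z.sub_move_0_r _ _)); apply: one_IZR_lt1; rewrite minus_IZR !mult_IZR -pow_IZR -!INR_IZR_INZ.
  have [? ?] := Rabs_def2 _ _ h1; have [? ?] := Rabs_def2 _ _ h2; lra.
have [i hi] : (Z.of_nat Q | j)%Z.
  apply: (@dvd_pow_coprime P Q j a) => //; first by apply: ltn_trans P2.
  by exists k.
exists i; move: hj; rewrite hi mult_IZR -INR_IZR_INZ (Rmult_comm (IZR i)) -Rmult_minus_distr_l Rabs_mult.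
rewrite Rabs_pos_eq; last lra.
by have := Rabs_pos (u - IZR i); nra.
Qed.

(** [x = u (p x) - v (q x)]. This serves the odd parity class, where the progressions start at [p]
    or [q] instead of 1: a frequency invisible to both is itself close to an integer. *)
Lemma near_bezout (p q u v : nat) x tau : (u * p = v * q + 1)%N ->
  near (INR p * x) tau -> near (INR q * x) tau -> near x (INR (u + v) * tau).
Proof.
move=> uv [k hk] [k' hk']; exists (Z.of_nat u * k - Z.of_nat v * k')%Z.
rewrite minus_IZR !mult_IZR -!INR_IZR_INZ plus_INR.
have E : INR u * INR p = INR v * INR q + 1 by have := f_equal INR uv; rewrite plus_INR !mult_INR.
have -> : x - (INR u * IZR k - INR v * IZR k') =
  INR u * (INR p * x - IZR k) - INR v * (INR q * x - IZR k').
  by transitivity ((INR u * INR p - INR v * INR q) * x - (INR u * IZR k - INR v * IZR k')); [rewrite E; ring | ring].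
have u1 : 1 <= INR u.
  apply: (@INR_leq 1); case: u uv {E} => // uv; lia.
have v0 := pos_INR v.
have [a1 a2] := Rabs_def2 _ _ hk'; have [b1 b2] := Rabs_def2 _ _ hk.
apply: Rabs_def1; nra.
Qed.

Section Hits.
Variables (P Q e0 : nat) (e th : R).
Hypotheses (P2 : (2 <= P)%N) (Q2 : (2 <= Q)%N) (cop : coprime P Q) (he : 0 <= e <= / 2).
Let dl := / (2 * INR P * INR Q).
(** The factor saved by one element whose multiple of the frequency stays [1/(2PQ)] away from the
    integers. That radius lies below both [1/(2P)] and [1/(2Q)], the thresholds produced by
    [near_of_orbit] and [far_orbit]. *)
Definition hitc := 1 - e * (1 - cos (2 * PI / (2 * INR P * INR Q))).
Notation fac b a := (psi e (2 * PI * (INR P ^ a * (INR Q ^ b * (INR e0 * th))))).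

Let p2 : 2 <= INR P. Proof. exact: (INR_leq P2). Qed.
Let q2 : 2 <= INR Q. Proof. exact: (INR_leq Q2). Qed.

Lemma hitc_bound : 0 <= hitc <= 1.
Proof.
by rewrite -/(psi e (2 * PI / (2 * INR P * INR Q))); apply: psi_bound.
Qed.

Let fac01 b a : 0 <= fac b a <= 1. Proof. exact: psi_bound. Qed.

Let fac_far x tau : dl <= tau <= / 2 -> ~ near x tau -> psi e (2 * PI * x) <= hitc.
Proof.
move=> ht hn; have dl0 : 0 < dl by apply: Rinv_0_lt_compat; nra.
have := @cos_le_of_far x tau ltac:(lra) hn.
have : cos (2 * PI * tau) <= cos (2 * PI * dl).
  have pi0 := PI_RGT_0; case: ht => [[h|<-] h2]; last lra.
  by left; apply: cos_decreasing_1; nra.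
rewrite /psi /hitc -/(Rdiv (2 * PI) _) /Rdiv -/dl; nra.
Qed.

(** If no row starts close to an integer, each of the [B] rows contains a saving element by
    [near_of_orbit]. Otherwise consider the first row that does; it is not row 0, and in the row
    before it all [L] elements save, by [far_orbit]. *)
Lemma hits_product (L B : nat) : (0 < L)%N ->
  ~ near (INR e0 * th) (/ (2 * INR P ^ L)) ->
  \prod_(b <- iota 0 B) \prod_(a <- iota 0 L) fac b a <= hitc ^ minn B L.
Proof.
move=> L0 start; have [c0 c1] := hitc_bound.
set t := fun b => INR Q ^ b * (INR e0 * th).
have dlP : dl <= / (2 * INR P) <= / 2.
  by split; apply: Rinv_le_contravar; nra.
have dlQ : dl <= / (2 * INR Q) <= / 2.
  by split; apply: Rinv_le_contravar; nra.
have row01 b : 0 <= \prod_(a <- iota 0 L) fac b a <= 1 by apply: Rprod_le1.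
pose pb b := (b < B)%N && (if excluded_middle_informative (near (t b) (/ (2 * INR P ^ L))) then true else false).
have prodB r : \prod_(b <- r) \prod_(a <- iota 0 L) fac b a <= 1 by case: (@Rprod_le1 _ r (fun b => \prod_(a <- iota 0 L) fac b a) (fun b _ => row01 b)).
have pow_min k : (minn B L <= k)%N -> hitc ^ k <= hitc ^ minn B L.
  move=> hk; rewrite -(subnKC hk) pow_add; have [h1 h2] := (pow_le hitc (minn B L) c0, pow_incr hitc 1 (k - minn B L) (conj c0 c1)).
  by rewrite pow1 in h2; nra.
case: (classic (exists b, pb b)) => [ex|no]; last first.
  apply: Rle_trans (pow_min B (geq_minl _ _)).
  apply: Rle_trans (Rprod_le (G := fun=> hitc) _) _; last by rewrite Rprod_const size_iota; lra.
  move=> b; rewrite mem_iota add0n => /andP [_ bB]; split; first by case: (row01 b).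
  have nb : ~ near (t b) (/ (2 * INR P ^ L)).
    by move=> h; apply: no; exists b; rewrite /pb bB; case: excluded_middle_informative.
  case: (classic (exists a, (a < L)%N /\ ~ near (INR P ^ a * t b) (/ (2 * INR P)))) => [[a [aL fa]]|all].
    apply: Rle_trans (Rprod_subset (r1 := [:: a]) _ _ (fun a _ => fac01 b a)) _ => //.
      by move=> i; rewrite inE => /eqP ->; rewrite mem_iota.
    by rewrite big_cons big_nil Rmult_1_r; apply: fac_far fa.
  exfalso; apply: nb; rewrite -(prednK L0); apply: near_of_orbit => // a aL.
  by apply: NNPP => h; apply: all; exists a; split => //; rewrite -(prednK L0).
case: (ex_minnP ex) => b /andP [bB hb] minb.
have nb : near (t b) (/ (2 * INR P ^ L)) by move: hb; case: excluded_middle_informative.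
case: b => [|b] in bB hb minb nb *.
  by exfalso; apply: start; rewrite /t /= Rmult_1_l in nb.
have fb : ~ near (t b) (/ (2 * INR P ^ L)).
  move=> h; have : pb b by rewrite /pb (ltnW bB); case: excluded_middle_informative.
  by move/minb; rewrite ltnn.
apply: Rle_trans (pow_min L (geq_minr _ _)).
apply: Rle_trans (Rprod_subset (r1 := [:: b]) _ _ (fun b _ => row01 b)) _ => //.
  by move=> i; rewrite inE => /eqP ->; rewrite mem_iota add0n; exact: ltnW.
rewrite big_cons big_nil Rmult_1_r.
apply: Rle_trans (Rprod_le (G := fun=> hitc) _) _; last by rewrite Rprod_const size_iota; lra.
move=> a; rewrite mem_iota add0n => /andP [_ aL]; split; first by case: (fac01 b a).
apply: fac_far dlQ _; apply: (far_orbit P2 Q2 cop aL fb).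
by move: nb; rewrite /t /= Rmult_assoc.
Qed.
End Hits.

(** * Elements of S below n *)

(** Exponents are capped at [t] to keep the list finite; for [t] at least the binary logarithm of
    [n] the cap excludes no element up to [n]. *)
Definition gen (ps : seq nat) (t : nat) : seq nat :=
  foldr (fun r s => [seq (r ^ a * h)%N | a <- iota 0 t.+1, h <- s]) [:: 1%N] ps.

Definition bases (ps : seq nat) := all (fun r => 1 < r)%N ps && pairwise coprime ps.

Lemma genP ps t r h : reflect (exists a h', [/\ (a <= t)%N, h' \in gen ps t & h = (r ^ a * h')%N])
  (h \in gen (r :: ps) t).
Proof.
apply: (iffP allpairsP) => [[[a h'] [ha hh ->]]|[a [h' [ha hh ->]]]].
  by exists a, h'; move: ha; rewrite mem_iota add0n => /andP [_].
by exists (a, h'); rewrite mem_iota.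
Qed.

Lemma bases_cons r ps : bases (r :: ps) = [&& (1 < r)%N, all (coprime r) ps & bases ps].
Proof. by rewrite /bases /= -!andbA; congr (_ && _); rewrite andbCA. Qed.

Lemma gen_gt0 ps t h : bases ps -> h \in gen ps t -> (0 < h)%N.
Proof.
elim: ps h => [|r ps IH] h; first by move=> _; rewrite inE => /eqP ->.
rewrite bases_cons => /and3P [r1 _ bp] /genP [a [h' [_ hh ->]]].
by rewrite muln_gt0 expn_gt0 (ltnW r1) (IH _ bp hh).
Qed.

Lemma gen_coprime ps t r h : all (coprime r) ps -> h \in gen ps t -> coprime r h.
Proof.
elim: ps h => [|s ps IH] h /=; first by move=> _; rewrite inE => /eqP ->; rewrite coprimen1.
move=> /andP [rs rp] /genP [a [h' [_ hh ->]]].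
by rewrite coprimeMr coprimeXr // IH.
Qed.

Lemma pow_coprime_inj r a b x y : (1 < r)%N -> coprime r x -> coprime r y -> (0 < x)%N ->
  (r ^ a * x = r ^ b * y)%N -> a = b /\ x = y.
Proof.
move=> r1 cx cy x0.
wlog ab : a b x y cx cy x0 / (a <= b)%N => [W E|E].
  case: (leqP a b) => h; first exact: W.
  have y0 : (0 < y)%N.
    have : (0 < r ^ b * y)%N by rewrite -E muln_gt0 expn_gt0 (ltnW r1).
    by rewrite muln_gt0 => /andP [].
  by have [-> ->] := W b a y x cy cx y0 (ltnW h) (esym E).
move: E; rewrite -{1}(subnKC ab) expnD -mulnA => /eqP.
rewrite eqn_pmul2l ?expn_gt0 ?(ltnW r1) // => /eqP E.
case D : (b - a)%N E => [|e] E; last first.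
  move: cx; rewrite E expnS -mulnA coprimeMr /coprime gcdnn; case: eqP => // h; lia.
by rewrite mul1n in E; split => //; apply/eqP; rewrite eqn_leq ab -subn_eq0 D.
Qed.

Lemma uniq_allpairs (I J K : eqType) (f : I -> J -> K) (s : seq I) (r : seq J) :
  uniq s -> uniq r ->
  (forall x y x' y', x \in s -> y \in r -> x' \in s -> y' \in r -> f x y = f x' y' -> x = x' /\ y = y') ->
  uniq [seq f x y | x <- s, y <- r].
Proof.
move=> us ur H; apply: allpairs_uniq => // [[x y]] [x' y'].
move=> /allpairsPdep [x1 [y1 [h1 h2 [-> ->]]]] /allpairsPdep [x2 [y2 [h3 h4 [-> ->]]]] /= E.
by have [-> ->] := H _ _ _ _ h1 h2 h3 h4 E.
Qed.

Lemma gen_uniq ps t : bases ps -> uniq (gen ps t).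
Proof.
elim: ps => [|r ps IH] //; rewrite bases_cons => /and3P [r1 cr bp].
apply: uniq_allpairs => [||a x b y _ hx _ hy]; [exact: iota_uniq | exact: IH |].
exact: pow_coprime_inj r1 (gen_coprime cr hx) (gen_coprime cr hy) (gen_gt0 bp hx).
Qed.

Lemma gen_size ps t : size (gen ps t) = (t.+1 ^ size ps)%N.
Proof. by elim: ps => [|r ps IH] //; rewrite size_allpairs size_iota IH expnS. Qed.

Lemma gen_mono ps v t : (v <= t)%N -> {subset gen ps v <= gen ps t}.
Proof.
move=> vt; elim: ps => [|r ps IH] h //; move/genP => [a [h' [ha hh ->]]].
by apply/genP; exists a, h'; rewrite (leq_trans ha vt) IH.
Qed.

Lemma gen1 ps t : 1%N \in gen ps t.
Proof. by elim: ps => [|r ps IH] //; apply/genP; exists 0%N, 1%N. Qed.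

Lemma gen_le ps v h : bases ps -> h \in gen ps v -> (h <= (\prod_(r <- ps) r) ^ v)%N.
Proof.
elim: ps h => [|r ps IH] h; first by move=> _; rewrite inE big_nil exp1n => /eqP ->.
rewrite bases_cons big_cons expnMn => /and3P [r1 _ bp] /genP [a [h' [ha hh ->]]].
by apply: leq_mul; [rewrite leq_exp2l | apply: IH].
Qed.

Lemma big_allpairs_sum (I J K : Type) (f : I -> J -> K) (r1 : seq I) (r2 : seq J) (F : K -> R) :
  \sum_(z <- [seq f x y | x <- r1, y <- r2]) F z = \sum_(x <- r1) \sum_(y <- r2) F (f x y).
Proof. by rewrite big_allpairs_dep. Qed.

Lemma leq_expl (x y a : nat) : (x <= y)%N -> (x ^ a <= y ^ a)%N.
Proof. by case: a => [|a] // h; rewrite leq_exp2r. Qed.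

Section Elements.
Variables (p q : nat) (rest : seq nat).
Hypothesis Hb : bases (p :: q :: rest).
Notation k := (size rest).

Let p1 : (1 < p)%N. Proof. by move: Hb; rewrite bases_cons => /and3P []. Qed.
Let q1 : (1 < q)%N. Proof. by move: Hb; rewrite !bases_cons => /and3P [_ _ /and3P []]. Qed.
Let brest : bases rest. Proof. by move: Hb; rewrite !bases_cons => /and3P [_ _ /and3P []]. Qed.
Let cpq : coprime p q. Proof. by move: Hb; rewrite !bases_cons /= => /and3P [_ /andP []]. Qed.
Let cprest : all (coprime p) rest. Proof. by move: Hb; rewrite !bases_cons /= => /and3P [_ /andP []]. Qed.
Let cqrest : all (coprime q) rest. Proof. by move: Hb; rewrite !bases_cons => /and3P [_ _ /and3P []]. Qed.

(** Two bases are singled out for the two-dimensional progressions; the third coordinate collects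
    the [k = m - 2] others and is 1 when there are none. *)
Definition hv (x : nat * nat * nat) : nat := (p ^ x.1.1 * (q ^ x.1.2 * x.2))%N.

Lemma hv_inj a b c a' b' c' t t' : c \in gen rest t -> c' \in gen rest t' ->
  hv (a, b, c) = hv (a', b', c') -> [/\ a = a', b = b' & c = c'].
Proof.
move=> hc hc'; rewrite /hv /= => E.
have c0 := gen_gt0 brest hc.
have C b1 c1 t1 : c1 \in gen rest t1 -> coprime p (q ^ b1 * c1).
  by move=> h; rewrite coprimeMr coprimeXr // (gen_coprime cprest h).
have x0 : (0 < q ^ b * c)%N by rewrite muln_gt0 expn_gt0 (ltnW q1).
have [-> E2] := pow_coprime_inj p1 (C b c t hc) (C b' c' t' hc') x0 E.
by have [-> ->] := pow_coprime_inj q1 (gen_coprime cqrest hc) (gen_coprime cqrest hc') c0 E2.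
Qed.

(** Integer stand-in for [log n], equal to it up to constant factors. As the bases are at least 2,
    it also bounds every exponent of an element up to [n]. *)
Definition tl (n : nat) := trunc_log 2 n.
Definition cube (n : nat) : seq (nat * nat * nat) :=
  [seq (ab, c) | ab <- [seq (a, b) | a <- iota 0 (tl n).+1, b <- iota 0 (tl n).+1], c <- gen rest (tl n)].
Definition idx (n : nat) := [seq x <- cube n | (hv x <= n)%N].

Lemma cubeP n a b c : (a, b, c) \in cube n = [&& (a <= tl n)%N, (b <= tl n)%N & c \in gen rest (tl n)].
Proof.
apply/allpairsPdep/and3P => [[ab [c' [h h3 [Eab ->]]]]|[h1 h2 h3]].
  move: h; rewrite -Eab => /allpairsPdep [a' [b' [h1 h2 [-> ->]]]].
  by move: h1 h2 h3; rewrite !mem_iota !add0n !ltnS.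
exists (a, b), c; split => //; apply/allpairsPdep; exists a, b.
by rewrite !mem_iota !add0n !ltnS.
Qed.

Lemma cube_uniq n : uniq (cube n).
Proof.
apply: uniq_allpairs; [|exact: gen_uniq|by move=> ? ? ? ? _ _ _ _ [-> ->]].
by apply: uniq_allpairs; [exact: iota_uniq | exact: iota_uniq |move=> ? ? ? ? _ _ _ _ [-> ->]].
Qed.

Lemma idx_uniq n : uniq (idx n).
Proof. exact/filter_uniq/cube_uniq. Qed.

Lemma exp_le_tl r a h n : (1 < r)%N -> (0 < h)%N -> (r ^ a * h <= n)%N -> (a <= tl n)%N.
Proof.
move=> r1 h0 H; apply: trunc_log_max => //; apply: leq_trans H.
apply: leq_trans (leq_pmulr _ h0); exact: leq_expl.
Qed.

Lemma idx_intro n a b c t : c \in gen rest t -> (t <= tl n)%N -> (hv (a, b, c) <= n)%N ->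
  (a, b, c) \in idx n.
Proof.
move=> hc tn H; rewrite mem_filter H cubeP (gen_mono tn hc) andbT /=.
have c0 := gen_gt0 brest hc.
have x0 : (0 < q ^ b * c)%N by rewrite muln_gt0 expn_gt0 (ltnW q1).
rewrite (exp_le_tl p1 x0 H) /=; apply: (exp_le_tl q1 c0).
by apply: leq_trans H; rewrite /hv /= leq_pmull // expn_gt0 (ltnW p1).
Qed.

Lemma hv_idx_inj n : {in idx n &, injective hv}.
Proof.
move=> [[a b] c] [[a' b'] c']; rewrite !mem_filter !cubeP => /andP [_ /and3P [_ _ h1]] /andP [_ /and3P [_ _ h2]] E.
by have [-> -> ->] := hv_inj h1 h2 E.
Qed.

Lemma hv_gt0 n x : x \in idx n -> (0 < hv x)%N.
Proof.
case: x => [[a b] c]; rewrite mem_filter cubeP => /andP [_ /and3P [_ _ h]].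
by rewrite /hv /= !muln_gt0 !expn_gt0 (ltnW p1) (ltnW q1) (gen_gt0 brest h).
Qed.

Lemma hv_le n x : x \in idx n -> (hv x <= n)%N.
Proof. by rewrite mem_filter => /andP []. Qed.

(** Summation along the exponent of [p] with the other coordinates fixed. There are at most
    [(t+1)^(m-1)] such geometric progressions, so a bound [D] independent of [n] saves a whole
    factor [t] over the number of elements. *)
Lemma sum_idx_le n (F : nat -> R) (D : R) : (forall h, 0 <= F h) ->
  (forall y, (0 < y)%N -> \sum_(a <- iota 0 (tl n).+1) (if (p ^ a * y <= n)%N then F (p ^ a * y)%N else 0) <= D) ->
  \sum_(x <- idx n) F (hv x) <= D * INR (tl n).+1 ^ k.+1.
Proof.
move=> F0 HD; rewrite /idx big_filter big_mkcond /cube.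
rewrite big_allpairs_sum.
rewrite (eq_bigr (fun ab => \sum_(c <- gen rest (tl n)) (if (hv (ab, c) <= n)%N then F (hv (ab, c)) else 0))) //.
rewrite big_allpairs_sum exchange_big /=.
apply: Rle_trans (_ : \sum_(b <- iota 0 (tl n).+1) (INR (tl n).+1 ^ k * D) <= _); last first.
  by rewrite Rsum_const size_iota; right; simpl; ring.
apply: Rsum_le => b _; rewrite exchange_big -pow_natE -(gen_size rest) -Rsum_const.
apply: Rsum_le => c hc.
have y0 : (0 < q ^ b * c)%N by rewrite muln_gt0 expn_gt0 (ltnW q1) (gen_gt0 brest hc).
exact: HD y0.
Qed.

Lemma size_idx_le n : INR (size (idx n)) <= INR (tl n).+1 ^ k.+2.
Proof.
rewrite -pow_natE; apply: INR_leq.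
apply: leq_trans (_ : size (cube n) <= _)%N; first by rewrite size_filter count_size.
by rewrite !size_allpairs !size_iota gen_size !expnS mulnA.
Qed.

Lemma count_exponents (n X j y T : nat) : (0 < y)%N -> (X < 2 ^ j)%N ->
  (size [seq a <- iota 0 T | (p ^ a * y <= n) && (n <= p ^ a * y * X)] <= j)%N.
Proof.
move=> y0 Xj; set r := filter _ _.
case: (posnP (size r)) => [->//|r0].
have ex : exists a, a \in r by exists (nth 0%N r 0); apply: mem_nth.
case: (ex_minnP ex) => a0 ha0 min.
have sub : {subset r <= iota a0 j}.
  move=> a ha; have le_a0 := min a ha; rewrite mem_iota le_a0 /=.
  move: ha0 ha; rewrite !mem_filter => /andP [/andP [_ h0] _] /andP [/andP [h1 _] _].
  rewrite -{1}(subnKC le_a0) ltn_add2l ltnNge; apply/negP => bad.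
  have : (p ^ a * y <= p ^ a0 * y * X)%N by apply: leq_trans h1 h0.
  rewrite -{1}(subnKC le_a0) expnD mulnAC leq_pmul2l ?muln_gt0 ?expn_gt0 ?(ltnW p1) //.
  move=> h2; have : (2 ^ j <= X)%N.
    apply: leq_trans h2; apply: leq_trans (_ : 2 ^ (a - a0) <= _)%N; first by rewrite leq_exp2l.
    exact: leq_expl.
  by rewrite leqNgt Xj.
by rewrite -(size_iota a0 j); apply: uniq_leq_size => //; apply: filter_uniq; apply: iota_uniq.
Qed.

Lemma sum_indicator (I : eqType) (r : seq I) (P : pred I) :
  \sum_(i <- r) (if P i then 1 else 0) = INR (size (filter P r)).
Proof.
elim: r => [|i r IH]; first by rewrite big_nil.
rewrite big_cons IH /=; case: (P i) => /=; last by lra.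
by rewrite -[RHS]/(INR (size (filter P r)).+1) S_INR; lra.
Qed.

(** For [X] a power of [t] the exponent [j] is of order [log t]; this count is the source of the
    [log log n] in the error terms. *)
Lemma size_big_le (n X j : nat) : (X < 2 ^ j)%N ->
  INR (size [seq x <- idx n | (n <= hv x * X)%N]) <= INR j * INR (tl n).+1 ^ k.+1.
Proof.
move=> Xj; rewrite -sum_indicator.
apply: (@sum_idx_le n (fun h => if (n <= h * X)%N then 1 else 0)); first by move=> h; case: ifP => _; lra.
move=> y y0.
apply: Rle_trans (_ : \sum_(a <- iota 0 (tl n).+1) (if (p ^ a * y <= n)%N && (n <= p ^ a * y * X)%N then 1 else 0) <= _).
  by apply: Rsum_le => a _; case: (p ^ a * y <= n)%N; exact: Rle_refl.
by rewrite sum_indicator; apply: INR_leq; apply: count_exponents.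
Qed.

(** With [K] of order [log t] this is O(t log t), within the admissible t^(m-1) log t because m is
    at least 2. *)
Lemma size_strip_le (n K : nat) :
  (size [seq x <- idx n | (x.2 == 1) && (x.1.2 <= K)] <= (tl n).+1 * K.+1)%N.
Proof.
have -> : ((tl n).+1 * K.+1)%N = size [seq (a, b, 1%N) | a <- iota 0 (tl n).+1, b <- iota 0 K.+1].
  by rewrite size_allpairs !size_iota.
apply: uniq_leq_size; first exact/filter_uniq/idx_uniq.
move=> [[a b] c]; rewrite !mem_filter cubeP => /andP [/andP [/eqP E hb] /andP [_ /and3P [ha _ _]]].
rewrite /= in E hb; rewrite E; apply/allpairsPdep; exists a, b.
by rewrite !mem_iota !add0n !ltnS.
Qed.

(* elements [p^s P^a Q^b c] of parity class [s] in the window [(X / P, X]] *)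
Definition window_exp (s v X b c : nat) := trunc_log (p ^ 2) (X %/ (p ^ s * (q ^ (2 * b) * c))).
Definition window_idx (s v X : nat) : seq (nat * nat * nat) :=
  [seq (2 * window_exp s v X b c + s, 2 * b, c)%N | b <- iota 0 v.+1, c <- gen rest v].

Lemma size_window s v X : size (window_idx s v X) = (v.+1 ^ k.+1)%N.
Proof. by rewrite size_allpairs size_iota gen_size expnS. Qed.

(** For given [b] and [c] exactly one power of [p^2] carries [p^s q^(2b) c] into the window,
    provided this number does not exceed [X]; the size hypothesis ensures that for all admissible
    [b] and [c]. *)
Lemma window_prop s v X x : (s <= 1)%N -> (p * (q ^ 2) ^ v * (\prod_(r <- rest) r) ^ v <= X)%N ->
  x \in window_idx s v X ->
  [/\ (hv x <= X)%N, (X < hv x * p ^ 2)%N, odd (x.1.1 + x.1.2) = odd s & x.2 \in gen rest v].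
Proof.
move=> s1 HX /allpairsPdep [b [c [hb hc ->]]] /=.
have {}hb : b \in iota 0 v.+1 := hb.
have {}hc : c \in gen rest v := hc.
rewrite mem_iota add0n ltnS in hb.
set y := (p ^ s * (q ^ (2 * b) * c))%N.
have c0 := gen_gt0 brest hc.
have y0 : (0 < y)%N by rewrite !muln_gt0 !expn_gt0 (ltnW p1) (ltnW q1).
have yX : (y <= X)%N.
  apply: leq_trans HX; rewrite /y mulnA; apply: leq_mul; last exact: gen_le.
  apply: leq_mul; first by rewrite -{2}(expn1 p) leq_exp2l.
  by rewrite -expnM leq_exp2l // leq_mul2l.
have P1 : (1 < p ^ 2)%N by rewrite -(exp1n 2) ltn_exp2r.
have d0 : (0 < X %/ y)%N by rewrite divn_gt0.
have E : hv (2 * window_exp s v X b c + s, 2 * b, c)%N = ((p ^ 2) ^ window_exp s v X b c * y)%N.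
  by rewrite /hv /= expnD expnM -mulnA.
rewrite E; split => //.
- by rewrite -leq_divRL //; apply: trunc_logP.
- by rewrite mulnAC -expnSr -ltn_divLR //; apply: trunc_log_ltn.
- by rewrite oddD oddD !oddM /= addbF.
Qed.

Lemma window_uniq s v X : uniq (map hv (window_idx s v X)).
Proof.
rewrite map_inj_in_uniq.
  apply: uniq_allpairs; [exact: iota_uniq|exact: gen_uniq|].
  by move=> b c b' c' _ _ _ _ [_ hb ->]; split => //; lia.
move=> x y /allpairsPdep [b [c [_ hc ->]]] /allpairsPdep [b' [c' [_ hc' ->]]] E.
by have [-> -> ->] := hv_inj hc hc' E.
Qed.

(* [e0 = p^i q^j] times a two-dimensional progression in [P = p^2], [Q = q^2] *)
Definition strip (i j L B : nat) : seq nat :=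
  [seq hv (2 * a + i, 2 * b + j, 1)%N | b <- iota 0 B, a <- iota 0 L].

Lemma strip_uniq i j L B : uniq (strip i j L B).
Proof.
apply: uniq_allpairs; [exact: iota_uniq | exact: iota_uniq |].
move=> b a b' a' _ _ _ _ E.
have [/eqP h1 /eqP h2 _] := hv_inj (gen1 rest 0) (gen1 rest 0) E.
by move: h1 h2; rewrite !eqn_add2r !eqn_mul2l /= => /eqP -> /eqP ->.
Qed.

Lemma hv_strip a b i j : hv (2 * a + i, 2 * b + j, 1)%N = ((p ^ 2) ^ a * ((q ^ 2) ^ b * (p ^ i * q ^ j)))%N.
Proof.
rewrite /hv /= muln1 (expnD p (2 * a)) (expnD q (2 * b)) (expnM p 2) (expnM q 2).
by rewrite -!mulnA; congr (_ * _)%N; rewrite mulnCA.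
Qed.

End Elements.

(** * Counting S *)

Lemma telescope (T : nat) (f : nat -> R) : \sum_(a < T) (f a - f a.+1) = f 0%N - f T.
Proof.
elim: T => [|T IH]; first by rewrite big_ord0; lra.
by rewrite big_ord_recr /= IH; lra.
Qed.

Lemma pow_diff_bounds (n : nat) u v : 0 <= v <= u ->
  INR n.+1 * v ^ n * (u - v) <= u ^ n.+1 - v ^ n.+1 <= INR n.+1 * u ^ n * (u - v).
Proof.
move=> [v0 vu]; elim: n => [|n IH]; first by simpl; lra.
have un := pow_le u n.+1 ltac:(lra); have vn := pow_le v n.+1 v0.
have E : u ^ n.+2 - v ^ n.+2 = u * (u ^ n.+1 - v ^ n.+1) + v ^ n.+1 * (u - v) by simpl; ring.
have uv : v ^ n.+1 <= u ^ n.+1 by apply: pow_incr.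
have A : v * (u ^ n.+1 - v ^ n.+1) <= u * (u ^ n.+1 - v ^ n.+1) by apply: Rmult_le_compat_r; lra.
have B := Rmult_le_compat_l v _ _ v0 (proj1 IH).
have C := Rmult_le_compat_l u _ _ (Rle_trans _ _ _ v0 vu) (proj2 IH).
have D : v ^ n.+1 * (u - v) <= u ^ n.+1 * (u - v) by apply: Rmult_le_compat_r; lra.
have B' : v * (INR n.+1 * v ^ n * (u - v)) = INR n.+1 * v ^ n.+1 * (u - v) by simpl pow; ring.
have C' : u * (INR n.+1 * u ^ n * (u - v)) = INR n.+1 * u ^ n.+1 * (u - v) by simpl pow; ring.
rewrite E (S_INR n.+1); split; lra.
Qed.

Lemma Rdiv_subl a b c : (a - b) / c = a / c - b / c.
Proof. by rewrite /Rdiv; ring. Qed.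

Lemma genE r ps t :
  gen (r :: ps) t = [seq (r ^ a * h)%N | a <- iota 0 t.+1, h <- gen ps t].
Proof. by []. Qed.

Definition cntr (ps : seq nat) (t : nat) (x : R) : R :=
  \sum_(h <- gen ps t) (if Rle_dec (INR h) x then 1 else 0).
Definition lsum (ps : seq nat) : R := \sum_(r <- ps) ln (INR r).
(** [y ^ size ps / cvol ps] is the volume of the simplex of nonnegative exponents with
    [sum a_i ln r_i <= y]. *)
Definition cvol (ps : seq nat) : R := INR ((size ps)`!) * \prod_(r <- ps) ln (INR r).

Lemma cntr_ge0 ps t x : 0 <= cntr ps t x.
Proof. by apply: Rsum_ge0 => h _; case: Rle_dec => ? /=; lra. Qed.

Lemma cntr_cons r ps t x : (1 < r)%N ->
  cntr (r :: ps) t x = \sum_(a < t.+1) cntr ps t (x / INR r ^ a).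
Proof.
move=> r1; rewrite /cntr genE (big_allpairs_sum (fun a h => (r ^ a * h)%N)).
rewrite (ord_sumE t.+1 (fun a => \sum_(h <- gen ps t) (if Rle_dec (INR h) (x / INR r ^ a) then 1 else 0))).
apply: eq_bigr => a _; apply: eq_bigr => h _.
have ra : 0 < INR r ^ a by apply: pow_lt; apply: INR_ltn0; apply: ltnW.
have E : INR (r ^ a * h)%N = INR r ^ a * INR h by rewrite mult_INR pow_natE.
have E2 : x / INR r ^ a * INR r ^ a = x by field; lra.
case: Rle_dec => h1; case: Rle_dec => h2 //; exfalso; [apply: h2 | apply: h1].
  by apply: (Rmult_le_reg_r (INR r ^ a)) => //; lra.
rewrite E -E2 Rmult_comm; apply: Rmult_le_compat_r; lra.
Qed.

Lemma cntr_lt1 ps t x : bases ps -> x < 1 -> cntr ps t x = 0.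
Proof.
move=> bp x1; rewrite /cntr big_seq big1 // => h hh; case: Rle_dec => // H.
by have := INR_leq (gen_gt0 bp hh); rewrite -[INR 1]/1; lra.
Qed.

Lemma ln_base_gt0 (r : nat) : (1 < r)%N -> 0 < ln (INR r).
Proof. by move=> r1; rewrite -ln_1; apply: ln_increasing; [lra | exact: (@INR_ltn 1)]. Qed.

Lemma ln_le_mono x y : 0 < x -> x <= y -> ln x <= ln y.
Proof. by move=> x0 [h|->]; [left; apply: ln_increasing | lra]. Qed.

Lemma ln_ge0 x : 1 <= x -> 0 <= ln x.
Proof. by move=> h; rewrite -ln_1; apply: ln_le_mono; lra. Qed.

Lemma ln_div_pow x (r : R) a : 0 < x -> 0 < r -> ln (x / r ^ a) = ln x - INR a * ln r.
Proof.
move=> x0 r0; have ra := pow_lt r a r0.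
by rewrite /Rdiv ln_mult //; [rewrite ln_Rinv // ln_pow //; lra | apply: Rinv_0_lt_compat].
Qed.

Lemma cvol_cons r ps : cvol (r :: ps) = INR (size ps).+1 * ln (INR r) * cvol ps.
Proof. by rewrite /cvol big_cons [size (r :: ps)]/= factS mult_INR; ring. Qed.

Lemma cvol_gt0 ps : bases ps -> 0 < cvol ps.
Proof.
elim: ps => [|r ps IH]; first by rewrite /cvol big_nil /=; lra.
rewrite bases_cons cvol_cons => /and3P [r1 _ bp].
apply: Rmult_lt_0_compat; last exact: IH.
by apply: Rmult_lt_0_compat; [exact: INR_ltn0 | exact: ln_base_gt0].
Qed.

Lemma lsum_ge0 ps : bases ps -> 0 <= lsum ps.
Proof.
move=> /andP [/allP H _]; apply: Rsum_ge0 => r hr; left; apply: ln_base_gt0; exact: H.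
Qed.

Lemma inv_div_pow_lt1 x (r : R) a : 0 < x -> 0 < r -> ln x - INR a * ln r < 0 -> x / r ^ a < 1.
Proof.
move=> x0 r0; rewrite -ln_div_pow // => h; apply: Rnot_le_lt => h1.
by have := ln_ge0 h1; lra.
Qed.

(** Induction on the bases. The sum over the exponent of [r] is compared with the telescoping
    differences of [g], the primitive of the bound for [ps], truncated at 0 so that exponents with
    [r^a > x] give nothing. The condition on [t] keeps the cap on the exponents from losing
    elements. *)
Lemma cntr_lower ps t x : bases ps -> 1 <= x < 2 ^ t.+1 ->
  ln x ^ size ps / cvol ps <= cntr ps t x.
Proof.
elim: ps x => [|r ps IH] x.
  move=> _ [x1 _]; rewrite /cntr /cvol /= big_cons !big_nil.
  by case: Rle_dec => h; simpl in h |- *; lra.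
rewrite bases_cons => /and3P [r1 _ bp] [x1 xt].
have l0 := ln_base_gt0 r1; have v0 := cvol_gt0 bp; have r0 := INR_ltn0 (ltnW r1).
set k := size ps in IH *; set l := ln (INR r) in l0 *; set y := ln x.
have k0 := INR_ltn0 (ltn0Sn k).
pose g (z : R) := Rmax 0 z ^ k.+1 / (INR k.+1 * l * cvol ps).
have den : 0 < INR k.+1 * l * cvol ps by do 2 (apply: Rmult_lt_0_compat => //).
have step a : g (y - INR a * l) - g (y - INR a.+1 * l) <= cntr ps t (x / INR r ^ a).
  set z := y - INR a * l; have -> : y - INR a.+1 * l = z - l by rewrite S_INR /z; ring.
  case: (Rlt_dec z 0) => hz.
    by rewrite /g !Rmax_left; try lra; rewrite Rminus_diag; apply: cntr_ge0.
  have xr : 1 <= x / INR r ^ a < 2 ^ t.+1.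
    have ra : 1 <= INR r ^ a by apply: pow_R1_Rle; apply: (@INR_leq 1); apply: ltnW.
    split.
      apply: Rnot_lt_le => h; apply: hz; rewrite /z /y /l -ln_div_pow; try lra.
      by rewrite -ln_1; apply: ln_increasing => //; apply: Rdiv_lt_0_compat; lra.
    apply: Rle_lt_trans xt; apply: (Rmult_le_reg_r (INR r ^ a)); first lra.
    by rewrite /Rdiv Rmult_assoc Rinv_l; nra.
  apply: Rle_trans (IH _ bp xr); rewrite ln_div_pow; try lra; rewrite -/l -/y -/z.
  rewrite /g -Rdiv_subl Rmax_right; last lra.
  have B : z ^ k.+1 - Rmax 0 (z - l) ^ k.+1 <= INR k.+1 * z ^ k * l.
    have zk : 0 <= INR k.+1 * z ^ k by apply: Rmult_le_pos; [lra | apply: pow_le; lra].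
    have M : 0 <= Rmax 0 (z - l) <= z by split; [exact: Rmax_l | apply: Rmax_lub; lra].
    apply: Rle_trans (proj2 (pow_diff_bounds k M)) _.
    by apply: Rmult_le_compat_l => //; have := Rmax_r 0 (z - l); lra.
  apply: (Rmult_le_reg_r (INR k.+1 * l * cvol ps)) => //.
  rewrite /Rdiv Rmult_assoc Rinv_l; last lra.
  have -> : z ^ k * / cvol ps * (INR k.+1 * l * cvol ps) = INR k.+1 * z ^ k * l by field; lra.
  lra.
rewrite cntr_cons //; apply: Rle_trans (Rsum_ord_le (fun a _ => step a)).
rewrite (telescope t.+1 (fun a => g (y - INR a * l))).
have y0 : 0 <= y by apply: ln_ge0.
have -> : g (y - INR t.+1 * l) = 0.
  rewrite /g Rmax_left; first by rewrite /= /Rdiv; ring.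
  have : y <= INR t.+1 * ln 2.
    rewrite -ln_pow; last lra.
    by apply: ln_le_mono; lra.
  have : ln 2 <= l by apply: ln_le_mono; [lra | exact: (@INR_leq 2)].
  by have := pos_INR t.+1; nra.
have -> : y - INR 0 * l = y by rewrite /=; ring.
rewrite cvol_cons -/k -/l -[size (r :: ps)]/(k.+1) /g Rmax_right //; lra.
Qed.

(** The same comparison with the argument enlarged by one step [ln r] per base, as the unit cubes at
    the lattice points stay in the enlarged simplex. Capping exponents only lowers the count, so [t]
    is arbitrary. *)
Lemma cntr_upper ps t x : bases ps -> 1 <= x ->
  cntr ps t x <= (ln x + lsum ps) ^ size ps / cvol ps.
Proof.
elim: ps x => [|r ps IH] x.
  move=> _ x1; rewrite /cntr /cvol /= big_cons !big_nil.
  by case: Rle_dec => h; simpl in h |- *; lra.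
rewrite bases_cons => /and3P [r1 _ bp] x1.
have l0 := ln_base_gt0 r1; have v0 := cvol_gt0 bp; have r0 := INR_ltn0 (ltnW r1).
have s0 := lsum_ge0 bp; set s := lsum ps in IH s0 *.
set k := size ps in IH *; set l := ln (INR r) in l0 *; set y := ln x.
have k0 := INR_ltn0 (ltn0Sn k).
pose g (z : R) := Rmax 0 (z + s + l) ^ k.+1 / (INR k.+1 * l * cvol ps).
have den : 0 < INR k.+1 * l * cvol ps by do 2 (apply: Rmult_lt_0_compat => //).
have g0 z : 0 <= g z.
  by apply: Rmult_le_pos; [apply: pow_le; apply: Rmax_l | left; apply: Rinv_0_lt_compat].
have step a : cntr ps t (x / INR r ^ a) <= g (y - INR a * l) - g (y - INR a.+1 * l).
  set z := y - INR a * l; have -> : y - INR a.+1 * l = z - l by rewrite S_INR /z; ring.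
  have mono : g (z - l) <= g z.
    apply: Rmult_le_compat_r; first by left; apply: Rinv_0_lt_compat.
    by apply: pow_incr; split; [exact: Rmax_l | apply: Rle_max_compat_l; lra].
  case: (Rlt_dec z 0) => hz.
    have C : x / INR r ^ a < 1 by apply: inv_div_pow_lt1 => //; lra.
    by rewrite cntr_lt1 //; lra.
  have xr : 1 <= x / INR r ^ a.
    apply: Rnot_lt_le => h; apply: hz; rewrite /z /y /l -ln_div_pow; try lra.
    rewrite -ln_1; apply: ln_increasing => //; apply: Rdiv_lt_0_compat; first lra.
    by apply: pow_lt.
  apply: Rle_trans (IH _ bp xr) _; rewrite ln_div_pow; try lra; rewrite -/l -/y -/z.
  rewrite /g -Rdiv_subl !Rmax_right; try lra.
  have M : 0 <= z - l + s + l <= z + s + l by lra.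
  have := proj1 (pow_diff_bounds k M).
  rewrite (_ : z - l + s + l = z + s); last by ring.
  rewrite (_ : z + s + l - (z + s) = l); last by ring.
  move=> B; apply: (Rmult_le_reg_r (INR k.+1 * l * cvol ps)) => //.
  have K u : u / (INR k.+1 * l * cvol ps) * (INR k.+1 * l * cvol ps) = u by field; lra.
  rewrite K.
  have -> : (z + s) ^ k / cvol ps * (INR k.+1 * l * cvol ps) = INR k.+1 * (z + s) ^ k * l by field; lra.
  lra.
rewrite cntr_cons //; apply: Rle_trans (Rsum_ord_le (fun a _ => step a)) _.
rewrite (telescope t.+1 (fun a => g (y - INR a * l))).
have y0 : 0 <= y by apply: ln_ge0.
have := g0 (y - INR t.+1 * l).
have -> : y - INR 0 * l = y by rewrite /=; ring.
rewrite {2}/g Rmax_right; last lra.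
have -> : lsum (r :: ps) = s + l by rewrite /lsum big_cons -/(lsum ps) -/s -/l; lra.
rewrite cvol_cons -/k -/l -[size (r :: ps)]/(k.+1) Rplus_assoc; lra.
Qed.

Lemma tl_spec n : (0 < n)%N -> 2 ^ tl n <= INR n < 2 ^ (tl n).+1.
Proof.
move=> n0; have [h1 h2] : (2 ^ tl n <= n)%N /\ (n < 2 ^ (tl n).+1)%N.
  by split; [apply: trunc_logP | apply: trunc_log_ltn].
by split; [have := INR_leq h1 | have := INR_ltn h2]; rewrite pow_natE.
Qed.

Lemma size_idxE p q rest n : bases (p :: q :: rest) ->
  INR (size (idx p q rest n)) = cntr (p :: q :: rest) (tl n) (INR n).
Proof.
move=> Hb; move: (Hb); rewrite !bases_cons => /and3P [p1 _ /and3P [q1 _ _]].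
rewrite /idx -sum_indicator /cube big_allpairs_sum.
rewrite (big_allpairs_sum (fun a b => (a, b)) _ _ (fun ab => \sum_(y <- gen rest (tl n)) (if (hv p q (ab, y) <= n)%N then 1 else 0))).
rewrite /cntr genE (big_allpairs_sum (fun a h => (p ^ a * h)%N)); apply: eq_bigr => a _.
rewrite genE (big_allpairs_sum (fun a h => (q ^ a * h)%N)); apply: eq_bigr => b _.
apply: eq_bigr => c _; rewrite /hv /=.
case: Rle_dec => h; case: ifP => // h'.
  by move/negbT: h'; rewrite -ltnNge => /INR_ltn; lra.
by exfalso; apply: h; apply: INR_leq.
Qed.

Lemma size_idx_asymp p q rest : bases (p :: q :: rest) ->
  let ps := p :: q :: rest in
  exists C, 0 <= C /\ forall n, lsum ps <= ln (INR n) -> (1 <= n)%N ->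
  Rabs (INR (size (idx p q rest n)) - ln (INR n) ^ size ps / cvol ps) <= C * ln (INR n) ^ (size ps - 1).
Proof.
move=> Hb ps; have v0 := cvol_gt0 Hb; have s0 := lsum_ge0 Hb.
rewrite -/ps in v0 s0; set k := (size rest).+1.
have vi := Rinv_0_lt_compat _ v0.
exists (INR k.+1 * 2 ^ k * lsum ps / cvol ps); split.
  apply: Rmult_le_pos; last lra; apply: Rmult_le_pos => //.
  by apply: Rmult_le_pos; [apply: pos_INR | apply: pow_le; lra].
move=> n hn n1; rewrite size_idxE // -/ps.
have x1 : 1 <= INR n by exact: (@INR_leq 1).
have L0 := ln_ge0 x1; have := tl_spec n1 => - [_ tn].
have lo := @cntr_lower ps (tl n) (INR n) Hb (conj x1 tn).
have up := @cntr_upper ps (tl n) (INR n) Hb x1.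
rewrite -[size ps]/(k.+1) subn1 -[k.+1.-1]/k.
rewrite -[size ps]/(k.+1) in lo up.
set L := ln (INR n) in L0 hn lo up *.
have D := proj2 (@pow_diff_bounds k (L + lsum ps) L ltac:(lra)).
rewrite (_ : L + lsum ps - L = lsum ps) in D; last by ring.
have E : (L + lsum ps) ^ k <= 2 ^ k * L ^ k.
  by rewrite -Rpow_mult_distr; apply: pow_incr; lra.
have F : INR k.+1 * (L + lsum ps) ^ k * lsum ps <= INR k.+1 * (2 ^ k * L ^ k) * lsum ps.
  by apply: Rmult_le_compat_r => //; apply: Rmult_le_compat_l => //; apply: pos_INR.
rewrite Rabs_pos_eq; last lra.
apply: Rle_trans (_ : (L + lsum ps) ^ k.+1 / cvol ps - L ^ k.+1 / cvol ps <= _); first lra.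
rewrite -Rdiv_subl /Rdiv.
have -> : INR k.+1 * 2 ^ k * lsum ps * / cvol ps * L ^ k = INR k.+1 * (2 ^ k * L ^ k) * lsum ps * / cvol ps by ring.
by apply: Rmult_le_compat_r; lra.
Qed.

(** * The tilted law *)

Definition tiltZ (d : nat) (r : R) (h : nat) : R := \sum_(k < d) exp (- (r * INR h * INR k)).
Definition tilt (d : nat) (r : R) (h k : nat) : R := exp (- (r * INR h * INR k)) / tiltZ d r h.

Section Tilt.
Variables (d : nat) (r : R).
Hypothesis d2 : (2 <= d)%N.

Lemma tiltZ_ge1 h : 1 <= tiltZ d r h.
Proof.
apply: Rle_trans (_ : exp (- (r * INR h * INR 0)) <= _).
  by rewrite (_ : - _ = 0) ?exp_0; [lra | simpl; ring].
apply: (Rsum_ord_ge1 (F := fun k => exp (- (r * INR h * INR k)))); last exact: ltnW.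
by move=> k _; left; apply: exp_pos.
Qed.

Lemma tilt_ge0 h k : 0 <= tilt d r h k.
Proof.
apply: Rmult_le_pos; first by left; apply: exp_pos.
by left; apply: Rinv_0_lt_compat; have := tiltZ_ge1 h; lra.
Qed.

Lemma tilt_sum h : \sum_(k < d) tilt d r h k = 1.
Proof.
rewrite -big_distrl /= -/(tiltZ d r h); have := tiltZ_ge1 h => H.
by rewrite Rinv_r //; lra.
Qed.

(** [Ex] with all weights 1: a plain sum over digit vectors, the link between the counting of
    representations and the tilted law. *)
Fixpoint Cnt (l : seq nat) (F : nat -> nat -> R) : R :=
  if l is h :: l' then \sum_(k < d) Cnt l' (fun x y => F (k + x)%N (k * h + y)%N)
  else F 0%N 0%N.

Lemma Cnt_ext l F G : (forall x y, F x y = G x y) -> Cnt l F = Cnt l G.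
Proof. by elim: l F G => [|h l IH] F G H //=; apply: eq_bigr => k _; apply: IH. Qed.

Lemma Cnt_scal l c F : Cnt l (fun x y => c * F x y) = c * Cnt l F.
Proof. by elim: l F => [|h l IH] F //=; rewrite big_distrr /=; apply: eq_bigr => k _. Qed.

Lemma Cnt_tilt l F :
  Cnt l (fun x y => exp (- (r * INR y)) * F x y) = \prod_(h <- l) tiltZ d r h * Ex d (tilt d r) l F.
Proof.
elim: l F => [|h l IH] F /=.
  by rewrite big_nil Rmult_0_r Ropp_0 exp_0.
rewrite big_cons big_distrr /=; apply: eq_bigr => k _.
rewrite (Cnt_ext _ (G := fun x y => exp (- (r * INR h * INR k)) *
  (exp (- (r * INR y)) * F (k + x)%N (k * h + y)%N))).
  rewrite Cnt_scal IH /tilt; field.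
  by have := tiltZ_ge1 h; lra.
move=> x y; rewrite -Rmult_assoc -exp_plus; congr (exp _ * _).
by rewrite plus_INR mult_INR; ring.
Qed.

End Tilt.

Section Functions.
Variables (N d : nat).
Hypothesis d0 : (0 < d)%N.
Notation fT := {ffun 'I_N -> 'I_d}.
Let z : 'I_d := Ordinal d0.

Definition supp_in (s : seq 'I_N) (a : fT) := [forall j, (j \notin s) ==> (nat_of_ord (a j) == 0%N)].
Definition upd (i : 'I_N) (k : 'I_d) (a : fT) : fT := [ffun j => if j == i then k else a j].

Lemma supp_inP (s : seq 'I_N) (a : fT) : reflect (forall j, j \notin s -> nat_of_ord (a j) = 0%N) (supp_in s a).
Proof.
by apply: (iffP forallP) => H j; [move=> hj; move: (H j); rewrite hj => /eqP | apply/implyP => /H ->].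
Qed.

Lemma sum_upd (i : 'I_N) k (a : fT) (g : 'I_N -> nat) : nat_of_ord (a i) = 0%N ->
  (\sum_j upd i k a j * g j = k * g i + \sum_j a j * g j)%N.
Proof.
move=> ai; rewrite (bigD1 i) //= [X in _ = (_ + X)%N](bigD1 i) //= ffunE eqxx ai mul0n add0n.
by congr (_ + _)%N; apply: eq_bigr => j /negbTE ji; rewrite ffunE ji.
Qed.

(** Passage from finite functions to recursion over a list: a function supported in [i :: s] is a
    value at [i] together with a function supported in [s]. *)
Lemma supp_sum (s : seq 'I_N) (F : nat -> nat -> R) : uniq s ->
  \big[Rplus/R0]_(a : fT | supp_in s a) F (\sum_j a j * 1)%N (\sum_j a j * j)%N =
  Cnt d (map val s) F.
Proof.
elim: s F => [|i s IH] F /=.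
  move=> _; rewrite (big_pred1 ([ffun=> z] : fT)).
    by rewrite !big1 // => j _; rewrite ffunE.
  move=> a; apply/supp_inP/eqP => [H|-> j _]; last by rewrite ffunE.
  by apply/ffunP => j; apply: val_inj; rewrite ffunE /= H.
move=> /andP [si us].
rewrite (partition_big (fun a : fT => a i) xpredT) //=; apply: eq_bigr => k _.
rewrite -IH // (reindex_onto (upd i k) (upd i z)).
  apply: eq_big => a.
    apply/andP/supp_inP => [[/andP [/supp_inP H _] /eqP E] j js|H].
      case: (eqVneq j i) => [->|ji]; first by rewrite -E !ffunE eqxx.
      by have := H j; rewrite inE negb_or ji js ffunE (negbTE ji) => /(_ isT).
    split; first (apply/andP; split).
    - apply/supp_inP => j; rewrite inE negb_or => /andP [ji js].
      by rewrite ffunE (negbTE ji) H.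
    - by rewrite ffunE eqxx.
    - apply/eqP/ffunP => j; rewrite !ffunE; case: eqP => [->|//].
      by apply: val_inj; rewrite /= H.
  move=> /andP [/andP [/supp_inP H _] /eqP E].
  have ai : nat_of_ord (a i) = 0%N by rewrite -E !ffunE eqxx.
  by rewrite !sum_upd // muln1.
move=> a /andP [_ /eqP <-]; apply/ffunP => j; rewrite !ffunE.
by case: eqP => [->|].
Qed.

End Functions.

(** Valid for every [r], with a prefactor that does not depend on [F] and so cancels in all ratios;
    the tilt remains free to be chosen. *)
Lemma reps_Ex (d m : nat) (p : 'I_m -> nat) (n : nat) (l : seq nat) (r : R) (F : nat -> R) :
  (2 <= d)%N -> uniq l -> (forall h, (h \in l) = (h <= n)%N && inSb p h) ->
  \big[Rplus/R0]_(a in reps d p n) F (digit_sum a) =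
  \prod_(h <- l) tiltZ d r h * exp (r * INR n) *
    Ex d (tilt d r) l (fun x y => if y == n then F x else 0).
Proof.
move=> d2 ul ml; have d0 : (0 < d)%N by apply: ltnW.
set s : seq 'I_n.+1 := [seq inord h | h <- l].
have sl : map val s = l.
  rewrite -map_comp map_id_in // => h; rewrite ml => /andP [hn _] /=.
  by rewrite inordK.
have us : uniq s by apply: (map_uniq (f := val)); rewrite sl.
have ms (j : 'I_n.+1) : (j \in s) = inSb p j.
  by rewrite -(mem_map val_inj) sl ml /= -ltnS ltn_ord.
rewrite (eq_bigl (fun a => supp_in s a && (\sum_j a j * j == n)%N)); last first.
  move=> a; rewrite inE /is_rep; congr (_ && _); apply: eq_forallb => h.
  by rewrite ms; case: (inSb p h); rewrite /= ?implybT ?implybF ?negbK.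
rewrite big_mkcondr /=.
rewrite (eq_bigr (fun a : {ffun 'I_n.+1 -> 'I_d} =>
  (fun x y => if y == n then F x else 0) (\sum_j a j * 1)%N (\sum_j a j * j)%N)); last first.
  move=> a _; case: ifP => _ //; congr F; rewrite /digit_sum.
  by apply: eq_bigr => j _; rewrite muln1.
rewrite (supp_sum d0 (fun x y => if y == n then F x else 0) us) sl.
rewrite (Cnt_ext d l (G := fun x y => exp (r * INR n) * (exp (- (r * INR y)) * (if y == n then F x else 0)))).
  by rewrite Cnt_scal Cnt_tilt //; ring.
move=> x y; case: eqP => [->|_]; last by ring.
by rewrite -Rmult_assoc -exp_plus Rplus_opp_r exp_0 Rmult_1_l.
Qed.

Lemma exp_ge_pow x (j : nat) : 0 <= x -> (0 < j)%N -> (x / INR j) ^ j <= exp x.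
Proof.
move=> x0 j0; have jr := INR_ltn0 j0.
rewrite (_ : exp x = exp (x / INR j) ^ j); last by rewrite -exp_mulN; congr exp; field; lra.
apply: pow_incr; split; first by apply: Rmult_le_pos => //; left; apply: Rinv_0_lt_compat.
by have := exp_ge1x (x / INR j); lra.
Qed.

Lemma pow_exp_ev (K : nat) (c C : R) : 0 < c -> exists T : nat, forall t : nat,
  (T <= t)%N -> C * INR t ^ K <= exp (c * INR t).
Proof.
move=> c0; set j := K.+1; have jr : 0 < INR j := INR_ltn0 (ltn0Sn K).
have cj : 0 < (c / INR j) ^ j by apply: pow_lt; apply: Rdiv_lt_0_compat.
have [T hT] := INR_unbounded (Rabs C / (c / INR j) ^ j); exists T => t tT.
have t0 := pos_INR t.
apply: Rle_trans (_ : (c * INR t / INR j) ^ j <= _); last first.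
  by apply: exp_ge_pow => //; apply: Rmult_le_pos; lra.
rewrite (_ : (c * INR t / INR j) ^ j = (c / INR j) ^ j * INR t * INR t ^ K); last first.
  by rewrite (_ : c * INR t / INR j = c / INR j * INR t) ?Rpow_mult_distr; [rewrite /j /=; ring | field; lra].
apply: Rmult_le_compat_r; first exact: pow_le.
apply: Rle_trans (Rle_abs C) _.
have E : Rabs C = (c / INR j) ^ j * (Rabs C / (c / INR j) ^ j) by field; lra.
by rewrite E; apply: Rmult_le_compat_l; [lra | have := INR_leq tT; lra].
Qed.

(** [G] is a potential with values in [0, 4] that increases by at least [Rmin z (/ z)] from [z] to
    [z * p], so the sum telescopes to a bound free of [T] and [y]. *)
Lemma min_geometric (p T : nat) (y : R) : (2 <= p)%N -> 0 < y ->
  \sum_(a <- iota 0 T) Rmin (y * INR p ^ a) (/ (y * INR p ^ a)) <= 4.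
Proof.
move=> p2 y0; have pr := INR_leq p2; rewrite -[INR 2]/2 in pr.
pose G z := if Rle_dec z 1 then 2 * z else 4 - 2 / z.
have G04 z : 0 < z -> 0 <= G z <= 4.
  move=> z0; rewrite /G; case: Rle_dec => h /=; first lra.
  have : 0 < / z <= 1 by split; [apply: Rinv_0_lt_compat | rewrite -Rinv_1; apply: Rinv_le_contravar; lra].
  by rewrite /Rdiv; lra.
have step z : 0 < z -> Rmin z (/ z) <= G (z * INR p) - G z.
  move=> z0; have zp : 2 * z <= z * INR p by nra.
  have zi : z * / z = 1 by apply: Rinv_r; lra.
  have zi0 := Rinv_0_lt_compat _ z0.
  rewrite /G; case: (Rle_dec z 1) => h1; case: Rle_dec => h2 /=.
  - by apply: Rle_trans (Rmin_l _ _) _; lra.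
  - apply: Rle_trans (Rmin_l _ _) _.
    have i1 : / (z * INR p) <= 1 by rewrite -Rinv_1; apply: Rinv_le_contravar; lra.
    have i2 : / (z * INR p) <= / (2 * z) by apply: Rinv_le_contravar; lra.
    rewrite (Rinv_mult 2 z) in i2; rewrite /Rdiv.
    case: (Rle_dec z (/ 2)) => h3; first lra.
    suff : 4 - / z - 3 * z >= 0 by lra.
    suff : 0 <= z * (4 - / z - 3 * z) by nra.
    have -> : z * (4 - / z - 3 * z) = (3 * z - 1) * (1 - z).
      by transitivity (4 * z - z * / z - 3 * z * z); [ring | rewrite zi; ring].
    by apply: Rmult_le_pos; lra.
  - by nra.
  - apply: Rle_trans (Rmin_r _ _) _.
    have i2 : / (z * INR p) <= / (2 * z) by apply: Rinv_le_contravar; lra.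
    by rewrite (Rinv_mult 2 z) in i2; rewrite /Rdiv; lra.
pose f a := - G (y * INR p ^ a).
have pa a : 0 < y * INR p ^ a by apply: Rmult_lt_0_compat => //; apply: pow_lt; lra.
apply: Rle_trans (_ : \sum_(a < T) (f a - f a.+1) <= _); last first.
  by rewrite telescope /f; have := G04 _ (pa 0%N); have := G04 _ (pa T); lra.
rewrite (ord_sumE T (fun a => f a - f a.+1)); apply: Rsum_le => a _.
have := step _ (pa a); rewrite /f (_ : y * INR p ^ a * INR p = y * INR p ^ a.+1); [lra | simpl; ring].
Qed.

(** The constant is 4^4, from [(y / 4)^4 <= exp y], which handles [y > 1]. *)
Lemma pow_exp_min (j : nat) y : (1 <= j <= 3)%N -> 0 < y -> y ^ j * exp (- y) <= 256 * Rmin y (/ y).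
Proof.
move=> /andP [j1 j3] y0.
have e0 := exp_pos (- y).
have e1 : exp (- y) <= 1 by rewrite -exp_0; apply: exp_le_compat; lra.
have e4 : y ^ 4 * exp (- y) <= 256.
  have := @exp_ge_pow y 4 ltac:(lra) isT; rewrite exp_Ropp.
  have ep := exp_pos y; rewrite (_ : (y / INR 4) ^ 4 = y ^ 4 / 256); last by simpl; field.
  move=> h; apply: (Rmult_le_reg_r (exp y)) => //; rewrite Rmult_assoc Rinv_l; lra.
case: (Rle_dec y 1) => h.
  have yj : y ^ j <= y.
    case: j j1 j3 => // j _ _ /=.
    have h1 : y ^ j <= 1 by rewrite -(pow1 j); apply: pow_incr; lra.
    by have := Rmult_le_compat_l y _ _ (Rlt_le _ _ y0) h1; lra.
  have yj0 : 0 <= y ^ j by apply: pow_le; lra.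
  have yi : / 1 <= / y by apply: Rinv_le_contravar; lra.
  rewrite Rinv_1 in yi.
  by rewrite Rmin_left; [nra | lra].
have iy : / y * y = 1 by apply: Rinv_l; lra.
have -> : Rmin y (/ y) = / y.
  have yi : / y <= / 1 by apply: Rinv_le_contravar; lra.
  by rewrite Rinv_1 in yi; rewrite Rmin_right //; lra.
apply: (Rmult_le_reg_r y) => //; rewrite Rmult_assoc (Rmult_assoc 256) iy.
have : y ^ j * y <= y ^ 4 by rewrite -[X in _ * X]pow_1 -pow_add; apply: Rle_pow; [lra | lia].
nra.
Qed.

Lemma sum_id (n : nat) : \sum_(i < n) INR i = INR n * (INR n - 1) / 2.
Proof.
by elim: n => [|n IH]; [rewrite big_ord0 /=; lra | rewrite big_ord_recr /= IH -[match n with 0%N => _ | _ => _ end]/(INR n.+1) S_INR; field].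
Qed.

Lemma sum_sqr (n : nat) : \sum_(i < n) INR i ^ 2 = INR n * (INR n - 1) * (2 * INR n - 1) / 6.
Proof.
elim: n => [|n IH]; first by rewrite big_ord0 /=; lra.
by rewrite big_ord_recr [LHS]/= IH S_INR; field.
Qed.

Section Moments.
Variables (d : nat) (r : R) (h : nat).
Hypothesis d2 : (2 <= d)%N.
Hypothesis r0 : 0 <= r.
Notation w := (tilt d r).
Notation y := (r * INR h).

Let y0 : 0 <= y. Proof. by apply: Rmult_le_pos => //; apply: pos_INR. Qed.
Let Z1 : 1 <= tiltZ d r h. Proof. exact: tiltZ_ge1. Qed.
Let Zi : 0 < / tiltZ d r h <= 1.
Proof. by split; [apply: Rinv_0_lt_compat; lra | rewrite -Rinv_1; apply: Rinv_le_contravar; lra]. Qed.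
Let d1 : 2 <= INR d. Proof. exact: (INR_leq d2). Qed.
Let w0 k : 0 <= w h k. Proof. exact: tilt_ge0. Qed.
Let ws : \sum_(k < d) w h k = 1. Proof. exact: tilt_sum. Qed.

Lemma tilt_le_exp k : (0 < k)%N -> w h k <= exp (- y).
Proof.
move=> k0; rewrite /tilt; apply: Rle_trans (_ : exp (- y) * 1 <= _); last lra.
apply: Rmult_le_compat; try lra; first by left; apply: exp_pos.
by apply: exp_le_compat; have := INR_leq k0; rewrite -[INR 1]/1; nra.
Qed.

Lemma dmean_ge0 : 0 <= dmean d w h.
Proof. by apply: (Rsum_ord_ge0 (F := fun k => w h k * INR k)) => k _; apply: Rmult_le_pos => //; apply: pos_INR. Qed.

Lemma dmean_le_exp : dmean d w h <= INR d ^ 2 * exp (- y).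
Proof.
have e0 := exp_pos (- y).
apply: Rle_trans (Rsum_ord_le (F := fun k => w h k * INR k) (G := fun=> exp (- y) * INR d) _) _.
  case=> [|k] kd; first by rewrite /= Rmult_0_r; apply: Rmult_le_pos; lra.
  by apply: Rmult_le_compat => //; [apply: pos_INR | apply: tilt_le_exp | apply: INR_leq; apply: ltnW].
by rewrite Rsum_ord_const; right; simpl; ring.
Qed.

Lemma dmean_le_d : dmean d w h <= INR d.
Proof.
apply: Rle_trans (Rsum_ord_le (F := fun k => w h k * INR k) (G := fun k => w h k * INR d) _) _.
  by move=> k kd; apply: Rmult_le_compat_l => //; apply: INR_leq; apply: ltnW.
by rewrite -big_distrl /= ws; lra.
Qed.

Lemma dvarE : dvar d w h = \sum_(k < d) (w h k * INR k ^ 2) - dmean d w h ^ 2.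
Proof.
rewrite /dvar; set mu := dmean d w h.
rewrite (eq_bigr (fun k : 'I_d => w h k * INR k ^ 2 + ((- 2 * mu) * (w h k * INR k) + mu ^ 2 * w h k))); last first.
  by move=> k _; ring.
by rewrite !big_split /= -!big_distrr /= ws -/(dmean d w h) -/mu; ring.
Qed.

Lemma dvar_ge0 : 0 <= dvar d w h.
Proof.
apply: (Rsum_ord_ge0 (F := fun k => w h k * (INR k - dmean d w h) ^ 2)) => k _.
by apply: Rmult_le_pos => //; apply: pow2_ge_0.
Qed.

Lemma dvar_le_mean : dvar d w h <= INR d * dmean d w h.
Proof.
rewrite dvarE; have := pow2_ge_0 (dmean d w h) => m2.
apply: Rle_trans (_ : \sum_(k < d) (w h k * INR k ^ 2) <= _); first lra.
rewrite /dmean big_distrr /=.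
apply: (Rsum_ord_le (F := fun k => w h k * INR k ^ 2) (G := fun k => INR d * (w h k * INR k))) => k kd.
have K := INR_leq (ltnW kd); have k0 := pos_INR k.
rewrite (_ : w h k * INR k ^ 2 = INR k * (w h k * INR k)); last by ring.
by apply: Rmult_le_compat_r => //; apply: Rmult_le_pos.
Qed.

Lemma dvar_le_exp : dvar d w h <= INR d ^ 3 * exp (- y).
Proof.
apply: Rle_trans dvar_le_mean _; have := dmean_le_exp => H.
by rewrite (_ : INR d ^ 3 * exp (- y) = INR d * (INR d ^ 2 * exp (- y))); [apply: Rmult_le_compat_l; lra | ring].
Qed.

Lemma dabs3_le : dabs3 d w h <= INR d * dvar d w h.
Proof.
rewrite /dvar big_distrr /=.
apply: (Rsum_ord_le (F := fun k => w h k * Rabs (INR k - dmean d w h) ^ 3)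
  (G := fun k => INR d * (w h k * (INR k - dmean d w h) ^ 2))) => k kd.
rewrite -pow2_abs; set u := Rabs _.
have u1 : 0 <= u <= INR d.
  split; first exact: Rabs_pos.
  apply: Rabs_le; have := INR_leq (ltnW kd); have := pos_INR k; have := dmean_ge0; have := dmean_le_d; lra.
rewrite (_ : w h k * u ^ 3 = u * (w h k * u ^ 2)); last by ring.
by apply: Rmult_le_compat_r; [apply: Rmult_le_pos => //; apply: pow2_ge_0 | lra].
Qed.

Lemma tiltZ_le : tiltZ d r h <= INR d.
Proof.
apply: Rle_trans (Rsum_ord_le (F := fun k => exp (- (r * INR h * INR k))) (G := fun=> 1) _) _.
  move=> k _; rewrite -exp_0; apply: exp_le_compat.
  by have := pos_INR k; nra.
by rewrite Rsum_ord_const; lra.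
Qed.

Lemma tilt_lower k : (k < d)%N -> y <= 1 -> exp (- INR d) / INR d <= w h k.
Proof.
move=> kd y1; apply: Rmult_le_compat.
- by left; apply: exp_pos.
- by left; apply: Rinv_0_lt_compat; lra.
- by apply: exp_le_compat; have := INR_leq (ltnW kd); have := pos_INR k; nra.
- by apply: Rinv_le_contravar; [lra | exact: tiltZ_le].
Qed.

Lemma dmean_lower : y <= 1 -> exp (- INR d) / INR d <= dmean d w h.
Proof.
move=> y1; apply: Rle_trans (tilt_lower (k := 1) d2 y1) _.
rewrite -[X in X <= _]Rmult_1_r.
apply: (Rsum_ord_ge1 (F := fun k => w h k * INR k) (j := 1)) => // k _.
by apply: Rmult_le_pos => //; apply: pos_INR.
Qed.

(** The mean is at distance at least 1/2 from 0 or from 1, and both values have weight at least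
    [exp (- d) / d]. *)
Lemma dvar_lower : y <= 1 -> exp (- INR d) / INR d / 4 <= dvar d w h.
Proof.
move=> y1; have c0 : 0 < exp (- INR d) / INR d by apply: Rdiv_lt_0_compat; [apply: exp_pos | lra].
have A := tilt_lower (k := 0) (ltnW d2) y1; have B := tilt_lower (k := 1) d2 y1.
set F := fun k => w h k * (INR k - dmean d w h) ^ 2.
have F0 k : (k < d)%N -> 0 <= F k by move=> _; apply: Rmult_le_pos => //; apply: pow2_ge_0.
have S0 := Rsum_ord_ge1 F0 (ltnW d2 : (0 < d)%N).
have S1 := Rsum_ord_ge1 F0 (d2 : (1 < d)%N).
rewrite -[\sum_(i < d) F i]/(dvar d w h) in S0 S1.
rewrite /F /= in S0 S1; move: S0 S1 A B; set mu := dmean d w h; set c := exp _ / _ in c0 *.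
move=> S0 S1 A B.
case: (Rle_dec mu (/ 2)) => hm.
  have : c * (/ 4) <= w h 1 * ((1 - mu) * ((1 - mu) * 1)) by apply: Rmult_le_compat; nra.
  by lra.
have : c * (/ 4) <= w h 0 * ((0 - mu) * ((0 - mu) * 1)) by apply: Rmult_le_compat; nra.
by lra.
Qed.

(** The error is linear in [r h], so over a list it adds up to a multiple of [r] times the sum of
    the list. *)
Lemma tilt_uniform k : (k < d)%N -> Rabs (w h k - / INR d) <= INR d * y.
Proof.
move=> kd; have kr := INR_leq (ltnW kd); have k0 := pos_INR k.
have di : 0 < / INR d by apply: Rinv_0_lt_compat; lra.
have dd : / INR d * INR d = 1 by apply: Rinv_l; lra.
have yk : 0 <= y * INR k <= y * INR d by split; [apply: Rmult_le_pos | apply: Rmult_le_compat_l].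
have ek : 1 - y * INR k <= exp (- (y * INR k)) <= 1.
  split; first by have := exp_ge1x (- (y * INR k)); lra.
  by rewrite -exp_0; apply: exp_le_compat; lra.
have Zl : INR d - INR d * (y * INR d) <= tiltZ d r h.
  apply: Rle_trans (Rsum_ord_le (F := fun=> 1 - y * INR d) (G := fun k => exp (- (y * INR k))) _).
    by rewrite Rsum_ord_const; lra.
  move=> j jd; have := exp_ge1x (- (y * INR j)); have := Rmult_le_compat_l _ _ _ y0 (INR_leq (ltnW jd)); lra.
have Zd := tiltZ_le.
have wE : w h k * tiltZ d r h = exp (- (y * INR k)) by rewrite /tilt; field; lra.
have wk := w0 k.
have w1 : w h k <= 1.
  by rewrite -ws; apply: (Rsum_ord_ge1 (F := w h)).
apply: Rabs_le; split.
  have : (1 - y * INR d) <= w h k * INR d by nra.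
  move=> H; have : (1 - y * INR d) * / INR d <= w h k.
    apply: (Rmult_le_reg_r (INR d)); first lra.
    by rewrite Rmult_assoc dd; lra.
  have : y * INR d * / INR d <= INR d * y by rewrite Rmult_assoc (Rmult_comm (INR d)) dd; nra.
  lra.
have : w h k * INR d <= 1 + INR d * (y * INR d) by nra.
move=> H; have : w h k <= (1 + INR d * (y * INR d)) * / INR d.
  apply: (Rmult_le_reg_r (INR d)); first lra.
  by rewrite Rmult_assoc dd; lra.
have -> : (1 + INR d * (y * INR d)) * / INR d = / INR d + y * INR d * (/ INR d * INR d) by ring.
by rewrite dd; lra.
Qed.

Lemma dmean_uniform : Rabs (dmean d w h - (INR d - 1) / 2) <= INR d ^ 3 * y.
Proof.
have -> : (INR d - 1) / 2 = \sum_(k < d) (/ INR d * INR k).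
  by rewrite -big_distrr /= sum_id; field; lra.
have -> : dmean d w h - \sum_(k < d) (/ INR d * INR k) = \sum_(k < d) ((w h k - / INR d) * INR k).
  rewrite -(Rsum_ord_sub d (fun k => w h k * INR k) (fun k => / INR d * INR k)).
  by apply: eq_bigr => k _; ring.
rewrite (ord_sumE d (fun k => (w h k - / INR d) * INR k)); apply: Rle_trans (Rsum_abs _ _) _.
rewrite -(ord_sumE d (fun k => Rabs ((w h k - / INR d) * INR k))).
apply: Rle_trans (Rsum_ord_le (F := fun k => Rabs ((w h k - / INR d) * INR k)) (G := fun=> INR d * y * INR d) _) _.
  move=> k kd; rewrite Rabs_mult (Rabs_pos_eq (INR k)); last exact: pos_INR.
  by apply: Rmult_le_compat; [apply: Rabs_pos | apply: pos_INR | apply: tilt_uniform | apply: INR_leq; apply: ltnW].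
by rewrite Rsum_ord_const; right; simpl; ring.
Qed.

Lemma dvar_uniform : Rabs (dvar d w h - (INR d ^ 2 - 1) / 12) <= 3 * INR d ^ 4 * y.
Proof.
rewrite dvarE.
have E2 : \sum_(k < d) (/ INR d * INR k ^ 2) = (INR d - 1) * (2 * INR d - 1) / 6.
  by rewrite -big_distrr /= (sum_sqr d); field; lra.
have -> : (INR d ^ 2 - 1) / 12 = \sum_(k < d) (/ INR d * INR k ^ 2) - ((INR d - 1) / 2) ^ 2.
  by rewrite E2; field.
set A := \sum_(k < d) _; set B := \sum_(k < d) _; set mu := dmean d w h.
have AB : Rabs (A - B) <= INR d ^ 4 * y.
  have -> : A - B = \sum_(k < d) ((w h k - / INR d) * INR k ^ 2).
    rewrite /A /B -(Rsum_ord_sub d (fun k => w h k * INR k ^ 2) (fun k => / INR d * INR k ^ 2)).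
    by apply: eq_bigr => k _; ring.
  rewrite (ord_sumE d (fun k => (w h k - / INR d) * INR k ^ 2)); apply: Rle_trans (Rsum_abs _ _) _.
  rewrite -(ord_sumE d (fun k => Rabs ((w h k - / INR d) * INR k ^ 2))).
  apply: Rle_trans (Rsum_ord_le (F := fun k => Rabs ((w h k - / INR d) * INR k ^ 2)) (G := fun=> INR d * y * INR d ^ 2) _) _.
    move=> k kd; rewrite Rabs_mult (Rabs_pos_eq (INR k ^ 2)); last exact: pow2_ge_0.
    apply: Rmult_le_compat; [apply: Rabs_pos | apply: pow2_ge_0 | apply: tilt_uniform => // |].
    by apply: pow_incr; split; [apply: pos_INR | apply: INR_leq; apply: ltnW].
  by rewrite Rsum_ord_const; right; simpl; ring.
have M := dmean_uniform; have m0 := dmean_ge0; have m1 := dmean_le_d; rewrite -/mu in M m0 m1.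
have MM : Rabs (mu ^ 2 - ((INR d - 1) / 2) ^ 2) <= INR d ^ 3 * y * (2 * INR d).
  have -> : mu ^ 2 - ((INR d - 1) / 2) ^ 2 = (mu - (INR d - 1) / 2) * (mu + (INR d - 1) / 2) by ring.
  rewrite Rabs_mult; apply: Rmult_le_compat => //; try exact: Rabs_pos.
  by rewrite Rabs_pos_eq; lra.
rewrite (_ : A - mu ^ 2 - (B - _) = (A - B) - (mu ^ 2 - ((INR d - 1) / 2) ^ 2)); last by ring.
apply: Rle_trans (Rabs_triang _ _) _; rewrite Rabs_Ropp.
have -> : 3 * INR d ^ 4 * y = INR d ^ 4 * y + INR d ^ 3 * y * (2 * INR d) by ring.
lra.
Qed.

End Moments.

Lemma cont_sum (I : Type) (s : seq I) (F : I -> R -> R) :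
  (forall i, continuity (F i)) -> continuity (fun r => \sum_(i <- s) F i r).
Proof.
move=> H; elim: s => [|i s IH].
  have E : continuity (fun _ : R => 0) by apply: continuity_const => ? ?.
  by move=> x; apply: (continuity_pt_ext (fun _ => 0)) => [r|]; [rewrite big_nil | apply: E].
move=> x; apply: (continuity_pt_ext (fun r => F i r + \sum_(j <- s) F j r)) => [r|].
  by rewrite big_cons.
by apply: continuity_pt_plus; [apply: H | apply: IH].
Qed.

Lemma nat_floor x : 1 <= x -> exists X : nat, INR X <= x /\ x <= 2 * INR X.
Proof.
move=> h; have [X [h1 h2]] := nfloor_ex x ltac:(lra); exists X; split => //.
have : 1 <= INR X; last lra.
apply: (@INR_leq 1); rewrite lt0n; apply/eqP => E; rewrite E /= in h2; lra.
Qed.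

(** * Windows of elements and the size of the tilt parameter *)

Section Setting.
Variables (p q : nat) (rest : seq nat).
Notation k := (size rest).
Notation hv := (hv p q).
Notation idx := (idx p q rest).

(** t^(m-1): the order of [r n], of the number of elements in a window of bounded ratio, and of the
    variance of [r N]. *)
Definition Lam (n : nat) : R := INR (tl n) ^ k.+1.

Lemma Lam_ge n : (1 <= tl n)%N -> INR (tl n) <= Lam n.
Proof.
move=> h; have := INR_leq h; rewrite -[INR 1]/1 => t1.
by rewrite /Lam -{1}(pow_1 (INR (tl n))); apply: Rle_pow; [lra | lia].
Qed.

Lemma Lam_succ n : (1 <= tl n)%N -> INR (tl n).+1 ^ k.+1 <= 2 ^ k.+1 * Lam n.
Proof.
move=> h; have := INR_leq h; rewrite -[INR 1]/1 => t1.
rewrite /Lam -Rpow_mult_distr; apply: pow_incr; rewrite S_INR; lra.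
Qed.

Lemma Lam_gt0 n : (1 <= tl n)%N -> 0 < Lam n.
Proof. by move=> h; apply: pow_lt; apply: INR_ltn0. Qed.

Lemma tl_gt0 n : (1 <= tl n)%N -> (1 < n)%N.
Proof. by rewrite /tl; case: n => [|[|n]]. Qed.

Hypothesis Hb : bases (p :: q :: rest).

Lemma p_gt1 : (1 < p)%N. Proof. by move: Hb; rewrite bases_cons => /and3P []. Qed.
Lemma q_gt1 : (1 < q)%N. Proof. by move: Hb; rewrite !bases_cons => /and3P [_ _ /and3P []]. Qed.
Lemma pq_coprime : coprime p q. Proof. by move: Hb; rewrite !bases_cons /= => /and3P [_ /andP []]. Qed.

Definition window_list (s v X : nat) := map hv (window_idx p q rest s v X).

(** The exponents of [q^2] and of the other bases may run up to [v = t / (2 D)]: the largest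
    cofactor is then at most [2^D * 2^(t/2)], and the spare [2^(t/2)] absorbs [t^K']. The constant
    depends on [D] only, not on how far [X] lies below [n]. *)
Lemma window_ev : exists cW : R, 0 < cW /\ forall K' : nat, exists T0 : nat,
  forall n, (T0 <= tl n)%N -> forall X s, (s <= 1)%N -> (X <= n)%N ->
  INR n <= INR X * INR (tl n) ^ K' -> exists W : seq nat,
  [/\ uniq W, cW * Lam n <= INR (size W),
     forall h, h \in W -> (h <= X)%N /\ (X < h * p ^ 2)%N &
     forall h, h \in W -> exists x, [/\ x \in idx n, odd (x.1.1 + x.1.2) = odd s & hv x = h]].
Proof.
set D := (p * q ^ 2 * \prod_(r <- rest) r)%N.
have D0 : (0 < D)%N.
  have brest : bases rest by move: Hb; rewrite !bases_cons => /and3P [_ _ /and3P []].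
  have := gen_le brest (gen1 rest 1); rewrite expn1 => h.
  by rewrite /D !muln_gt0 h (ltnW p_gt1) (ltnW q_gt1).
exists (/ (2 * INR D) ^ k.+1); split.
  by apply: Rinv_0_lt_compat; apply: pow_lt; have := INR_ltn0 D0; lra.
move=> K'.
have ln2 : 0 < ln 2 by rewrite -ln_1; apply: ln_increasing; lra.
have [T hT] := @pow_exp_ev K' (ln 2 / 2) (2 ^ D) ltac:(lra).
exists (T + 1)%N => n hn X s s1 Xn HX.
have t1 : (1 <= tl n)%N by lia.
set t := tl n in hn HX t1 *; set v := (t %/ (2 * D))%N.
have vt : (v <= t)%N by apply: leq_div.
have HW : (p * (q ^ 2) ^ v * (\prod_(r <- rest) r) ^ v <= X)%N.
  have A : (p * (q ^ 2) ^ v * (\prod_(r <- rest) r) ^ v <= 2 ^ D * 2 ^ (D * v))%N.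
    apply: leq_trans (_ : D ^ v.+1 <= _)%N.
      rewrite (expnS D v) -mulnA; apply: leq_mul.
        by move: D0; rewrite /D -mulnA muln_gt0 => /andP [_ D0]; apply: leq_pmulr.
      by rewrite -expnMn; apply: leq_expl; rewrite /D -mulnA; apply: leq_pmull; apply: ltnW p_gt1.
    rewrite -expnD -{2}(muln1 D) -mulnDr add1n expnM; apply: leq_expl; apply: ltnW; exact: ltn_expl.
  apply: leq_trans A _.
  have tr : 0 < INR t ^ K' by apply: pow_lt; apply: INR_ltn0.
  suff : INR (2 ^ D * 2 ^ (D * v)) <= INR X by move/INR_le; lia.
  apply: (Rmult_le_reg_r (INR t ^ K')) => //; apply: Rle_trans HX.
  have [n2 _] := @tl_spec n ltac:(have := tl_gt0 t1; lia); apply: Rle_trans n2.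
  rewrite mult_INR !pow_natE -[INR 2]/2 -/t.
  have E2 j : 2 ^ j = exp (ln 2 * INR j) by rewrite Rmult_comm exp_mulN exp_ln; lra.
  have B : 2 ^ (D * v) <= exp (ln 2 / 2 * INR t).
    rewrite E2; apply: exp_le_compat.
    have : INR (2 * (D * v)) <= INR t by apply: INR_leq; rewrite mulnA mulnC; apply: leq_trunc_div.
    rewrite mult_INR -[INR 2]/2; nra.
  rewrite [X in _ <= X]E2 (_ : ln 2 * INR t = ln 2 / 2 * INR t + ln 2 / 2 * INR t); last by field.
  rewrite exp_plus (_ : 2 ^ D * 2 ^ (D * v) * INR t ^ K' = 2 ^ D * INR t ^ K' * 2 ^ (D * v)); last by ring.
  apply: Rmult_le_compat => //; try (by left; apply: Rmult_lt_0_compat => //; apply: pow_lt; lra).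
  - by left; apply: pow_lt; lra.
  - by apply: hT; lia.
exists (window_list s v X); split.
- exact: window_uniq.
- rewrite size_map size_window pow_natE /Lam -/t.
  have -> : / (2 * INR D) ^ k.+1 * INR t ^ k.+1 = (INR t / (2 * INR D)) ^ k.+1.
    by rewrite /Rdiv (Rpow_mult_distr (INR t)) pow_inv Rmult_comm.
  have D0r := INR_ltn0 D0.
  apply: pow_incr; split; first by apply: Rmult_le_pos; [exact: pos_INR | left; apply: Rinv_0_lt_compat; lra].
  apply: (Rmult_le_reg_r (2 * INR D)); first lra.
  rewrite /Rdiv Rmult_assoc Rinv_l; last lra.
  have : (t <= v.+1 * (2 * D))%N by apply: ltnW; apply: ltn_ceil; rewrite muln_gt0.
  by move/INR_leq; rewrite !mult_INR -[INR 2]/2; lra.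
- by move=> h /mapP [x hx ->]; have [h1 h2 _ _] := window_prop Hb s1 HW hx.
- move=> h /mapP [[[a b] c] hx ->]; have [h1 h2 h3 h4] := window_prop Hb s1 HW hx.
  exists (a, b, c); split => //; apply: (idx_intro Hb h4 vt); exact: leq_trans h1 Xn.
Qed.

(** Along a progression [p^a y] only the terms near [1 / r] count, whatever [r] is, so each
    progression contributes at most 1024 = 256 * 4. *)
Lemma moment_sum_le (n j : nat) r : (1 <= j <= 3)%N -> 0 < r ->
  \sum_(x <- idx n) ((r * INR (hv x)) ^ j * exp (- (r * INR (hv x)))) <= 1024 * INR (tl n).+1 ^ k.+1.
Proof.
move=> hj r0.
apply: (@sum_idx_le p q rest Hb n (fun h => (r * INR h) ^ j * exp (- (r * INR h)))).
  move=> h; apply: Rmult_le_pos; last by left; apply: exp_pos.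
  by apply: pow_le; apply: Rmult_le_pos; [lra | apply: pos_INR].
move=> y y0; have yr := INR_ltn0 y0.
have py a : 0 < r * INR y * INR p ^ a.
  apply: Rmult_lt_0_compat; first exact: Rmult_lt_0_compat.
  by apply: pow_lt; apply: INR_ltn0; apply: ltnW p_gt1.
apply: Rle_trans (_ : \sum_(a <- iota 0 (tl n).+1) (256 * Rmin (r * INR y * INR p ^ a) (/ (r * INR y * INR p ^ a))) <= _).
  apply: Rsum_le => a _; case: ifP => _.
    rewrite (_ : r * INR (p ^ a * y) = r * INR y * INR p ^ a); last by rewrite mult_INR pow_natE; ring.
    exact: pow_exp_min.
  apply: Rmult_le_pos; first lra.
  by apply: Rmin_glb; left => //; apply: Rinv_0_lt_compat.
rewrite Rsum_distr.
have M := @min_geometric p (tl n).+1 _ p_gt1 (Rmult_lt_0_compat _ _ r0 yr).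
by apply: Rle_trans (Rmult_le_compat_l 256 _ 4 _ M) _; lra.
Qed.

Variable d : nat.
Hypothesis d2 : (2 <= d)%N.

Lemma dmean_cont h : continuity (fun r => dmean d (tilt d r) h).
Proof.
have Ce a : continuity (fun r => exp (- (r * INR h * INR a))).
  move=> x; apply: derivable_continuous_pt; apply: ex_derive_Reals_0.
  by auto_derive.
move=> x; apply: (continuity_pt_ext (fun r => \sum_(a <- iota 0 d) (exp (- (r * INR h * INR a)) / tiltZ d r h * INR a))).
  by move=> r; rewrite /dmean -(ord_sumE d (fun a => exp (- (r * INR h * INR a)) / tiltZ d r h * INR a)).
apply: cont_sum => a y; apply: continuity_pt_mult; last by apply: continuity_pt_const => ? ?.
apply: continuity_pt_div; first exact: Ce; last by have := tiltZ_ge1 y d2 h; lra.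
apply: (continuity_pt_ext (fun r => \sum_(a <- iota 0 d) exp (- (r * INR h * INR a)))).
  by move=> r; rewrite /tiltZ -(ord_sumE d (fun a => exp (- (r * INR h * INR a)))).
by apply: cont_sum => b; apply: Ce.
Qed.

Definition meanN (n : nat) (r : R) := \sum_(x <- idx n) (INR (hv x) * dmean d (tilt d r) (hv x)).

(** Intermediate value theorem. At [r = 0] the window just below [n] alone has mean of order
    [t^(m-1) n], which exceeds [n]; for large [r] every mean is exponentially small. *)
Lemma exists_tilt : exists T0 : nat, forall n, (T0 <= tl n)%N -> exists r, 0 < r /\ meanN n r = INR n.
Proof.
have [cW [cW0 HW]] := window_ev; have [T hT] := HW 0%N.
set cw := exp (- INR d) / INR d.
have dr := INR_leq d2; rewrite -[INR 2]/2 in dr.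
have cw0 : 0 < cw by apply: Rdiv_lt_0_compat; [apply: exp_pos | lra].
have P0 : 0 < INR (p ^ 2) by apply: INR_ltn0; rewrite expn_gt0 (ltnW p_gt1).
have [T1 hT1] := INR_unbounded (INR (p ^ 2) / (cw * cW)).
exists (T + T1 + 1)%N => n hn; have t1 : (1 <= tl n)%N by lia.
have n0 : 0 < INR n by apply: INR_ltn0; have := tl_gt0 t1; lia.
have M0 : INR n < meanN n 0.
  have [|W [uW sW W1 W2]] := hT n ltac:(lia) n 0%N isT (leqnn n); first by simpl; lra.
  apply: Rlt_le_trans (_ : INR (size W) * (cw * (INR n / INR (p ^ 2))) <= _).
    have L : INR (p ^ 2) < cw * cW * Lam n.
      have := Lam_ge t1; have := @INR_leq T1 (tl n) ltac:(lia) => h1 h2.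
      have : INR (p ^ 2) = cw * cW * (INR (p ^ 2) / (cw * cW)) by field; split; lra.
      by move=> {1}->; apply: Rmult_lt_compat_l; [apply: Rmult_lt_0_compat | lra].
    have : INR n = INR (p ^ 2) * (INR n / INR (p ^ 2)) by field; lra.
    move=> {1}->; have x0 : 0 < INR n / INR (p ^ 2) by apply: Rdiv_lt_0_compat.
    by rewrite -Rmult_assoc; apply: Rmult_lt_compat_r => //; nra.
  rewrite /meanN -(big_map hv xpredT (fun h => INR h * dmean d (tilt d 0) h)) -Rsum_const.
  apply: Rle_trans (_ : \sum_(h <- W) (INR h * dmean d (tilt d 0) h) <= _); last first.
    apply: Rsum_subset => // [h hh|h _]; first by have [x [h1 _ <-]] := W2 h hh; apply: map_f.
    by apply: Rmult_le_pos; [apply: pos_INR | apply: dmean_ge0].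
  apply: Rsum_le => h hh; have [_ h2] := W1 h hh.
  rewrite Rmult_comm; apply: Rmult_le_compat => //; try lra.
  - by apply: Rmult_le_pos; [lra | left; apply: Rinv_0_lt_compat].
  - apply: (Rmult_le_reg_r (INR (p ^ 2))) => //.
    rewrite /Rdiv Rmult_assoc Rinv_l; last lra.
    by rewrite Rmult_1_r -mult_INR; apply: INR_leq; apply: ltnW.
  - by apply: dmean_lower; [|lra|rewrite Rmult_0_l; lra].
set N := INR (size (idx n)).
(* Chosen so that [d^2 N exp (- r1) < 1], by [exp r1 >= 1 + r1]. *)
pose r1 := INR d ^ 2 * N + 1.
have N0 : 0 <= N := pos_INR _.
have r10 : 0 < r1 by have := pow2_ge_0 (INR d); rewrite /r1; nra.
have M1 : meanN n r1 < INR n.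
  apply: Rle_lt_trans (_ : N * (INR n * (INR d ^ 2 * exp (- r1))) < _).
    rewrite /N -Rsum_const; apply: Rsum_le => x hx.
    have h0 := INR_leq (hv_gt0 Hb hx); rewrite -[INR 1]/1 in h0.
    apply: Rmult_le_compat; [lra | exact: dmean_ge0 | exact: INR_leq (hv_le hx) |].
    apply: Rle_trans (@dmean_le_exp d r1 (hv x) d2 (Rlt_le _ _ r10)) _.
    apply: Rmult_le_compat_l; first exact: pow2_ge_0.
    by apply: exp_le_compat; nra.
  have : INR d ^ 2 * N * exp (- r1) < 1.
    rewrite exp_Ropp; apply: (Rmult_lt_reg_r (exp r1)); first exact: exp_pos.
    rewrite Rmult_assoc Rinv_l; last by have := exp_pos r1; lra.
    by have := exp_ge1x r1; rewrite /r1; lra.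
  by nra.
have C : continuity (fun r => INR n - meanN n r).
  move=> x; apply: continuity_pt_minus; first by apply: continuity_pt_const => ? ?.
  apply: cont_sum => y; apply: continuity_mult; last exact: dmean_cont.
  by apply: continuity_const => ? ?.
have [r [[hr0 _] hr]] := IVT (fun r => INR n - meanN n r) 0 r1 C r10 ltac:(lra) ltac:(lra).
exists r; split; last lra.
by case: hr0 => // E; move: hr; rewrite -E; lra.
Qed.

(** The upper bound comes from the first moment sum, as [n] is the mean of [N] and this mean is
    O(Lam / r); the lower bound holds because a smaller tilt would let one window of elements exceed
    the mean [n]. *)
Lemma tilt_bounds : exists c1 C1 : R, [/\ 0 < c1, 0 < C1 & exists T0 : nat, forall n, (T0 <= tl n)%N ->
  forall r, 0 < r -> meanN n r = INR n -> c1 * Lam n <= r * INR n <= C1 * Lam n].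
Proof.
have [cW [cW0 HW]] := window_ev; have [T hT] := HW k.+1.
set cw := exp (- INR d) / INR d.
have dr := INR_leq d2; rewrite -[INR 2]/2 in dr.
have cw0 : 0 < cw by apply: Rdiv_lt_0_compat; [apply: exp_pos | lra].
have P0 : 0 < INR (p ^ 2) by apply: INR_ltn0; rewrite expn_gt0 (ltnW p_gt1).
have P4 : 1 <= INR (p ^ 2) by apply: (@INR_leq 1); rewrite expn_gt0 (ltnW p_gt1).
(* The second entry makes the window contribution at least twice [n] in the final contradiction; the
   first keeps [X] within [t^(k+1)] of [n]. *)
set a := Rmin (/ 2) (cw * cW / (4 * INR (p ^ 2))).
have a0 : 0 < a by apply: Rmin_glb_lt; [lra | apply: Rdiv_lt_0_compat; [apply: Rmult_lt_0_compat | lra]].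
have a1 : a <= / 2 := Rmin_l _ _.
have a2 : a * (4 * INR (p ^ 2)) <= cw * cW.
  have := Rmin_r (/ 2) (cw * cW / (4 * INR (p ^ 2))); rewrite -/a => h.
  have E : cw * cW = cw * cW / (4 * INR (p ^ 2)) * (4 * INR (p ^ 2)) by field; lra.
  by rewrite E; apply: Rmult_le_compat_r; lra.
exists a, (1024 * INR d ^ 2 * 2 ^ k.+1); split => //.
  by apply: Rmult_lt_0_compat; [have : 0 < INR d ^ 2 by [apply: pow_lt; lra]; lra | apply: pow_lt; lra].
have ln2 : 0 < ln 2 by rewrite -ln_1; apply: ln_increasing; lra.
have [T1 hT1] := @pow_exp_ev k.+1 (ln 2) a ltac:(lra).
have [T2 hT2] := INR_unbounded (2 / a).
exists (T + T1 + T2 + 2)%N => n hn r r0 Hr; have t1 : (1 <= tl n)%N by lia.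
have n0 : 0 < INR n by apply: INR_ltn0; have := tl_gt0 t1; lia.
have L0 := Lam_gt0 t1; have Lt := Lam_ge t1.
have nL : a * Lam n <= INR n.
  have [n2 _] := @tl_spec n ltac:(have := tl_gt0 t1; lia); apply: Rle_trans n2.
  by rewrite (_ : 2 ^ tl n = exp (ln 2 * INR (tl n))); [apply: hT1; lia | rewrite Rmult_comm exp_mulN exp_ln; lra].
split; last first.
  have : INR n <= INR d ^ 2 * / r * (1024 * INR (tl n).+1 ^ k.+1).
    rewrite -{1}Hr /meanN.
    apply: Rle_trans (_ : INR d ^ 2 * / r * \sum_(x <- idx n) ((r * INR (hv x)) ^ 1 * exp (- (r * INR (hv x)))) <= _); last first.
      apply: Rmult_le_compat_l; last exact: moment_sum_le.
      by apply: Rmult_le_pos; [apply: pow2_ge_0 | left; apply: Rinv_0_lt_compat].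
    rewrite -Rsum_distr; apply: Rsum_le => x _.
    have -> : INR d ^ 2 * / r * ((r * INR (hv x)) ^ 1 * exp (- (r * INR (hv x)))) =
      INR (hv x) * (INR d ^ 2 * exp (- (r * INR (hv x)))) by field; lra.
    by apply: Rmult_le_compat_l; [apply: pos_INR | apply: dmean_le_exp => //; lra].
  move=> H; apply: Rle_trans (Rmult_le_compat_l r _ _ (Rlt_le _ _ r0) H) _.
  have -> : r * (INR d ^ 2 * / r * (1024 * INR (tl n).+1 ^ k.+1)) = 1024 * INR d ^ 2 * INR (tl n).+1 ^ k.+1 by field; lra.
  rewrite (Rmult_assoc (1024 * INR d ^ 2) (2 ^ k.+1)); apply: Rmult_le_compat_l; last exact: Lam_succ.
  by have := pow2_ge_0 (INR d); lra.
apply: Rnot_lt_le => hlt.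
(* take X close to n / (a Lam): then r X <= 1 and the window below X alone contributes more than n *)
have aL : 2 <= a * Lam n.
  have := @INR_leq T2 (tl n) ltac:(lia) => h1.
  have E : 2 = a * (2 / a) by field; lra.
  by rewrite {1}E; apply: Rmult_le_compat_l; lra.
have iaL : 1 <= INR n / (a * Lam n).
  by apply: (Rmult_le_reg_r (a * Lam n)); [lra | rewrite /Rdiv Rmult_assoc Rinv_l; lra].
have [X [X1 X2]] := nat_floor iaL.
have XaL : INR n / (a * Lam n) * (a * Lam n) = INR n by field; split; lra.
have Xn : (X <= n)%N by apply/leP; apply: INR_le; nra.
have rX : r * INR X <= 1.
  have : r * INR X * INR n <= 1 * INR n; last by move/Rmult_le_reg_r; apply.
  have : INR X * (r * INR n) <= INR X * (a * Lam n) by apply: Rmult_le_compat_l; [apply: pos_INR | lra].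
  have : INR X * (a * Lam n) <= INR n by rewrite -XaL; apply: Rmult_le_compat_r; lra.
  lra.
have [|W [uW sW W1 W2]] := hT n ltac:(lia) X 0%N isT Xn.
  rewrite -/(Lam n); have h3 : INR n <= 2 * INR X * (a * Lam n) by rewrite -{1}XaL; apply: Rmult_le_compat_r; lra.
  have x0 := pos_INR X; have : INR X * (a * Lam n) <= INR X * (/ 2 * Lam n).
    by apply: Rmult_le_compat_l => //; apply: Rmult_le_compat_r; lra.
  lra.
have : INR (size W) * (cw * (INR X / INR (p ^ 2))) <= INR n.
  rewrite -[INR n]Hr /meanN -(big_map hv xpredT (fun h => INR h * dmean d (tilt d r) h)) -Rsum_const.
  apply: Rle_trans (_ : \sum_(h <- W) (INR h * dmean d (tilt d r) h) <= _); last first.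
    apply: Rsum_subset => // [h hh|h _]; first by have [x [h1 _ <-]] := W2 h hh; apply: map_f.
    by apply: Rmult_le_pos; [apply: pos_INR | apply: dmean_ge0].
  apply: Rsum_le => h hh; have [h1 h2] := W1 h hh.
  rewrite Rmult_comm; apply: Rmult_le_compat => //; try lra.
  - by apply: Rmult_le_pos; [apply: pos_INR | left; apply: Rinv_0_lt_compat].
  - apply: (Rmult_le_reg_r (INR (p ^ 2))) => //.
    rewrite /Rdiv Rmult_assoc Rinv_l; last lra.
    by rewrite Rmult_1_r -mult_INR; apply: INR_leq; apply: ltnW.
  - apply: dmean_lower; [by []|lra|].
    by apply: Rle_trans rX; apply: Rmult_le_compat_l; [lra | apply: INR_leq].
move=> H.
have X0 : 0 < INR X by have := iaL; lra.
have Z0 : 0 < Lam n * INR X by apply: Rmult_lt_0_compat.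
have E1 : cW * Lam n * (cw * (INR X / INR (p ^ 2))) <= INR n.
  apply: Rle_trans H; apply: Rmult_le_compat_r => //.
  by left; do 2 (apply: Rmult_lt_0_compat => //); apply: Rinv_0_lt_compat.
have E2 : INR n <= 2 * INR X * (a * Lam n) by rewrite -{1}XaL; apply: Rmult_le_compat_r; lra.
have E3 : cW * cw * (Lam n * INR X) <= 2 * (a * INR (p ^ 2)) * (Lam n * INR X).
  have -> : cW * cw * (Lam n * INR X) = cW * Lam n * (cw * (INR X / INR (p ^ 2))) * INR (p ^ 2) by field; lra.
  have -> : 2 * (a * INR (p ^ 2)) * (Lam n * INR X) = 2 * INR X * (a * Lam n) * INR (p ^ 2) by ring.
  by apply: Rmult_le_compat_r; lra.
have E4 := Rmult_le_reg_r _ _ _ Z0 E3.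
have : 0 < cW * cw by apply: Rmult_lt_0_compat.
lra.
Qed.

End Setting.

(** * Smoothness of the two parity classes *)

Lemma atan_deriv u : is_derive atan u (/ (1 + u ^ 2)).
Proof. by apply/is_derive_Reals; have := derivable_pt_lim_atan u; rewrite /Rsqr /= Rmult_1_r. Qed.

(** Each term but the first is below the integral over the preceding unit interval, with primitive
    [atan (b u) / b], and the arctangent stays below 2. *)
Lemma sum_lorentz (b : R) (N : nat) : 0 < b ->
  \sum_(j < N) / (1 + (b * INR j) ^ 2) <= 1 + 2 / b.
Proof.
move=> b0; have P u : 0 < 1 + u ^ 2 by have := pow2_ge_0 u; lra.
have step j : / (1 + (b * INR j.+1) ^ 2) <= / b * (atan (b * INR j.+1) - atan (b * INR j)).
  have j0 := pos_INR j.
  have [c [hc E]] := MVT_gen atan (b * INR j) (b * INR j.+1) (fun u => / (1 + u ^ 2))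
    (fun u _ => atan_deriv u)
    (fun u _ => derivable_continuous_pt _ _ (derivable_pt_atan u)).
  have bj : b * INR j <= b * INR j.+1 by apply: Rmult_le_compat_l; [lra | rewrite S_INR; lra].
  rewrite Rmin_left // Rmax_right // in hc.
  rewrite E (_ : b * INR j.+1 - b * INR j = b); last by rewrite S_INR; ring.
  rewrite (Rmult_comm _ b) -Rmult_assoc Rinv_l ?Rmult_1_l; last lra.
  apply: Rinv_le_contravar => //; apply: Rplus_le_compat_l; apply: pow_incr.
  by split; [apply: Rle_trans (proj1 hc); apply: Rmult_le_pos; lra | lra].
have tot M : \sum_(j < M) / (1 + (b * INR j.+1) ^ 2) <= 2 / b.
  apply: Rle_trans (Rsum_ord_le (F := fun j => / (1 + (b * INR j.+1) ^ 2)) (fun j _ => step j)) _.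
  rewrite (Rsum_ord_distr M (/ b) (fun j => atan (b * INR j.+1) - atan (b * INR j))).
  have -> : \sum_(j < M) (atan (b * INR j.+1) - atan (b * INR j)) = atan (b * INR M) - atan (b * INR 0).
    have := telescope M (fun j => - atan (b * INR j)).
    by rewrite (eq_bigr (fun j : 'I_M => atan (b * INR j.+1) - atan (b * INR j))) => [->|j _]; ring.
  rewrite /= Rmult_0_r atan_0 Rmult_comm /Rdiv; apply: Rmult_le_compat_r.
    by left; apply: Rinv_0_lt_compat.
  by have [_] := atan_bound (b * INR M); have := PI_4; lra.
have b2 : 0 < 2 / b by apply: Rdiv_lt_0_compat; lra.
case: N => [|N]; first by rewrite big_ord0; lra.
rewrite big_ord_recl /= Rmult_0_r.
have -> : / (1 + 0 ^ 2) = 1 by rewrite /= Rmult_0_l Rplus_0_r Rinv_1.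
by apply: Rplus_le_compat_l; apply: tot.
Qed.

(** Frequencies near 0 and near 1 are treated alike, which doubles the bound. For [Q >= rho] the
    major arcs thus have total weight O(1 / rho). *)
Lemma sum_fdist (Q : nat) (rho : R) : (0 < Q)%N -> 0 < rho ->
  / INR Q * \sum_(x < Q) / (1 + (rho * fdist Q x) ^ 2) <= 2 / INR Q + 4 / rho.
Proof.
move=> Q0 rho0; have q0 := INR_ltn0 Q0; have qi := Rinv_0_lt_compat _ q0.
set b := rho / INR Q; have b0 : 0 < b by apply: Rdiv_lt_0_compat.
set f := fun j : nat => / (1 + (b * INR j) ^ 2).
have P u : 0 < 1 + u ^ 2 by have := pow2_ge_0 u; lra.
have f0 j : 0 <= f j by left; apply: Rinv_0_lt_compat.
have S1 : \sum_(x < Q) f x <= 1 + 2 / b := sum_lorentz Q b0.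
have S2 : \sum_(x < Q) f (Q - x)%N <= 1 + 2 / b.
  apply: Rle_trans S1; rewrite (reindex_inj rev_ord_inj) /=.
  rewrite (eq_bigr (fun x : 'I_Q => f x.+1)); last by move=> x _; rewrite subKn.
  apply: (Rsum_ord_le (F := fun x => f x.+1) (G := f)) => j _.
  apply: Rinv_le_contravar => //; apply: Rplus_le_compat_l; apply: pow_incr.
  have := pos_INR j; rewrite S_INR => j0; split; first by apply: Rmult_le_pos; lra.
  by apply: Rmult_le_compat_l; lra.
have : \sum_(x < Q) / (1 + (rho * fdist Q x) ^ 2) <= \sum_(x < Q) f x + \sum_(x < Q) f (Q - x)%N.
  rewrite -big_split /=.
  apply: (Rsum_ord_le (F := fun x => / (1 + (rho * fdist Q x) ^ 2)) (G := fun x => f x + f (Q - x)%N)) => x xQ.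
  have := f0 x; have := f0 (Q - x)%N; rewrite /f /b.
  case: (fdist_cases xQ) => ->.
    by rewrite (_ : rho * (INR x / INR Q) = rho / INR Q * INR x); [lra | field; lra].
  rewrite (_ : rho * (1 - INR x / INR Q) = rho / INR Q * INR (Q - x)); first lra.
  by rewrite minus_INR; [field; lra | lia].
move=> H; apply: Rle_trans (Rmult_le_compat_l _ _ _ (Rlt_le _ _ qi) H) _.
apply: Rle_trans (_ : / INR Q * (2 * (1 + 2 / b)) <= _).
  by apply: Rmult_le_compat_l; lra.
by right; rewrite /b; field; split; lra.
Qed.

Lemma sin_half z : 0 <= z <= PI / 3 -> z / 2 <= sin z.
Proof.
move=> [z0 z1]; have pi0 := PI_RGT_0.
have [c [hc E]] := MVT_gen (fun u => sin u - u / 2) 0 z (fun u => cos u - / 2)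
  (fun u _ => ltac:(auto_derive => //; field))
  (fun u _ => ltac:(apply: derivable_continuous_pt; apply: ex_derive_Reals_0; auto_derive => //)).
rewrite Rmin_left // Rmax_right // sin_0 in hc E.
have : / 2 <= cos c.
  have -> : / 2 = cos (PI / 3) by rewrite cos_PI3; field.
  by apply: cos_decr_1; lra.
move=> h; have h2 : 0 <= (cos c - / 2) * (z - 0) by apply: Rmult_le_pos; lra.
by lra.
Qed.

Lemma cos_lower y : 0 <= y <= / 3 -> 2 * y ^ 2 <= 1 - cos (2 * PI * y).
Proof.
move=> [y0 y1]; have pi2 : 2 <= PI by have := PI2_1; lra.
have s : PI * y / 2 <= sin (PI * y) by apply: sin_half; nra.
rewrite (_ : 2 * PI * y = 2 * (PI * y)); last by ring.
rewrite cos_2a_sin; have : y <= sin (PI * y) by nra.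
move=> h; have := Rmult_le_compat _ _ _ _ y0 y0 h h; simpl; lra.
Qed.

Lemma near_fdist (Q x : nat) tau : (x < Q)%N -> near (INR x / INR Q) tau -> fdist Q x < tau.
Proof.
move=> xQ [j hj]; apply: Rle_lt_trans hj.
have q0 : 0 < INR Q by apply: INR_ltn0; apply: leq_ltn_trans xQ.
have xq : 0 <= INR x / INR Q by apply: Rmult_le_pos; [apply: pos_INR | left; apply: Rinv_0_lt_compat].
have qi := Rlt_le _ _ (Rinv_0_lt_compat _ q0).
have f1 : fdist Q x <= INR x / INR Q.
  by apply: Rmult_le_compat_r => //; apply: INR_leq; apply: geq_minl.
have f2 : fdist Q x <= 1 - INR x / INR Q.
  have -> : 1 - INR x / INR Q = INR (Q - x) / INR Q by rewrite minus_INR; [field; lra | lia].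
  by apply: Rmult_le_compat_r => //; apply: INR_leq; apply: geq_minr.
case: (Z_le_gt_dec j 0) => h.
  have hj0 : IZR j <= 0 by apply: IZR_le.
  by rewrite Rabs_pos_eq; lra.
have : 1 <= IZR j by apply: IZR_le; lia.
have : INR x / INR Q < 1.
  by apply: (Rmult_lt_reg_r (INR Q)) => //; rewrite /Rdiv Rmult_assoc Rinv_l; [rewrite Rmult_1_r Rmult_1_l; apply: INR_ltn | lra].
by move=> h1 h2; rewrite Rabs_left1; lra.
Qed.

Lemma near_mono x s t : s <= t -> near x s -> near x t.
Proof. by move=> st [j hj]; exists j; lra. Qed.

(** * Major arcs *)

Section Arcs.
Variables (p q : nat) (rest : seq nat) (e : R).
Hypothesis Hb : bases (p :: q :: rest).
Hypothesis he : 0 < e <= / 8.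
Notation k := (size rest).
Notation hv := (hv p q).
Notation idx := (idx p q rest).
Notation Lam := (Lam rest).
Variables c1 C1 : R.
Hypothesis c10 : 0 < c1.
Hypothesis C10 : 0 < C1.

(** Integer stand-in for [log log n]. *)
Definition gl (n : nat) := trunc_log 2 (tl n).

Let P4 : 1 <= INR (p ^ 2).
Proof. by apply: (@INR_leq 1); rewrite expn_gt0 (ltnW (p_gt1 Hb)). Qed.
Let Pq : (2 <= p ^ 2)%N.
Proof. exact: leq_trans (p_gt1 Hb) (leq_pexp2l (n1 := 1) (n2 := 2) (ltnW (p_gt1 Hb)) isT). Qed.
Let Qq : (2 <= q ^ 2)%N.
Proof. exact: leq_trans (q_gt1 Hb) (leq_pexp2l (n1 := 1) (n2 := 2) (ltnW (q_gt1 Hb)) isT). Qed.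

(* For a frequency below [t^K1 / n] a window of about [Lam n] consecutive elements
   already produces Gaussian decay. *)
Lemma major_window : exists cM : R, 0 < cM /\ forall K1 : nat, exists T0 : nat,
  forall n, (T0 <= tl n)%N -> forall r, c1 * Lam n <= r * INR n <= C1 * Lam n ->
  forall s theta, (s <= 1)%N -> 0 < theta -> theta * INR n <= INR (tl n) ^ K1 ->
  exists W : seq nat, [/\ uniq W,
    forall h, h \in W -> r * INR h <= 1 /\ (n <= h * tl n ^ (K1 + k + 4))%N,
    forall h, h \in W -> exists x, [/\ x \in idx n, odd (x.1.1 + x.1.2) = odd s & hv x = h] &
    \prod_(h <- W) psi e (2 * PI * theta * INR h) <= exp (- (cM * Lam n * Rmin (theta / r) 1 ^ 2))].
Proof.
have [cW [cW0 HW]] := window_ev Hb.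
have P4' := P4; set P := INR (p ^ 2) in P4' *.
exists (cW * (2 * e / (36 * P ^ 2))); split.
  have : 0 < P ^ 2 by apply: pow_lt; lra.
  by move=> ?; apply: Rmult_lt_0_compat => //; apply: Rdiv_lt_0_compat; lra.
move=> K1; have [T hT] := HW (K1 + k + 3)%N.
have ln2 : 0 < ln 2 by rewrite -ln_1; apply: ln_increasing; lra.
have [T2 hT2] := @pow_exp_ev (K1 + k + 2) (ln 2) 1 ln2.
have [T1 hT1] := INR_unbounded (1 / c1 + 2 * C1 + 6 + P).
exists (T + T1 + T2 + 2)%N => n hn r [hr1 hr2] s th s1 th0 thn.
have t1 : (1 <= tl n)%N by lia.
have n0 : 0 < INR n by apply: INR_ltn0; have := tl_gt0 t1; lia.
have L0 := Lam_gt0 rest t1; have Lt := Lam_ge rest t1.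
set t := INR (tl n) in thn Lt *.
have tT : 1 / c1 + 2 * C1 + 6 + P < t by have := @INR_leq T1 (tl n) ltac:(lia); rewrite -/t; lra.
have c1i : 0 < 1 / c1 by apply: Rdiv_lt_0_compat; lra.
have t6 : 6 < t by lra.
have r0 : 0 < r.
  have : 0 < r * INR n by apply: Rlt_le_trans hr1; apply: Rmult_lt_0_compat.
  by move=> h; apply: (Rmult_lt_reg_r (INR n)) => //; lra.
have cL : 1 <= c1 * Lam n.
  have E : 1 = c1 * (1 / c1) by field; lra.
  by rewrite E; apply: Rmult_le_compat_l; lra.
(* Top of the window: below [1 / r] the digits 0 and 1 keep weights bounded below, and below
   [1 / (3 th)] one has [th h <= 1/3], where [1 - cos] is quadratic. *)
set m := Rmin (/ r) (/ (3 * th)).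
have m0 : 0 < m by apply: Rmin_glb_lt; apply: Rinv_0_lt_compat; lra.
have mr : r * m <= 1.
  have -> : 1 = r * / r by field; lra.
  by apply: Rmult_le_compat_l; [lra | exact: Rmin_l].
have mth : th * m <= / 3.
  have -> : / 3 = th * / (3 * th) by field; lra.
  by apply: Rmult_le_compat_l; [lra | exact: Rmin_r].
have tp j : 0 < t ^ j by apply: pow_lt; lra.
have nm : INR n <= m * t ^ (K1 + k + 2).
  have rmin u v x : 0 <= x -> INR n <= u * x -> INR n <= v * x -> INR n <= Rmin u v * x.
    by move=> x0 hu hv'; rewrite /Rmin; case: Rle_dec.
  apply: rmin; first by left.
    have : INR n * r <= t ^ (K1 + k + 2).
      apply: Rle_trans (_ : C1 * Lam n <= _); first by lra.
      rewrite (_ : (K1 + k + 2)%N = (k.+1 + K1.+1)%N); last by lia.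
      rewrite pow_add /Lam -/t Rmult_comm; apply: Rmult_le_compat_l; first by left.
      apply: Rle_trans (_ : t ^ 1 <= _); first by rewrite pow_1; lra.
      by apply: Rle_pow; [lra | lia].
    move=> A; apply: (Rmult_le_reg_r r) => //.
    have E u : / r * u * r = u by field; lra.
    by rewrite E.
  have : INR n * (3 * th) <= t ^ (K1 + k + 2).
    apply: Rle_trans (_ : t ^ K1.+1 <= _); last by apply: Rle_pow; [lra | lia].
    rewrite /= (_ : INR n * (3 * th) = 3 * (th * INR n)); last by ring.
    by apply: Rmult_le_compat; [lra | apply: Rmult_le_pos; lra | lra |].
  move=> A; apply: (Rmult_le_reg_r (3 * th)); first lra.
  have E u : / (3 * th) * u * (3 * th) = u by field; lra.
  by rewrite E.
have m1 : 1 <= m.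
  have tn : t ^ (K1 + k + 2) <= INR n.
    have [n2 _] := @tl_spec n ltac:(have := tl_gt0 t1; lia); apply: Rle_trans n2.
    rewrite (_ : 2 ^ tl n = exp (ln 2 * INR (tl n))); last by rewrite Rmult_comm exp_mulN exp_ln; lra.
    by have := hT2 (tl n) ltac:(lia); rewrite Rmult_1_l.
  apply: (Rmult_le_reg_r (t ^ (K1 + k + 2))) => //; lra.
have [X [X1 X2]] := nat_floor m1.
have Xn : (X <= n)%N.
  apply/leP; apply: INR_le; apply: Rle_trans X1 _; apply: Rle_trans (Rmin_l _ _) _.
  by apply: (Rmult_le_reg_r r) => //; rewrite Rinv_l; lra.
have nX : INR n <= INR X * t ^ (K1 + k + 3).
  apply: Rle_trans nm _; rewrite (_ : (K1 + k + 3)%N = (K1 + k + 2).+1); last by lia.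
  rewrite /= -Rmult_assoc; apply: Rmult_le_compat_r; first by left.
  by have := pos_INR X; nra.
have [W [uW sW W1 W2]] := hT n ltac:(lia) X s s1 Xn nX.
have P2 : 0 < P ^ 2 by apply: pow_lt; lra.
(* At most [3 th m], hence within a constant factor of [th h] for the elements of the window. *)
set mu := Rmin (th / r) 1.
have mu0 : 0 <= mu by apply: Rmin_glb; [apply: Rmult_le_pos; [lra | left; apply: Rinv_0_lt_compat] | lra].
have hW h : h \in W -> mu / (6 * P) <= th * INR h <= / 3.
  move=> hh; have [h1 h2] := W1 h hh; have := INR_leq h1; have := INR_ltn h2.
  rewrite mult_INR -/P => h2r h1r; split; last first.
    by apply: Rle_trans mth; apply: Rmult_le_compat_l; lra.
  apply: (Rmult_le_reg_r (6 * P)); first lra.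
  rewrite /Rdiv Rmult_assoc Rinv_l; last lra.
  have : mu <= 3 * (th * m).
    rewrite /m /mu; apply: Rle_trans (_ : 3 * (th * Rmin (/ r) (/ (3 * th))) <= _); last lra.
    rewrite {2}/Rmin; case: Rle_dec => _.
      apply: Rle_trans (Rmin_l _ _) _; rewrite /Rdiv.
      have : 0 <= th * / r by apply: Rmult_le_pos; [lra | left; apply: Rinv_0_lt_compat].
      lra.
    by apply: Rle_trans (Rmin_r _ _) _; right; field; lra.
  have : th * m <= th * (2 * (INR h * P)) by apply: Rmult_le_compat_l; lra.
  lra.
exists W; split => //.
- move=> h hh; have [h1 h2] := W1 h hh; split.
    apply: Rle_trans mr; apply: Rmult_le_compat_l; first lra.
    by apply: Rle_trans X1; apply: INR_leq.
  apply/leP; apply: INR_le; rewrite mult_INR pow_natE -/t.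
  apply: Rle_trans nX _; rewrite (_ : (K1 + k + 4)%N = (K1 + k + 3).+1); last by lia.
  rewrite /= -Rmult_assoc; apply: Rmult_le_compat_r; first by left.
  have := INR_ltn h2; rewrite mult_INR -/P => h3.
  have : INR h * P <= INR h * t by apply: Rmult_le_compat_l; [apply: pos_INR | lra].
  lra.
- apply: Rle_trans (Rprod_le (G := fun=> exp (- (2 * e / (36 * P ^ 2) * mu ^ 2))) _) _.
    move=> h hh; split; first by case: (@psi_bound e (2 * PI * th * INR h) ltac:(lra)).
    have [a1 a2] := hW h hh.
    have q0 : 0 <= mu / (6 * P) by apply: Rmult_le_pos; [lra | left; apply: Rinv_0_lt_compat; lra].
    have := @cos_lower (th * INR h) ltac:(lra).
    rewrite (_ : 2 * PI * (th * INR h) = 2 * PI * th * INR h); last by ring.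
    move=> cl; apply: Rle_trans (exp_ge1x _); rewrite /psi.
    have : (mu / (6 * P)) ^ 2 <= (th * INR h) ^ 2 by apply: pow_incr.
    have -> : (mu / (6 * P)) ^ 2 = mu ^ 2 / (36 * P ^ 2) by field; lra.
    rewrite (_ : 2 * e / (36 * P ^ 2) * mu ^ 2 = e * (2 * (mu ^ 2 / (36 * P ^ 2)))); last by field; lra.
    move=> b; have : e * (2 * (mu ^ 2 / (36 * P ^ 2))) <= e * (1 - cos (2 * PI * th * INR h)).
      by apply: Rmult_le_compat_l; lra.
    lra.
  rewrite Rprod_const -exp_mulN; apply: exp_le_compat.
  have g0 : 0 <= 2 * e / (36 * P ^ 2) * mu ^ 2.
    by apply: Rmult_le_pos; [apply: Rmult_le_pos; [lra | left; apply: Rinv_0_lt_compat; lra] | apply: pow2_ge_0].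
  have E : cW * (2 * e / (36 * P ^ 2)) * Lam n * mu ^ 2 = cW * Lam n * (2 * e / (36 * P ^ 2) * mu ^ 2) by ring.
  rewrite E -Ropp_mult_distr_r; apply: Ropp_le_contravar; exact: Rmult_le_compat_r.
Qed.

End Arcs.

Lemma contraction_pow (c : R) (A : nat) : 0 <= c < 1 -> exists C : nat, c ^ C <= (/ 2) ^ A.
Proof.
move=> [c0 c1]; have h : 0 < (/ 2) ^ A by apply: pow_lt; lra.
have [N hN] := pow_lt_1_zero c ltac:(rewrite Rabs_pos_eq; lra) _ h.
by exists N; have := hN N (le_n N); rewrite Rabs_pos_eq; [lra | apply: pow_le].
Qed.

Lemma gl_spec n : (1 <= tl n)%N -> 2 ^ gl n <= INR (tl n) < 2 ^ (gl n).+1.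
Proof. exact: tl_spec. Qed.

Lemma gl_ge1 n : (2 <= tl n)%N -> (1 <= gl n)%N.
Proof. by move=> h; apply: trunc_log_max. Qed.

(** Exponents of order [log t] cost only a fixed power of [t]. *)
Lemma pow_gl_le (Q C n : nat) : (1 <= tl n)%N -> (Q ^ (C * gl n) <= tl n ^ (Q ^ C))%N.
Proof.
move=> t1; rewrite expnM; apply: leq_trans (_ : (2 ^ (Q ^ C)) ^ gl n <= _)%N.
  by apply: leq_expl; apply: ltnW; exact: ltn_expl.
by rewrite -expnM mulnC expnM; apply: leq_expl; apply: trunc_logP.
Qed.

(** Conversely, order [log t] contractions save any power of [t]; the factor [2 ^ A] comes from
    rounding the logarithm down. *)
Lemma contraction_gl (c : R) (C A n : nat) : 0 <= c -> c ^ C <= (/ 2) ^ A -> (1 <= tl n)%N ->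
  c ^ (C * gl n) * INR (tl n) ^ A <= 2 ^ A.
Proof.
move=> c0 H t1; have [_ g2] := gl_spec t1; have t0 := INR_ltn0 t1.
have A1 : c ^ (C * gl n) <= ((/ 2) ^ gl n) ^ A.
  rewrite pow_mult; apply: Rle_trans (_ : ((/ 2) ^ A) ^ gl n <= _).
    by apply: pow_incr; split => //; apply: pow_le.
  by right; rewrite -!pow_mult; congr (_ ^ _); lia.
apply: Rle_trans (Rmult_le_compat_r _ _ _ (pow_le _ A (Rlt_le _ _ t0)) A1) _.
rewrite -Rpow_mult_distr; apply: pow_incr.
have i0 : 0 < (/ 2) ^ gl n by apply: pow_lt; lra.
split; first by apply: Rmult_le_pos; lra.
apply: Rle_trans (_ : (/ 2) ^ gl n * (2 * 2 ^ gl n) <= _); first by apply: Rmult_le_compat_l; simpl in g2; lra.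
rewrite pow_inv; right; field; apply: pow_nonzero; lra.
Qed.

(** * Minor arcs: two-dimensional progressions *)

Section Strips.
Variables (p q : nat) (rest : seq nat) (e : R).
Hypothesis Hb : bases (p :: q :: rest).
Hypothesis he : 0 < e <= / 8.
Notation k := (size rest).
Notation hv := (hv p q).
Notation idx := (idx p q rest).
Notation Lam := (Lam rest).

(** Row length: the powers of [p^2] fill all scales up to [n / t^K]. *)
Definition Lq (n K : nat) := trunc_log (p ^ 2) (n %/ tl n ^ K).

Let Pq : (2 <= p ^ 2)%N.
Proof. exact: leq_trans (p_gt1 Hb) (leq_pexp2l (n1 := 1) (n2 := 2) (ltnW (p_gt1 Hb)) isT). Qed.
Let Qq : (2 <= q ^ 2)%N.
Proof. exact: leq_trans (q_gt1 Hb) (leq_pexp2l (n1 := 1) (n2 := 2) (ltnW (q_gt1 Hb)) isT). Qed.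

Lemma exp2_beats_pow (K : nat) : exists T : nat, forall n, (T <= tl n)%N -> (tl n ^ K < n)%N.
Proof.
have ln2 : 0 < ln 2 by rewrite -ln_1; apply: ln_increasing; lra.
have [T hT] := @pow_exp_ev K.+1 (ln 2) 1 ln2; exists (T + 2)%N => n hn.
have t2 : (2 <= tl n)%N by lia.
have := hT (tl n) ltac:(lia); rewrite Rmult_1_l Rmult_comm exp_mulN exp_ln; last lra.
have [n2 _] := @tl_spec n ltac:(have := @tl_gt0 n ltac:(lia); lia) => H.
have : INR (tl n ^ K.+1) <= INR n by rewrite pow_natE; lra.
move/INR_le/leP; rewrite expnS => H2.
apply: leq_trans H2; rewrite -{1}(mul1n (_ ^ _)%N) ltn_mul2r expn_gt0; lia.
Qed.

Lemma Lq_props (C K : nat) : exists T0 : nat, forall n, (T0 <= tl n)%N ->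
  [/\ (n < (p ^ 2) ^ (Lq n K).+1 * tl n ^ K)%N, ((p ^ 2) ^ Lq n K * tl n ^ K <= n)%N,
      (C * gl n < Lq n K)%N & (Lq n K <= tl n)%N].
Proof.
have [T hT] := exp2_beats_pow ((p ^ 2) ^ C + p ^ 2 + K)%N.
exists (T + 2)%N => n hn; have t2 : (2 <= tl n)%N by lia.
have tK j : (0 < tl n ^ j)%N by rewrite expn_gt0; lia.
have big := hT n ltac:(lia).
have nK : (tl n ^ K <= n)%N.
  by apply: leq_trans (ltnW big); apply: leq_pexp2l; lia.
have A1 : (n < (p ^ 2) ^ (Lq n K).+1 * tl n ^ K)%N by rewrite -ltn_divLR //; apply: trunc_log_ltn.
have A2 : ((p ^ 2) ^ Lq n K * tl n ^ K <= n)%N.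
  by rewrite -leq_divRL //; apply: trunc_logP => //; rewrite divn_gt0.
split => //.
- rewrite ltnNge; apply/negP => bad.
  have : (n <= tl n ^ ((p ^ 2) ^ C + p ^ 2 + K))%N; last by rewrite leqNgt big.
  apply: leq_trans (ltnW A1) _; rewrite expnD leq_mul2r; apply/orP; right.
  rewrite expnS mulnC expnD; apply: leq_mul; last first.
    apply: leq_trans (ltnW (ltn_expl (p ^ 2) (ltnSn 1))) _; exact: leq_expl.
  apply: leq_trans (_ : (p ^ 2) ^ (C * gl n) <= _)%N; first by apply: leq_pexp2l; lia.
  by apply: pow_gl_le; lia.
- apply: trunc_log_max => //; apply: leq_trans A2.
  apply: leq_trans (_ : (p ^ 2) ^ Lq n K <= _)%N; first exact: leq_expl.
  exact: leq_pmulr.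
Qed.

(** The powers of [q^2] raise an element by at most [t^((q^2)^C)]; the remaining [t^(k+2)] in [K]
    exceeds [r n], of order [t^(k+1)], by enough to give [r h <= 1]. *)
Lemma strip_scale (c1 C1 : R) (C K : nat) : 0 < c1 -> 0 < C1 -> ((q ^ 2) ^ C + k + 2 <= K)%N ->
  exists T0 : nat, forall n, (T0 <= tl n)%N ->
  forall r, c1 * Lam n <= r * INR n <= C1 * Lam n -> forall i j h, (i <= 1)%N -> (j <= 1)%N ->
  h \in strip p q i j (Lq n K) (C * gl n) ->
  r * INR h <= 1 /\ exists x, [/\ x \in idx n, x.2 = 1%N, (x.1.2 <= 2 * (C * gl n) + 1)%N,
    odd (x.1.1 + x.1.2) = odd (i + j) & hv x = h].
Proof.
move=> c10 C10 HK; have [T hT] := Lq_props C K.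
have [T1 hT1] := INR_unbounded (INR (p * q) * C1 + 1 / c1).
exists (T + T1 + p * q + 2)%N => n hn r [hr1 hr2] i j h i1 j1 /allpairsPdep [b [a [hb ha ->]]].
rewrite !mem_iota !add0n in hb ha.
have t1 : (1 <= tl n)%N by lia.
have [_ A2 _ _] := hT n ltac:(lia).
have t0 := INR_ltn0 t1; set t := INR (tl n) in t0.
have n0 : 0 < INR n by apply: INR_ltn0; have := tl_gt0 t1; lia.
have L0 := Lam_gt0 rest t1.
have r0 : 0 < r.
  have : 0 < r * INR n by apply: Rlt_le_trans hr1; apply: Rmult_lt_0_compat.
  by move=> h0; apply: (Rmult_lt_reg_r (INR n)) => //; lra.
set hh := hv _.
have hE : (hh * tl n ^ k.+2 <= p * q * n)%N.
  rewrite /hh hv_strip.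
  apply: leq_trans (_ : (p ^ 2) ^ Lq n K * (tl n ^ ((q ^ 2) ^ C) * (p * q)) * tl n ^ k.+2 <= _)%N.
    rewrite leq_mul2r; apply/orP; right; apply: leq_mul; first by apply: leq_pexp2l; lia.
    apply: leq_mul.
      apply: leq_trans (_ : (q ^ 2) ^ (C * gl n) <= _)%N; first by apply: leq_pexp2l; lia.
      exact: pow_gl_le.
    apply: leq_mul.
      exact: (leq_pexp2l (n2 := 1) (ltnW (p_gt1 Hb)) i1).
    exact: (leq_pexp2l (n2 := 1) (ltnW (q_gt1 Hb)) j1).
  rewrite [X in (X <= _)%N](_ : _ = (p * q * ((p ^ 2) ^ Lq n K * (tl n ^ ((q ^ 2) ^ C) * tl n ^ k.+2)))%N); last first.
    by rewrite !mulnA; nia.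
  rewrite leq_mul2l; apply/orP; right; apply: leq_trans A2; rewrite leq_mul2l -expnD; apply/orP; right.
  by apply: leq_pexp2l; lia.
have hEr : INR hh * t ^ k.+2 <= INR (p * q) * INR n.
  by have := INR_leq hE; rewrite (mult_INR hh) (mult_INR (p * q)) pow_natE.
have tC : INR (p * q) * C1 <= t.
  have : 0 < 1 / c1 by apply: Rdiv_lt_0_compat; lra.
  have := @INR_leq T1 (tl n) ltac:(lia); rewrite -/t; lra.
split.
  apply: (Rmult_le_reg_r (INR n * t ^ k.+2)).
    by apply: Rmult_lt_0_compat => //; apply: pow_lt.
  have X1 : r * INR n * (INR hh * t ^ k.+2) <= C1 * Lam n * (INR (p * q) * INR n).
    apply: Rmult_le_compat => //; first by apply: Rmult_le_pos; lra.
    by apply: Rmult_le_pos; [apply: pos_INR | apply: pow_le; lra].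
  apply: Rle_trans (_ : C1 * Lam n * (INR (p * q) * INR n) <= _); first by lra.
  rewrite /Lam -/t [t ^ k.+2]/= -/(t ^ k.+1).
  have := Rmult_le_compat_r (t ^ k.+1 * INR n) _ _ _ tC.
  have : 0 <= t ^ k.+1 * INR n by apply: Rmult_le_pos; [apply: pow_le; lra | lra].
  move=> u0 u1; have := u1 u0; simpl pow; lra.
exists (2 * a + i, 2 * b + j, 1)%N; split => //.
- apply: (idx_intro Hb (gen1 rest 0)) => //; rewrite -/hh.
  have tpos : (0 < tl n ^ k.+2)%N by rewrite expn_gt0; lia.
  rewrite -(leq_pmul2r tpos); apply: leq_trans hE _; rewrite mulnC leq_mul2l; apply/orP; right.
  apply: leq_trans (_ : tl n <= _)%N; first lia.
  by rewrite -{1}(expn1 (tl n)); apply: leq_pexp2l.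
- by rewrite /=; lia.
- by rewrite /= !mul2n !oddD !odd_double /=; case: (odd i); case: (odd j).
Qed.

(** [g] is the product over one column of the strip. At [y / P] with [0 < y < P] no element of the
    column makes the frequency an integer, as [q] is prime to [p], so [g <= c^B <= 2 / t] there and
    the sum [G] is at most [exp (2 P / t)]. At most [t] rows occur, hence [G^L] is bounded, and
    [1 / P^L] is of order [t^K / n]. The constant [C] precedes [K] because [K] must later exceed
    [(q^2)^C]. *)
Lemma strip_average : exists C : nat, forall K : nat, exists (D : R) (T0 : nat), 0 < D /\
  forall n, (T0 <= tl n)%N -> forall j RR, (Lq n K <= RR)%N ->
  / INR ((p ^ 2) ^ RR) * \sum_(x < (p ^ 2) ^ RR) \prod_(h <- strip p q 0 j (Lq n K) (C * gl n))
     psi e (2 * PI * INR x / INR ((p ^ 2) ^ RR) * INR h) <= D * INR (tl n) ^ K / INR n.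
Proof.
set P := (p ^ 2)%N; have P0 : (0 < P)%N by apply: ltnW.
have p2 := INR_leq Pq; rewrite -[INR 2]/2 -/P in p2.
have pi0 := PI_RGT_0.
set c := 1 - e * (1 - cos (2 * PI * (/ INR P))).
have cosP : cos (2 * PI * (/ INR P)) < 1.
  have i1 : 0 < / INR P <= / 2 by split; [apply: Rinv_0_lt_compat | apply: Rinv_le_contravar]; lra.
  by rewrite -cos_0; apply: cos_decreasing_1; nra.
have c01 : 0 <= c < 1.
  split; first by case: (@psi_bound e (2 * PI * (/ INR P)) ltac:(lra)).
  by rewrite /c; nra.
have [C hC] := contraction_pow 1 c01.
exists C => K; have [T hT] := Lq_props C K.
exists (exp (2 * INR P) * INR P), (T + 2)%N; split.
  by apply: Rmult_lt_0_compat; [apply: exp_pos | lra].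
move=> n hn j RR hR; have [A1 A2 A3 A4] := hT n ltac:(lia).
set L := Lq n K in hR A1 A2 A3 A4 *; set B := (C * gl n)%N.
have t1 : (1 <= tl n)%N by lia.
pose g (u : R) := \prod_(b <- iota 0 B) psi e (2 * PI * INR ((q ^ 2) ^ b * q ^ j) * u).
have g01 u : 0 <= g u <= 1 by apply: Rprod_le1 => b _; apply: psi_bound; lra.
have pg : posdef g by apply: posdef_prod => b; apply: posdef_psi; lra.
set G := \sum_(y < P) g (INR y / INR P).
have PR : 0 < INR (P ^ RR) by apply: INR_ltn0; rewrite expn_gt0 P0.
have avg : / INR (P ^ RR) * \sum_(x < P ^ RR) \prod_(h <- strip p q 0 j L B)
     psi e (2 * PI * INR x / INR (P ^ RR) * INR h) <= G ^ L * / INR P ^ L.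
  have -> : G ^ L * / INR P ^ L = / INR (P ^ RR) * (G ^ L * INR P ^ (RR - L)).
    have E : INR P ^ RR = INR P ^ L * INR P ^ (RR - L) by rewrite -pow_add; congr (_ ^ _); lia.
    by rewrite pow_natE E; field; split; apply: pow_nonzero; lra.
  apply: Rmult_le_compat_l; first by left; apply: Rinv_0_lt_compat.
  apply: Rle_trans (posdef_average P0 pg (fun u => proj1 (g01 u)) hR); right.
  apply: eq_bigr => x _; rewrite /strip (big_allpairs_dep) exchange_big /=.
  apply: eq_bigr => a _; apply: eq_bigr => b _; congr psi.
  rewrite hv_strip mul1n -/P (mult_INR (P ^ a)) (pow_natE P a) (pow_natE P RR); field; apply: pow_nonzero; lra.
apply: Rle_trans avg _.
have t0 := INR_ltn0 t1.
have Gb : G <= exp (2 * INR P / INR (tl n)).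
  have cB : c ^ B * INR (tl n) <= 2.
    by have := contraction_gl (proj1 c01) hC t1; rewrite !pow_1.
  have cB2 : c ^ B <= 2 / INR (tl n).
    by apply: (Rmult_le_reg_r (INR (tl n))) => //; rewrite /Rdiv Rmult_assoc Rinv_l; lra.
  apply: Rle_trans (exp_ge1x _).
  have c0 : 0 <= c ^ B by apply: pow_le; lra.
  apply: Rle_trans (_ : 1 + INR P * c ^ B <= _); last first.
    by rewrite /Rdiv; have := Rmult_le_compat_l (INR P) _ _ ltac:(lra) cB2; rewrite /Rdiv; lra.
  have first : \sum_(y < P) (if (y == 0 :> nat)%N then 1 else 0) <= 1.
    case: (P) => [|P']; first by rewrite big_ord0; lra.
    by rewrite big_ord_recl /= big1 //; lra.
  apply: Rle_trans (Rsum_ord_le (F := fun y => g (INR y / INR P))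
    (G := fun y => (if (y == 0)%N then 1 else 0) + c ^ B) _) _; last first.
    by rewrite big_split /=; apply: Rplus_le_compat first _; rewrite Rsum_ord_const; lra.
  case=> [|y] yP /=; first by have := g01 (0 / INR P); lra.
  rewrite -/(INR y.+1) Rplus_0_l.
  rewrite /g -[B in c ^ B](size_iota 0) -Rprod_const; apply: Rprod_le => b _.
  split; first by case: (@psi_bound e (2 * PI * INR ((q ^ 2) ^ b * q ^ j) * (INR y.+1 / INR P)) ltac:(lra)).
  rewrite /psi /c; suff : cos (2 * PI * INR ((q ^ 2) ^ b * q ^ j) * (INR y.+1 / INR P)) <= cos (2 * PI * / INR P).
    by move=> H; have := Rmult_le_compat_l e _ _ ltac:(lra) H; lra.
  set N := ((q ^ 2) ^ b * q ^ j * y.+1)%N.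
  have -> : 2 * PI * INR ((q ^ 2) ^ b * q ^ j) * (INR y.+1 / INR P) = 2 * PI * (INR N / INR P).
    by rewrite /N (mult_INR _ y.+1); field; lra.
  apply: cos_le_of_far; first by split; [apply: Rinv_0_lt_compat; lra | apply: Rinv_le_contravar; lra].
  move=> [z hz].
  have E : (Z.of_nat N = z * Z.of_nat P)%Z.
    apply: (proj1 (Z.sub_move_0_r _ _)); apply: one_IZR_lt1; rewrite minus_IZR mult_IZR -!INR_IZR_INZ.
    have : Rabs ((INR N / INR P - IZR z) * INR P) < 1.
      rewrite Rabs_mult (Rabs_pos_eq (INR P)); last lra.
      by apply: Rlt_le_trans (Rmult_lt_compat_r (INR P) _ _ ltac:(lra) hz) _; rewrite Rinv_l; lra.
    have -> : (INR N / INR P - IZR z) * INR P = INR N - IZR z * INR P by field; lra.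
    by move/Rabs_def2 => [? ?]; lra.
  have dv : (P %| N)%N.
    apply/dvdnP; exists (Z.to_nat z).
    have : (0 <= z)%Z by nia.
    by move=> z0; have ez := Z2Nat.id z z0; move: (Z.to_nat z) ez => w ez; move: E; rewrite -ez; clearbody N P; lia.
  have cop : coprime P ((q ^ 2) ^ b * q ^ j).
    by rewrite coprimeXl // -expnM -expnD coprimeXr // (pq_coprime Hb).
  move: dv; rewrite /N Gauss_dvdr //; move/dvdn_leq => /(_ isT); lia.
have G0 : 0 <= G by apply: (Rsum_ord_ge0 (F := fun y => g (INR y / INR P))) => y _; case: (g01 (INR y / INR P)).
have GL : G ^ L <= exp (2 * INR P).
  apply: Rle_trans (_ : exp (2 * INR P / INR (tl n)) ^ L <= _); first by apply: pow_incr.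
  rewrite -exp_mulN; apply: exp_le_compat.
  have := INR_leq A4 => Lt; rewrite /Rdiv.
  have -> : INR L * (2 * INR P * / INR (tl n)) = 2 * INR P * (INR L * / INR (tl n)) by ring.
  have : INR L * / INR (tl n) <= 1.
    by apply: (Rmult_le_reg_r (INR (tl n))) => //; rewrite Rmult_assoc Rinv_l; lra.
  by nra.
have n0 : 0 < INR n by apply: INR_ltn0; have := tl_gt0 t1; lia.
have PL : 0 < INR P ^ L by apply: pow_lt; lra.
have PLn : / INR P ^ L <= INR P * INR (tl n) ^ K / INR n.
  apply: (Rmult_le_reg_r (INR P ^ L * INR n)); first exact: Rmult_lt_0_compat.
  have := INR_ltn A1; rewrite (mult_INR (P ^ L.+1)) (pow_natE P) (pow_natE (tl n)) [INR P ^ L.+1]/=.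
  have -> : / INR P ^ L * (INR P ^ L * INR n) = INR n by field; lra.
  have -> : INR P * INR (tl n) ^ K / INR n * (INR P ^ L * INR n) = INR P * INR P ^ L * INR (tl n) ^ K by field; lra.
  lra.
apply: Rle_trans (_ : exp (2 * INR P) * (INR P * INR (tl n) ^ K / INR n) <= _); last by right; field; lra.
apply: Rmult_le_compat => //; first exact: pow_le.
by left; apply: Rinv_0_lt_compat.
Qed.

(** Rows are longer than their number [C * gl n], so [hits_product] yields [C * gl n] contractions,
    that is, a saving of [t^A], outside a neighbourhood of radius O(t^K / n) of the integers. *)
Lemma strip_hits (A : nat) : exists C : nat, forall K : nat, exists T0 : nat,
  forall n, (T0 <= tl n)%N -> forall i j theta,
  ~ near (INR (p ^ i * q ^ j) * theta) (/ (2 * INR (p ^ 2) ^ Lq n K)) ->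
  \prod_(h <- strip p q i j (Lq n K) (C * gl n)) psi e (2 * PI * theta * INR h) * INR (tl n) ^ A <= 2 ^ A.
Proof.
set P := (p ^ 2)%N; set Q := (q ^ 2)%N.
have cop : coprime P Q by rewrite coprimeXl // coprimeXr // (pq_coprime Hb).
have p2 := INR_leq Pq; have q2 := INR_leq Qq; rewrite -[INR 2]/2 -/P -/Q in p2 q2.
have pi0 := PI_RGT_0.
have c01 : 0 <= hitc P Q e < 1.
  have [h0 _] := @hitc_bound P Q e ltac:(lra); split => //; rewrite /hitc.
  have i0 : 0 < / (2 * INR P * INR Q) <= / 2.
    by split; [apply: Rinv_0_lt_compat | apply: Rinv_le_contravar]; nra.
  have : cos (2 * PI / (2 * INR P * INR Q)) < 1.
    by rewrite -cos_0 /Rdiv; apply: cos_decreasing_1; nra.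
  by nra.
have [C hC] := contraction_pow A c01.
exists C => K; have [T hT] := Lq_props C K.
exists (T + 2)%N => n hn i j th far; have [A1 A2 A3 A4] := hT n ltac:(lia).
have t1 : (1 <= tl n)%N by lia.
apply: Rle_trans (contraction_gl (proj1 c01) hC t1).
apply: Rmult_le_compat_r; first by apply: pow_le; apply: pos_INR.
have he' : 0 <= e <= / 2 by lra.
have L0 : (0 < Lq n K)%N by apply: leq_ltn_trans A3.
have := hits_product Pq Qq cop he' (C * gl n) L0 far.
rewrite (minn_idPl (ltnW A3)); apply: Rle_trans; right.
rewrite /strip big_allpairs_dep /=; apply: eq_bigr => b _; apply: eq_bigr => a _; congr psi.
rewrite hv_strip (mult_INR (_ ^ a)) (mult_INR (_ ^ b)) (pow_natE _ a) (pow_natE _ b) -/P -/Q; ring.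
Qed.

End Strips.

(** Gaussian decay is traded for [1 / (1 + u^2)], whose sum over frequencies is explicit; the spare
    factor [1 + u] pays for the additional [fdist] in the Lipschitz estimate. *)
Lemma gauss_poly (c : R) : 0 < c -> exists C, 1 <= C /\
  forall u, 0 <= u -> exp (- (c * u ^ 2)) * ((1 + u) * (1 + u ^ 2)) <= C.
Proof.
move=> c0; have ci : 0 < / c ^ 2 by apply: Rinv_0_lt_compat; apply: pow_lt.
exists (4 + 16 * / c ^ 2); split; first lra.
move=> u u0; have ep := exp_pos (c * u ^ 2).
have cu : 0 <= c * u ^ 2 by apply: Rmult_le_pos; [lra | apply: pow2_ge_0].
have e1 : 1 <= exp (c * u ^ 2) by have := exp_ge1x (c * u ^ 2); lra.
have e2 := @exp_ge_pow (c * u ^ 2) 2 cu isT.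
have u4 : u ^ 4 <= 4 * / c ^ 2 * exp (c * u ^ 2).
  have -> : u ^ 4 = 4 * / c ^ 2 * (c * u ^ 2 / INR 2) ^ 2 by rewrite -[INR 2]/2; field; lra.
  by apply: Rmult_le_compat_l => //; lra.
have pol : (1 + u) * (1 + u ^ 2) <= 4 + 4 * u ^ 4.
  have := pow2_ge_0 (u - 1); have := pow2_ge_0 (u ^ 2 - 1); have := pow2_ge_0 (u ^ 2 - u).
  have := pow2_ge_0 u; have -> : u ^ 4 = u ^ 2 * u ^ 2 by ring.
  by nra.
rewrite exp_Ropp; apply: (Rmult_le_reg_l (exp (c * u ^ 2))) => //.
rewrite -Rmult_assoc Rinv_r ?Rmult_1_l; last lra.
apply: Rle_trans pol _; nra.
Qed.

(** * Combination of the arcs: boundedness and smoothness of the density of each parity class *)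

Section Smoothing.
Variables (p q : nat) (rest : seq nat).
Hypothesis Hb : bases (p :: q :: rest).
Notation k := (size rest).
Notation hv := (hv p q).
Notation idx := (idx p q rest).
Notation Lam := (Lam rest).

(* The digits of the elements outside [inT] are the nearly uniform ones; the two
   parity classes of [inT] each contain enough elements to smooth out the sum. *)
Definition inT (K Kb n : nat) (x : nat * nat * nat) : bool :=
  (n <= hv x * tl n ^ K)%N || ((x.2 == 1%N) && (x.1.2 <= Kb * gl n)%N).
Definition Tl (K Kb n : nat) (s : bool) : seq nat :=
  [seq hv x | x <- idx n & inT K Kb n x && (odd (x.1.1 + x.1.2) == s)].
Definition Zl (K Kb n : nat) : seq nat := [seq hv x | x <- idx n & ~~ inT K Kb n x].
(** The scale of the standard deviation of [N]: about [Lam n] elements of size [1 / r] dominate its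
    variance. *)
Definition rho (r : R) (n : nat) : R := sqrt (Lam n) / r.

Lemma uniq_hv_filter n (P : pred (nat * nat * nat)) : uniq [seq hv x | x <- idx n & P x].
Proof.
rewrite map_inj_in_uniq; first exact/filter_uniq/(idx_uniq Hb).
move=> x y; rewrite mem_filter => /andP [_ hx]; rewrite mem_filter => /andP [_ hy].
exact: (hv_idx_inj Hb hx hy).
Qed.

Lemma Tl_intro K Kb n s x : x \in idx n -> inT K Kb n x -> odd (x.1.1 + x.1.2) = s ->
  hv x \in Tl K Kb n s.
Proof. by move=> hx hT <-; apply: map_f; rewrite mem_filter hT eqxx. Qed.

Variables (c1 C1 : R).
Hypothesis c10 : 0 < c1.
Hypothesis C10 : 0 < C1.

Lemma rho_facts n r : (1 <= tl n)%N -> 0 < r -> c1 * Lam n <= r * INR n ->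
  [/\ 0 < rho r n, rho r n ^ 2 = Lam n / r ^ 2 & / INR n <= / c1 * / rho r n].
Proof.
move=> t1 r0 hr; have L0 := Lam_gt0 rest t1.
have n0 : 0 < INR n by apply: INR_ltn0; have := tl_gt0 t1; lia.
have s0 := sqrt_lt_R0 _ L0; have ss := sqrt_sqrt _ (Rlt_le _ _ L0).
have t1' := INR_leq t1; rewrite -[INR 1]/1 in t1'.
have L1 : 1 <= Lam n by have := Lam_ge rest t1; lra.
have s1 : 1 <= sqrt (Lam n) by rewrite -sqrt_1; apply: sqrt_le_1_alt.
have R0 : 0 < rho r n by apply: Rdiv_lt_0_compat.
split => //; first by rewrite -[Lam n in RHS]ss /rho; field; lra.
rewrite -Rinv_mult; apply: Rinv_le_contravar; first exact: Rmult_lt_0_compat.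
rewrite /rho; apply: (Rmult_le_reg_r r) => //.
have -> : c1 * (sqrt (Lam n) / r) * r = c1 * sqrt (Lam n) by field; lra.
apply: Rle_trans (_ : c1 * Lam n <= _); last lra.
by apply: Rmult_le_compat_l; [lra | nra].
Qed.

Variable d : nat.
Hypothesis d2 : (2 <= d)%N.

(** Major arcs contribute O(1 / rho) to the density and O(1 / rho^2) per unit of shift. On the minor
    arcs one copy of the product is averaged and the other saves a power of [t]; no smoothness is
    available there, whence the second error term. *)
Lemma smoothing (A : nat) : exists Kb K0 : nat, forall K, (K0 <= K)%N ->
  exists (C : R) (T0 : nat), 0 < C /\ forall n, (T0 <= tl n)%N ->
  forall r, 0 < r -> c1 * Lam n <= r * INR n <= C1 * Lam n -> forall s : bool,
  (forall m, hit d (tilt d r) (Tl K Kb n s) n m <= C / rho r n) /\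
  (forall m m', (m <= m')%N ->
    Rabs (hit d (tilt d r) (Tl K Kb n s) n m - hit d (tilt d r) (Tl K Kb n s) n m') <=
    C * (INR (m' - m) / rho r n ^ 2 + / INR (tl n) ^ A / rho r n)).
Proof.
set cw := exp (- INR d) / INR d.
have dr := INR_leq d2; rewrite -[INR 2]/2 in dr.
have cw0 : 0 < cw by apply: Rdiv_lt_0_compat; [apply: exp_pos | lra].
have cw2 : cw <= / 2.
  rewrite /cw /Rdiv -[X in _ <= X]Rmult_1_l; apply: Rmult_le_compat; try (by left; apply: exp_pos).
  - by left; apply: Rinv_0_lt_compat; lra.
  - by rewrite -exp_0; apply: exp_le_compat; lra.
  - by apply: Rinv_le_contravar; lra.
(* For [r h <= 1] the digits 0 and 1 have weight at least [cw], so [2 e] is at most the product of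
   the two weights, and [e <= 1/8] as [cw <= 1/2]. *)
set e := cw ^ 2 / 4.
have he : 0 < e <= / 8 by rewrite /e; split; nra.
have he8 : 0 <= e <= / 8 by lra.
have he2 : 0 <= e <= / 2 by lra.
have P2 : (2 <= p ^ 2)%N.
  exact: leq_trans (p_gt1 Hb) (leq_pexp2l (n1 := 1) (n2 := 2) (ltnW (p_gt1 Hb)) isT).
set P := (p ^ 2)%N in P2 *; set Q' := (q ^ 2)%N.
have P2r := INR_leq P2; rewrite -[INR 2]/2 in P2r.
have [CU HU] := strip_average Hb he; set KU := (Q' ^ CU + k + 2)%N.
have [D [TU [D0 hTU]]] := HU KU.
(* The averaged copy loses [t^KU]; the pointwise saving pays for it and leaves [t^A]. *)
set A2 := (A + KU)%N.
have [C2 HH] := strip_hits Hb he A2; set K2 := (Q' ^ C2 + k + 2)%N.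
have [TH hTH] := HH K2.
have [TSU hTSU] := @strip_scale p q rest Hb c1 C1 CU KU c10 C10 (leqnn _).
have [TSH hTSH] := @strip_scale p q rest Hb c1 C1 C2 K2 c10 C10 (leqnn _).
have [TL hTL] := Lq_props Hb C2 K2.
have [cM [cM0 HM]] := major_window Hb he c10 C10.
(* The major arcs have to reach the radius of order [t^K2 / n] beyond which [strip_hits] works; the
   extra power of [t] absorbs constants. *)
set K1 := K2.+1; have [TM hTM] := HM K1.
have [CE [CE1 hCE]] := gauss_poly cM0.
have [u [v uv]] := coprime_bezout (ltnW (p_gt1 Hb)) (pq_coprime Hb).
set Nuv := (u + v + 1)%N.
have [TE hTE] := @pow_exp_ev (3 * K1) cM ((1 + / c1) ^ 3) cM0.
have pi0 := PI_RGT_0.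
set Cm := 2 ^ A2 * D * / c1.
have Cm0 : 0 < Cm.
  apply: Rmult_lt_0_compat; last exact: Rinv_0_lt_compat.
  by apply: Rmult_lt_0_compat => //; apply: pow_lt; lra.
(* The first value makes room for the [q]-exponents of both strips, the second for the windows of
   the major arcs. *)
exists (2 * CU + 2 * C2 + 1)%N, (K1 + k + 4)%N => K HK.
set Kb := (2 * CU + 2 * C2 + 1)%N.
exists (2 * Cm + 6 * CE + 12 * PI * CE), (TU + TH + TSU + TSH + TL + TM + TE + Nuv * P + 2)%N.
have PC : 0 < PI * CE by apply: Rmult_lt_0_compat; lra.
split; first lra.
move=> n hn r r0 [hr1 hr2] s.
have t2 : (2 <= tl n)%N by lia.
have t1 : (1 <= tl n)%N by lia.
have g1 := gl_ge1 t2.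
have n0 : 0 < INR n by apply: INR_ltn0; have := tl_gt0 t1; lia.
have t0 := INR_ltn0 t1; set t := INR (tl n) in t0 *.
have t1r : 1 <= t by have := INR_leq t1.
have L0 := Lam_gt0 rest t1; have Lt := Lam_ge rest t1; rewrite -/t in Lt.
have [R0 R2 Rn] := rho_facts t1 r0 hr1.
set T := Tl K Kb n s; set w := tilt d r.
have w0 := tilt_ge0 r d2; have ws := tilt_sum r d2.
have tA j : 0 < t ^ j by apply: pow_lt.
have [B1 B2 B3 B4] := hTL n ltac:(lia).
set LU := Lq p n KU; set LH := Lq p n K2 in B1 B2 B3 B4.
set i0 := 0%N; set j0 := nat_of_bool s.
set SU := strip p q 0 j0 LU (CU * gl n).
pose PsiU (QQ x : nat) := \prod_(h <- SU) psi e (2 * PI * INR x / INR QQ * INR h).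
(* [Nuv] exceeds the factor [u + v] lost in [near_bezout] and is at least 1, so one radius suits
   both parities. *)
set tau0 := INR Nuv * / (2 * INR P ^ LH).
pose maj (th : R) := if Rle_dec th tau0 then exp (- (cM * Lam n * Rmin (th / r) 1 ^ 2)) else 0.
pose bnd (QQ x : nat) := 2 ^ A2 / t ^ A2 * PsiU QQ x + maj (fdist QQ x).
have PLH : 0 < INR P ^ LH by apply: pow_lt; lra.
have tauK : tau0 * INR n <= t ^ K1.
  have Bn := INR_ltn B1; rewrite (mult_INR (_ ^ _)) (pow_natE (p ^ 2)) (pow_natE (tl n)) -/t in Bn.
  have NP : INR Nuv * INR P <= t by rewrite -mult_INR; apply: INR_leq; lia.
  have N0 := pos_INR Nuv.
  rewrite /tau0; apply: Rle_trans (_ : INR Nuv * / (2 * INR P ^ LH) * (INR P ^ LH.+1 * t ^ K2) <= _).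
    apply: Rmult_le_compat_l; last by left.
    by apply: Rmult_le_pos => //; left; apply: Rinv_0_lt_compat; lra.
  have -> : INR Nuv * / (2 * INR P ^ LH) * (INR P ^ LH.+1 * t ^ K2) = INR Nuv * INR P * t ^ K2 / 2.
    by rewrite /=; field; lra.
  rewrite /K1 [t ^ K2.+1]/=; have := Rmult_le_compat_r _ _ _ (Rlt_le _ _ (tA K2)) NP.
  have := tA K2; nra.
have maj0 th : 0 <= maj th by rewrite /maj; case: Rle_dec => ? /=; [left; apply: exp_pos | lra].
have maj_in th : th <= tau0 -> maj th = exp (- (cM * Lam n * Rmin (th / r) 1 ^ 2)).
  by rewrite /maj; case: Rle_dec.
have maj_out th : ~ th <= tau0 -> maj th = 0 by rewrite /maj; case: Rle_dec.
have majb th : 0 <= th -> maj th * ((1 + rho r n * th) * (1 + (rho r n * th) ^ 2)) <= CE.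
  move=> th0; case: (Rle_dec th tau0) => hth; last by rewrite maj_out //; lra.
  rewrite maj_in //.
  have u0 : 0 <= rho r n * th by apply: Rmult_le_pos; lra.
  case: (Rle_dec (th / r) 1) => h1; last rewrite Rmin_right; try lra.
    rewrite Rmin_left //; have E : cM * Lam n * (th / r) ^ 2 = cM * (rho r n * th) ^ 2.
      by rewrite Rpow_mult_distr R2; field; lra.
    by rewrite E; apply: hCE.
  (* Here [th > r], and the Gaussian bound has saturated at [exp (- cM * Lam n)]. On the major arcs
     [rho * th] is at most a power of [t], which this still beats because [Lam n >= t]. *)
  have thn : th * INR n <= t ^ K1.
    by apply: Rle_trans tauK; apply: Rmult_le_compat_r; lra.
  have ub : rho r n * th <= / c1 * t ^ K1.
    have a1 : rho r n <= / c1 * INR n.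
      have := Rn => h; have := Rmult_le_compat_r (rho r n * INR n) _ _ ltac:(nra) h.
      have -> : / INR n * (rho r n * INR n) = rho r n by field; lra.
      by have -> : / c1 * / rho r n * (rho r n * INR n) = / c1 * INR n by field; lra.
    apply: Rle_trans (_ : / c1 * INR n * th <= _); first by apply: Rmult_le_compat_r.
    by rewrite Rmult_assoc; apply: Rmult_le_compat_l; [left; apply: Rinv_0_lt_compat | lra].
  have ci : 0 < / c1 by apply: Rinv_0_lt_compat.
  have tK := tA K1; have tK1 : 1 <= t ^ K1 by apply: pow_R1_Rle.
  have U : (1 + rho r n * th) * (1 + (rho r n * th) ^ 2) <= exp (cM * Lam n).
    set y := rho r n * th in u0 ub *.
    apply: Rle_trans (_ : (1 + y) ^ 3 <= _); first by simpl; nra.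
    apply: Rle_trans (_ : ((1 + / c1) * t ^ K1) ^ 3 <= _); first by apply: pow_incr; lra.
    rewrite Rpow_mult_distr -pow_mult.
    apply: Rle_trans (_ : exp (cM * t) <= _).
      apply: Rle_trans (hTE (tl n) ltac:(lia)); right; congr (_ * _ ^ _); lia.
    by apply: exp_le_compat; apply: Rmult_le_compat_l; lra.
  rewrite pow1 Rmult_1_r exp_Ropp; have ep := exp_pos (cM * Lam n).
  apply: Rle_trans CE1; apply: (Rmult_le_reg_l (exp (cM * Lam n))) => //.
  by rewrite -Rmult_assoc Rinv_r; lra.
have iA2 : 0 < 2 ^ A2 / t ^ A2 by apply: Rdiv_lt_0_compat => //; apply: pow_lt; lra.
have PsiU0 QQ x : 0 <= PsiU QQ x.
  by apply: Rprod_ge0 => h _; case: (psi_bound (2 * PI * INR x / INR QQ * INR h) he2).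
have stripT C : (C <= CU + C2)%N ->
  forall h i j, odd (i + j) = s ->
  (exists x, [/\ x \in idx n, x.2 = 1%N, (x.1.2 <= 2 * (C * gl n) + 1)%N, odd (x.1.1 + x.1.2) = odd (i + j) & hv x = h]) ->
  h \in T.
  move=> CC h i j ij [x [hx x2 xb xo <-]]; apply: Tl_intro => //; last by rewrite xo.
  rewrite /inT x2 eqxx /=; apply/orP; right; apply: leq_trans xb _.
  rewrite /Kb; nia.
have key QQ x : (x < QQ)%N -> sqrt (cmod2 d w T (2 * PI * INR x / INR QQ)) <= bnd QQ x.
  move=> xQ; set th := 2 * PI * INR x / INR QQ.
  pose Wall := [seq h <- T | if Rle_dec (r * INR h) 1 then true else false].
  have uW : uniq Wall by apply/filter_uniq/uniq_hv_filter.
  have inW h : h \in T -> r * INR h <= 1 -> h \in Wall.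
    by move=> hT h1; rewrite mem_filter hT andbT; case: Rle_dec.
  have W1 h : h \in Wall -> 2 * e <= w h 0%N * w h 1%N.
    rewrite mem_filter => /andP [h1 _].
    have {}h1 : r * INR h <= 1 by move: h1; case: Rle_dec.
    have a1 := @tilt_lower d r h d2 (Rlt_le _ _ r0) 0%N (ltnW d2) h1.
    have a2 := @tilt_lower d r h d2 (Rlt_le _ _ r0) 1%N d2 h1.
    rewrite -/cw -/w in a1 a2.
    have : cw * cw <= w h 0%N * w h 1%N by apply: Rmult_le_compat; lra.
    by rewrite /e; nra.
  apply: Rle_trans (cmod2_le d2 w0 ws th he8 uW (mem_subseq (filter_subseq _ _)) W1) _.
  set Pr := \prod_(h <- Wall) _.
  have Pr01 : 0 <= Pr <= 1 by apply: Rprod_le1 => h _; apply: psi_bound; lra.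
  have sub V : uniq V -> {subset V <= Wall} -> Pr <= \prod_(h <- V) psi e (th * INR h).
    by move=> uV sV; apply: Rprod_subset => // h _; apply: psi_bound; lra.
  have f0 := proj1 (fdist_bound xQ).
  case: (Rle_dec (fdist QQ x) tau0) => hf.
    apply: Rle_trans (_ : maj (fdist QQ x) <= _); last first.
      by have := Rmult_le_pos _ _ (Rlt_le _ _ iA2) (PsiU0 QQ x); rewrite /bnd; lra.
    apply: Rle_trans (_ : Pr <= _); first by simpl; nra.
    rewrite maj_in //.
    case: f0 => [f0|<-]; last first.
      rewrite /Rdiv Rmult_0_l Rmin_left; last lra.
      by rewrite (_ : - _ = 0) ?exp_0; [lra | simpl; ring].
    have [|V [uV V1 V2 V3]] := hTM n ltac:(lia) r (conj hr1 hr2) s (fdist QQ x) (leq_b1 s) f0.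
      by apply: Rle_trans tauK; apply: Rmult_le_compat_r; lra.
    apply: Rle_trans V3.
    rewrite (eq_bigr (fun h => psi e (th * INR h))); last first.
      by move=> h _; rewrite /psi /th (cos_fdist h xQ).
    apply: sub => // h hh; have [h1 h2] := V1 h hh; have [y [hy yo yh]] := V2 h hh.
    apply: inW => //; rewrite -yh; apply: Tl_intro => //; last by rewrite yo oddb.
    apply/orP; left; rewrite yh; apply: leq_trans h2 _.
    by rewrite leq_mul2l leq_pexp2l ?orbT //; lia.
  have LHi : / (2 * INR P ^ LH) <= tau0.
    rewrite /tau0 -[X in X <= _]Rmult_1_l; apply: Rmult_le_compat_r.
      by left; apply: Rinv_0_lt_compat; lra.
    by apply: (@INR_leq 1); rewrite /Nuv; lia.
  (* Starting element of the strip: 1 for the even class; for the odd class [p], or [q] if the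
     frequency is invisible from [p]. *)
  have far : exists i j, [/\ (i <= 1)%N, (j <= 1)%N, odd (i + j) = s &
    ~ near (INR (p ^ i * q ^ j) * (INR x / INR QQ)) (/ (2 * INR P ^ LH))].
    have nf tau : tau <= tau0 -> ~ near (INR x / INR QQ) tau.
      by move=> ht hn'; apply: hf; left; apply: near_fdist => //; apply: near_mono hn'.
    case: (s); last first.
      by exists 0%N, 0%N; split => //; rewrite Rmult_1_l; apply: nf.
    case: (classic (near (INR (p ^ 1 * q ^ 0) * (INR x / INR QQ)) (/ (2 * INR P ^ LH)))) => hp; last by exists 1%N, 0%N.
    exists 0%N, 1%N; split => // hq.
    rewrite expn1 expn0 muln1 in hp; rewrite expn1 expn0 mul1n in hq.
    apply: (nf (INR (u + v) * / (2 * INR P ^ LH))); last exact: near_bezout uv hp hq.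
    apply: Rmult_le_compat_r; first by left; apply: Rinv_0_lt_compat; lra.
    by apply: INR_leq; rewrite /Nuv; lia.
  have [i [j [i1 j1 ij hfar]]] := far.
  have H1 : Pr * t ^ A2 <= 2 ^ A2.
    apply: Rle_trans (hTH n ltac:(lia) i j (INR x / INR QQ) hfar).
    apply: Rmult_le_compat_r; first by left.
    rewrite (eq_bigr (fun h => psi e (th * INR h))); last first.
      by move=> h _; have -> : 2 * PI * (INR x / INR QQ) * INR h = th * INR h by rewrite /th /Rdiv; ring.
    apply: sub => [|h hh]; first exact: (strip_uniq Hb).
    have [h1 hx] := hTSH n ltac:(lia) r (conj hr1 hr2) i j h i1 j1 hh.
    by apply: inW => //; apply: (stripT C2 _ h i j ij hx); lia.
  have H2 : Pr <= PsiU QQ x.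
    apply: sub => [|h hh]; first exact: (strip_uniq Hb).
    have [h1 hx] := hTSU n ltac:(lia) r (conj hr1 hr2) 0%N j0 h isT (leq_b1 s) hh.
    by apply: inW => //; apply: (stripT CU _ h 0%N j0 _ hx); [lia | rewrite /j0 oddb].
  have H3 : Pr <= 2 ^ A2 / t ^ A2.
    by apply: (Rmult_le_reg_r (t ^ A2)) => //; rewrite /Rdiv Rmult_assoc Rinv_l; have := tA A2; lra.
  (* One copy of the product is bounded by the pointwise saving, the other by the strip that is
     averaged later. *)
  apply: Rle_trans (_ : Pr * Pr <= _); first by simpl; lra.
  by rewrite /bnd; have := maj0 (fdist QQ x); have := Rmult_le_compat _ _ _ _ (proj1 Pr01) (proj1 Pr01) H3 H2; lra.
have R0i : 0 < / rho r n by apply: Rinv_0_lt_compat.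
have tAi : 0 < / t ^ A by apply: Rinv_0_lt_compat.
have minor RR : (LU <= RR)%N ->
  / INR (P ^ RR) * \sum_(x < P ^ RR) (2 ^ A2 / t ^ A2 * PsiU (P ^ RR)%N x) <= Cm * (/ t ^ A / rho r n).
  move=> hR; rewrite (Rsum_ord_distr _ _ (PsiU (P ^ RR)%N)).
  have B : / INR (P ^ RR) * \sum_(x < P ^ RR) PsiU (P ^ RR)%N x <= D * t ^ KU / INR n := hTU n ltac:(lia) j0 RR hR.
  apply: Rle_trans (_ : 2 ^ A2 / t ^ A2 * (D * t ^ KU / INR n) <= _).
    rewrite -Rmult_assoc (Rmult_comm (/ _)) Rmult_assoc.
    by apply: Rmult_le_compat_l => //; lra.
  have -> : 2 ^ A2 / t ^ A2 * (D * t ^ KU / INR n) = 2 ^ A2 * D * / t ^ A * / INR n.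
    by rewrite /A2 (pow_add t); field; repeat split; apply: Rgt_not_eq => //; exact: tA.
  have -> : Cm * (/ t ^ A / rho r n) = 2 ^ A2 * D * / t ^ A * (/ c1 * / rho r n).
    by rewrite /Cm; field; repeat split; apply: Rgt_not_eq => //; exact: tA.
  apply: Rmult_le_compat_l => //; left; apply: Rmult_lt_0_compat => //.
  by apply: Rmult_lt_0_compat => //; apply: pow_lt; lra.
have [NR hNR] := INR_unbounded (rho r n).
(* The modulus must be a power of [P] for the averaging, exceed all values of the sum for the
   inversion, and exceed [rho] so that the term [2 / Q] of [sum_fdist] is harmless. *)
have large (y : nat) : exists RR, [/\ (LU <= RR)%N, (y < P ^ RR)%N & rho r n <= INR (P ^ RR)].
  exists (LU + y + NR)%N; have H : (LU + y + NR < P ^ (LU + y + NR))%N by apply: ltn_expl.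
  split; [lia | lia |].
  by have := @INR_leq NR (P ^ (LU + y + NR)) ltac:(lia); lra.
have lor RR : rho r n <= INR (P ^ RR) ->
  / INR (P ^ RR) * \sum_(x < P ^ RR) / (1 + (rho r n * fdist (P ^ RR) x) ^ 2) <= 6 / rho r n.
  move=> hR; have P0 : (0 < P ^ RR)%N by rewrite expn_gt0; lia.
  apply: Rle_trans (sum_fdist P0 R0) _.
  have : / INR (P ^ RR) <= / rho r n by apply: Rinv_le_contravar.
  by rewrite /Rdiv; lra.
have majl QQ x : (x < QQ)%N ->
  maj (fdist QQ x) <= CE * / (1 + (rho r n * fdist QQ x) ^ 2) /\
  fdist QQ x * maj (fdist QQ x) <= CE * / rho r n * / (1 + (rho r n * fdist QQ x) ^ 2).
  move=> xQ; have f0 := proj1 (fdist_bound xQ); have := majb _ f0; have := maj0 (fdist QQ x).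
  set th := fdist QQ x in f0 *; set M := maj th => M0 MB.
  have y0 : 0 <= rho r n * th by apply: Rmult_le_pos; lra.
  set y := rho r n * th in y0 MB *.
  have y2 : 0 < 1 + y ^ 2 by have := pow2_ge_0 y; lra.
  have My : M * (1 + y) <= CE * / (1 + y ^ 2).
    by apply: (Rmult_le_reg_r (1 + y ^ 2)) => //; rewrite (Rmult_assoc CE) Rinv_l; lra.
  split; first by nra.
  have -> : th * M = / rho r n * (y * M) by rewrite /y; field; lra.
  rewrite (Rmult_comm CE) Rmult_assoc; apply: Rmult_le_compat_l; [lra | nra].
split=> [m|m m' mm].
  have [RR [hR1 hR2 hR3]] := large (n + (m + d * sumn T))%N.
  have q1 : (n < P ^ RR)%N by lia.
  have q2 : (m + d * sumn T < P ^ RR)%N by lia.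
  apply: Rle_trans (hit_le w0 q1 q2 (fun x xQ => key _ x xQ)) _.
  rewrite /bnd big_split /= Rmult_plus_distr_l.
  have M1 := minor RR hR1.
  have tA1 : / t ^ A <= 1.
    by rewrite -Rinv_1; apply: Rinv_le_contravar; [lra | apply: pow_R1_Rle].
  have M2 : / INR (P ^ RR) * \sum_(x < P ^ RR) maj (fdist (P ^ RR) x) <= CE * (6 / rho r n).
    apply: Rle_trans (Rmult_le_compat_l CE _ _ ltac:(lra) (lor RR hR3)).
    rewrite (Rmult_comm CE) Rmult_assoc; apply: Rmult_le_compat_l.
      by left; apply: Rinv_0_lt_compat; have := R0; lra.
    rewrite Rmult_comm -(Rsum_ord_distr _ CE (fun x => / (1 + (rho r n * fdist (P ^ RR) x) ^ 2))).
    apply: (Rsum_ord_le (F := fun x => maj (fdist (P ^ RR) x)) (G := fun x => CE * / (1 + (rho r n * fdist (P ^ RR) x) ^ 2))) => x xQ.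
    by case: (majl _ _ xQ).
  apply: Rle_trans (Rplus_le_compat _ _ _ _ M1 M2) _.
  have : Cm * (/ t ^ A / rho r n) <= Cm * (1 / rho r n).
    by apply: Rmult_le_compat_l; [lra | apply: Rmult_le_compat_r; lra].
  have : 0 <= PI * CE * / rho r n by apply: Rmult_le_pos; lra.
  have : 0 <= Cm * / rho r n by apply: Rmult_le_pos; lra.
  by rewrite /Rdiv; lra.
have [RR [hR1 hR2 hR3]] := large (n + (m' + d * sumn T))%N.
have q1 : (n < P ^ RR)%N by lia.
have q2 : (m + d * sumn T < P ^ RR)%N by lia.
have q3 : (m' + d * sumn T < P ^ RR)%N by lia.
apply: Rle_trans (hit_lip d2 w0 q1 q2 q3 mm (fun x xQ => key _ x xQ)) _.
set dm := INR (m' - m); have dm0 : 0 <= dm := pos_INR _.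
have M1 := minor RR hR1.
have PR0 : 0 < / INR (P ^ RR) by apply: Rinv_0_lt_compat; have := R0; lra.
have M2 : / INR (P ^ RR) * \sum_(x < P ^ RR) (fdist (P ^ RR) x * maj (fdist (P ^ RR) x)) <= CE * / rho r n * (6 / rho r n).
  have CR : 0 <= CE * / rho r n by apply: Rmult_le_pos; lra.
  apply: Rle_trans (Rmult_le_compat_l (CE * / rho r n) _ _ CR (lor RR hR3)).
  rewrite -Rmult_assoc (Rmult_comm _ (/ INR (P ^ RR))) Rmult_assoc; apply: Rmult_le_compat_l; first lra.
  rewrite -(Rsum_ord_distr _ (CE * / rho r n) (fun x => / (1 + (rho r n * fdist (P ^ RR) x) ^ 2))).
  apply: (Rsum_ord_le (F := fun x => fdist (P ^ RR) x * maj (fdist (P ^ RR) x)) (G := fun x => CE * / rho r n * / (1 + (rho r n * fdist (P ^ RR) x) ^ 2))) => x xQ.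
  by case: (majl _ _ xQ).
apply: Rle_trans (_ : 2 * (Cm * (/ t ^ A / rho r n)) + 2 * PI * dm * (CE * / rho r n * (6 / rho r n)) <= _).
  have pd0 : 0 <= 2 * PI * dm by apply: Rmult_le_pos; lra.
  apply: Rle_trans _ (Rplus_le_compat _ _ _ _ (Rmult_le_compat_l 2 _ _ ltac:(lra) M1)
    (Rmult_le_compat_l (2 * PI * dm) _ _ pd0 M2)).
  have dst a b x1 x2 x3 : a * (x3 * x1) + b * (x3 * x2) = x3 * (a * x1 + b * x2) by ring.
  rewrite dst; apply: Rmult_le_compat_l; first lra.
  rewrite -(Rsum_ord_distr _ 2 (fun x => 2 ^ A2 / t ^ A2 * PsiU (P ^ RR)%N x)).
  rewrite -(Rsum_ord_distr _ (2 * PI * dm) (fun x => fdist (P ^ RR) x * maj (fdist (P ^ RR) x))).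
  rewrite -big_split /=.
  apply: (Rsum_ord_le (F := fun x => bnd (P ^ RR)%N x * Rmin 2 (2 * PI * dm * fdist (P ^ RR) x))
    (G := fun x => 2 * (2 ^ A2 / t ^ A2 * PsiU (P ^ RR)%N x) + 2 * PI * dm * (fdist (P ^ RR) x * maj (fdist (P ^ RR) x)))) => x xQ.
  rewrite /bnd; have m1 := Rmin_l 2 (2 * PI * dm * fdist (P ^ RR) x); have m2 := Rmin_r 2 (2 * PI * dm * fdist (P ^ RR) x).
  have q4 := Rmult_le_pos _ _ (Rlt_le _ _ iA2) (PsiU0 (P ^ RR)%N x).
  rewrite Rmult_plus_distr_r; apply: Rplus_le_compat.
    have := Rmult_le_compat_l _ _ _ q4 m1; lra.
  have := Rmult_le_compat_l _ _ _ (maj0 (fdist (P ^ RR) x)) m2; lra.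
have R2i : / rho r n ^ 2 = / rho r n * / rho r n by field; lra.
rewrite /Rdiv R2i.
have x1 : 0 <= dm * (/ rho r n * / rho r n) by apply: Rmult_le_pos => //; nra.
have x2 : 0 <= / t ^ A * / rho r n by nra.
have := Rmult_le_pos _ _ (Rlt_le _ _ Cm0) x1.
have := Rmult_le_pos _ _ (Rlt_le _ _ PC) x2.
have : 0 <= CE * (/ t ^ A * / rho r n) by apply: Rmult_le_pos; lra.
have : 0 <= CE * (dm * (/ rho r n * / rho r n)) by apply: Rmult_le_pos; lra.
lra.
Qed.

End Smoothing.

(** * The law conditioned on N = n *)

Section Conditional.
Variables (d : nat) (w : nat -> nat -> R) (n : nat).
Hypothesis w_ge0 : forall h k, 0 <= w h k.
Hypothesis w_sum : forall h, \sum_(k < d) w h k = 1.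
Notation Ex := (Ex d w).
Notation hit := (hit d w).

(** Expectation of [F] of the three partial digit sums on the event [N = n], not yet divided by its
    probability. *)
Definition joint (lZ l0 l1 : seq nat) (F : nat -> nat -> nat -> R) : R :=
  Ex lZ (fun x y => Ex l0 (fun x0 y0 => Ex l1 (fun x1 y1 =>
    if (y + y0 + y1 == n)%N then F x x0 x1 else 0))).

Lemma joint_ext lZ l0 l1 F G : (forall x x0 x1, F x x0 x1 = G x x0 x1) ->
  joint lZ l0 l1 F = joint lZ l0 l1 G.
Proof.
move=> H; apply: Ex_ext => x y; apply: Ex_ext => x0 y0; apply: Ex_ext => x1 y1.
by rewrite H.
Qed.

Lemma joint_swap lZ l0 l1 F : joint lZ l0 l1 F = joint lZ l1 l0 (fun x x1 x0 => F x x0 x1).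
Proof.
apply: Ex_ext => x y; rewrite Ex_comm; apply: Ex_ext => x1 y1; apply: Ex_ext => x0 y0.
by rewrite -!addnA (addnC y0).
Qed.

Lemma joint_add lZ l0 l1 F G : joint lZ l0 l1 (fun x x0 x1 => F x x0 x1 + G x x0 x1) =
  joint lZ l0 l1 F + joint lZ l0 l1 G.
Proof.
rewrite /joint -Ex_add; apply: Ex_ext => x y; rewrite -Ex_add; apply: Ex_ext => x0 y0.
by rewrite -Ex_add; apply: Ex_ext => x1 y1; case: ifP => _; lra.
Qed.

Lemma joint_scal lZ l0 l1 c F : joint lZ l0 l1 (fun x x0 x1 => c * F x x0 x1) = c * joint lZ l0 l1 F.
Proof.
rewrite /joint -Ex_scal; apply: Ex_ext => x y; rewrite -Ex_scal; apply: Ex_ext => x0 y0.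
by rewrite -Ex_scal; apply: Ex_ext => x1 y1; case: ifP => _; lra.
Qed.

Lemma joint_le lZ l0 l1 F G : (forall x x0 x1, F x x0 x1 <= G x x0 x1) ->
  joint lZ l0 l1 F <= joint lZ l0 l1 G.
Proof.
move=> H; apply: Ex_le => // x y; apply: Ex_le => // x0 y0; apply: Ex_le => // x1 y1.
by case: ifP => _; [apply: H | lra].
Qed.

Lemma joint_cat lZ l0 l1 (F : nat -> R) :
  Ex (lZ ++ l0 ++ l1) (fun x y => if y == n then F x else 0) =
  joint lZ l0 l1 (fun x x0 x1 => F (x + x0 + x1)%N).
Proof.
rewrite Ex_cat; apply: Ex_ext => x y; rewrite Ex_cat; apply: Ex_ext => x0 y0; apply: Ex_ext => x1 y1.
by rewrite !addnA.
Qed.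

(** Integrating out [l1] first turns the constraint into the density of [l1] at the offset left by
    the other two groups. *)
Lemma joint_hit lZ l0 l1 (G H : nat -> R) :
  joint lZ l0 l1 (fun x x0 _ => G x * H x0) =
  Ex lZ (fun x y => G x * Ex l0 (fun x0 y0 => H x0 * hit l1 n (y + y0))).
Proof.
apply: Ex_ext => x y; rewrite -Ex_scal; apply: Ex_ext => x0 y0.
rewrite -Rmult_assoc /hit -Ex_scal; apply: Ex_ext => x1 y1.
by case: ifP => _; lra.
Qed.

Section Bounds.
Variables (lZ l0 l1 : seq nat) (B D b : R).
Hypothesis hB : forall m, hit l1 n m <= B.
Hypothesis hD : forall m y, (y <= d * sumn lZ)%N -> Rabs (hit l1 n (m + y) - hit l1 n m) <= D.
Notation J := (joint lZ l0 l1).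

(* Shifting the smooth density [hit l1 n] by the small sum over [lZ] changes it by at
   most [D], so the digits in [lZ] are almost independent of those in [l0]. *)
Lemma joint_decouple (G H : nat -> R) :
  Rabs (J (fun x x0 _ => G x * H x0) - Ex lZ (fun x _ => G x) * J (fun _ x0 _ => H x0)) <=
  2 * D * Ex lZ (fun x _ => Rabs (G x)) * Ex l0 (fun x _ => Rabs (H x)).
Proof.
set a0 := Ex l0 (fun x0 y0 => H x0 * hit l1 n y0).
set EH := Ex l0 (fun x _ => Rabs (H x)); set EG := Ex lZ (fun x _ => Rabs (G x)).
have EH0 : 0 <= EH by apply: Ex_ge0 => // x y; apply: Rabs_pos.
have D0 : 0 <= D by exact: (Rle_trans _ _ _ (Rabs_pos _) (@hD 0%N 0%N (leq0n _))).
have A y : (y <= d * sumn lZ)%N ->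
  Rabs (Ex l0 (fun x0 y0 => H x0 * hit l1 n (y + y0)) - a0) <= D * EH.
  move=> hy; rewrite /a0 -Ex_sub; apply: Rle_trans (@Ex_abs d w w_ge0 _ _) _.
  rewrite /EH -Ex_scal; apply: Ex_le => // x0 y0.
  rewrite -Rmult_minus_distr_l Rabs_mult Rmult_comm; apply: Rmult_le_compat_r; first exact: Rabs_pos.
  by rewrite addnC; apply: hD.
(* Comparison with [a0], the value at offset 0 from [lZ]. It is applied to [G] and to the constant
   1, which explains the factor 2. *)
have key (K : nat -> R) : Rabs (J (fun x x0 _ => K x * H x0) - Ex lZ (fun x _ => K x) * a0) <=
    D * EH * Ex lZ (fun x _ => Rabs (K x)).
  rewrite joint_hit.
  have -> : Ex lZ (fun x _ => K x) * a0 = Ex lZ (fun x _ => a0 * K x) by rewrite Ex_scal; ring.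
  rewrite -Ex_sub; apply: Rle_trans (@Ex_abs d w w_ge0 _ _) _; rewrite -Ex_scal.
  apply: Ex_le_in => // x y _ hy.
  rewrite (Rmult_comm a0) -Rmult_minus_distr_l Rabs_mult Rmult_comm.
  by apply: Rmult_le_compat_r; [apply: Rabs_pos | apply: A].
have K1 := key G; rewrite -/EG in K1.
have K2 := key (fun=> 1); rewrite !Ex_const // Rabs_R1 in K2.
have E1 : J (fun _ x0 _ => 1 * H x0) = J (fun _ x0 _ => H x0) by apply: joint_ext => x x0 x1; ring.
rewrite E1 in K2; set jH := J (fun _ x0 _ => H x0) in K2 *; set eG := Ex lZ (fun x _ => G x) in K1 *.
have eGb : Rabs eG <= EG by apply: Ex_abs.
set jGH := J _ in K1 *.
have -> : jGH - eG * jH = (jGH - eG * a0) - eG * (jH - 1 * a0) by ring.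
apply: Rle_trans (Rabs_triang _ _) _; rewrite Rabs_Ropp Rabs_mult.
have X : Rabs eG * Rabs (jH - 1 * a0) <= EG * (D * EH * 1).
  by apply: Rmult_le_compat => //; apply: Rabs_pos.
lra.
Qed.

(** Whatever the other digits are, [l1] completes the sum to [n] with probability at most [B]. *)
Lemma joint_sqr (H : nat -> R) : (forall x, 0 <= H x) ->
  J (fun _ x0 _ => H x0) <= B * Ex l0 (fun x _ => H x).
Proof.
move=> H0.
rewrite (@joint_ext lZ l0 l1 _ (fun _ x0 _ => 1 * H x0)); last by move=> x x0 x1; ring.
rewrite (joint_hit lZ l0 l1 (fun=> 1) H) -[X in _ <= X](Ex_const w_sum lZ).
apply: Ex_le => // x y; rewrite Rmult_1_l -Ex_scal; apply: Ex_le => // x0 y0.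
by rewrite Rmult_comm; apply: Rmult_le_compat_r.
Qed.

End Bounds.

Section Moments2.
Variables (lZ l0 l1 : seq nat) (B D b : R).
Hypothesis hB0 : forall m, hit l0 n m <= B.
Hypothesis hB1 : forall m, hit l1 n m <= B.
Hypothesis hD0 : forall m y, (y <= d * sumn lZ)%N -> Rabs (hit l0 n (m + y) - hit l0 n m) <= D.
Hypothesis hD1 : forall m y, (y <= d * sumn lZ)%N -> Rabs (hit l1 n (m + y) - hit l1 n m) <= D.
Notation J := (joint lZ l0 l1).
Definition tot := J (fun _ _ _ => 1).
Hypothesis b0 : 0 < b.
Hypothesis hb : b <= tot.
(** Conditional expectation given [N = n]. Of the constants below, [k1] is the relative error of
    decoupling and [k2] the bounded loss for nonnegative functions of one half. *)
Definition CE (F : nat -> nat -> nat -> R) := J F / tot.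
Let k1 := 2 * D / b.
Let k2 := B / b.

Let tot0 : 0 < tot. Proof. lra. Qed.
Let ti : 0 < / tot <= / b.
Proof. by split; [apply: Rinv_0_lt_compat | apply: Rinv_le_contravar]. Qed.
Let D0 : 0 <= D. Proof. by exact: (Rle_trans _ _ _ (Rabs_pos _) (@hD1 0%N 0%N (leq0n _))). Qed.
Let k10 : 0 <= k1.
Proof. by apply: Rmult_le_pos; [lra | left; apply: Rinv_0_lt_compat]. Qed.

Lemma CE_ext F G : (forall x x0 x1, F x x0 x1 = G x x0 x1) -> CE F = CE G.
Proof. by move=> H; rewrite /CE (joint_ext _ _ _ H). Qed.
Lemma CE_add F G : CE (fun x x0 x1 => F x x0 x1 + G x x0 x1) = CE F + CE G.
Proof. by rewrite /CE joint_add; field; lra. Qed.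
Lemma CE_scal c F : CE (fun x x0 x1 => c * F x x0 x1) = c * CE F.
Proof. by rewrite /CE joint_scal; field; lra. Qed.
Lemma CE_le F G : (forall x x0 x1, F x x0 x1 <= G x x0 x1) -> CE F <= CE G.
Proof. by move=> H; apply: Rmult_le_compat_r; [lra | apply: joint_le]. Qed.
Lemma CE_const c : CE (fun _ _ _ => c) = c.
Proof.
rewrite (@CE_ext _ (fun _ _ _ => c * 1)); last by move=> ? ? ?; ring.
by rewrite CE_scal /CE -/tot; field; lra.
Qed.

Let scaled X Y c : Rabs (X - Y * tot) <= 2 * D * c -> 0 <= c -> Rabs (X / tot - Y) <= k1 * c.
Proof.
move=> h c0.
have -> : X / tot - Y = (X - Y * tot) * / tot by field; lra.
rewrite Rabs_mult (Rabs_pos_eq (/ tot)); last lra.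
have -> : k1 * c = (2 * D * c) * / b by rewrite /k1; field; lra.
by apply: Rmult_le_compat; try lra; apply: Rabs_pos.
Qed.

Lemma CE_decouple0 (G H : nat -> R) :
  Rabs (CE (fun x x0 _ => G x * H x0) - Ex lZ (fun x _ => G x) * CE (fun _ x0 _ => H x0)) <=
  k1 * (Ex lZ (fun x _ => Rabs (G x)) * Ex l0 (fun x _ => Rabs (H x))).
Proof.
apply: scaled; last by apply: Rmult_le_pos; apply: Ex_ge0 => // ? ?; apply: Rabs_pos.
have -> : Ex lZ (fun x _ => G x) * CE (fun _ x0 _ => H x0) * tot =
  Ex lZ (fun x _ => G x) * J (fun _ x0 _ => H x0) by rewrite /CE; field; lra.
by rewrite -Rmult_assoc; apply: joint_decouple.
Qed.

(** The halves exchange roles: now [l0] supplies the smooth density. *)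
Lemma CE_decouple1 (G H : nat -> R) :
  Rabs (CE (fun x _ x1 => G x * H x1) - Ex lZ (fun x _ => G x) * CE (fun _ _ x1 => H x1)) <=
  k1 * (Ex lZ (fun x _ => Rabs (G x)) * Ex l1 (fun x _ => Rabs (H x))).
Proof.
apply: scaled; last by apply: Rmult_le_pos; apply: Ex_ge0 => // ? ?; apply: Rabs_pos.
have -> : Ex lZ (fun x _ => G x) * CE (fun _ _ x1 => H x1) * tot =
  Ex lZ (fun x _ => G x) * J (fun _ _ x1 => H x1) by rewrite /CE; field; lra.
by rewrite -Rmult_assoc !(joint_swap lZ l0 l1); apply: joint_decouple.
Qed.

Lemma CE_lZ (G : nat -> R) :
  Rabs (CE (fun x _ _ => G x) - Ex lZ (fun x _ => G x)) <= k1 * Ex lZ (fun x _ => Rabs (G x)).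
Proof.
have := CE_decouple0 G (fun=> 1).
rewrite CE_const Ex_const // Rabs_R1 !Rmult_1_r (@CE_ext _ (fun x _ _ => G x)) // => x x0 x1.
by rewrite Rmult_1_r.
Qed.

Lemma CE_sqr0 (H : nat -> R) : (forall x, 0 <= H x) -> CE (fun _ x0 _ => H x0) <= k2 * Ex l0 (fun x _ => H x).
Proof.
move=> H0; have := joint_sqr lZ l0 hB1 H0 => h.
have E0 : 0 <= Ex l0 (fun x _ => H x) by apply: Ex_ge0.
have J0 : 0 <= J (fun _ x0 _ => H x0).
  by rewrite -(Rmult_0_l (J (fun _ _ _ => 1))) -joint_scal; apply: joint_le => x x0 x1; rewrite Rmult_0_l.
have -> : k2 * Ex l0 (fun x _ => H x) = B * Ex l0 (fun x _ => H x) * / b by rewrite /k2; field; lra.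
by apply: Rmult_le_compat; lra.
Qed.

Lemma CE_sqr1 (H : nat -> R) : (forall x, 0 <= H x) -> CE (fun _ _ x1 => H x1) <= k2 * Ex l1 (fun x _ => H x).
Proof.
move=> H0; have := joint_sqr lZ l1 hB0 H0 => h.
have E0 : 0 <= Ex l1 (fun x _ => H x) by apply: Ex_ge0.
have J0 : 0 <= J (fun _ _ x1 => H x1).
  by rewrite -(Rmult_0_l (J (fun _ _ _ => 1))) -joint_scal; apply: joint_le => x x0 x1; rewrite Rmult_0_l.
have -> : k2 * Ex l1 (fun x _ => H x) = B * Ex l1 (fun x _ => H x) * / b by rewrite /k2; field; lra.
by rewrite /CE; rewrite joint_swap in J0 *; apply: Rmult_le_compat; lra.
Qed.

Lemma CE_sqr_le F : CE F ^ 2 <= CE (fun x x0 x1 => F x x0 x1 ^ 2).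
Proof.
set c := CE F.
have : 0 <= CE (fun x x0 x1 => (F x x0 x1 - c) ^ 2).
  by rewrite -(CE_const 0); apply: CE_le => x x0 x1; apply: pow2_ge_0.
rewrite (@CE_ext _ (fun x x0 x1 => F x x0 x1 ^ 2 + ((- 2 * c) * F x x0 x1 + c ^ 2))); last by move=> *; ring.
by rewrite !CE_add CE_scal CE_const -/c; nra.
Qed.

Variables (mZ m0 m1 vZ v0 v1 : R).
Hypothesis EZ : Ex lZ (fun x _ => INR x - mZ) = 0.
Hypothesis VZ : Ex lZ (fun x _ => (INR x - mZ) ^ 2) = vZ.
Hypothesis V0 : Ex l0 (fun x _ => (INR x - m0) ^ 2) = v0.
Hypothesis V1 : Ex l1 (fun x _ => (INR x - m1) ^ 2) = v1.
Notation G := (fun x : nat => INR x - mZ).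
Notation H0 := (fun x : nat => INR x - m0).
Notation H1 := (fun x : nat => INR x - m1).
(** Conditional second moment of the digits in both halves about their unconditional means. *)
Definition condT := CE (fun _ x0 x1 => (H0 x0 + H1 x1) ^ 2).

(** The cross term is dropped by [(u + v)^2 <= 2 u^2 + 2 v^2], after which each half is bounded
    through the density of the other. *)
Lemma condT_le : condT <= 2 * k2 * (v0 + v1).
Proof.
have A0 := CE_sqr0 (fun x => pow2_ge_0 (H0 x)); have A1 := CE_sqr1 (fun x => pow2_ge_0 (H1 x)).
rewrite V0 in A0; rewrite V1 in A1.
apply: Rle_trans (_ : CE (fun _ x0 x1 => 2 * (H0 x0) ^ 2 + 2 * (H1 x1) ^ 2) <= _).
  by apply: CE_le => x x0 x1; have := pow2_ge_0 (H0 x0 - H1 x1); nra.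
by rewrite CE_add !CE_scal; lra.
Qed.

Lemma vZ_ge0 : 0 <= vZ. Proof. by rewrite -VZ; apply: Ex_ge0 => // x y; apply: pow2_ge_0. Qed.
Lemma v0_ge0 : 0 <= v0. Proof. by rewrite -V0; apply: Ex_ge0 => // x y; apply: pow2_ge_0. Qed.
Lemma v1_ge0 : 0 <= v1. Proof. by rewrite -V1; apply: Ex_ge0 => // x y; apply: pow2_ge_0. Qed.

Notation S := (fun x x0 x1 : nat => INR (x + x0 + x1)).
Notation mu := (mZ + m0 + m1).

Lemma cond_center F : CE (fun x x0 x1 => F (INR (x + x0 + x1) - mu)) = CE (fun x x0 x1 => F (G x + (H0 x0 + H1 x1))).
Proof. by apply: CE_ext => x x0 x1; congr F; rewrite !plus_INR; ring. Qed.

(** The centred sum over [lZ] has unconditional mean 0, so its conditional mean is at most [k1]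
    times its absolute moment; the halves enter through their second moment. *)
Lemma cond_mean_sqr : (CE S - mu) ^ 2 <= 2 * (k1 ^ 2 * vZ) + 2 * condT.
Proof.
have -> : CE S - mu = CE (fun x _ _ => G x) + CE (fun _ x0 x1 => H0 x0 + H1 x1).
  rewrite -CE_add -{1}(CE_const mu) (_ : CE S - _ = CE S + (-1) * CE (fun _ _ _ => mu)); last by ring.
  by rewrite -CE_scal -CE_add; apply: CE_ext => x x0 x1; rewrite !plus_INR; ring.
have A : CE (fun x _ _ => G x) ^ 2 <= k1 ^ 2 * vZ.
  have := CE_lZ G; rewrite EZ Rminus_0_r => h.
  have h2 := Ex_sqr_le w_ge0 w_sum lZ (fun x _ => Rabs (G x)).
  rewrite (Ex_ext _ _ _ (F := fun x _ => Rabs (INR x - mZ) ^ 2) (G := fun x _ => (INR x - mZ) ^ 2)) ?VZ in h2; last by move=> x y; rewrite pow2_abs.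
  rewrite -pow2_abs; apply: Rle_trans (_ : (k1 * Ex lZ (fun x _ => Rabs (INR x - mZ))) ^ 2 <= _).
    by apply: pow_incr; split; [apply: Rabs_pos | apply: h].
  by rewrite Rpow_mult_distr; apply: Rmult_le_compat_l; [apply: pow2_ge_0 | lra].
have A2 := CE_sqr_le (fun _ x0 x1 => H0 x0 + H1 x1); rewrite -/condT in A2.
set u := CE _ in A *; set v := CE _ in A2 *.
by have := pow2_ge_0 (u - v); nra.
Qed.

(** Expansion of the square about [mu]: the term of [lZ] is [vZ] up to [k1 vZ], and each cross term
    of [lZ] with a half is within a [k1]-error of a product with the vanishing mean of [lZ].
    Bounding the cross terms by Cauchy-Schwarz would not give the required error term. *)
Lemma cond_var : Rabs (CE (fun x x0 x1 => (S x x0 x1 - CE S) ^ 2) - vZ) <=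
  k1 * vZ + 4 * k1 * (vZ + v0 + v1) + 3 * condT + 2 * (k1 ^ 2 * vZ).
Proof.
have M := cond_mean_sqr; set c := CE S in M *.
have E : CE (fun x x0 x1 => (S x x0 x1 - c) ^ 2) =
  CE (fun x x0 x1 => (G x + (H0 x0 + H1 x1)) ^ 2) - (c - mu) ^ 2.
  rewrite -(cond_center (fun z => z ^ 2)).
  set c2 := 2 * (c - mu) * mu + (c - mu) ^ 2.
  rewrite (@CE_ext _ (fun x x0 x1 => (S x x0 x1 - mu) ^ 2 + ((- 2 * (c - mu)) * S x x0 x1 + c2))).
    by rewrite CE_add CE_add CE_scal CE_const -/c /c2; ring.
  by move=> *; rewrite /c2; ring.
have E2 : CE (fun x x0 x1 => (G x + (H0 x0 + H1 x1)) ^ 2) =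
  CE (fun x _ _ => G x ^ 2) + (2 * CE (fun x x0 _ => G x * H0 x0) + (2 * CE (fun x _ x1 => G x * H1 x1) + condT)).
  rewrite /condT -!CE_scal -!CE_add; apply: CE_ext => x x0 x1; ring.
have B1 : Rabs (CE (fun x _ _ => G x ^ 2) - vZ) <= k1 * vZ.
  have -> : k1 * vZ = k1 * Ex lZ (fun x _ => Rabs (G x ^ 2)).
    rewrite -VZ; congr (_ * _); apply: Ex_ext => x y; rewrite Rabs_pos_eq //; exact: pow2_ge_0.
  by rewrite -{1}VZ; apply: (CE_lZ (fun x => G x ^ 2)).
have am (l : seq nat) m v : Ex l (fun x _ => (INR x - m) ^ 2) = v ->
  0 <= Ex l (fun x _ => Rabs (INR x - m)) /\ Ex l (fun x _ => Rabs (INR x - m)) ^ 2 <= v.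
  move=> hv; split; first by apply: Ex_ge0 => // x y; apply: Rabs_pos.
  apply: Rle_trans (Ex_sqr_le w_ge0 w_sum _ _) _; rewrite -hv; right.
  by apply: Ex_ext => x y; rewrite pow2_abs.
have [aZ0 aZ] := am _ _ _ VZ; have [a00 a0] := am _ _ _ V0; have [a10 a1] := am _ _ _ V1.
have B2 := CE_decouple0 G H0; have B3 := CE_decouple1 G H1.
rewrite EZ Rmult_0_l Rminus_0_r in B2 B3.
have pr u v U V : 0 <= u -> 0 <= v -> u ^ 2 <= U -> v ^ 2 <= V -> k1 * (u * v) <= k1 * (U + V).
  by move=> u0 v0' hu hv; apply: Rmult_le_compat_l => //; have := pow2_ge_0 (u - v); nra.
have C2 := Rle_trans _ _ _ B2 (pr _ _ _ _ aZ0 a00 aZ a0).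
have C3 := Rle_trans _ _ _ B3 (pr _ _ _ _ aZ0 a10 aZ a1).
have T0 : 0 <= condT by rewrite -(CE_const 0); apply: CE_le => x x0 x1; apply: pow2_ge_0.
have := pow2_ge_0 (c - mu); have zz := vZ_ge0.
have kz : 0 <= k1 * vZ by apply: Rmult_le_pos.
have kz0 : 0 <= k1 * v0 by apply: Rmult_le_pos => //; exact: v0_ge0.
have kz1 : 0 <= k1 * v1 by apply: Rmult_le_pos => //; exact: v1_ge0.
rewrite E E2; move: B1 C2 C3 M => /Rabs_le_between [? ?] /Rabs_le_between [? ?] /Rabs_le_between [? ?] M ?.
apply/Rabs_le_between; lra.
Qed.

End Moments2.
End Conditional.

(** * The local lower bound *)

Section Total.
Variables (p q : nat) (rest : seq nat).
Hypothesis Hb : bases (p :: q :: rest).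
Notation k := (size rest).
Notation hv := (hv p q).
Notation idx := (idx p q rest).
Notation Lam := (Lam rest).
Notation rho := (rho rest).
Variable d : nat.
Hypothesis d2 : (2 <= d)%N.
Variables (c1 C1 : R).
Hypothesis c10 : 0 < c1.
Hypothesis C10 : 0 < C1.

Definition Full K Kb n := Zl p q rest K Kb n ++ Tl p q rest K Kb n false ++ Tl p q rest K Kb n true.

Lemma Full_perm K Kb n : perm_eq (Full K Kb n) [seq hv x | x <- idx n].
Proof.
rewrite /Full /Zl /Tl -!map_cat; apply: perm_map.
set T := inT p q K Kb n.
have -> : [seq x <- idx n | T x && (odd (x.1.1 + x.1.2) == false)] =
  [seq x <- [seq x <- idx n | T x] | ~~ odd (x.1.1 + x.1.2)].
  by rewrite -filter_predI; apply: eq_filter => x /=; rewrite andbC; case: (odd _).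
have -> : [seq x <- idx n | T x && (odd (x.1.1 + x.1.2) == true)] =
  [seq x <- [seq x <- idx n | T x] | odd (x.1.1 + x.1.2)].
  by rewrite -filter_predI; apply: eq_filter => x /=; rewrite andbC; case: (odd _).
rewrite perm_catC.
apply: perm_trans (_ : perm_eq ([seq x <- idx n | T x] ++ [seq x <- idx n | ~~ T x]) _); last first.
  by rewrite perm_filterC.
rewrite perm_cat2r perm_catC; by rewrite (permPl (permEl (perm_filterC _ _))).
Qed.

Lemma Full_sum K Kb n (F : nat -> R) : \sum_(h <- Full K Kb n) F h = \sum_(x <- idx n) F (hv x).
Proof. by rewrite (perm_big _ (Full_perm K Kb n)) big_map. Qed.

Lemma sqr_exp_le x : 0 <= x -> x ^ 2 * exp (- x) <= 4.
Proof.
move=> x0; have := @exp_ge_pow x 2 x0 isT; rewrite -[INR 2]/2 => h.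
rewrite exp_Ropp; apply: (Rmult_le_reg_r (exp x)); first exact: exp_pos.
rewrite Rmult_assoc Rinv_l; last by have := exp_pos x; lra.
by move: h; rewrite /Rdiv Rpow_mult_distr; lra.
Qed.

(** Scaled by [1 / rho], the element [h] has coefficient [r h / sqrt Lam]. The second moment sum
    bounds the variance above, the window just below [n / (C1 Lam)], where [r h] is of order 1,
    bounds it below, and the third moment sum gives a Lindeberg error of order [1 / sqrt Lam]. *)
Lemma lvar_bounds : exists cs Cs T0, [/\ 0 < cs, 0 < Cs & forall n r K Kb, (T0 <= tl n)%N -> 0 < r ->
  c1 * Lam n <= r * INR n <= C1 * Lam n ->
  let w := tilt d r in let b := / rho r n in let l := Full K Kb n in
  [/\ cs <= lvar d w 0 b l <= Cs &
   \sum_(h <- l) (Rabs (lcoef 0 b h) ^ 3 * dabs3 d w h + (lcoef 0 b h ^ 2 * dvar d w h) ^ 2)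
     <= Cs / sqrt (Lam n)]].
Proof.
have [cW [cW0 HW]] := window_ev Hb; have [T hT] := HW k.+2.
set cw := exp (- INR d) / INR d / 4.
have dr := INR_leq d2; rewrite -[INR 2]/2 in dr.
have cw0 : 0 < cw by apply: Rdiv_lt_0_compat; [apply: Rdiv_lt_0_compat; [apply: exp_pos | lra] | lra].
have P0 : 0 < INR (p ^ 2) by apply: INR_ltn0; rewrite expn_gt0 (ltnW (p_gt1 Hb)).
set Cv := INR d ^ 3 * (1024 * 2 ^ k.+1).
have d3 : 0 < INR d ^ 3 by apply: pow_lt; lra.
have pk : 0 < 2 ^ k.+1 by apply: pow_lt; lra.
have Cv0 : 0 < Cv by apply: Rmult_lt_0_compat; lra.
have [T1 hT1] := INR_unbounded (2 * C1).
have [T2 hT2] := @pow_exp_ev k.+1 (ln 2) C1 ltac:(rewrite -ln_1; apply: ln_increasing; lra).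
have [T3 hT3] := INR_unbounded (/ C1).
pose g := c1 / (2 * C1) / INR (p ^ 2).
have g0 : 0 < g by apply: Rdiv_lt_0_compat => //; apply: Rdiv_lt_0_compat; lra.
exists (cW * cw * g ^ 2), (Cv * (1 + INR d + 4 * INR d ^ 3)), (T + T1 + T2 + T3 + 1)%N; split.
- by apply: Rmult_lt_0_compat; [apply: Rmult_lt_0_compat | apply: pow_lt].
- by apply: Rmult_lt_0_compat => //; lra.
move=> n r K Kb hn r0 hr w b l; have t1 : (1 <= tl n)%N by lia.
have n0 : 0 < INR n by apply: INR_ltn0; have := tl_gt0 t1; lia.
have t1' := INR_leq t1; rewrite -[INR 1]/1 in t1'.
have L0 := Lam_gt0 rest t1; have Lt := Lam_ge rest t1.
have s0 := sqrt_lt_R0 _ L0; have ss := sqrt_sqrt _ (Rlt_le _ _ L0).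
have s1 : 1 <= sqrt (Lam n) by rewrite -sqrt_1; apply: sqrt_le_1_alt; lra.
have bE : b = r / sqrt (Lam n) by rewrite /b /rho; field; lra.
have lc h : lcoef 0 b h = r * INR h / sqrt (Lam n) by rewrite /lcoef bE; field; lra.
have lc2 h : lcoef 0 b h ^ 2 = (r * INR h) ^ 2 / Lam n by rewrite lc -{2}ss; field; lra.
have rh h : 0 <= r * INR h by apply: Rmult_le_pos; [lra | apply: pos_INR].
have msum j : (0 < j <= 3)%N -> INR d ^ 3 * \sum_(x <- idx n) ((r * INR (hv x)) ^ j * exp (- (r * INR (hv x)))) <= Cv * Lam n.
  move=> hj; rewrite /Cv Rmult_assoc; apply: Rmult_le_compat_l; first lra.
  apply: Rle_trans (moment_sum_le Hb n hj r0) _; rewrite Rmult_assoc.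
  by apply: Rmult_le_compat_l; [lra | apply: Lam_succ].
have dv h : dvar d w h <= INR d ^ 3 * exp (- (r * INR h)) by apply: dvar_le_exp => //; lra.
have dv0 h : 0 <= dvar d w h by apply: dvar_ge0.
have li : 0 < / Lam n by apply: Rinv_0_lt_compat.
have vle : lvar d w 0 b l <= Cv.
  rewrite /lvar (Full_sum K Kb n (fun h => lcoef 0 b h ^ 2 * dvar d w h)).
  apply: Rle_trans (_ : / Lam n * (INR d ^ 3 * \sum_(x <- idx n) ((r * INR (hv x)) ^ 2 * exp (- (r * INR (hv x))))) <= _).
    rewrite -!Rsum_distr; apply: Rsum_le => x _; rewrite lc2.
    have := Rmult_le_compat_l ((r * INR (hv x)) ^ 2 * / Lam n) _ _ _ (dv (hv x)).
    rewrite /Rdiv => h; have {}h := h ltac:(apply: Rmult_le_pos; [apply: pow2_ge_0 | lra]).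
    by lra.
  apply: Rle_trans (Rmult_le_compat_l _ _ _ (Rlt_le _ _ li) (msum 2%N isT)) _; right; field; lra.
split; first split => //.
- have CL : 2 <= INR (tl n) / C1.
    have := @INR_leq T1 (tl n) ltac:(lia) => h; apply: (Rmult_le_reg_r C1) => //.
    by rewrite /Rdiv Rmult_assoc Rinv_l; lra.
  have nL : 1 <= INR n / (C1 * Lam n).
    have [n2 _] := @tl_spec n ltac:(have := tl_gt0 t1; lia).
    have h2 := hT2 (tl n) ltac:(lia).
    rewrite (_ : exp (ln 2 * INR (tl n)) = 2 ^ tl n) in h2; last by rewrite Rmult_comm exp_mulN exp_ln; lra.
    apply: (Rmult_le_reg_r (C1 * Lam n)); first exact: Rmult_lt_0_compat.
    by rewrite /Rdiv Rmult_assoc Rinv_l ?Rmult_1_r; [rewrite /Lam; lra | apply: Rgt_not_eq; apply: Rmult_lt_0_compat].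
  have [X [X1 X2]] := nat_floor nL.
  have XE : INR n / (C1 * Lam n) * (C1 * Lam n) = INR n by field; lra.
  have CL0 : 0 < C1 * Lam n by apply: Rmult_lt_0_compat.
  have X0 : 0 < INR X by lra.
  have XL : INR X * (C1 * Lam n) <= INR n by rewrite -{1}XE; apply: Rmult_le_compat_r; lra.
  have XU : INR n <= 2 * INR X * (C1 * Lam n) by rewrite -{1}XE; apply: Rmult_le_compat_r; lra.
  have rX : r * INR X <= 1.
    apply: (Rmult_le_reg_r (C1 * Lam n)) => //.
    have := Rmult_le_compat_l r _ _ (Rlt_le _ _ r0) XL; lra.
  have rX2 : c1 / (2 * C1) <= r * INR X.
    apply: (Rmult_le_reg_r (2 * C1 * Lam n)); first by lra.
    have := Rmult_le_compat_l r _ _ (Rlt_le _ _ r0) XU.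
    have -> : c1 / (2 * C1) * (2 * C1 * Lam n) = c1 * Lam n by field; lra.
    lra.
  have Xn : (X <= n)%N.
    apply/leP; apply: INR_le.
    have h1 : 1 <= C1 * Lam n.
      have := @INR_leq T3 (tl n) ltac:(lia) => h3.
      by rewrite -(Rinv_r C1); [apply: Rmult_le_compat_l; lra | lra].
    apply: Rle_trans XL; rewrite -{1}(Rmult_1_r (INR X)); apply: Rmult_le_compat_l; lra.
  have [|W [uW sW W1 W2]] := hT n ltac:(lia) X 0%N isT Xn.
    apply: Rle_trans XU _; rewrite (_ : _ ^ _ = INR (tl n) * Lam n) //.
    have := @INR_leq T1 (tl n) ltac:(lia) => h1.
    have : 2 * C1 * (INR X * Lam n) <= INR (tl n) * (INR X * Lam n).
      by apply: Rmult_le_compat_r; [apply: Rmult_le_pos | ]; lra.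
    lra.
  apply: Rle_trans (_ : \sum_(h <- W) (lcoef 0 b h ^ 2 * dvar d w h) <= _); last first.
    rewrite /lvar; apply: Rsum_subset => // [h hh|h _].
      by have [x [h1 _ <-]] := W2 h hh; rewrite (perm_mem (Full_perm K Kb n)); apply: map_f.
    by apply: Rmult_le_pos => //; apply: pow2_ge_0.
  apply: Rle_trans (_ : INR (size W) * (g ^ 2 / Lam n * cw) <= _).
    have -> : cW * cw * g ^ 2 = cW * Lam n * (g ^ 2 / Lam n * cw) by field; lra.
    apply: Rmult_le_compat_r => //; apply: Rmult_le_pos; last lra.
    by apply: Rmult_le_pos; [apply: pow2_ge_0 | lra].
  rewrite -Rsum_const; apply: Rsum_le => h hh; have [h1 h2] := W1 h hh.
  apply: Rmult_le_compat; [by apply: Rmult_le_pos; [apply: pow2_ge_0 | lra] | lra | |].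
    rewrite lc2; apply: Rmult_le_compat_r; first lra.
    apply: pow_incr; split; first lra.
    rewrite /g; apply: (Rmult_le_reg_r (INR (p ^ 2))) => //.
    have -> : c1 / (2 * C1) / INR (p ^ 2) * INR (p ^ 2) = c1 / (2 * C1) by field; lra.
    apply: Rle_trans rX2 _; rewrite Rmult_assoc -mult_INR.
    by apply: Rmult_le_compat_l; [lra | apply: INR_leq; apply: ltnW].
  apply: dvar_lower => //; first lra.
  by apply: Rle_trans rX; apply: Rmult_le_compat_l; [lra | apply: INR_leq].
- apply: Rle_trans vle _; have : 0 <= Cv * (INR d + 4 * INR d ^ 3) by apply: Rmult_le_pos; lra.
  lra.
have si : 0 < / sqrt (Lam n) by apply: Rinv_0_lt_compat.
rewrite Rsum_add.
have A3 : \sum_(h <- l) (Rabs (lcoef 0 b h) ^ 3 * dabs3 d w h) <= Cv * INR d * / sqrt (Lam n).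
  rewrite (Full_sum K Kb n (fun h => Rabs (lcoef 0 b h) ^ 3 * dabs3 d w h)).
  apply: Rle_trans (_ : INR d * / Lam n * / sqrt (Lam n) * (INR d ^ 3 * \sum_(x <- idx n) ((r * INR (hv x)) ^ 3 * exp (- (r * INR (hv x))))) <= _).
    rewrite -!Rsum_distr; apply: Rsum_le => x _; rewrite lc.
    rewrite (Rabs_pos_eq (r * INR (hv x) / sqrt (Lam n))); last by apply: Rmult_le_pos => //; lra.
    have -> : (r * INR (hv x) / sqrt (Lam n)) ^ 3 = (r * INR (hv x)) ^ 3 * (/ Lam n * / sqrt (Lam n)).
      by rewrite -{2}ss; field; lra.
    set A := (r * INR (hv x)) ^ 3; set e := exp _; set u := / Lam n * / sqrt (Lam n).
    have A0 : 0 <= A by apply: pow_le.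
    have u0 : 0 < u by apply: Rmult_lt_0_compat.
    have h3 : dabs3 d w (hv x) <= INR d * (INR d ^ 3 * e).
      by apply: Rle_trans (@dabs3_le d r (hv x) d2) _; apply: Rmult_le_compat_l; [lra | apply: dv].
    have := Rmult_le_compat_l (A * u) _ _ _ h3 => h; have {}h := h ltac:(apply: Rmult_le_pos; lra).
    apply: Rle_trans h _; right; rewrite /u; ring.
  apply: Rle_trans (Rmult_le_compat_l _ _ _ _ (msum 3%N isT)) _.
    by apply: Rmult_le_pos; [apply: Rmult_le_pos | ]; lra.
  right; field; lra.
(* One of the two equal factors is O(1 / Lam) uniformly in [h]; the other sums to the variance. *)
have A4 : \sum_(h <- l) (lcoef 0 b h ^ 2 * dvar d w h) ^ 2 <= 4 * INR d ^ 3 * / Lam n * Cv.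
  apply: Rle_trans (_ : 4 * INR d ^ 3 * / Lam n * lvar d w 0 b l <= _); last first.
    by apply: Rmult_le_compat_l => //; apply: Rmult_le_pos; lra.
  rewrite /lvar -Rsum_distr; apply: Rsum_le => h _.
  rewrite -[X in X <= _]/(_ * (_ * 1)) Rmult_1_r; apply: Rmult_le_compat_r.
    by apply: Rmult_le_pos => //; apply: pow2_ge_0.
  rewrite lc2; have h2 := sqr_exp_le (rh h); have h3 := dv h.
  have := Rmult_le_compat_l ((r * INR h) ^ 2) _ _ (pow2_ge_0 _) h3 => h4.
  have h5 : (r * INR h) ^ 2 * dvar d w h <= 4 * INR d ^ 3.
    by apply: Rle_trans h4 _; have := Rmult_le_compat_l (INR d ^ 3) _ _ (Rlt_le _ _ d3) h2; lra.
  by have := Rmult_le_compat_r (/ Lam n) _ _ (Rlt_le _ _ li) h5; rewrite /Rdiv; lra.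
have A5 : / Lam n <= / sqrt (Lam n) by apply: Rinv_le_contravar => //; move: ss s1; set u := sqrt _; nra.
have A6 : 4 * INR d ^ 3 * / Lam n * Cv <= 4 * INR d ^ 3 * Cv * / sqrt (Lam n).
  have : 0 <= 4 * INR d ^ 3 * Cv by apply: Rmult_le_pos; lra.
  by move=> h; have := Rmult_le_compat_l _ _ _ h A5; lra.
have A7 : 0 <= Cv * / sqrt (Lam n) by apply: Rmult_le_pos; lra.
apply: Rle_trans (Rplus_le_compat _ _ _ _ A3 (Rle_trans _ _ _ A4 A6)) _.
rewrite /Rdiv; lra.
Qed.

Lemma gcdf_slope B x y : - B <= x -> x <= y -> y <= B -> (y - x) * (gker B * hc) <= gcdf y - gcdf x.
Proof.
move=> Bx xy yB; have [c [hc' ->]] := MVT_gen gcdf x y _ (fun z _ => gcdf_deriv z) (fun z _ => gcdf_cont z).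
rewrite Rmult_comm; apply: Rmult_le_compat_r; first lra.
rewrite Rmin_left // Rmax_right // in hc'.
rewrite /Rdiv -/hc; apply: Rmult_le_compat_r; first by have := hc_bound; lra.
by rewrite /gker; apply: exp_le_compat; nra.
Qed.

Lemma hit_cat w (l1 l2 : seq nat) n m :
  hit d w (l1 ++ l2) n m = Ex d w l1 (fun _ y => hit d w l2 n (m + y)).
Proof.
by rewrite /hit Ex_cat; apply: Ex_ext => x y; apply: Ex_ext => x' y'; rewrite addnA.
Qed.

(* A smoothed one-sided window of width [theta] below the mean carries mass of order
   [theta] by the central limit theorem; the mass of a point cannot vary much inside it. *)
Lemma hit_lower (C : R) : 0 < C -> exists (b : R) (T0 : nat), 0 < b /\
  forall n r K Kb, (T0 <= tl n)%N -> 0 < r ->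
  c1 * Lam n <= r * INR n <= C1 * Lam n -> meanN p q rest d n r = INR n ->
  (forall m m', (m <= m')%N ->
    Rabs (hit d (tilt d r) (Tl p q rest K Kb n true) n m - hit d (tilt d r) (Tl p q rest K Kb n true) n m') <=
    C * (INR (m' - m) / rho r n ^ 2 + / INR (tl n) ^ 1 / rho r n)) ->
  b / rho r n <= hit d (tilt d r) (Full K Kb n) n 0.
Proof.
move=> C0; have [cs [Cs [T [cs0 Cs0 HT]]]] := lvar_bounds.
have scs := sqrt_lt_R0 _ cs0; have sCs : 0 < sqrt (Cs + 1) by apply: sqrt_lt_R0; lra.
set B := / sqrt cs; have B0 : 0 < B by apply: Rinv_0_lt_compat.
have [hc0 _] := hc_bound; have gB := gker_gt0 B.
(* Gaussian mass per unit of [th]: a strip of width [th / 2], divided by a standard deviation of at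
   most [sqrt (Cs + 1)], where the density is at least [gker B * hc]. The choice of [B] contains the
   rescaled thresholds since [th <= 1]. *)
set c0 := gker B * hc / (2 * sqrt (Cs + 1)).
have c00 : 0 < c0 by apply: Rdiv_lt_0_compat; [apply: Rmult_lt_0_compat | lra].
(* Makes the variation [3 * th * C] of the density over the window at most [c0 / 24]; together with
   the [1 / t] term this consumes half of the final [c0 / 6]. *)
set th := Rmin 1 (c0 / (72 * C)).
have th0 : 0 < th by apply: Rmin_glb_lt; [lra | apply: Rdiv_lt_0_compat; lra].
have th1 : th <= 1 := Rmin_l _ _.
have thC : 3 * th * C <= c0 / 24.
  have := Rmin_r 1 (c0 / (72 * C)); rewrite -/th => h.
  have := Rmult_le_compat_r C _ _ (Rlt_le _ _ C0) h.
  have -> : c0 / (72 * C) * C = c0 / 72 by field; lra.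
  lra.
have th3 : 0 < th ^ 3 by apply: pow_lt.
(* Mollification time so short that the Gaussian tails [64 * s / th ^ 2] outside the window take at
   most a quarter of the main term. *)
set s := Rmin 1 (c0 * th ^ 3 / 256).
have s0 : 0 < s by apply: Rmin_glb_lt; [lra | apply: Rdiv_lt_0_compat; [apply: Rmult_lt_0_compat | lra]].
have s1 : s <= 1 := Rmin_l _ _.
have sth : 64 * s / th ^ 2 <= c0 * th / 4.
  have := Rmin_r 1 (c0 * th ^ 3 / 256); rewrite -/s => h.
  have th2 : 0 < th ^ 2 by apply: pow_lt.
  have := Rmult_le_compat_r (64 / th ^ 2) _ _ ltac:(by left; apply: Rdiv_lt_0_compat; lra) h.
  have -> : c0 * th ^ 3 / 256 * (64 / th ^ 2) = c0 * th / 4 by field; lra.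
  lra.
set e := sqrt s; have e0 : 0 < e := sqrt_lt_R0 _ s0; have ee : e * e = s by apply: sqrt_sqrt; lra.
have [M [M0 HM]] := heat_bounds s0.
have [T1 hT1] := INR_unbounded ((8 * M * Cs / (c0 * th)) ^ 2).
have [T2 hT2] := @pow_exp_ev k.+1 (ln 2) (C1 / th) ltac:(rewrite -ln_1; apply: ln_increasing; lra).
have [T3 hT3] := INR_unbounded (24 * C / c0).
exists (c0 / 12), (T + T1 + T2 + T3 + 1)%N; split; first lra.
move=> n r K Kb hn r0 hr Hm Hlip; have t1 : (1 <= tl n)%N by lia.
have n0 : 0 < INR n by apply: INR_ltn0; have := tl_gt0 t1; lia.
have t1' := INR_leq t1; rewrite -[INR 1]/1 in t1'.
have L0 := Lam_gt0 rest t1; have Lt := Lam_ge rest t1.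
have sL0 := sqrt_lt_R0 _ L0; have ss := sqrt_sqrt _ (Rlt_le _ _ L0).
have [hr1 hr2] := hr; have [R0 R2 _] := rho_facts Hb c10 t1 r0 hr1.
have [[V1 V2] V3] := HT n r K Kb ltac:(lia) r0 hr.
set w := tilt d r in V1 V2 V3 Hlip *; set l := Full K Kb n in V1 V2 V3 *; set bb := / rho r n in V1 V2 V3.
set V := lvar d w 0 bb l in V1 V2 V3.
have w0 : forall h j, 0 <= w h j by apply: tilt_ge0.
have w1 : forall h, \sum_(j < d) w h j = 1 by apply: tilt_sum.
have bb0 : 0 < bb by apply: Rinv_0_lt_compat.
have lf x y : lform d w 0 bb l x y + 0 = bb * (INR y - INR n).
  rewrite /lform /lmean (Full_sum K Kb n (fun h => lcoef 0 bb h * dmean d w h)).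
  have -> : \sum_(x <- idx n) (lcoef 0 bb (hv x) * dmean d w (hv x)) = bb * INR n.
    rewrite -Hm /meanN -Rsum_distr; apply: eq_bigr => i _; rewrite /lcoef -/w; ring.
  by ring.
have err : M * (Cs / sqrt (Lam n)) <= c0 * th / 8.
  have h1 : 8 * M * Cs / (c0 * th) <= sqrt (Lam n).
    rewrite -[X in X <= _]sqrt_pow2; last first.
      by apply: Rmult_le_pos; [nra | left; apply: Rinv_0_lt_compat; apply: Rmult_lt_0_compat].
    by apply: sqrt_le_1_alt; have := @INR_leq T1 (tl n) ltac:(lia); lra.
  apply: (Rmult_le_reg_r (sqrt (Lam n))) => //.
  have -> : M * (Cs / sqrt (Lam n)) * sqrt (Lam n) = 8 * M * Cs / (c0 * th) * (c0 * th / 8) by field; lra.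
  by rewrite Rmult_comm; apply: Rmult_le_compat_l => //; have := Rmult_lt_0_compat _ _ c00 th0; lra.
have L (a : R) : Rabs (Ex d w l (fun x y => heat a s (bb * (INR y - INR n))) - heat a (s + V) 0) <= c0 * th / 8.
  have [h1 h2] := HM a.
  have := lindeberg w0 w1 0 bb l h1 h2 0 (Rle_refl s).
  rewrite (Ex_ext _ _ _ (G := fun x y => heat a s (bb * (INR y - INR n)))); last by move=> x y; rewrite lf.
  move=> h; apply: Rle_trans h _; apply: Rle_trans err.
  by apply: Rmult_le_compat_l.
(* The difference of the mollified indicators at these thresholds lives on the middle half of the
   window [- th, 0], leaving a margin [th / 4] on each side for the tails. *)
set a1 := - th / 4; set a2 := - (3 * th) / 4.
have G0 : c0 * th <= heat a1 (s + V) 0 - heat a2 (s + V) 0.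
  rewrite /heat !Rminus_0_r; set S := sqrt (s + V).
  have S1 : sqrt cs <= S by apply: sqrt_le_1_alt; lra.
  have S2 : S <= sqrt (Cs + 1) by apply: sqrt_le_1_alt; lra.
  have Si : 0 < / S by apply: Rinv_0_lt_compat; lra.
  have SB : / S <= B by apply: Rinv_le_contravar.
  apply: Rle_trans (@gcdf_slope B (a2 / S) (a1 / S) _ _ _); rewrite /Rdiv /a1 /a2; try nra.
  have -> : (- th * / 4 * / S - - (3 * th) * / 4 * / S) * (gker B * hc) = th * (gker B * hc) / 2 * / S by field; lra.
  have -> : c0 * th = th * (gker B * hc) / 2 * / sqrt (Cs + 1) by rewrite /c0; field; lra.
  apply: Rmult_le_compat_l; last by apply: Rinv_le_contravar; lra.
  by apply: Rmult_le_pos; [apply: Rmult_le_pos; [lra | apply: Rmult_le_pos; lra] | lra].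
have thr : 1 <= th * rho r n.
  have [n2 _] := @tl_spec n ltac:(have := tl_gt0 t1; lia).
  have h2 := hT2 (tl n) ltac:(lia).
  rewrite (_ : exp (ln 2 * INR (tl n)) = 2 ^ tl n) in h2; last by rewrite Rmult_comm exp_mulN exp_ln; lra.
  have h3 : C1 / th * Lam n <= INR n by rewrite /Lam; lra.
  have h4 : C1 * Lam n <= th * INR n.
    have := Rmult_le_compat_l th _ _ (Rlt_le _ _ th0) h3.
    by have -> : th * (C1 / th * Lam n) = C1 * Lam n by field; lra.
  have h5 : r <= th.
    by apply: (Rmult_le_reg_r (INR n)) => //; lra.
  have sL1 : 1 <= sqrt (Lam n) by rewrite -sqrt_1; apply: sqrt_le_1_alt; lra.
  rewrite /rho; apply: (Rmult_le_reg_r r) => //.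
  have -> : th * (sqrt (Lam n) / r) * r = th * sqrt (Lam n) by field; lra.
  nra.
(* [Mm] exceeds [th * rho], so the offsets below it cover the whole window, and it is at most
   [3 * th * rho]. *)
have [X [X1 X2]] := nat_floor thr; set Mm := (2 * X).+1.
have MmE : INR Mm = 2 * INR X + 1 by rewrite /Mm S_INR mult_INR.
have D (x y : nat) : heat a1 s (bb * (INR y - INR n)) - heat a2 s (bb * (INR y - INR n)) <=
    \sum_(i < Mm) (if (i + y == n)%N then 1 else 0) + 64 * s / th ^ 2.
  set z := bb * _.
  have S0 : 0 <= \sum_(i < Mm) (if (i + y == n)%N then 1 else 0).
    by apply: (@Rsum_ord_ge0 Mm (fun i => if (i + y == n)%N then 1 else 0)) => i _; case: ifP => _; lra.
  have tail := @gcdf_tail (th / (4 * e)) ltac:(apply: Rdiv_lt_0_compat; lra).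
  have tE : 4 / (th / (4 * e)) ^ 2 = 64 * s / th ^ 2 by rewrite -ee; field; lra.
  rewrite tE in tail.
  rewrite /heat -/e; have b1 := gcdf_bound ((a1 - z) / e); have b2 := gcdf_bound ((a2 - z) / e).
  have ei : 0 < / e by apply: Rinv_0_lt_compat.
  case: (Rle_lt_dec z 0) => [z0|z0]; last first.
    have : gcdf ((a1 - z) / e) <= gcdf (- (th / (4 * e))).
      apply: gcdf_mono; have -> : - (th / (4 * e)) = a1 / e by rewrite /a1; field; lra.
      by apply: Rmult_le_compat_r; lra.
    by rewrite gcdf_opp; lra.
  case: (Rle_lt_dec (- th) z) => [z1|z1]; last first.
    have : gcdf (th / (4 * e)) <= gcdf ((a2 - z) / e).
      apply: gcdf_mono; have -> : th / (4 * e) = th / 4 / e by field; lra.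
      by apply: Rmult_le_compat_r; rewrite /a2; lra.
    by lra.
  have zE : INR y - INR n = z * rho r n by rewrite /z /bb; field; lra.
  have yn : (y <= n)%N by apply/leP; apply: INR_le; nra.
  have nyM : (n - y < Mm)%N.
    apply/ltP; apply: INR_lt; rewrite MmE minus_INR; last by apply/leP.
    have : - z * rho r n <= th * rho r n by apply: Rmult_le_compat_r; lra.
    by lra.
  have := @Rsum_ord_ge1 Mm (n - y) (fun i => if (i + y == n)%N then 1 else 0).
  rewrite subnK // eqxx => h; have {}h := h _ nyM.
  have : 1 <= \sum_(i < Mm) (if (i + y == n)%N then 1 else 0).
    by apply: h => i _; case: ifP => _; lra.
  have : 0 <= 64 * s / th ^ 2.
    by apply: Rmult_le_pos; [lra | left; apply: Rinv_0_lt_compat; apply: pow_lt].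
  lra.
have E1 : c0 * th / 2 <= \sum_(i < Mm) hit d w l n i.
  have h1 := L a1; have h2 := L a2.
  have h3 : Ex d w l (fun x y => heat a1 s (bb * (INR y - INR n))) - Ex d w l (fun x y => heat a2 s (bb * (INR y - INR n)))
      <= \sum_(i < Mm) hit d w l n i + 64 * s / th ^ 2.
    rewrite -Ex_sub; apply: Rle_trans (@Ex_le d w w0 l _ _ D) _.
    by rewrite Ex_add Ex_const // (Ex_sum d w l Mm (fun i _ y => if (i + y == n)%N then 1 else 0)); apply: Rle_refl.
  move: h1 h2 => /Rabs_le_between [? ?] /Rabs_le_between [? ?].
  lra.
(* The smoothness of the odd class alone, averaged over all other digits, transfers the offset [i]
   to the offset 0. *)
have H0 i : (i < Mm)%N -> hit d w l n i <= hit d w l n 0 + C * (INR Mm / rho r n ^ 2 + / INR (tl n) / rho r n).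
  move=> iM; rewrite /l /Full catA !hit_cat.
  set l1 := _ ++ _; set T1' := Tl _ _ _ _ _ _ _.
  have : Ex d w l1 (fun _ y => hit d w T1' n (i + y)) - Ex d w l1 (fun _ y => hit d w T1' n (0 + y)) <=
    C * (INR Mm / rho r n ^ 2 + / INR (tl n) / rho r n); last by lra.
  rewrite -Ex_sub -[X in _ <= X](Ex_const w1 l1); apply: Ex_le => // _ y.
  have := Hlip (0 + y)%N (i + y)%N (leq_add (leq0n i) (leqnn y)).
  rewrite -/T1' addnK pow_1 => /Rabs_le_between [h _].
  have : INR i / rho r n ^ 2 <= INR Mm / rho r n ^ 2.
    apply: Rmult_le_compat_r; last by apply: INR_leq; apply: ltnW.
    by left; apply: Rinv_0_lt_compat; apply: pow_lt.
  nra.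
have {E1} E1 : c0 * th / 2 <= INR Mm * (hit d w l n 0 + C * (INR Mm / rho r n ^ 2 + / INR (tl n) / rho r n)).
  apply: Rle_trans E1 _; rewrite -Rsum_ord_const.
  exact: (@Rsum_ord_le Mm (hit d w l n) (fun=> _) H0).
have h00 : 0 <= hit d w l n 0 by apply: Ex_ge0 => // x y; case: ifP => _; lra.
have MR : INR Mm <= 3 * th * rho r n by lra.
have ti : / INR (tl n) * C <= c0 / 24.
  have := @INR_leq T3 (tl n) ltac:(lia) => h1.
  apply: (Rmult_le_reg_r (INR (tl n))); first lra.
  have -> : / INR (tl n) * C * INR (tl n) = 24 * C / c0 * (c0 / 24) by field; lra.
  by rewrite (Rmult_comm (c0 / 24)); apply: Rmult_le_compat_r; lra.
have Q : INR Mm / rho r n ^ 2 <= 3 * th / rho r n.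
  apply: (Rmult_le_reg_r (rho r n ^ 2)); first exact: pow_lt.
  have -> : INR Mm / rho r n ^ 2 * rho r n ^ 2 = INR Mm by field; lra.
  by have -> : 3 * th / rho r n * rho r n ^ 2 = 3 * th * rho r n by field; lra.
have tp : 0 < / INR (tl n) by apply: Rinv_0_lt_compat; lra.
set h0 := hit d w l n 0 in E1 h00 *.
have E2 : c0 * th / 2 <= 3 * th * rho r n * (h0 + C * (3 * th / rho r n + / INR (tl n) / rho r n)).
  apply: Rle_trans E1 _; apply: Rmult_le_compat; [exact: pos_INR | | exact: MR |].
    apply: Rplus_le_le_0_compat => //; apply: Rmult_le_pos; first lra.
    apply: Rplus_le_le_0_compat; apply: Rmult_le_pos; try (left; apply: Rinv_0_lt_compat => //; exact: pow_lt).
      exact: pos_INR.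
    lra.
  apply: Rplus_le_compat_l; apply: Rmult_le_compat_l; lra.
have E3 : c0 / 6 <= rho r n * h0 + (3 * th * C + / INR (tl n) * C).
  apply: (Rmult_le_reg_l (3 * th)); first lra.
  have -> : 3 * th * (rho r n * h0 + (3 * th * C + / INR (tl n) * C)) =
    3 * th * rho r n * (h0 + C * (3 * th / rho r n + / INR (tl n) / rho r n)) by field; lra.
  lra.
apply: (Rmult_le_reg_l (rho r n)) => //.
have -> : rho r n * (c0 / 12 / rho r n) = c0 / 12 by field; lra.
lra.
Qed.

End Total.

(** * Moments of the digit sum *)

Section DigitSum.
Variables (d : nat) (w : nat -> nat -> R).
Hypothesis w_sum : forall h, \sum_(j < d) w h j = 1.

Lemma lmean_digit l : lmean d w 1 0 l = \sum_(h <- l) dmean d w h.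
Proof. by apply: eq_bigr => h _; rewrite /lcoef; ring. Qed.

Lemma Ex_digit_center l : Ex d w l (fun x _ => INR x - \sum_(h <- l) dmean d w h) = 0.
Proof.
rewrite -(lform_mean w_sum 1 0 l 0); apply: Ex_ext => x y; rewrite /lform lmean_digit; ring.
Qed.

Lemma Ex_digit_var l : Ex d w l (fun x _ => (INR x - \sum_(h <- l) dmean d w h) ^ 2) = \sum_(h <- l) dvar d w h.
Proof.
have := lform_var w_sum 1 0 l 0; rewrite /lvar pow_i ?Rplus_0_r; last by lia.
rewrite (eq_bigr (dvar d w)) => [<-|h _]; last by rewrite /lcoef; ring.
apply: Ex_ext => x y; rewrite /lform lmean_digit; ring.
Qed.
End DigitSum.

Section Split.
Variables (p q : nat) (rest : seq nat).
Hypothesis Hb : bases (p :: q :: rest).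
Notation k := (size rest).
Notation hv := (hv p q).
Notation idx := (idx p q rest).
Notation Lam := (Lam rest).
Notation rho := (rho rest).
Variable d : nat.
Hypothesis d2 : (2 <= d)%N.

(** t^(m-1) log t, the size of the error terms. *)
Definition tau (n : nat) : R := INR (tl n) ^ k.+1 * INR (gl n).
Notation size_n n := (INR (size (idx n))).

(** Interface between the Fourier analysis and the moments: [lZ] carries the nearly uniform digits,
    [l0] and [l1] the two halves. Only the ratios [2 D / b = O(1/t)] and [B / b = O(1)] are
    retained, so the scale [rho] disappears from here on. *)
Record split_law (C : R) (n : nat) (r B D b : R) (lZ l0 l1 : seq nat) : Prop := {
  sl_r : 0 < r;
  sl_perm : perm_eq (lZ ++ l0 ++ l1) [seq hv x | x <- idx n];
  sl_B0 : forall m, hit d (tilt d r) l0 n m <= B;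
  sl_B1 : forall m, hit d (tilt d r) l1 n m <= B;
  sl_D0 : forall m y, (y <= d * sumn lZ)%N ->
    Rabs (hit d (tilt d r) l0 n (m + y) - hit d (tilt d r) l0 n m) <= D;
  sl_D1 : forall m y, (y <= d * sumn lZ)%N ->
    Rabs (hit d (tilt d r) l1 n (m + y) - hit d (tilt d r) l1 n m) <= D;
  sl_b0 : 0 < b;
  sl_b : b <= tot d (tilt d r) n lZ l0 l1;
  sl_k1 : 2 * D / b <= C / INR (tl n);
  sl_k2 : B / b <= C;
  sl_mZ : Rabs (\sum_(h <- lZ) dmean d (tilt d r) h - size_n n * ((INR d - 1) / 2)) <= C * tau n;
  sl_vZ : Rabs (\sum_(h <- lZ) dvar d (tilt d r) h - size_n n * ((INR d ^ 2 - 1) / 12)) <= C * tau n;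
  sl_m0 : \sum_(h <- l0) dmean d (tilt d r) h <= C * tau n;
  sl_m1 : \sum_(h <- l1) dmean d (tilt d r) h <= C * tau n;
  sl_v0 : \sum_(h <- l0) dvar d (tilt d r) h <= C * tau n;
  sl_v1 : \sum_(h <- l1) dvar d (tilt d r) h <= C * tau n }.

Lemma sumn_INR (l : seq nat) : INR (sumn l) = \sum_(h <- l) INR h.
Proof. by elim: l => [|h l IH]; rewrite ?big_nil // big_cons -IH -plus_INR. Qed.

Lemma t_pow_succ n j : (1 <= tl n)%N -> INR (tl n).+1 ^ j <= 2 ^ j * INR (tl n) ^ j.
Proof.
move=> t1; rewrite -Rpow_mult_distr; apply: pow_incr; split; first exact: pos_INR.
by have h := INR_leq t1; rewrite -[INR 1]/1 in h; rewrite S_INR; lra.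
Qed.

Lemma tau_ge n : (2 <= tl n)%N -> INR (tl n) ^ k.+1 <= tau n /\ 1 <= tau n /\ 1 <= INR (tl n).
Proof.
move=> t2; have g1 := INR_leq (gl_ge1 t2); rewrite -[INR 1]/1 in g1.
have t1 := INR_leq t2; rewrite -[INR 2]/2 in t1.
have := pow_R1_Rle (INR (tl n)) k.+1 ltac:(lra) => h.
by rewrite /tau; split; [nra | split; nra].
Qed.

Lemma size_idx_le2 n : (1 <= tl n)%N -> size_n n <= 2 ^ k.+2 * INR (tl n) ^ k.+2.
Proof. by move=> t1; apply: Rle_trans (size_idx_le _ _ _ _) (t_pow_succ _ t1). Qed.

(** The elements above [n / t^K] span O(log t) dyadic scales with O(t^(m-1)) elements each; the
    strip adds O(t log t). *)
Lemma size_Tl_le K Kb n s : (2 <= tl n)%N -> (0 < K)%N ->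
  INR (size (Tl p q rest K Kb n s)) <= (INR (2 * K) * 2 ^ k.+1 + 2 * INR Kb.+1) * tau n.
Proof.
move=> t2 K0; have [h1 [h2 h3]] := tau_ge t2; have t1 : (1 <= tl n)%N by lia.
have g1 := gl_ge1 t2; have g1' := INR_leq g1; rewrite -[INR 1]/1 in g1'.
have X : (tl n ^ K < 2 ^ (K * (gl n).+1))%N.
  have [_ u] := gl_spec t1; rewrite mulnC expnM ltn_exp2r //.
  by apply/ltP; apply: INR_lt; rewrite pow_natE.
have A1 := size_big_le Hb n X; have A2 := size_strip_le Hb n (Kb * gl n).
have S : (size (Tl p q rest K Kb n s) <= size [seq x <- idx n | (n <= hv x * tl n ^ K)%N] +
   size [seq x <- idx n | (x.2 == 1) && (x.1.2 <= Kb * gl n)])%N.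
  rewrite /Tl size_map !size_filter -count_predUI addnC.
  apply: leq_trans (leq_addl _ _); apply: sub_count => x /= /andP [hT _].
  by move: hT; rewrite /inT.
apply: Rle_trans (INR_leq S) _; rewrite plus_INR Rmult_plus_distr_r; apply: Rplus_le_compat.
  apply: Rle_trans A1 _.
  have e1 : INR (K * (gl n).+1) <= INR (2 * K) * INR (gl n).
    by rewrite -mult_INR; apply: INR_leq; nia.
  have e2 := @t_pow_succ n k.+1 t1.
  apply: Rle_trans (Rmult_le_compat _ _ _ _ (pos_INR _) _ e1 e2) _; first by apply: pow_le; apply: pos_INR.
  by rewrite /tau; right; ring.
apply: Rle_trans (INR_leq A2) _; rewrite mult_INR.
have e1 : INR (tl n).+1 <= 2 * INR (tl n) ^ k.+1.
  rewrite S_INR; have : INR (tl n) <= INR (tl n) ^ k.+1.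
    by rewrite -{1}(pow_1 (INR (tl n))); apply: Rle_pow; [lra | lia].
  lra.
have e2 : INR (Kb * gl n).+1 <= INR Kb.+1 * INR (gl n) by rewrite -mult_INR; apply: INR_leq; nia.
apply: Rle_trans (Rmult_le_compat _ _ _ _ (pos_INR _) (pos_INR _) e1 e2) _.
by rewrite /tau; right; ring.
Qed.

Lemma split_law_exists : exists C T0, 0 < C /\ forall n, (T0 <= tl n)%N ->
  exists r B D b lZ l0 l1, split_law C n r B D b lZ l0 l1.
Proof.
have [c1 [C1 [c10 C10 [Ta HTa]]]] := tilt_bounds Hb d2.
have [Kb [K0 HK]] := smoothing Hb c10 C10 d2 1.
(* Then [r] times the sum of [lZ] is at most [r n * size / t^K], of order [t^((k+1) + (k+2) - K)],
   hence O(1/t). *)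
pose K := (K0 + 2 * k + 4)%N.
have [Cs [Ts [Cs0 HTs]]] := HK K ltac:(rewrite /K; lia).
have [b [Tb [b0 HTb]]] := hit_lower Hb d2 c10 C10 Cs0.
have [Te HTe] := exists_tilt Hb d2.
have dr := INR_leq d2; rewrite -[INR 2]/2 in dr.
pose Cz := C1 * 2 ^ k.+2; pose CT := INR (2 * K) * 2 ^ k.+1 + 2 * INR Kb.+1.
have Cz0 : 0 < Cz by apply: Rmult_lt_0_compat => //; apply: pow_lt; lra.
have CT0 : 0 <= CT.
  by apply: Rplus_le_le_0_compat; apply: Rmult_le_pos; try apply: pos_INR; try lra; apply: pow_le; lra.
have i1 : 0 <= Cs / b by apply: Rmult_le_pos; [lra | left; apply: Rinv_0_lt_compat].
have d4 : 0 <= INR d ^ 4 by apply: pow_le; lra.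
have d3 : 0 <= INR d ^ 3 by apply: pow_le; lra.
have d5 := pow2_ge_0 (INR d).
pose C := 1 + Cs / b + 2 * (Cs / b) * (INR d * Cz + 1) + 3 * INR d ^ 4 * Cz + INR d ^ 3 * Cz
  + 4 * (INR d ^ 2 + 1) * CT.
have q1 : 0 <= INR d * Cz by apply: Rmult_le_pos; lra.
have q2 : 0 <= (Cs / b) * (INR d * Cz + 1) by apply: Rmult_le_pos; lra.
have q3 : 0 <= INR d ^ 4 * Cz by apply: Rmult_le_pos; lra.
have q4 : 0 <= INR d ^ 3 * Cz by apply: Rmult_le_pos; lra.
have q5 : 0 <= INR d ^ 2 * CT by apply: Rmult_le_pos; lra.
exists C, (Ta + Ts + Tb + Te + 2)%N; split; first by rewrite /C; lra.
move=> n hn; have t2 : (2 <= tl n)%N by lia.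
have t1 : (1 <= tl n)%N by lia.
have [ta1 [ta2 ta3]] := tau_ge t2.
have [r [r0 Hr]] := HTe n ltac:(lia).
have hr := HTa n ltac:(lia) r r0 Hr; have [hr1 hr2] := hr.
have n0 : 0 < INR n by apply: INR_ltn0; have := tl_gt0 t1; lia.
have L0 := Lam_gt0 rest t1; have Lt := Lam_ge rest t1.
have sL0 := sqrt_lt_R0 _ L0; have sL1 : 1 <= sqrt (Lam n) by rewrite -sqrt_1; apply: sqrt_le_1_alt; lra.
have [R0 _ _] := rho_facts Hb c10 t1 r0 hr1.
set lZ := Zl p q rest K Kb n.
(* everything in [lZ] is negligible against the scale 1/r: r * sum h = O(1/t) *)
have Zs : r * INR (sumn lZ) * INR (tl n) <= Cz.
  have : INR (sumn lZ) * INR (tl n) ^ K <= size_n n * INR n.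
    rewrite sumn_INR Rmult_comm -Rsum_distr -Rsum_const.
    rewrite /lZ /Zl big_map big_filter.
    apply: Rle_trans (_ : \sum_(x <- idx n | ~~ inT p q K Kb n x) INR n <= _); last first.
      rewrite -big_filter !Rsum_const; apply: Rmult_le_compat_r; first lra.
      by apply: INR_leq; rewrite size_filter; apply: count_size.
    rewrite -!(big_filter _ (fun x => ~~ inT p q K Kb n x)); apply: Rsum_le => x.
    rewrite mem_filter => /andP [hT _]; move: hT; rewrite /inT negb_or -ltnNge => /andP [hT _].
    by rewrite -pow_natE -mult_INR; apply: INR_leq; rewrite -[Nat.mul _ _]/(_ * _)%N mulnC; apply: ltnW.
  move=> h; have h2 := size_idx_le2 t1.
  have tK : INR (tl n) ^ k.+1 * INR (tl n) ^ k.+2 * INR (tl n) <= INR (tl n) ^ K.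
    rewrite -{3}(pow_1 (INR (tl n))) -!pow_add; apply: Rle_pow => //; rewrite /K; lia.
  have tp : 0 < INR (tl n) ^ K by apply: pow_lt; lra.
  have tp1 : 0 < INR (tl n) ^ k.+2 by apply: pow_lt; lra.
  have pk : 0 < 2 ^ k.+2 by apply: pow_lt; lra.
  apply: (Rmult_le_reg_r (INR (tl n) ^ K)) => //.
  have e1 : r * INR (sumn lZ) * INR (tl n) * INR (tl n) ^ K <= r * INR (tl n) * (size_n n * INR n).
    have -> : r * INR (sumn lZ) * INR (tl n) * INR (tl n) ^ K = r * INR (tl n) * (INR (sumn lZ) * INR (tl n) ^ K) by ring.
    by apply: Rmult_le_compat_l => //; apply: Rmult_le_pos; lra.
  have e2 : r * INR (tl n) * (size_n n * INR n) <= C1 * Lam n * (INR (tl n) * (2 ^ k.+2 * INR (tl n) ^ k.+2)).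
    have -> : r * INR (tl n) * (size_n n * INR n) = r * INR n * (INR (tl n) * size_n n) by ring.
    apply: Rmult_le_compat => //; try (by apply: Rmult_le_pos; lra).
      by apply: Rmult_le_pos; [lra | apply: pos_INR].
    by apply: Rmult_le_compat_l; lra.
  apply: Rle_trans e1 (Rle_trans _ _ _ e2 _).
  have -> : C1 * Lam n * (INR (tl n) * (2 ^ k.+2 * INR (tl n) ^ k.+2)) =
    Cz * (INR (tl n) ^ k.+1 * INR (tl n) ^ k.+2 * INR (tl n)) by rewrite /Cz /Lam; ring.
  by apply: Rmult_le_compat_l; lra.
have Zs2 : r * INR (sumn lZ) <= Cz / INR (tl n).
  by apply: (Rmult_le_reg_r (INR (tl n))); [lra | have -> : Cz / INR (tl n) * INR (tl n) = Cz by [field; lra]; lra].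
have Zs3 : Cz / INR (tl n) <= Cz.
  by rewrite -[X in _ <= X]Rdiv_1_r; apply: Rmult_le_compat_l; [lra | apply: Rinv_le_contravar; lra].
have HS s := HTs n ltac:(lia) r r0 hr s.
set l0 := Tl p q rest K Kb n false; set l1 := Tl p q rest K Kb n true.
pose B := Cs / rho r n.
(* A shift by at most [d * sumn lZ] is O(1 / (r t)), and [1 / rho <= r] turns the Lipschitz bound
   into O(1 / (t rho)). *)
pose D := Cs * (INR d * Cz + 1) / INR (tl n) / rho r n.
have lip s m y : (y <= d * sumn lZ)%N -> Rabs (hit d (tilt d r) (Tl p q rest K Kb n s) n (m + y) -
    hit d (tilt d r) (Tl p q rest K Kb n s) n m) <= D.
  move=> hy; rewrite Rabs_minus_sym; have [_ h] := HS s.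
  apply: Rle_trans (h m (m + y)%N (leq_addr _ _)) _; rewrite addKn pow_1 /D.
  have -> : Cs * (INR d * Cz + 1) / INR (tl n) / rho r n =
    Cs * (INR d * (Cz / INR (tl n)) / rho r n + / INR (tl n) / rho r n) by field; lra.
  apply: Rmult_le_compat_l; first lra.
  apply: Rplus_le_compat_r.
  have -> : INR y / rho r n ^ 2 = INR y * / rho r n * / rho r n by field; lra.
  apply: Rmult_le_compat_r; first by left; apply: Rinv_0_lt_compat.
  have rr : / rho r n <= r.
    rewrite /rho; apply: (Rmult_le_reg_l (sqrt (Lam n))) => //.
    have -> : sqrt (Lam n) * / (sqrt (Lam n) / r) = r * 1 by field; lra.
    by rewrite (Rmult_comm _ r); apply: Rmult_le_compat_l; lra.
  apply: Rle_trans (Rmult_le_compat_l _ _ _ (pos_INR _) rr) _.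
  apply: Rle_trans (Rmult_le_compat_r r _ _ (Rlt_le _ _ r0) (INR_leq hy)) _; rewrite mult_INR.
  have -> : INR d * INR (sumn lZ) * r = INR d * (r * INR (sumn lZ)) by ring.
  by apply: Rmult_le_compat_l; lra.
have szT s := @size_Tl_le K Kb n s t2 ltac:(rewrite /K; lia).
rewrite -/CT in szT.
have sumT s (F : nat -> R) : (forall h, F h <= INR d ^ 2) -> \sum_(h <- Tl p q rest K Kb n s) F h <= C * tau n.
  move=> hF; apply: Rle_trans (Rsum_le (fun h _ => hF h)) _; rewrite Rsum_const.
  apply: Rle_trans (Rmult_le_compat_r _ _ _ d5 (szT s)) _.
  rewrite Rmult_assoc (Rmult_comm (tau n)) -Rmult_assoc; apply: Rmult_le_compat_r; first lra.
  by rewrite /C; lra.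
have dmd h : dmean d (tilt d r) h <= INR d ^ 2.
  by apply: Rle_trans (@dmean_le_d d r h d2) _; nra.
have dvd h : dvar d (tilt d r) h <= INR d ^ 2.
  apply: Rle_trans (@dvar_le_mean d r h d2) _.
  by have := @dmean_le_d d r h d2; nra.
have sizeE : size_n n = INR (size lZ) + (INR (size l0) + INR (size l1)).
  by rewrite -(size_map hv) -(perm_size (Full_perm p q rest K Kb n)) /Full !size_cat !plus_INR.
(* [c] is the value for a uniform digit. The error has two sources: the tilt on [lZ], of total O(1),
   and the elements of the halves, which are counted in [size_n n] but do not belong to [lZ]. *)
have approx (F : nat -> R) c M : 0 <= c <= INR d ^ 2 -> 0 <= M -> (forall h, Rabs (F h - c) <= M * (r * INR h)) ->
  M * Cz + 2 * INR d ^ 2 * CT <= C -> Rabs (\sum_(h <- lZ) F h - size_n n * c) <= C * tau n.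
  move=> hc M0 hF hC.
  have -> : \sum_(h <- lZ) F h - size_n n * c = \sum_(h <- lZ) (F h - c) - (INR (size l0) + INR (size l1)) * c.
    have -> : \sum_(h <- lZ) (F h - c) = \sum_(h <- lZ) F h + INR (size lZ) * (- c).
      by rewrite -Rsum_const -Rsum_add.
    by rewrite sizeE; ring.
  apply: Rle_trans (Rabs_triang _ _) _; rewrite Rabs_Ropp.
  have X1 : Rabs (\sum_(h <- lZ) (F h - c)) <= M * Cz.
    apply: Rle_trans (Rsum_abs _ _) _; apply: Rle_trans (Rsum_le (fun h _ => hF h)) _.
    rewrite !Rsum_distr -sumn_INR; apply: Rmult_le_compat_l => //; lra.
  have X2 : Rabs ((INR (size l0) + INR (size l1)) * c) <= 2 * CT * tau n * INR d ^ 2.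
    have := pos_INR (size l0); have := pos_INR (size l1) => p1 p2.
    rewrite Rabs_pos_eq; last by apply: Rmult_le_pos; lra.
    by apply: Rmult_le_compat; try lra; have := szT true; have := szT false; rewrite -/l0 -/l1; lra.
  have X3 : M * Cz <= M * Cz * tau n by have : 0 <= M * Cz by [apply: Rmult_le_pos; lra]; nra.
  have := Rmult_le_compat_r (tau n) _ _ ltac:(lra) hC; lra.
exists r, B, D, (b / rho r n), lZ, l0, l1; split => //.
- exact: Full_perm.
- by have [] := HS false.
- by have [] := HS true.
- by move=> m y; apply: lip.
- by move=> m y; apply: lip.
- exact: Rdiv_lt_0_compat.
- have := HTb n r K Kb ltac:(lia) r0 hr Hr (proj2 (HS true)).
  rewrite /tot -(joint_cat d (tilt d r) n lZ l0 l1 (fun=> 1)).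
  move=> h; apply: Rle_trans h _; right; rewrite /hit; apply: Ex_ext => x y; by rewrite add0n.
- have -> : 2 * D / (b / rho r n) = 2 * (Cs / b) * (INR d * Cz + 1) / INR (tl n) by rewrite /D; field; lra.
  by apply: Rmult_le_compat_r; [left; apply: Rinv_0_lt_compat; lra | rewrite /C; lra].
- have -> : B / (b / rho r n) = Cs / b by rewrite /B; field; lra.
  by rewrite /C; lra.
- apply: (approx _ _ (INR d ^ 3)) => //; first by nra.
    by move=> h; apply: dmean_uniform => //; lra.
  by rewrite /C; lra.
- apply: (approx _ _ (3 * INR d ^ 4)) => //; [nra | lra | | by rewrite /C; lra].
  by move=> h; apply: dvar_uniform => //; lra.
- exact: sumT.
- exact: sumT.
- exact: sumT.
- exact: sumT.
Qed.

End Split.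

(** * Representations of n as the conditioned law, and their first two moments *)

Lemma gen_intro (I : Type) (s : seq I) (pp alpha : I -> nat) n : (forall i, (1 < pp i)%N) ->
  (\prod_(i <- s) pp i ^ alpha i <= n)%N ->
  (\prod_(i <- s) pp i ^ alpha i)%N \in gen [seq pp i | i <- s] (tl n).
Proof.
move=> pp1; have pos (l : seq I) : (0 < \prod_(i <- l) pp i ^ alpha i)%N.
  by apply: prodn_gt0 => i; rewrite expn_gt0 ltnW.
elim: s => [|i s IH]; first by rewrite big_nil.
rewrite big_cons /= => H; apply/genP; exists (alpha i), (\prod_(j <- s) pp j ^ alpha j)%N; split => //.
  exact: (exp_le_tl (pp1 i) (pos s) H).
by apply: IH; apply: leq_trans H; rewrite leq_pmull // expn_gt0 ltnW.
Qed.

Lemma gen_elim (I : eqType) (s : seq I) (pp : I -> nat) t h : uniq s ->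
  h \in gen [seq pp i | i <- s] t -> exists alpha : I -> nat, h = (\prod_(i <- s) pp i ^ alpha i)%N.
Proof.
elim: s h => [|i s IH] h /=; first by move=> _; rewrite inE => /eqP ->; exists (fun=> 0%N); rewrite big_nil.
move=> /andP [is_ us] /genP [a [h' [_ hh ->]]]; have [al ->] := IH h' us hh.
exists (fun j => if j == i then a else al j); rewrite big_cons eqxx; congr (_ * _)%N.
rewrite !big_seq; apply: eq_bigr => j js; case: eqP => // ji.
by move: is_; rewrite -ji js.
Qed.

Section Indices.
Variables (p q : nat) (rest : seq nat).
Hypothesis Hb : bases (p :: q :: rest).
Notation k := (size rest).
Notation hv := (hv p q).
Notation idx := (idx p q rest).

Lemma mem_hv_idx n h : (h \in [seq hv x | x <- idx n]) = (h <= n)%N && (h \in gen [:: p, q & rest] (tl n)).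
Proof.
apply/mapP/andP => [[x hx ->]|[hn /genP [a [h1 [ha /genP [b [c [hb hc ->]]] E]]]]].
  split; first exact: hv_le hx.
  move: x hx => [[a b] c]; rewrite mem_filter cubeP => /andP [_ /and3P [h1 h2 h3]].
  by apply/genP; exists a, (q ^ b * c)%N; split => //; apply/genP; exists b, c.
by exists (a, b, c) => //; apply: (idx_intro Hb hc (leqnn _)); rewrite /hv /= -E.
Qed.

Section Law.
Variables (d m n : nat) (pp : 'I_m -> nat) (r : R) (lZ l0 l1 : seq nat).
Hypothesis d2 : (2 <= d)%N.
Hypothesis hS : forall h, (h \in [seq hv x | x <- idx n]) = (h <= n)%N && inSb pp h.
Hypothesis hperm : perm_eq (lZ ++ l0 ++ l1) [seq hv x | x <- idx n].
Hypothesis ht : 0 < tot d (tilt d r) n lZ l0 l1.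

Let sumE (F : nat -> R) : \big[Rplus/R0]_(a in reps d pp n) F (digit_sum a) =
  \prod_(h <- lZ ++ l0 ++ l1) tiltZ d r h * exp (r * INR n) *
  joint d (tilt d r) n lZ l0 l1 (fun x x0 x1 => F (x + x0 + x1)%N).
Proof.
rewrite -joint_cat; apply: reps_Ex => // [|h]; last by rewrite (perm_mem hperm).
rewrite (perm_uniq hperm); have := uniq_hv_filter Hb n xpredT.
by rewrite filter_predT.
Qed.

Let W := \prod_(h <- lZ ++ l0 ++ l1) tiltZ d r h * exp (r * INR n).
Let W0 : 0 < W.
Proof.
apply: Rmult_lt_0_compat; last exact: exp_pos.
elim: (lZ ++ l0 ++ l1) => [|h l IH]; first by rewrite big_nil; lra.
by rewrite big_cons; apply: Rmult_lt_0_compat => //; have := @tiltZ_ge1 d r d2 h; lra.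
Qed.

Lemma Pn_tot : INR (Pn d pp n) = W * tot d (tilt d r) n lZ l0 l1.
Proof.
rewrite /tot -(sumE (fun=> 1)) /Pn -sum1_card.
by rewrite (big_morph INR plus_INR (erefl (INR 0))).
Qed.

Lemma reps_CE (F : nat -> R) : \big[Rplus/R0]_(a in reps d pp n) F (digit_sum a) / INR (Pn d pp n) =
  CE d (tilt d r) n lZ l0 l1 (fun x x0 x1 => F (x + x0 + x1)%N).
Proof. by rewrite sumE Pn_tot -/W /CE; field; lra. Qed.

Lemma EX_CE : EX d pp n = CE d (tilt d r) n lZ l0 l1 (fun x x0 x1 => INR (x + x0 + x1)).
Proof. exact: (reps_CE INR). Qed.

Lemma VarX_CE : VarX d pp n = CE d (tilt d r) n lZ l0 l1 (fun x x0 x1 => (INR (x + x0 + x1) - EX d pp n) ^ 2).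
Proof. exact: (reps_CE (fun x => (INR x - EX d pp n) ^ 2)). Qed.

Lemma cdf_CE z : cdf_norm d pp n z = CE d (tilt d r) n lZ l0 l1
  (fun x x0 x1 => if Rle_dec ((INR (x + x0 + x1) - EX d pp n) / sqrt (VarX d pp n)) z then 1 else 0).
Proof.
rewrite -(reps_CE (fun x => if Rle_dec ((INR x - EX d pp n) / sqrt (VarX d pp n)) z then 1 else 0)).
rewrite /cdf_norm -sum1_card (big_morph INR plus_INR (erefl (INR 0))); congr (_ / _).
rewrite [LHS](eq_bigl (fun a => (a \in reps d pp n) &&
  (if Rle_dec ((INR (digit_sum a) - EX d pp n) / sqrt (VarX d pp n)) z then true else false))).
  by rewrite big_mkcondr; apply: eq_bigr => a _; case: Rle_dec.
by move=> a; rewrite inE.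
Qed.
End Law.

Variable d : nat.
Hypothesis d2 : (2 <= d)%N.
Notation tau := (tau rest).
Notation size_n n := (INR (size (idx n))).

Lemma gl_le n : (1 <= tl n)%N -> INR (gl n) <= INR (tl n).
Proof.
move=> t1; have [h _] := gl_spec t1; apply: Rle_trans h; rewrite -[2]/(INR 2) -pow_natE.
by apply: INR_leq; apply: ltnW; apply: ltn_expl.
Qed.

(** [vZ] is O(t^m) and [k1] is O(1/t), so decoupling costs O(t^(m-1)); everything that involves the
    halves is O(tau). *)
Lemma split_moments C : 0 < C -> exists C', 0 < C' /\ forall n r B D b lZ l0 l1, (2 <= tl n)%N ->
  split_law p q rest d C n r B D b lZ l0 l1 ->
  let w := tilt d r in
  let mZ := \sum_(h <- lZ) dmean d w h in let m0 := \sum_(h <- l0) dmean d w h in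
  let m1 := \sum_(h <- l1) dmean d w h in let vZ := \sum_(h <- lZ) dvar d w h in
  let S := CE d w n lZ l0 l1 (fun x x0 x1 => INR (x + x0 + x1)) in
  let V := CE d w n lZ l0 l1 (fun x x0 x1 => (INR (x + x0 + x1) - S) ^ 2) in
  [/\ (S - (mZ + m0 + m1)) ^ 2 <= C' * tau n, Rabs (S - size_n n * ((INR d - 1) / 2)) <= C' * tau n,
    Rabs (V - vZ) <= C' * tau n, Rabs (V - size_n n * ((INR d ^ 2 - 1) / 12)) <= C' * tau n &
    condT d w n lZ l0 l1 m0 m1 <= C' * tau n].
Proof.
move=> C0; have dr := INR_leq d2; rewrite -[INR 2]/2 in dr.
pose W := 2 ^ k.+2 * INR d ^ 2 + C.
have W0 : 0 < W by have := pow2_ge_0 (INR d); have := pow_lt 2 k.+2 ltac:(lra); rewrite /W; nra.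
have CW : 0 < C * W by apply: Rmult_lt_0_compat.
have CCW : 0 < C * (C * W) by apply: Rmult_lt_0_compat.
have CC : 0 < C * C by apply: Rmult_lt_0_compat.
pose C' := 1 + 8 * (C * W) + 4 * (C * (C * W)) + 30 * (C * C) + 5 * C.
exists C'; split; first by rewrite /C'; lra.
move=> n r B D b lZ l0 l1 t2 [r0 hperm hB0 hB1 hD0 hD1 b0 hb hk1 hk2 hmZ hvZ hm0 hm1 hv0 hv1] w mZ m0 m1 vZ S V.
have t1 : (1 <= tl n)%N by lia.
have w0 : forall h j, 0 <= w h j by apply: tilt_ge0.
have w1 : forall h, \sum_(j < d) w h j = 1 by apply: tilt_sum.
have EZ := Ex_digit_center w1 lZ; have VZ := Ex_digit_var w1 lZ.
have V0 := Ex_digit_var w1 l0; have V1 := Ex_digit_var w1 l1.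
rewrite -/mZ -/vZ in EZ VZ hmZ hvZ; rewrite -/m0 -/w in V0 hm0 hv0; rewrite -/m1 -/w in V1 hm1 hv1.
have [T1 [T2 T3]] := @tau_ge rest n t2.
have TT : tau n <= INR (tl n) ^ k.+2.
  rewrite /tau [X in _ <= X]/= Rmult_comm; apply: Rmult_le_compat_r; last exact: gl_le.
  by apply: pow_le; lra.
have tk : 0 < INR (tl n) ^ k.+2 by apply: pow_lt; lra.
have vW : vZ <= W * INR (tl n) ^ k.+2.
  have := size_idx_le2 p q rest t1; move: hvZ => /Rabs_le_between [_ h].
  have s0 := pos_INR (size (idx n)) => h2.
  have h3 : size_n n * ((INR d ^ 2 - 1) / 12) <= 2 ^ k.+2 * INR (tl n) ^ k.+2 * INR d ^ 2.
    by apply: Rmult_le_compat => //; nra.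
  have := Rmult_le_compat_l C _ _ (Rlt_le _ _ C0) TT; rewrite /W; lra.
set k1 := 2 * D / b in hk1.
have D0 : 0 <= D by exact: (Rle_trans _ _ _ (Rabs_pos _) (@hD1 0%N 0%N (leq0n _))).
have k10 : 0 <= k1 by apply: Rmult_le_pos; [lra | left; apply: Rinv_0_lt_compat].
have ti : 0 < / INR (tl n) by apply: Rinv_0_lt_compat; lra.
have k1C : k1 <= C.
  apply: Rle_trans hk1 _; rewrite -[X in _ <= X]Rdiv_1_r; apply: Rmult_le_compat_l; first lra.
  by apply: Rinv_le_contravar; lra.
have vZ0 : 0 <= vZ by apply: (vZ_ge0 w0 w1 VZ).
have kv : k1 * vZ <= C * W * tau n.
  apply: Rle_trans (Rmult_le_compat _ _ _ _ k10 vZ0 hk1 vW) _.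
  have -> : C / INR (tl n) * (W * INR (tl n) ^ k.+2) = C * W * INR (tl n) ^ k.+1 by rewrite -(tech_pow_Rmult (INR (tl n)) k.+1); set x := _ ^ k.+1; field; lra.
  by apply: Rmult_le_compat_l; lra.
have kkv : k1 ^ 2 * vZ <= C * (C * W) * tau n.
  have -> : k1 ^ 2 * vZ = k1 * (k1 * vZ) by ring.
  rewrite (Rmult_assoc C); apply: Rmult_le_compat => //.
  exact: Rmult_le_pos.
have k1t x : x <= C * tau n -> k1 * x <= C * C * tau n.
  move=> h; have := Rmult_le_compat_l k1 _ _ k10 h.
  have : k1 * (C * tau n) <= C * (C * tau n) by apply: Rmult_le_compat_r => //; apply: Rmult_le_pos; lra.
  lra.
have cT : condT d w n lZ l0 l1 m0 m1 <= 4 * (C * C) * tau n.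
  apply: Rle_trans (condT_le w0 w1 hB0 hB1 b0 hb V0 V1) _.
  have v00 : 0 <= \sum_(h <- l0) dvar d w h + \sum_(h <- l1) dvar d w h.
    by apply: Rplus_le_le_0_compat; apply: Rsum_ge0 => h _; apply: dvar_ge0.
  have : B / b * (\sum_(h <- l0) dvar d w h + \sum_(h <- l1) dvar d w h) <= C * (2 * C * tau n).
    apply: Rle_trans (_ : C * (\sum_(h <- l0) dvar d w h + \sum_(h <- l1) dvar d w h) <= _).
      exact: Rmult_le_compat_r.
    by apply: Rmult_le_compat_l; lra.
  lra.
have Mn := cond_mean_sqr w0 w1 hD1 b0 hb m0 m1 EZ VZ; rewrite -/k1 -/S in Mn.
have Vn := cond_var w0 w1 hD0 hD1 b0 hb EZ VZ V0 V1; rewrite -/k1 -/S -/V in Vn.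
have Vn' : Rabs (V - vZ) <= (5 * (C * W) + 8 * (C * C) + 12 * (C * C) + 2 * (C * (C * W))) * tau n.
  apply: Rle_trans Vn _; have := k1t _ hv0; have := k1t _ hv1; lra.
have Mn' : (S - (mZ + m0 + m1)) ^ 2 <= (2 * (C * (C * W)) + 8 * (C * C)) * tau n by lra.
have le x : x <= C' -> x * tau n <= C' * tau n by move=> h; apply: Rmult_le_compat_r; lra.
(* [|u| <= 1 + u^2] suffices here, although the bound on the square would give order [sqrt tau]. *)
have sq : Rabs (S - (mZ + m0 + m1)) <= 1 * tau n + (2 * (C * (C * W)) + 8 * (C * C)) * tau n.
  rewrite -pow2_abs in Mn'; have := pow2_ge_0 (Rabs (S - (mZ + m0 + m1)) - 1); have := Rabs_pos (S - (mZ + m0 + m1)).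
  nra.
have m00 : 0 <= m0 by apply: Rsum_ge0 => h _; apply: dmean_ge0.
have m10 : 0 <= m1 by apply: Rsum_ge0 => h _; apply: dmean_ge0.
split.
- by apply: Rle_trans Mn' _; apply: le; rewrite /C'; lra.
- apply: Rle_trans (_ : (1 + (2 * (C * (C * W)) + 8 * (C * C)) + 3 * C) * tau n <= _).
    move: sq hmZ => /Rabs_le_between [? ?] /Rabs_le_between [? ?].
    by apply/Rabs_le_between; lra.
  by apply: le; rewrite /C'; lra.
- by apply: Rle_trans Vn' _; apply: le; rewrite /C'; lra.
- apply: Rle_trans (_ : (5 * (C * W) + 8 * (C * C) + 12 * (C * C) + 2 * (C * (C * W)) + C) * tau n <= _).
    move: Vn' hvZ => /Rabs_le_between [? ?] /Rabs_le_between [? ?].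
    by apply/Rabs_le_between; lra.
  by apply: le; rewrite /C'; lra.
- by apply: Rle_trans cT _; apply: le; rewrite /C'; lra.
Qed.

End Indices.

(** * The central limit theorem *)

Lemma gcdf_lip x y : Rabs (gcdf x - gcdf y) <= Rabs (x - y).
Proof.
wlog xy : x y / x <= y.
  move=> W; case: (Rle_lt_dec x y) => h; first exact: W.
  by rewrite Rabs_minus_sym (Rabs_minus_sym x); apply: W; lra.
have [c [_ E]] := MVT_gen gcdf x y _ (fun z _ => gcdf_deriv z) (fun z _ => gcdf_cont z).
rewrite Rabs_minus_sym (Rabs_minus_sym x) E Rabs_mult; rewrite -[X in _ <= X]Rmult_1_l.
apply: Rmult_le_compat_r; first exact: Rabs_pos.
have [h0 h1] := hc_bound; have g0 := gker_gt0 c.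
have g1 : gker c <= 1 by rewrite /gker -exp_0; apply: exp_le_compat; have := pow2_ge_0 c; lra.
rewrite /Rdiv -/hc Rabs_pos_eq; first by rewrite -[X in _ <= X]Rmult_1_l; apply: Rmult_le_compat; lra.
by apply: Rmult_le_pos; lra.
Qed.

(** [del ^ 3 + 1] is the mollification time plus the unit variance of the normalized sum; both
    perturbations of the argument are linear in [del]. *)
Lemma gcdf_perturb x del a : 0 < del <= 1 -> Rabs (a - x) <= 3 * del ->
  Rabs (gcdf (a / sqrt (del ^ 3 + 1)) - gcdf x) <= (3 + Rabs x) * del.
Proof.
move=> [d0 d1] ha; apply: Rle_trans (gcdf_lip _ _) _.
have d3 : 0 < del ^ 3 by apply: pow_lt.
have d3' : del ^ 3 <= del by rewrite -{2}(pow_1 del); simpl; nra.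
set S := sqrt (del ^ 3 + 1).
have S1 : 1 <= S by rewrite -sqrt_1; apply: sqrt_le_1_alt; lra.
have SS : S * S = del ^ 3 + 1 by apply: sqrt_sqrt; lra.
have Si : 0 < / S by apply: Rinv_0_lt_compat; lra.
have Si1 : / S <= 1 by rewrite -Rinv_1; apply: Rinv_le_contravar; lra.
have ES : / S * S = 1 by apply: Rinv_l; lra.
have u : 1 - / S <= del by nra.
have -> : a / S - x = (a - x) * / S - x * (1 - / S) by field; lra.
apply: Rle_trans (Rabs_triang _ _) _; rewrite Rabs_Ropp !Rabs_mult.
rewrite (Rabs_pos_eq (/ S)) ?(Rabs_pos_eq (1 - / S)); try lra.
have := Rmult_le_compat_l _ _ _ (Rabs_pos x) u.
have := Rmult_le_compat_l _ _ _ (Rabs_pos (a - x)) Si1.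
lra.
Qed.

(* Slutsky step: replacing an indicator by a mollified one costs [4 del], and removing the
   perturbation [h] costs its second moment. *)
Lemma indicator_sandwich x y del u h (Q : Prop) (dec : {Q} + {~ Q}) : 0 < del <= 1 -> Rabs (y - x) <= del ->
  (Q <-> u + h <= y) ->
  heat (x - 3 * del) (del ^ 3) u - (4 * del + / del ^ 2 * h ^ 2) <= (if dec then 1 else 0)
  <= heat (x + 3 * del) (del ^ 3) u + (4 * del + / del ^ 2 * h ^ 2).
Proof.
move=> [d0 d1] /Rabs_le_between [y1 y2] HQ.
have d3 : 0 < del ^ 3 by apply: pow_lt.
have d2 : 0 < del ^ 2 by apply: pow_lt.
(* With time [del ^ 3] the margin [del] is [del^(-1/2)] standard deviations, so the tail bound is
   [4 * del]. *)
set e := sqrt (del ^ 3); have e0 : 0 < e := sqrt_lt_R0 _ d3.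
have ee : e * e = del ^ 3 by apply: sqrt_sqrt; lra.
have [t1 _] := @gcdf_tail (del / e) ltac:(by apply: Rdiv_lt_0_compat).
have tE : 4 / (del / e) ^ 2 = 4 * del.
  have -> : 4 / (del / e) ^ 2 = 4 * (e * e) / del ^ 2 by field; lra.
  by rewrite ee; field; lra.
rewrite tE in t1; have t2 := gcdf_opp (del / e).
have b1 := gcdf_bound ((x - 3 * del - u) / e); have b2 := gcdf_bound ((x + 3 * del - u) / e).
have h0 : 0 <= / del ^ 2 * h ^ 2 by apply: Rmult_le_pos; [left; apply: Rinv_0_lt_compat | apply: pow2_ge_0].
rewrite /heat -/e.
have ei : 0 < / e by apply: Rinv_0_lt_compat.
case: (Rle_lt_dec (Rabs h) del) => [/Rabs_le_between [h1 h2]|hb]; last first.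
  have : 1 <= / del ^ 2 * h ^ 2.
    rewrite -(Rinv_l (del ^ 2)); last lra.
    apply: Rmult_le_compat_l; first by left; apply: Rinv_0_lt_compat.
    by rewrite -(pow2_abs h); apply: pow_incr; lra.
  by set A := / _ * _ in h0 *; case: dec => ? /=; lra.
set A := / _ * _ in h0 *; case: dec => hq /=.
  have {}hq := proj1 HQ hq.
  have : gcdf (del / e) <= gcdf ((x + 3 * del - u) / e).
    by apply: gcdf_mono; apply: Rmult_le_compat_r; lra.
  by lra.
have {}hq : y < u + h by apply: Rnot_le_lt => /HQ.
have : gcdf ((x - 3 * del - u) / e) <= gcdf (- (del / e)).
  apply: gcdf_mono; have -> : - (del / e) = (- del) / e by field; lra.
  by apply: Rmult_le_compat_r; lra.
lra.
Qed.

Lemma ln2_gt : / 2 < ln 2.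
Proof. exact: ln_lt_2. Qed.

Lemma pow2_exp t : exp (ln 2 * INR t) = 2 ^ t.
Proof. by rewrite Rmult_comm exp_mulN exp_ln; lra. Qed.

Lemma ln_tl n : (1 <= tl n)%N -> INR (tl n) * ln 2 <= ln (INR n).
Proof.
move=> t1; have n0 := tl_gt0 t1; have [h _] := @tl_spec n ltac:(lia).
have := ln_le _ _ (pow_lt 2 (tl n) ltac:(lra)) h.
by rewrite ln_pow; lra.
Qed.

Section Limit.
Variables (p q : nat) (rest : seq nat).
Hypothesis Hb : bases (p :: q :: rest).
Notation k := (size rest).
Notation hv := (hv p q).
Notation idx := (idx p q rest).
Notation tau := (tau rest).
Notation size_n n := (INR (size (idx n))).

(** Either [gl n] is large and [2 ^ gl n <= t] beats [gl n / eps], or [gl n] is bounded and [t]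
    alone is large enough. *)
Lemma tau_small eps : 0 < eps -> exists T0, forall n, (T0 <= tl n)%N -> tau n <= eps * INR (tl n) ^ k.+2.
Proof.
move=> e0; have l2 := ln2_gt; have [T HT] := @pow_exp_ev 1 (ln 2) (/ eps) ltac:(lra).
have [T1 hT1] := INR_unbounded (INR T / eps).
exists (T1 + 1)%N => n hn; have t1 : (1 <= tl n)%N by lia.
rewrite /tau -(tech_pow_Rmult _ k.+1) (Rmult_comm (_ ^ _)) -Rmult_assoc.
apply: Rmult_le_compat_r; first by apply: pow_le; apply: pos_INR.
have T1' := @INR_leq T1 (tl n) ltac:(lia).
case: (leqP T (gl n)) => h.
  have := HT _ h; rewrite pow_1 pow2_exp; have [h2 _] := gl_spec t1 => h3.
  have h4 : / eps * INR (gl n) <= INR (tl n) by lra.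
  have := Rmult_le_compat_l eps _ _ (Rlt_le _ _ e0) h4.
  by have -> : eps * (/ eps * INR (gl n)) = INR (gl n) by field; lra.
have := INR_ltn h; have h4 : INR T / eps <= INR (tl n) by lra.
have := Rmult_le_compat_l eps _ _ (Rlt_le _ _ e0) h4.
have -> : eps * (INR T / eps) = INR T by field; lra.
lra.
Qed.

Lemma size_idx_lower : exists c T0, 0 < c /\ forall n, (T0 <= tl n)%N -> c * INR (tl n) ^ k.+2 <= size_n n.
Proof.
have [C [C0 H]] := size_idx_asymp Hb; have v0 := cvol_gt0 Hb.
set ps := [:: p, q & rest] in H v0; set v := cvol ps in H v0.
have l2 := ln2_gt; have ls := lsum_ge0 Hb; rewrite -/ps in ls.
have [T1 hT1] := INR_unbounded ((2 * C * v + lsum ps) * 2).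
have c0 : 0 < / (2 * v) * (/ 2) ^ k.+2 by apply: Rmult_lt_0_compat; [apply: Rinv_0_lt_compat; lra | apply: pow_lt; lra].
exists (/ (2 * v) * (/ 2) ^ k.+2), (T1 + 1)%N; split => //.
move=> n hn; have t1 : (1 <= tl n)%N by lia.
have lt := ln_tl t1; have T1' := @INR_leq T1 (tl n) ltac:(lia).
have t0 := pos_INR (tl n); have n0 := tl_gt0 t1.
have L : INR (tl n) * / 2 <= ln (INR n) by nra.
have Cv : 0 <= C * v by apply: Rmult_le_pos; lra.
have L1 : lsum ps <= ln (INR n) by lra.
have L2 : 2 * C * v <= ln (INR n) by lra.
have := H n L1 ltac:(lia); rewrite (_ : (size ps - 1)%N = k.+1); last by rewrite subn1.
rewrite -[size ps]/(k.+2) -tech_pow_Rmult => /Rabs_le_between [h _].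
set l := ln (INR n) in L L1 L2 h *.
have l0 : 0 <= l by lra.
have lk : 0 <= l ^ k.+1 by apply: pow_le.
have e1 : C * l ^ k.+1 <= l * l ^ k.+1 / (2 * v).
  have -> : l * l ^ k.+1 / (2 * v) = (l * / (2 * v)) * l ^ k.+1 by rewrite /Rdiv; ring.
  apply: Rmult_le_compat_r => //; apply: (Rmult_le_reg_r (2 * v)); first lra.
  by rewrite Rmult_assoc Rinv_l; lra.
have e2 : l * l ^ k.+1 / (2 * v) <= size_n n.
  have E : l * l ^ k.+1 / v = l * l ^ k.+1 / (2 * v) + l * l ^ k.+1 / (2 * v) by field; lra.
  by rewrite E in h; lra.
apply: Rle_trans e2.
have -> : / (2 * v) * (/ 2) ^ k.+2 * INR (tl n) ^ k.+2 = (INR (tl n) * / 2) ^ k.+2 * / (2 * v).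
  by rewrite (Rpow_mult_distr (INR (tl n))); ring.
apply: Rmult_le_compat_r; first by left; apply: Rinv_0_lt_compat; lra.
by rewrite tech_pow_Rmult; apply: pow_incr; split => //; lra.
Qed.

Variables (d m : nat) (pp : 'I_m -> nat).
Hypothesis d2 : (2 <= d)%N.
Hypothesis hS : forall n h, (h \in [seq hv x | x <- idx n]) = (h <= n)%N && inSb pp h.

Lemma moments_tau : exists C T0, 0 < C /\ forall n, (T0 <= tl n)%N ->
  Rabs (EX d pp n - size_n n * ((INR d - 1) / 2)) <= C * tau n /\
  Rabs (VarX d pp n - size_n n * ((INR d ^ 2 - 1) / 12)) <= C * tau n.
Proof.
have [C [T0 [C0 HT]]] := split_law_exists Hb d2.
have [C' [C0' HM]] := split_moments Hb d2 C0.
exists C', (T0 + 2)%N; split => // n hn.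
have [r [B [D [b [lZ [l0 [l1 H]]]]]]] := HT n ltac:(lia).
have [_ A1 _ A2 _] := HM n r B D b lZ l0 l1 ltac:(lia) H.
have t0 : 0 < tot d (tilt d r) n lZ l0 l1 by have := sl_b0 H; have := sl_b H; lra.
have E := EX_CE Hb d2 (hS n) (sl_perm H) t0; rewrite -E in A1 A2.
by rewrite (VarX_CE Hb d2 (hS n) (sl_perm H) t0).
Qed.

(** The halves have conditional second moment o(vZ) and are discarded by Chebyshev's inequality. For
    a bounded function of the digits in [lZ], conditioning changes the expectation by at most [k1],
    and the unconditional sum is Gaussian in the limit by [lindeberg]. *)
Lemma clt x eps : 0 < eps -> exists T0, forall n, (T0 <= tl n)%N -> Rabs (cdf_norm d pp n x - gcdf x) <= eps.
Proof.
move=> e0.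
have [C [T0 [C0 HT]]] := split_law_exists Hb d2.
have [C' [C0' HM]] := split_moments Hb d2 C0.
have dr := INR_leq d2; rewrite -[INR 2]/2 in dr.
have x0 := Rabs_pos x.
(* The final error is [(5 + |x|) del] from the mollified expectation, [4 del] from mollification and
   [del] from the halves. *)
set del := Rmin 1 (eps / (10 + Rabs x)).
have del0 : 0 < del by apply: Rmin_glb_lt; [lra | apply: Rdiv_lt_0_compat; lra].
have del1 : del <= 1 := Rmin_l _ _.
have dele : (10 + Rabs x) * del <= eps.
  have := Rmin_r 1 (eps / (10 + Rabs x)); rewrite -/del => h.
  have := Rmult_le_compat_l (10 + Rabs x) _ _ ltac:(lra) h.
  by have -> : (10 + Rabs x) * (eps / (10 + Rabs x)) = eps by field; lra.
have hdel : 0 < del <= 1 by [].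
have s0 : 0 < del ^ 3 by apply: pow_lt.
have [M [M0 HMh]] := heat_bounds s0.
(* [eta] bounds [C' tau / vZ], hence the relative error of the variance, and [seta] that of the mean
   in units of [sg]. They are tuned so that the threshold moves by at most [|x| eta + seta <= del]
   and Chebyshev's inequality costs [eta / del^2 <= del]. *)
set seta := del ^ 2 / (2 * (1 + Rabs x)); set eta := seta ^ 2.
have seta0 : 0 < seta by apply: Rdiv_lt_0_compat; [apply: pow_lt | lra].
have setaE : seta * (2 * (1 + Rabs x)) = del ^ 2 by rewrite /seta; field; lra.
have dd : del ^ 2 <= del by simpl; nra.
have seta1 : seta <= / 2 * del ^ 2 by nra.
have eta0 : 0 < eta by apply: pow_lt.
have etad : Rabs x * eta + seta <= del by rewrite /eta; nra.
have eta1 : eta <= / 4 by rewrite /eta; nra.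
have etad2 : / del ^ 2 * eta <= del.
  apply: (Rmult_le_reg_l (del ^ 2)); first exact: pow_lt.
  have -> : del ^ 2 * (/ del ^ 2 * eta) = eta by field; lra.
  rewrite /eta; have : seta ^ 2 <= del ^ 2 * (/ 4 * del ^ 2) by simpl; nra.
  have := pow2_ge_0 del; nra.
have [c [T1 [c0 Hc]]] := size_idx_lower.
pose c8 := c / 8.
have c80 : 0 < c8 by rewrite /c8; lra.
have [T2 HT2] := @tau_small (Rmin (c8 / C) (eta * c8 / C')) ltac:(apply: Rmin_glb_lt; apply: Rdiv_lt_0_compat => //; exact: Rmult_lt_0_compat).
have [T3 hT3] := INR_unbounded (C / del).
(* A standard deviation of at least [e1] makes the Lindeberg error [M (d + d^2) / sg] at most
   [del]. *)
pose e1 := M * (INR d + INR d ^ 2) / del + 1.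
have Md : 0 <= M * (INR d + INR d ^ 2) by apply: Rmult_le_pos; nra.
have e10 : 1 <= e1 by rewrite /e1; have : 0 <= M * (INR d + INR d ^ 2) / del by [apply: Rmult_le_pos => //; left; apply: Rinv_0_lt_compat]; lra.
have [T4 hT4] := INR_unbounded (e1 ^ 2 / c8).
exists (T0 + T1 + T2 + T3 + T4 + 2)%N => n hn.
have t2 : (2 <= tl n)%N by lia.
have t1 : (1 <= tl n)%N by lia.
have [ta1 [ta2 ta3]] := @tau_ge rest n t2.
have [r [B [D [b [lZ [l0 [l1 H]]]]]]] := HT n ltac:(lia).
have := HM n r B D b lZ l0 l1 ltac:(lia) H; move=> /=.
have tt0 : 0 < tot d (tilt d r) n lZ l0 l1 by have := sl_b0 H; have := sl_b H; lra.
rewrite -(EX_CE Hb d2 (hS n) (sl_perm H) tt0) -(VarX_CE Hb d2 (hS n) (sl_perm H) tt0).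
have hv := sl_vZ H.
set w := tilt d r in hv *; set mZ := \sum_(h <- lZ) dmean d w h; set m0 := \sum_(h <- l0) dmean d w h.
set m1 := \sum_(h <- l1) dmean d w h; set vZ := \sum_(h <- lZ) dvar d w h in hv *.
set E := EX d pp n; set V := VarX d pp n; move=> [A1 _ A2 _ A3].
have w0 : forall h j, 0 <= w h j by apply: tilt_ge0.
have w1 : forall h, \sum_(j < d) w h j = 1 by apply: tilt_sum.
have tk0 : 0 < INR (tl n) ^ k.+2 by apply: pow_lt; lra.
have ts := HT2 n ltac:(lia).
have tsC : C * tau n <= c8 * INR (tl n) ^ k.+2.
  have h := Rmin_l (c8 / C) (eta * c8 / C').
  have := Rmult_le_compat_r _ _ _ (Rlt_le _ _ tk0) h => h2.
  have := Rmult_le_compat_l C _ _ (Rlt_le _ _ C0) (Rle_trans _ _ _ ts h2).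
  by have -> : C * (c8 / C * INR (tl n) ^ k.+2) = c8 * INR (tl n) ^ k.+2 by field; lra.
have vlow : c8 * INR (tl n) ^ k.+2 <= vZ.
  have := Hc n ltac:(lia) => h; move: hv => /Rabs_le_between [h1 _].
  have : size_n n * (/ 4) <= size_n n * ((INR d ^ 2 - 1) / 12).
    by apply: Rmult_le_compat_l; [exact: pos_INR | nra].
  move: tsC; rewrite /c8; lra.
have vZ0 : 0 < vZ by apply: Rlt_le_trans vlow; apply: Rmult_lt_0_compat.
have tsE : C' * tau n <= eta * vZ.
  have h := Rmin_r (c8 / C) (eta * c8 / C').
  have := Rmult_le_compat_r _ _ _ (Rlt_le _ _ tk0) h => h2.
  have := Rmult_le_compat_l C' _ _ (Rlt_le _ _ C0') (Rle_trans _ _ _ ts h2).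
  have -> : C' * (eta * c8 / C' * INR (tl n) ^ k.+2) = eta * (c8 * INR (tl n) ^ k.+2) by field; lra.
  by have := Rmult_le_compat_l eta _ _ (Rlt_le _ _ eta0) vlow; lra.
set sg := sqrt vZ; have sg0 : 0 < sg := sqrt_lt_R0 _ vZ0.
have sgE : sg * sg = vZ by apply: sqrt_sqrt; lra.
have sge : e1 <= sg.
  rewrite -(sqrt_pow2 e1); last lra.
  apply: sqrt_le_1_alt; apply: Rle_trans vlow.
  have := @INR_leq T4 (tl n) ltac:(lia) => h4.
  have h5 : INR (tl n) <= INR (tl n) ^ k.+2 by rewrite -{1}(pow_1 (INR (tl n))); apply: Rle_pow; [lra | lia].
  have -> : e1 ^ 2 = c8 * (e1 ^ 2 / c8) by field; lra.
  by apply: Rmult_le_compat_l; lra.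
have sV : (1 - eta) * vZ <= V by move: A2 => /Rabs_le_between; lra.
have V0 : 0 < V by apply: Rlt_le_trans sV; apply: Rmult_lt_0_compat; lra.
set sv := sqrt V; have sv0 : 0 < sv := sqrt_lt_R0 _ V0.
have svE : sv * sv = V by apply: sqrt_sqrt; lra.
have svs : Rabs (sv - sg) <= eta * sg.
  apply: (Rmult_le_reg_r (sv + sg)); first lra.
  have {1}-> : sv + sg = Rabs (sv + sg) by rewrite Rabs_pos_eq; lra.
  rewrite -Rabs_mult; have -> : (sv - sg) * (sv + sg) = V - vZ by rewrite -svE -sgE; ring.
  apply: Rle_trans A2 _; apply: Rle_trans tsE _; rewrite -sgE.
  have : 0 <= eta * sg * sv by apply: Rmult_le_pos; [apply: Rmult_le_pos | ]; lra.
  lra.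
set mu := mZ + m0 + m1 in A1.
have Emu : Rabs (E - mu) <= seta * sg.
  have h : 0 <= seta * sg by apply: Rmult_le_pos; lra.
  rewrite -(Rabs_pos_eq _ h); apply: Rsqr_le_abs_0; rewrite !Rsqr_pow2.
  by rewrite Rpow_mult_distr -/eta -[sg ^ 2]/(sg * (sg * 1)) Rmult_1_r sgE; lra.
(* The threshold [x] for the exact normalization by [E] and [sv], rewritten for the normalization by
   [mu] and [sg]. *)
pose y := (x * sv + E - mu) / sg.
have yx : Rabs (y - x) <= del.
  have -> : y - x = (x * (sv - sg) + (E - mu)) * / sg by rewrite /y; field; lra.
  rewrite Rabs_mult (Rabs_pos_eq (/ sg)); last by left; apply: Rinv_0_lt_compat.
  apply: (Rmult_le_reg_r sg) => //; rewrite Rmult_assoc Rinv_l ?Rmult_1_r; last lra.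
  apply: Rle_trans (Rabs_triang _ _) _; rewrite Rabs_mult.
  have h1 := Rmult_le_compat_l _ _ _ x0 svs.
  by have := Rmult_le_compat_r _ _ _ (Rlt_le _ _ sg0) etad; lra.
have condE (s : R) : CE d w n lZ l0 l1 (fun _ x0 x1 => s * (((INR x0 - m0) + (INR x1 - m1)) / sg) ^ 2) <= s * eta \/ s < 0.
  case: (Rle_lt_dec 0 s) => hs; last by right.
  left; rewrite (@CE_ext d w n lZ l0 l1 _ (fun _ x0 x1 => s / vZ * ((INR x0 - m0) + (INR x1 - m1)) ^ 2)); last first.
    by move=> a1 a2 a3; rewrite -sgE; field; lra.
  have b0 := sl_b0 H; have hb := sl_b H.
  rewrite (CE_scal b0 hb) -/(condT d w n lZ l0 l1 m0 m1).
  have si : 0 <= s / vZ by apply: Rmult_le_pos => //; left; apply: Rinv_0_lt_compat.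
  apply: Rle_trans (Rmult_le_compat_l _ _ _ si (Rle_trans _ _ _ A3 tsE)) _.
  by right; field; lra.
have b0 := sl_b0 H; have hb := sl_b H.
have k1d : 2 * D / b <= del.
  apply: Rle_trans (sl_k1 H) _; have := @INR_leq T3 (tl n) ltac:(lia) => h3.
  apply: (Rmult_le_reg_r (INR (tl n))); first lra.
  have -> : C / INR (tl n) * INR (tl n) = C by field; lra.
  have : del * (C / del) <= del * INR (tl n) by apply: Rmult_le_compat_l; lra.
  by have -> : del * (C / del) = C by field; lra.
pose U (a : nat) := (INR a - mZ) / sg.
have heatE (a : R) : Rabs (a - x) <= 3 * del ->
  Rabs (CE d w n lZ l0 l1 (fun xz _ _ => heat a (del ^ 3) (U xz)) - gcdf x) <= (5 + Rabs x) * del.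
  move=> ha; have [h1 h2] := HMh a.
  have Lq := lindeberg w0 w1 (/ sg) 0 lZ h1 h2 0 (Rle_refl (del ^ 3)).
  have lmE : lmean d w (/ sg) 0 lZ = / sg * mZ.
    by rewrite /lmean /mZ -Rsum_distr; apply: eq_bigr => h _; rewrite /lcoef; ring.
  have lvE : lvar d w (/ sg) 0 lZ = 1.
    have -> : lvar d w (/ sg) 0 lZ = / vZ * vZ; last by field; lra.
    by rewrite {2}/vZ /lvar -Rsum_distr; apply: eq_bigr => h _; rewrite /lcoef -sgE; field; lra.
  rewrite lvE (Ex_ext _ _ _ (G := fun xz _ => heat a (del ^ 3) (U xz))) in Lq; last first.
    by move=> a1 a2; congr (heat _ _ _); rewrite /lform lmE /U; field; lra.
  have er : M * \sum_(h <- lZ) (Rabs (lcoef (/ sg) 0 h) ^ 3 * dabs3 d w h + (lcoef (/ sg) 0 h ^ 2 * dvar d w h) ^ 2) <= del.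
    apply: Rle_trans (_ : M * ((INR d + INR d ^ 2) / sg) <= _); last first.
      apply: (Rmult_le_reg_r sg) => //.
      have -> : M * ((INR d + INR d ^ 2) / sg) * sg = del * (M * (INR d + INR d ^ 2) / del) by field; lra.
      by apply: Rmult_le_compat_l; [lra | move: sge; rewrite /e1; lra].
    apply: Rmult_le_compat_l => //.
    have si : 0 < / sg by apply: Rinv_0_lt_compat.
    have si1 : / sg <= 1 by rewrite -Rinv_1; apply: Rinv_le_contravar; lra.
    have -> : (INR d + INR d ^ 2) / sg = (INR d + INR d ^ 2) * / sg ^ 3 * vZ by rewrite -sgE; field; lra.
    rewrite /vZ -Rsum_distr; apply: Rsum_le => h _.
    have -> : lcoef (/ sg) 0 h = / sg by rewrite /lcoef; ring.
    rewrite (Rabs_pos_eq (/ sg)); last lra.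
    have v0 : 0 <= dvar d w h by apply: dvar_ge0.
    have v1 := @dabs3_le d r h d2; rewrite -/w in v1.
    have v2 : dvar d w h <= INR d ^ 2.
      by apply: Rle_trans (@dvar_le_mean d r h d2) _; have := @dmean_le_d d r h d2; nra.
    have i3 : 0 < (/ sg) ^ 3 by apply: pow_lt.
    have i4 : (/ sg) ^ 4 <= (/ sg) ^ 3 by rewrite -(tech_pow_Rmult _ 3); nra.
    have u1 := Rmult_le_compat_l _ _ _ (Rlt_le _ _ i3) v1.
    have u2 : ((/ sg) ^ 2 * dvar d w h) ^ 2 <= (/ sg) ^ 3 * (INR d ^ 2 * dvar d w h).
      have -> : ((/ sg) ^ 2 * dvar d w h) ^ 2 = (/ sg) ^ 4 * (dvar d w h * dvar d w h) by ring.
      apply: Rmult_le_compat => //; [by apply: pow_le; lra | exact: Rmult_le_pos |].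
      by apply: Rmult_le_compat_r.
    by rewrite -pow_inv; lra.
  (* Passage to the unconditional law of [lZ]; the test function is bounded by 1, so the cost is at
     most [k1]. *)
  have K := CE_lZ w0 w1 (sl_D1 H) b0 hb (fun xz => heat a (del ^ 3) (U xz)).
  have h01 : Ex d w lZ (fun xz _ => Rabs (heat a (del ^ 3) (U xz))) <= 1.
    rewrite -[X in _ <= X](Ex_const w1 lZ); apply: (@Ex_le d w w0) => a1 a2.
    by rewrite /heat; have := gcdf_bound ((a - U a1) / sqrt (del ^ 3)) => h; rewrite Rabs_pos_eq; lra.
  have h00 : 0 <= Ex d w lZ (fun xz _ => Rabs (heat a (del ^ 3) (U xz))).
    by apply: Ex_ge0 => // a1 a2; apply: Rabs_pos.
  have K2 : Rabs (CE d w n lZ l0 l1 (fun xz _ _ => heat a (del ^ 3) (U xz)) -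
     Ex d w lZ (fun xz _ => heat a (del ^ 3) (U xz))) <= del.
    apply: Rle_trans K _; rewrite -[X in _ <= X]Rmult_1_r.
    apply: Rle_trans (Rmult_le_compat_r _ _ _ h00 k1d) _.
    by apply: Rmult_le_compat_l; lra.
  have G := gcdf_perturb hdel ha.
  rewrite {2}/heat Rminus_0_r in Lq.
  move: K2 (Rle_trans _ _ _ Lq er) G => /Rabs_le_between [? ?] /Rabs_le_between [? ?] /Rabs_le_between [? ?].
  by apply/Rabs_le_between; lra.
have di : 0 < / del ^ 2 by apply: Rinv_0_lt_compat; apply: pow_lt.
have cE : CE d w n lZ l0 l1 (fun _ x0 x1 => / del ^ 2 * (((INR x0 - m0) + (INR x1 - m1)) / sg) ^ 2) <= del.
  by case: (condE (/ del ^ 2)) => h; lra.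
have ev a1 a2 a3 : (INR (a1 + a2 + a3) - E) / sv <= x <->
   U a1 + ((INR a2 - m0) + (INR a3 - m1)) / sg <= y.
  have -> : U a1 + ((INR a2 - m0) + (INR a3 - m1)) / sg = (INR (a1 + a2 + a3) - E + (E - mu)) / sg.
    by rewrite /U /mu !plus_INR; field; lra.
  split=> h.
    apply: Rmult_le_compat_r; first by left; apply: Rinv_0_lt_compat.
    have := Rmult_le_compat_r _ _ _ (Rlt_le _ _ sv0) h.
    by have -> : (INR (a1 + a2 + a3) - E) / sv * sv = INR (a1 + a2 + a3) - E by [field; lra]; lra.
  apply: (Rmult_le_reg_r sv) => //.
  have -> : (INR (a1 + a2 + a3) - E) / sv * sv = INR (a1 + a2 + a3) - E by field; lra.
  have := Rmult_le_compat_r _ _ _ (Rlt_le _ _ sg0) h.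
  have -> : (INR (a1 + a2 + a3) - E + (E - mu)) / sg * sg = INR (a1 + a2 + a3) - E + (E - mu) by field; lra.
  have -> : y * sg = x * sv + E - mu by rewrite /y; field; lra.
  lra.
rewrite (cdf_CE Hb d2 (hS n) (sl_perm H) tt0) -/E -/V -/sv -/w.
have sw a1 a2 a3 := indicator_sandwich (Rle_dec ((INR (a1 + a2 + a3) - E) / sv) x) hdel yx (ev a1 a2 a3).
have up := CE_le w0 b0 hb (fun a1 a2 a3 => proj2 (sw a1 a2 a3)).
have lo := CE_le w0 b0 hb (fun a1 a2 a3 => proj1 (sw a1 a2 a3)).
rewrite (CE_add b0 hb) (CE_add b0 hb) (CE_const b0 hb) in up.
rewrite (@CE_ext d w n lZ l0 l1 _ (fun a1 a2 a3 => heat (x - 3 * del) (del ^ 3) (U a1) +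
  (-1) * (4 * del + / del ^ 2 * (((INR a2 - m0) + (INR a3 - m1)) / sg) ^ 2))) in lo; last by move=> *; ring.
rewrite (CE_add b0 hb) (CE_scal b0 hb) (CE_add b0 hb) (CE_const b0 hb) in lo.
have g1 := heatE (x + 3 * del) ltac:(rewrite Rabs_pos_eq; lra).
have g2 := heatE (x - 3 * del) ltac:(rewrite Rabs_left1; lra).
rewrite -/w in up lo; move: g1 g2 => /Rabs_le_between [? ?] /Rabs_le_between [? ?].
apply/Rabs_le_between; lra.
Qed.

End Limit.

(** * Translation to the given bases, to kappa and to natural logarithms *)

Lemma inSbP (m : nat) (pp : 'I_m -> nat) h : reflect (inS pp h) (inSb pp h).
Proof. by rewrite /inSb; case: excluded_middle_informative => H; constructor. Qed.

Lemma gen_inSb (m : nat) (pp : 'I_m -> nat) n h : (forall i, (1 < pp i)%N) -> (h <= n)%N ->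
  (h \in gen [seq pp i | i <- enum 'I_m] (tl n)) = inSb pp h.
Proof.
move=> pp1 hn; apply/idP/inSbP => [/(gen_elim (enum_uniq _)) [al ->]|[al E]].
  by exists al; rewrite big_enum.
by move: hn; rewrite E -big_enum; apply: gen_intro.
Qed.

Lemma bases_enum (m : nat) (pp : 'I_m -> nat) : (forall i, (1 < pp i)%N) ->
  (forall i j, i != j -> coprime (pp i) (pp j)) -> bases [seq pp i | i <- enum 'I_m].
Proof.
move=> pp1 cop; rewrite /bases all_map pairwise_map; apply/andP; split; first by apply/allP => i _; apply: pp1.
by apply: sub_pairwise (_ : pairwise (fun i j => i != j) _); [move=> i j; apply: cop | rewrite -uniq_pairwise enum_uniq].
Qed.

Lemma kappa_cvol (d m : nat) (pp : 'I_m -> nat) : (2 <= d)%N -> (forall i, (1 < pp i)%N) ->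
  kappa d pp = ln (INR d) / cvol [seq pp i | i <- enum 'I_m].
Proof.
move=> d2 pp1; rewrite /kappa /cvol size_map size_enum_ord big_map.
have -> : \big[Rmult/R1]_(j < m) / ln (INR (pp j)) = / \prod_(j <- enum 'I_m) ln (INR (pp j)).
  rewrite -big_enum.
  elim: (enum _) => [|i s IH]; first by rewrite !big_nil Rinv_1.
  by rewrite !big_cons IH Rinv_mult.
have f0 : INR (m`!) <> 0 by apply: not_0_INR; have := fact_gt0 m; lia.
by rewrite /Rdiv Rinv_mult Rmult_assoc.
Qed.

Lemma tl_large T0 n : 2 ^ T0 <= INR n -> (T0 <= tl n)%N.
Proof.
move=> h; apply: trunc_log_max => //; apply/leP; apply: INR_le.
by rewrite pow_natE.
Qed.

(** Beyond [exp (exp 1)] the iterated logarithm is at least 1, so it absorbs additive constants when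
    binary logarithms are exchanged for natural ones. *)
Lemma tau_ln rest n : exp (exp 1) <= INR n -> (1 <= tl n)%N ->
  tau rest n <= 4 * 2 ^ (size rest).+1 * ln (INR n) ^ (size rest).+1 * ln (ln (INR n)) /\ 1 <= ln (ln (INR n))
  /\ 0 <= ln (INR n).
Proof.
move=> hn t1; have l2 := ln2_gt; have lt := ln_tl t1; set l := ln (INR n) in lt *.
have e1 := exp_pos 1.
have le : exp 1 <= l by rewrite -(ln_exp (exp 1)); apply: ln_le => //; apply: exp_pos.
have l0 : 0 < l by lra.
have ll : 1 <= ln l by rewrite -(ln_exp 1); apply: ln_le.
split; last by split=> //; lra.
have t0 := INR_leq t1; rewrite -[INR 1]/1 in t0.
have tl2 : INR (tl n) <= 2 * l by nra.
have gl4 : INR (gl n) <= 4 * ln l.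
  have [g _] := gl_spec t1; have := ln_le _ _ (pow_lt 2 (gl n) ltac:(lra)) (Rle_trans _ _ _ g tl2).
  rewrite ln_pow; last lra.
  rewrite ln_mult; try lra.
  have l21 : ln 2 < 1 by rewrite -[X in _ < X](ln_exp 1); apply: ln_increasing; [lra | have := exp_ineq1 1; lra].
  have := pos_INR (gl n); nra.
rewrite /tau; have tp : INR (tl n) ^ (size rest).+1 <= 2 ^ (size rest).+1 * l ^ (size rest).+1.
  by rewrite -Rpow_mult_distr; apply: pow_incr; lra.
apply: Rle_trans (Rmult_le_compat _ _ _ _ _ (pos_INR _) tp gl4) _; first by apply: pow_le; lra.
by right; ring.
Qed.

Section Transfer.
Variables (p q : nat) (rest : seq nat).
Hypothesis Hb : bases (p :: q :: rest).
Notation ps := (p :: q :: rest).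

(** The number of elements is replaced by the simplex volume; that error, of order (log n)^(m-1), is
    absorbed since [ln (ln n) >= 1]. *)
Lemma moment_ln (Y : nat -> R) (c C : R) (T0 : nat) : 0 <= c -> 0 <= C ->
  (forall n, (T0 <= tl n)%N -> Rabs (Y n - INR (size (idx p q rest n)) * c) <= C * tau rest n) ->
  exists C' N, forall n, N <= INR n ->
  Rabs (Y n - c / cvol ps * ln (INR n) ^ size ps) <= C' * ln (INR n) ^ (size ps - 1) * ln (ln (INR n)).
Proof.
move=> c0 C0 H; have [Cn [Cn0 Hn]] := size_idx_asymp Hb; have v0 := cvol_gt0 Hb.
exists (C * (4 * 2 ^ (size rest).+1) + Cn * c), (2 ^ T0.+1 + exp (exp 1) + exp (lsum ps)) => n hn.
have P0 : 0 < 2 ^ T0.+1 by apply: pow_lt; lra.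
have e1 := exp_pos (exp 1); have e2 := exp_pos (lsum ps).
have t := @tl_large T0.+1 n ltac:(lra).
have [h1 [h2 h3]] := @tau_ln rest n ltac:(lra) ltac:(lia).
have n1 : (0 < n)%N by have := @tl_gt0 n ltac:(lia); lia.
have ls : lsum ps <= ln (INR n) by rewrite -(ln_exp (lsum ps)); apply: ln_le => //; lra.
have A := Hn n ls n1; have B := H n ltac:(lia).
rewrite -[size ps]/((size rest).+2) subn1 -[(size rest).+2.-1]/((size rest).+1) in A *.
set l := ln (INR n) in h1 h2 h3 A *; set N := INR (size _) in A B.
have lk : 0 <= l ^ (size rest).+1 by apply: pow_le.
set u := l ^ (size rest).+1 in h1 lk A *; set v := cvol _ in v0 A *.
have A2 : Rabs (N * c - c / v * l ^ (size rest).+2) <= Cn * c * u.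
  have -> : N * c - c / v * l ^ (size rest).+2 = (N - l ^ (size rest).+2 / v) * c by field; lra.
  rewrite Rabs_mult (Rabs_pos_eq c) //.
  by have := Rmult_le_compat_r _ _ _ c0 A; lra.
have X1 : C * tau rest n <= C * (4 * 2 ^ (size rest).+1) * u * ln l.
  by have := Rmult_le_compat_l _ _ _ C0 h1; lra.
have X2 : Cn * c * u <= Cn * c * u * ln l.
  have : 0 <= Cn * c * u by apply: Rmult_le_pos => //; apply: Rmult_le_pos.
  by nra.
move: A2 B => /Rabs_le_between [? ?] /Rabs_le_between [? ?].
by apply/Rabs_le_between; lra.
Qed.
End Transfer.

Theorem mainTheorem3 (d m : nat) (p : 'I_m -> nat)
  (hd : (2 <= d)%N) (hm : (2 <= m)%N)
  (hp1 : forall i, (1 < p i)%N)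
  (hpinc : forall i j : 'I_m, (i < j)%N -> (p i < p j)%N)
  (hcop : forall i j : 'I_m, i != j -> coprime (p i) (p j)) :
  (exists C N : R, forall n : nat, N <= INR n ->
     Rabs (EX d p n - kappa d p * (INR d - 1) / (2 * ln (INR d)) * ln (INR n) ^ m)
      <= C * ln (INR n) ^ (m - 1) * ln (ln (INR n))) /\
  (exists C N : R, forall n : nat, N <= INR n ->
     Rabs (VarX d p n - kappa d p * (INR d - 1) * (INR d + 1) / (12 * ln (INR d)) * ln (INR n) ^ m)
      <= C * ln (INR n) ^ (m - 1) * ln (ln (INR n))) /\
  (forall x : R, exists l : R,
     std_normal_cdf_is x l /\ Un_cv (fun n => cdf_norm d p n x) l).
Proof.
have Hb := bases_enum hp1 hcop; have kv := kappa_cvol hd hp1.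
have sz : size [seq p i | i <- enum 'I_m] = m by rewrite size_map size_enum_ord.
have gS n h := @gen_inSb m p n h hp1.
(* [hm] provides the two bases that are singled out. *)
move: Hb kv sz gS; case: [seq p i | i <- enum 'I_m] => [|p0 [|q0 rest]] Hb kv sz gS; try (by rewrite -sz in hm).
have hS n h : (h \in [seq hv p0 q0 x | x <- idx p0 q0 rest n]) = (h <= n)%N && inSb p h.
  by rewrite (mem_hv_idx Hb); case: leqP => hn //=; apply: gS.
have dr := INR_leq hd; rewrite -[INR 2]/2 in dr.
have ld : 0 < ln (INR d) by apply: ln_base_gt0.
have v0 := cvol_gt0 Hb.
have [C [T0 [C0 HM]]] := moments_tau Hb hd hS.
split; [|split].
- have [C' [N HN]] := @moment_ln p0 q0 rest Hb (EX d p) ((INR d - 1) / 2) C T0 ltac:(lra) ltac:(lra)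
    (fun n hn => proj1 (HM n hn)).
  exists C', N => n hn; have := HN n hn; rewrite sz kv.
  have -> : ln (INR d) / cvol [:: p0, q0 & rest] * (INR d - 1) / (2 * ln (INR d)) =
    (INR d - 1) / 2 / cvol [:: p0, q0 & rest] by field; lra.
  by [].
- have [C' [N HN]] := @moment_ln p0 q0 rest Hb (VarX d p) ((INR d ^ 2 - 1) / 12) C T0 ltac:(nra) ltac:(lra)
    (fun n hn => proj2 (HM n hn)).
  exists C', N => n hn; have := HN n hn; rewrite sz kv.
  have -> : ln (INR d) / cvol [:: p0, q0 & rest] * (INR d - 1) * (INR d + 1) / (12 * ln (INR d)) =
    (INR d ^ 2 - 1) / 12 / cvol [:: p0, q0 & rest] by field; lra.
  by [].
move=> x; exists (gcdf x); split; first exact: gcdf_std.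
move=> eps e0; have [T HT] := @clt p0 q0 rest Hb d m p hd hS x (eps / 2) ltac:(lra).
exists (2 ^ T)%N => n hn; rewrite /Rdist; apply: Rle_lt_trans (HT n _) _; last lra.
by apply: trunc_log_max => //; apply/leP.
Qed.
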